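(* Let $\rho\in(0,1)$, $T>0$, $\alpha>0$, $a>\frac12$, and $\Omega=(0,\pi)\times(0,T]$. Suppose that (1) $t^{1-\rho}f(x,t)\in C^a_x(\overline{\Omega})$; (2) $\varphi_0,\varphi_1\in C^a_2[0,\pi]$. Then the initial-boundary value problem $$\left\{\begin{aligned} &(\partial_t^\rho)^2u(x,t)+2\alpha\,\partial_t^\rho u(x,t)-u_{xx}(x,t)=f(x,t),\quad (x,t)\in\Omega,\\ &u(0,t)=u(\pi,t)=0,\quad 0<t\le T,\\ &\lim_{t\to0}J_t^{\rho-1}(\partial_t^\rho u(x,t))=\varphi_0(x),\quad 0\le x\le\pi,\\ &\lim_{t\to0}J_t^{\rho-1}u(x,t)=\varphi_1(x),\quad 0\le x\le\pi, \end{aligned}\right.$$ has a unique solution $u$ (in the sense defined in the context). Moreover, there is a constant $C>0$, not depending on $\varphi_0,\varphi_1,f$, such that $$\|t^{1-\rho}(\partial_t^\rho)^2u\|_{C(\overline{\Omega})}+\|t^{1-\rho}\partial_t^\rho u\|_{C(\overline{\Omega})}+\|t^{1-\rho}u_{xx}\|_{C(\overline{\Omega})}\le C\Big[\|\varphi_0\|_{C^a_2[0,\pi]}+\|\varphi_1\|_{C^a_2[0,\pi]}+\|t^{1-\rho}f\|_{C^a_x(\overline{\Omega})}\Big].$$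
   Context: Fractional calculus. For $\sigma<0$ and a function $g$ of $t$, $J_t^\sigma g(t)=\frac{1}{\Gamma(-\sigma)}\int_0^t\frac{g(\xi)}{(t-\xi)^{\sigma+1}}\,d\xi$, $t>0$, whenever the right-hand side exists. The Riemann-Liouville derivative of order $\rho\in(0,1)$ is $\partial_t^\rho g(t)=\frac{d}{dt}J_t^{\rho-1}g(t)$, and $(\partial_t^\rho)^2g=\partial_t^\rho(\partial_t^\rho g)$ (this differs in general from $\partial_t^{2\rho}g$). For functions of $(x,t)$ these operators act in $t$. Solution. A solution of the problem is a function $u(x,t)$ with $(\partial_t^\rho)^2u,\ \partial_t^\rho u,\ u_{xx}\in C(\Omega)$ and $t^{1-\rho}\partial_t^\rho u,\ t^{1-\rho}u\in C(\overline{\Omega})$ that satisfies all conditions of the problem. Function classes. $\overline\Omega=[0,\pi]\times[0,T]$, and $\|\cdot\|_{C(\overline\Omega)}$ is the supremum norm. For $a>0$, $C^a[0,\pi]$ is the class of $g\in C[0,\pi]$ with $g(0)=g(\pi)=0$ and $\omega_g(\delta):=\sup_{|x_1-x_2|\le\delta}|g(x_1)-g(x_2)|\le C\delta^a$ for some constant $C$ independent of $\delta$; $\|g\|_{C^a[0,\pi]}$ is the smallest such $C$. $C^a_x(\overline\Omega)$ is the class of continuous $h$ on $\overline\Omega$ with $h(0,t)=h(\pi,t)=0$ for $t\in[0,T]$ and $\omega_h(\delta;t):=\sup_{|x_1-x_2|\le\delta}|h(x_1,t)-h(x_2,t)|\le C\delta^a$ with $C$ independent of $t$ and $\delta$; $\|h\|_{C^a_x(\overline\Omega)}$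 is the smallest such $C$. $C^a_2[0,\pi]$ is the class of functions $g$ on $[0,\pi]$ with $g''\in C^a[0,\pi]$ and $g(0)=g(\pi)=0$ (so also $g''(0)=g''(\pi)=0$), with norm $\|g\|_{C^a_2[0,\pi]}=\|g''\|_{C^a[0,\pi]}$. *)

(* Defs.v *)
From HB Require Import structures.
From mathcomp Require Import all_boot all_order all_algebra.
From mathcomp Require Import all_classical all_reals all_analysis.

Set Implicit Arguments.
Unset Strict Implicit.
Unset Printing Implicit Defensive.

Import Order.TTheory GRing.Theory Num.Theory.
Import numFieldNormedType.Exports.

Local Open Scope classical_set_scope.
Local Open Scope ring_scope.

Section defs.
Context {R : realType}.
Implicit Types (A : set R) (D : set (R * R)) (g : R -> R) (h : R -> R -> R).

(* Derivative relative to A: one-sided at an endpoint of A belonging to A.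
   It is needed at t = T for the time derivative, and at 0 and pi for g''. *)
Definition diff_quot g (x y : R) : R := (g y - g x) / (y - x).

Definition derivable_on A g (x : R) : Prop :=
  cvg (diff_quot g x y @[y --> within A x^']).

Definition derive_on A g (x : R) : R :=
  lim (diff_quot g x y @[y --> within A x^']).

Definition Gamma (z : R) : R :=
  \int[lebesgue_measure]_(s in `]0, +oo[) (s `^ (z - 1) * expR (- s)).

(* J_t^sigma for sigma < 0. The value is meaningful only where
   frac_int_exists holds. *)
Definition frac_int_exists (sigma : R) g (t : R) : Prop :=
  lebesgue_measure.-integrable `]0, t[
    (fun xi => (g xi / (t - xi) `^ (sigma + 1))%:E).

Definition frac_int (sigma : R) g (t : R) : R :=
  (Gamma (- sigma))^-1 *
  \int[lebesgue_measure]_(xi in `]0, t[) (g xi / (t - xi) `^ (sigma + 1)).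

(* Riemann-Liouville derivative of order rho of a function on ]0, T];
   the second definition says that it exists at every point of ]0, T]. *)
Definition RL (rho T : R) g (t : R) : R :=
  derive_on `]0, T] (frac_int (rho - 1) g) t.

Definition RL_exists (rho T : R) g : Prop :=
  forall t, 0 < t <= T ->
    frac_int_exists (rho - 1) g t /\
    derivable_on `]0, T] (frac_int (rho - 1) g) t.

(* Functions of (x, t) are curried, x first. *)
Definition dt_rho (rho T : R) h : R -> R -> R := fun x => RL rho T (h x).

Definition dxx h (x t : R) : R := derive1n 2 (h ^~ t) x.

Definition dxx_exists h (x t : R) : Prop :=
  derivable (h ^~ t) x 1 /\ derivable (derive1 (h ^~ t)) x 1.

Definition Omega (T : R) : set (R * R) := `]0, pi[ `*` `]0, T].
(* Omega together with its lateral boundary *)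
Definition Omega_lat (T : R) : set (R * R) := `[0, pi] `*` `]0, T].
Definition Omega_bar (T : R) : set (R * R) := `[0, pi] `*` `[0, T].

Definition continuous_on D h : Prop :=
  {within D, continuous (fun p : R * R => h p.1 p.2)}.

Definition tweight (rho : R) h (x t : R) : R := t `^ (1 - rho) * h x t.

(* Weighted functions such as t^(1-rho) u carry no information at t = 0, and
   u_xx is only given for 0 < x < pi, so membership in C(Omega_bar) means
   having a continuous extension to Omega_bar. The extension is unique, and its
   values are the limits from Omega. *)
Definition ext (T : R) h (x t : R) : R :=
  lim (h p.1 p.2 @[p --> within (Omega T) (nbhs (x, t))]).

(* h, whose natural domain is D (between Omega and Omega_bar), belongs to
   C(Omega_bar). *)
Definition in_Cbar (T : R) D h : Prop :=
  continuous_on (Omega_bar T) (ext T h) /\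
  forall x t, D (x, t) -> ext T h x t = h x t.

Definition Cbar_norm (T : R) h : R :=
  sup [set `|ext T h p.1 p.2| | p in Omega_bar T].

(* modulus of continuity on [0, pi] *)
Definition modulus g (delta : R) : R :=
  sup [set `|g p.1 - g p.2| | p in
    [set p : R * R | [/\ 0 <= p.1 <= pi, 0 <= p.2 <= pi &
                         `|p.1 - p.2| <= delta]]].

Definition Ca_bound (a : R) g (C : R) : Prop :=
  forall delta, 0 < delta -> modulus g delta <= C * delta `^ a.

Definition in_Ca (a : R) g : Prop :=
  [/\ {within `[0, pi], continuous g}, g 0 = 0, g pi = 0 &
      exists C, Ca_bound a g C].

Definition Ca_norm (a : R) g : R := inf [set C | Ca_bound a g C].

(* h is defined on Omega_lat, and its extension to Omega_bar is in C^a_x. *)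
Definition Cax_bound (a T : R) h (C : R) : Prop :=
  forall t, 0 <= t <= T -> Ca_bound a (ext T h ^~ t) C.

Definition in_Cax (a T : R) h : Prop :=
  [/\ in_Cbar T (Omega_lat T) h,
      forall t, 0 <= t <= T -> ext T h 0 t = 0 /\ ext T h pi t = 0 &
      exists C, Cax_bound a T h C].

Definition Cax_norm (a T : R) h : R := inf [set C | Cax_bound a T h C].

Definition d2 g : R -> R := derive_on `[0, pi] (derive_on `[0, pi] g).

Definition in_C2a (a : R) g : Prop :=
  [/\ forall x, 0 <= x <= pi ->
        derivable_on `[0, pi] g x /\
        derivable_on `[0, pi] (derive_on `[0, pi] g) x,
      in_Ca a (d2 g), g 0 = 0 & g pi = 0].

Definition C2a_norm (a : R) g : R := Ca_norm a (d2 g).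

Record is_solution (rho T alpha : R) (f : R -> R -> R) (phi0 phi1 : R -> R)
    (u : R -> R -> R) : Prop := IsSolution {
  sol_dt_exists : forall x, 0 <= x <= pi -> RL_exists rho T (u x) ;
  sol_dt2_exists : forall x, 0 < x < pi ->
    RL_exists rho T (dt_rho rho T u x) ;
  sol_dxx_exists : forall x t, 0 < x < pi -> 0 < t <= T -> dxx_exists u x t ;
  sol_dt2_cont : continuous_on (Omega T) (dt_rho rho T (dt_rho rho T u)) ;
  sol_dt_cont : continuous_on (Omega T) (dt_rho rho T u) ;
  sol_dxx_cont : continuous_on (Omega T) (dxx u) ;
  sol_dt_Cbar : in_Cbar T (Omega_lat T) (tweight rho (dt_rho rho T u)) ;
  sol_Cbar : in_Cbar T (Omega_lat T) (tweight rho u) ;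
  sol_eq : forall x t, 0 < x < pi -> 0 < t <= T ->
    dt_rho rho T (dt_rho rho T u) x t + 2 * alpha * dt_rho rho T u x t
      - dxx u x t = f x t ;
  sol_boundary : forall t, 0 < t <= T -> u 0 t = 0 /\ u pi t = 0 ;
  sol_init0 : forall x, 0 <= x <= pi ->
    frac_int (rho - 1) (dt_rho rho T u x) t @[t --> 0^'+] --> phi0 x ;
  sol_init1 : forall x, 0 <= x <= pi ->
    frac_int (rho - 1) (u x) t @[t --> 0^'+] --> phi1 x
}.

End defs.

(* Main.v *)
Require Import Defs.
From HB Require Import structures.
From mathcomp Require Import all_boot all_order all_algebra.
From mathcomp Require Import all_classical all_reals all_analysis.
From mathcomp Require Import measurable_realfun ring lra.
Import Order.TTheory GRing.Theory Num.Theory.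
Import numFieldNormedType.Exports.
Local Open Scope classical_set_scope.
Local Open Scope ring_scope.
Set Implicit Arguments.
Unset Strict Implicit.
Unset Printing Implicit Defensive.

(** Write g_b(t) = t^(b-1) / Gamma(b), so that J^(rho-1) is the convolution with
    g_(1-rho) on the half line, and let [conv] be denoted by a star. For the n-th
    sine coefficients U of u, V of its fractional derivative and F of f the
    problem becomes the pair of Volterra equations
      g_(1-rho) * U = a1 + 1 * V,
      g_(1-rho) * V = a0 + 1 * (F - 2 alpha V - n^2 U),
    where a0, a1 are the coefficients of phi0, phi1. If G and H are kernels with
      g_(1-rho) * G = 1 * H,   g_(1-rho) * H = 1 - 2 alpha 1 * H - n^2 1 * G,
    then associativity of the convolution gives the solution
      U = (a0 + 2 alpha a1) G + a1 H + G * F,   V = a0 H - n^2 a1 G + H * F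
    ([mode_algebra]) and its uniqueness ([homogeneous_mode]).

    The data are only Hoelder continuous with exponent a > 1/2, so the decay of G
    in n decides whether n^2 U is summable. It is obtained by subordination, not
    from the asymptotics of Mittag-Leffler functions. Let P solve the telegraph
    equation P'' + 2 alpha P' + n^2 P = 0, P(0) = 0, P'(0) = 1. An integral
    operator [subord], built on the density factor A of Kanter's formula for
    one-sided stable laws, sends s^m / m! to g_(rho (m+1)), because the moments of
    A are quotients of Gamma values ([kanter_moment]); it therefore sends P to G
    and P' to H. Conservation of energy bounds P' by 1, P by 1/n and the primitive
    of P by a constant over n^2. These bounds pass to the kernels, the last one
    after an integration by parts:
      |H| <= C t^(rho-1),  |G| <= C t^(rho-1) / n,  |G| <= C t^(-1) / n^2
    ([mode_bounds]). By interpolation n^2 |G| <= C n^eps t^(eps rho - 1), which is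
    integrable, and n^2 (G * F) costs no more than n^eps |F|, whose sum converges
    uniformly by Bernstein's theorem on absolutely convergent Fourier series
    ([bernstein], [coef_tails]).

    Every function that is singular at t = 0 is kept in the form t^(b-1) q(t) with
    q continuous on the whole line ([sg]). The series of the symbols q converge
    uniformly, so u, its fractional derivatives and u_xx are t^(rho-1) times
    continuous functions; the fractional derivatives are found by summing the
    Volterra equations of the modes and differentiating 1 * V ([RL_step],
    [assembled]).

    For uniqueness, u_xx of a solution is only known to be continuous inside
    Omega. The difference of two solutions is therefore tested against sines of a
    slightly shorter interval, away from t = 0; two integrations by parts leave
    boundary values of the difference, which vanish in the limit where the
    interval is exhausted ([isin_parts], [mode_equation]). The sine coefficients
    then solve the homogeneous Volterra equations, hence are zero, and the sines
    are complete ([fsin_complete], [solutions_eq]).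

    The constants of the existence proof are linear in any admissible Hoelder
    constants of the data, so the norm estimate follows by passing to the infimum
    of these constants. *)

(** * Integrals of real functions *)

Section integration.
Context {R : realType}.
Notation mu := (@lebesgue_measure R).
Implicit Types (D : set R) (g : R -> R).

Lemma integrable_dom d (T : measurableType d) (m : {measure set T -> \bar R})
    (D : set T) (f g : T -> R) :
  measurable D -> measurable_fun D f -> (forall x, D x -> `|f x| <= g x) ->
  m.-integrable D (EFin \o g) -> m.-integrable D (EFin \o f).
Proof.
move=> mD mf fg ig; apply: (le_integrable mD _ _ ig); first exact/measurable_EFinP.
move=> x Dx /=; rewrite lee_fin (le_trans (fg _ Dx))//; exact: ler_norm.
Qed.

(** The shape in which dominated convergence is used below: real integrands, and
    integrability of the limit together with convergence of the integrals. *)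
Lemma Rdominated_cvg d (T : measurableType d) (m : {measure set T -> \bar R})
    (D : set T) (f_ : nat -> T -> R) (f g : T -> R) :
  measurable D -> (forall n, measurable_fun D (f_ n)) ->
  (forall x, D x -> f_ n x @[n --> \oo] --> f x) ->
  m.-integrable D (EFin \o g) ->
  (forall n x, D x -> `|f_ n x| <= g x) ->
  m.-integrable D (EFin \o f) /\
  \int[m]_(x in D) f_ n x @[n --> \oo] --> \int[m]_(x in D) f x.
Proof.
move=> mD mf_ f_f ig f_g.
have mf : measurable_fun D f by apply: measurable_fun_cvg f_f.
have [] := @dominated_convergence _ _ _ m D mD (fun n x => (f_ n x)%:E)
  (EFin \o f) (EFin \o g) _ _ _ ig _.
- by move=> n; exact/measurable_EFinP.
- exact/measurable_EFinP.
- apply: aeW => x Dx; apply: cvg_EFin; first exact: nearW.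
  exact: f_f.
- by apply: aeW => x n Dx; rewrite /= lee_fin f_g.
move=> intf _ cf; split => //.
rewrite /Rintegral; apply: fine_cvg.
by rewrite fineK//; exact: integrable_fin_num.
Qed.

(** Sequences suffice for limits in a metric space, which brings dominated
    convergence to bear on limits of functions. *)
Lemma cvg_within_seq (M : pseudoMetricType R) (A : set M) (p0 : M) (h : M -> R) (l : R) :
  (forall u : nat -> M, (forall n, A (u n)) -> u @ \oo --> p0 ->
     h (u n) @[n --> \oo] --> l) ->
  h x @[x --> within A (nbhs p0)] --> l.
Proof.
move=> H; apply: contrapT => /cvgrPdist_lt /existsNP [e /not_implyP [e0 /= ne]].
have P n : exists p, [/\ A p, ball p0 n.+1%:R^-1 p & e <= `|l - h p|].
  apply: contrapT => nP; apply: ne; rewrite /within /=; apply/nbhs_ballP.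
  exists n.+1%:R^-1 => /=; first by rewrite invr_gt0.
  move=> p bp Ap; rewrite ltNge; apply/negP => ep; apply: nP.
  by exists p; split.
have [u uP] := choice P.
have cu : u @ \oo --> p0.
  apply/cvg_ballP => d d0; near=> n.
  have [_ + _] := uP n; apply: le_ball.
  near: n; exists (Num.truncn d^-1) => // n /= nd.
  rewrite invf_ple ?posrE// ltW// (lt_le_trans (truncnS_gt _))// ler_nat.
  by rewrite ltnS.
have /cvgrPdist_lt /(_ e e0) [N _ HN] := H u (fun n => let: And3 a _ _ := uP n in a) cu.
have [_ _] := uP N; rewrite leNgt => /negP; apply; exact: (HN N (leqnn _)).
Unshelve. all: end_near. Qed.

(** The carrier is the measurable copy of the line, so that the image measure of
    the Lebesgue measure under this map is defined. *)
Definition affine (a b : R) (x : measurableTypeR R) : measurableTypeR R := a * x + b.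

Lemma measurable_affine a b : measurable_fun setT (affine a b).
Proof.
by apply: (@measurable_funD _ _ _ _ (fun x : R => a * x)) => //;
  apply: measurable_funM.
Qed.
HB.instance Definition _ a b :=
  isMeasurableFun.Build _ _ _ _ (affine a b) (measurable_affine a b).

Lemma measurable_affine_preimage a b (D : set R) :
  measurable D -> measurable ((fun x => a * x + b) @^-1` D).
Proof.
by move=> mD; have := measurable_affine a b measurableT mD; rewrite setTI.
Qed.

Let image_measure a b : {p : {measure set (measurableTypeR R) -> \bar R} |
  forall A, p A = mu (affine a b @^-1` A)}.
Proof.
by unshelve eexists; [unshelve refine (pushforward mu (affine a b)); exact: measurable_affine|].
Qed.

(** The scaled image measure agrees with the Lebesgue measure on intervals, and a
    measure on the line is determined by its values there. *)
Lemma lebesgue_measure_affine (a b : R) (A : set R) : a != 0 -> measurable A ->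
  mu A = (`|a|%:E * mu ((fun x => (a * x + b)%R) @^-1` A))%E.
Proof.
move=> a0 mA.
have a0' : 0 <= `|a| by [].
have [p pE] := image_measure a b.
pose m := mscale (NngNum a0') p.
suff H : mu A = m A by rewrite H /m /mscale /= pE.
apply: lebesgue_measure_unique => // _ [[u v]] _ <-.
transitivity (`|a|%:E * p [set` `]u, v]])%E; last by [].
rewrite pE lebesgue_measure_itv /= lte_fin.
have [an|ap|/eqP] := ltgtP a 0; last by rewrite (negbTE a0).
- have -> : affine a b @^-1` [set` `]u, v]] = [set` `[(v - b) / a, (u - b) / a[].
    by apply/seteqP; split => x /=; rewrite !in_itv/= ler_ndivrMr// ltr_ndivlMr//;
    rewrite /affine => /andP[h1 h2]; apply/andP; split; lra.
  rewrite lebesgue_measure_itv /= lte_fin ltr_nM2r ?invr_lt0// ltrD2r ltr0_norm//.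
  case: ifPn => // uv; last by rewrite mule0.
  by rewrite -!EFinB -EFinM; congr EFin; field; rewrite lt_eqF.
- have -> : affine a b @^-1` [set` `]u, v]] = [set` `](u - b) / a, (v - b) / a]].
    by apply/seteqP; split => x /=; rewrite !in_itv/= ler_pdivlMr// ltr_pdivrMr//;
    rewrite /affine => /andP[h1 h2]; apply/andP; split; lra.
  rewrite lebesgue_measure_itv /= lte_fin ltr_pM2r ?invr_gt0// ltrD2r gtr0_norm//.
  case: ifPn => // uv; last by rewrite mule0.
  by rewrite -!EFinB -EFinM; congr EFin; field; rewrite gt_eqF.
Qed.

Lemma ge0_integral_affine (a b : R) (D : set R) (f : R -> \bar R) : a != 0 ->
  measurable D -> measurable_fun D f -> (forall x, D x -> (0 <= f x)%E) ->
  (\int[mu]_(x in D) f x =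
   `|a|%:E * \int[mu]_(x in (fun x => (a * x + b)%R) @^-1` D) f (a * x + b)%R)%E.
Proof.
move=> a0 mD mf f0.
have a0' : 0 <= `|a| by [].
have [p pE] := image_measure a b.
pose m := mscale (NngNum a0') p.
transitivity (\int[m]_(x in D) f x)%E.
  apply: eq_measure_integral => A mA _.
  transitivity (`|a|%:E * p A)%E; last by [].
  by rewrite pE; exact: lebesgue_measure_affine.
rewrite ge0_integral_mscale//; congr (_ * _)%E.
transitivity (\int[pushforward mu (affine a b)]_(x in D) f x)%E.
  by apply: eq_measure_integral => A mA _; exact: pE.
rewrite ge0_integral_pushforward//; by move=> y /set_mem; exact: f0.
Qed.

Lemma integrable_affine (a b : R) (D : set R) (f : R -> R) : a != 0 ->
  measurable D -> mu.-integrable D (EFin \o f) ->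
  mu.-integrable ((fun x => a * x + b) @^-1` D) (EFin \o (fun x => f (a * x + b))).
Proof.
move=> a0 mD /integrableP [/measurable_EFinP mf fi].
have mD' := measurable_affine_preimage a b mD.
apply/integrableP; split.
  apply/measurable_EFinP; apply: (measurable_comp mD _ mf).
    by move=> _ [x Dx <-].
  exact: measurable_funS (measurable_affine a b).
have mf' : measurable_fun D (fun x => `|(f x)%:E|%E).
  by apply: measurableT_comp => //; exact/measurable_EFinP.
have H := @ge0_integral_affine a b D (fun x => `|(f x)%:E|%E) a0 mD
  mf' (fun _ _ => abse_ge0 _).
move: fi; rewrite /comp H.
set I := (X in (_ * X)%E).
have : (0 <= I)%E by exact: integral_ge0.
rewrite -/I => I0 Ii; rewrite -/I ltey; apply/eqP => Iy; move: Ii; rewrite Iy.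
by rewrite gt0_muley// lte_fin normr_gt0.
Qed.

Lemma Rintegral_affine (a b : R) (D : set R) (f : R -> R) : a != 0 ->
  measurable D -> mu.-integrable D (EFin \o f) ->
  \int[mu]_(x in D) f x =
   `|a| * \int[mu]_(x in (fun x => a * x + b) @^-1` D) f (a * x + b).
Proof.
move=> a0 mD fi; have /measurable_int mf := fi.
have fi' := integrable_affine b a0 mD fi.
have mD' := measurable_affine_preimage a b mD.
have E1 := @ge0_integral_affine a b D (EFin \o f)^\+%E a0 mD
  (measurable_funepos mf) (fun _ _ => funepos_ge0 _ _).
have E2 := @ge0_integral_affine a b D (EFin \o f)^\-%E a0 mD
  (measurable_funeneg mf) (fun _ _ => funeneg_ge0 _ _).
have Ep : (fun x => (EFin \o f)^\+ (a * x + b)%R)%E =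
    ((EFin \o (fun x => f (a * x + b)%R))^\+)%E.
  by apply/funext => x; rewrite !funeposE.
have En : (fun x => (EFin \o f)^\- (a * x + b)%R)%E =
    ((EFin \o (fun x => f (a * x + b)%R))^\-)%E.
  by apply/funext => x; rewrite !funenegE.
rewrite Ep in E1; rewrite En in E2.
have F1 : (\int[mu]_(x in (fun x => (a * x + b)%R) @^-1` D)
    (EFin \o (fun x => f (a * x + b)%R))^\+ x)%E \is a fin_num.
  by apply: integrable_fin_num => //; exact: integrable_funepos.
have F2 : (\int[mu]_(x in (fun x => (a * x + b)%R) @^-1` D)
    (EFin \o (fun x => f (a * x + b)%R))^\- x)%E \is a fin_num.
  by apply: integrable_fin_num => //; exact: integrable_funeneg.
rewrite /Rintegral integralE [in RHS]integralE.
rewrite [X in fine (X - _)]E1 [X in fine (_ - X)]E2.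
rewrite -muleBr//; last by apply: fin_num_adde_defl; rewrite fin_numN.
by rewrite fineM// fin_numB; apply/andP; split.
Qed.

(** Integrability on the rectangle comes from the bound on the inner integrals, by
    the theorem for nonnegative functions. *)
Lemma RFubini (D1 D2 : set R) (f : R * R -> R) g :
  measurable D1 -> measurable D2 -> measurable_fun (D1 `*` D2) f ->
  (forall x, D1 x -> mu.-integrable D2 (EFin \o (fun y => f (x, y)))) ->
  (forall y, D2 y -> mu.-integrable D1 (EFin \o (fun x => f (x, y)))) ->
  mu.-integrable D1 (EFin \o g) ->
  (forall x, D1 x -> \int[mu]_(y in D2) `|f (x, y)| <= g x) ->
  \int[mu]_(x in D1) \int[mu]_(y in D2) f (x, y) =
  \int[mu]_(y in D2) \int[mu]_(x in D1) f (x, y).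
Proof.
move=> mD1 mD2 mf i2 i1 ig fg.
have mD : measurable (D1 `*` D2) by exact: measurableX.
pose F := (EFin \o f) \_ (D1 `*` D2).
have mF : measurable_fun setT F.
  by apply/(measurable_restrictT _ _).1 => //; exact/measurable_EFinP.
have Fx x y : F (x, y) = ((fun x => ((fun y => (f (x, y))%:E) \_ D2) y) \_ D1) x.
  rewrite /F /patch in_setX /=; case: ifPn => [/andP[-> ->]//|].
  by case: (x \in D1) => //= /negbTE ->.
have Fx' x y : F (x, y) = ((fun y => ((fun x => (f (x, y))%:E) \_ D1) x) \_ D2) y.
  rewrite /F /patch in_setX /=; case: ifPn => [/andP[-> ->]//|].
  by case: (y \in D2) => //=; rewrite ?andbT ?andbF // => /negbTE ->.
have IF x : D1 x -> (\int[mu]_y F (x, y) = (\int[mu]_(y in D2) f (x, y))%:E)%E.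
  move=> Dx; rewrite /Rintegral fineK; last by apply: integrable_fin_num => //; exact: i2.
  rewrite [RHS]integral_mkcond; apply: eq_integral => y _.
  by rewrite Fx patchE mem_set.
have IF' y : D2 y -> (\int[mu]_x F (x, y) = (\int[mu]_(x in D1) f (x, y))%:E)%E.
  move=> Dx; rewrite /Rintegral fineK; last by apply: integrable_fin_num => //; exact: i1.
  rewrite [RHS]integral_mkcond; apply: eq_integral => x _.
  by rewrite Fx' patchE mem_set.
have IF0 x : ~ D1 x -> (\int[mu]_y F (x, y) = 0)%E.
  move=> nD; rewrite integral0_eq// => y _; rewrite Fx patchE memNset//.
have IF0' y : ~ D2 y -> (\int[mu]_x F (x, y) = 0)%E.
  move=> nD; rewrite integral0_eq// => x _; rewrite Fx' patchE memNset//.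
have iF : (mu \x mu)%E.-integrable setT F.
  apply/integrable12ltyP => //.
  pose H x := (\int[mu]_y `|F (x, y)|)%E.
  have mH : measurable_fun setT H.
    have aF0 (z : R * R) : (0 <= (abse \o F) z)%E by exact: (abse_ge0 (F z)).
    apply: (measurable_fun_fubini_tonelli_F (m2 := mu) (abse \o F)) => //.
    exact: measurableT_comp.
  have HD x : D1 x -> (H x <= (g x)%:E)%E.
    move=> Dx; rewrite (_ : H x = (\int[mu]_(y in D2) `|f (x, y)|)%:E) ?lee_fin ?fg//.
    rewrite /Rintegral fineK; last first.
      apply: integrable_fin_num => //; exact: integrable_abse (i2 _ Dx).
    rewrite [RHS]integral_mkcond /H; apply: eq_integral => y _.
    by rewrite Fx patchE mem_set// !patchE; case: ifPn => // _; rewrite abse0.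
  have HnD x : ~ D1 x -> H x = 0%E.
    move=> nD; rewrite /H integral0_eq// => y _.
    by rewrite Fx patchE memNset// abse0.
  rewrite -/H.
  suff : (\int[mu]_x H x < +oo)%E by [].
  have -> : H = H \_ D1.
    by apply/funext => x; rewrite patchE; case: ifPn => // /negP nD; apply: HnD => Dx;
      apply: nD; rewrite mem_set.
  rewrite -integral_mkcond.
  move/integrableP : ig => [/measurable_EFinP mg]; apply: le_lt_trans.
  apply: ge0_le_integral => //.
  - by move=> x _; apply: integral_ge0.
  - exact: measurable_funS mH.
  - by apply: measurableT_comp => //; exact/measurable_EFinP.
  - by move=> x Dx /=; apply: (le_trans (HD x Dx)); rewrite lee_fin ler_norm.
have FE := Fubini iF.
rewrite /Rintegral; congr fine.
rewrite [LHS]integral_mkcond [RHS]integral_mkcond.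
transitivity (\int[mu]_x \int[mu]_y F (x, y))%E.
  apply: eq_integral => x _; rewrite patchE; case: ifPn => [/set_mem Dx|/negP nD].
    by rewrite (IF _ Dx).
  by rewrite IF0// => Dx; apply: nD; rewrite mem_set.
rewrite FE; apply: eq_integral => y _; rewrite patchE; case: ifPn => [/set_mem Dx|/negP nD].
  by rewrite (IF' _ Dx).
by rewrite IF0'// => Dx; apply: nD; rewrite mem_set.
Qed.
End integration.

(** * Calculus on the line *)

Section calculus.
Context {R : realType}.
Notation mu := (@lebesgue_measure R).

(** Stated for a fixed measurable structure on the line, these avoid the two
    convertible presentations of its Borel sets. *)
Lemma integZ (D : set R) (k : R) (f : R -> R) : measurable D ->
  mu.-integrable D (EFin \o f) -> mu.-integrable D (EFin \o (fun x => k * f x)).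
Proof.
move=> mD fi.
have H : mu.-integrable D (fun x => (k%:E * (EFin \o f) x)%E) by apply: integrableZl.
by apply: eq_integrable H.
Qed.

Lemma integD (D : set R) (f g : R -> R) : measurable D ->
  mu.-integrable D (EFin \o f) -> mu.-integrable D (EFin \o g) ->
  mu.-integrable D (EFin \o (fun x => f x + g x)).
Proof.
move=> mD fi gi.
have H : mu.-integrable D ((EFin \o f) \+ (EFin \o g))%E by apply: integrableD.
by apply: eq_integrable H.
Qed.

Lemma integB (D : set R) (f g : R -> R) : measurable D ->
  mu.-integrable D (EFin \o f) -> mu.-integrable D (EFin \o g) ->
  mu.-integrable D (EFin \o (fun x => f x - g x)).
Proof.
move=> mD fi gi.
have H : mu.-integrable D ((EFin \o f) \- (EFin \o g))%E by apply: integrableB.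
by apply: eq_integrable H.
Qed.

Lemma eq_integ (D : set R) (f g : R -> R) : measurable D ->
  (forall x, D x -> f x = g x) ->
  mu.-integrable D (EFin \o f) -> mu.-integrable D (EFin \o g).
Proof.
by move=> mD fg; apply: eq_integrable => // x /set_mem Dx; rewrite /= fg.
Qed.

Lemma integ_sub (D E : set R) (f : R -> R) : measurable D -> measurable E ->
  E `<=` D -> mu.-integrable D (EFin \o f) -> mu.-integrable E (EFin \o f).
Proof. by move=> mD mE ED; apply: integrableS. Qed.

Lemma integ_patch (D : set R) (f : R -> R) : measurable D ->
  mu.-integrable D (EFin \o f) -> mu.-integrable setT (EFin \o (f \_ D)).
Proof.
move=> mD fi; rewrite -restrict_EFin.
exact: (integrable_mkcond _ _).1.
Qed.

Lemma integ_dom (D : set R) (f g : R -> R) : measurable D -> measurable_fun D f ->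
  (forall x, D x -> `|f x| <= g x) -> mu.-integrable D (EFin \o g) ->
  mu.-integrable D (EFin \o f).
Proof. by move=> mD mf fg; apply: integrable_dom. Qed.

Lemma eq_Rint (D : set R) (f g : R -> R) : (forall x, D x -> f x = g x) ->
  \int[mu]_(x in D) f x = \int[mu]_(x in D) g x.
Proof. by move=> fg; apply: eq_Rintegral => x /set_mem; exact: fg. Qed.

Lemma RintZ (D : set R) (k : R) (f : R -> R) : measurable D ->
  mu.-integrable D (EFin \o f) ->
  \int[mu]_(x in D) (k * f x) = k * \int[mu]_(x in D) f x.
Proof. by move=> mD fi; apply: RintegralZl. Qed.

Lemma RintD (D : set R) (f g : R -> R) : measurable D ->
  mu.-integrable D (EFin \o f) -> mu.-integrable D (EFin \o g) ->
  \int[mu]_(x in D) (f x + g x) = \int[mu]_(x in D) f x + \int[mu]_(x in D) g x.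
Proof. by move=> mD fi gi; apply: RintegralD. Qed.

Lemma RintB (D : set R) (f g : R -> R) : measurable D ->
  mu.-integrable D (EFin \o f) -> mu.-integrable D (EFin \o g) ->
  \int[mu]_(x in D) (f x - g x) = \int[mu]_(x in D) f x - \int[mu]_(x in D) g x.
Proof. by move=> mD fi gi; apply: RintegralB. Qed.

Lemma le_Rint (D : set R) (f g : R -> R) : measurable D ->
  mu.-integrable D (EFin \o f) -> mu.-integrable D (EFin \o g) ->
  (forall x, D x -> f x <= g x) ->
  \int[mu]_(x in D) f x <= \int[mu]_(x in D) g x.
Proof. by move=> mD fi gi fg; apply: le_Rintegral. Qed.

Lemma le_norm_Rint (D : set R) (f g : R -> R) : measurable D ->
  measurable_fun D f -> mu.-integrable D (EFin \o g) ->
  (forall x, D x -> `|f x| <= g x) ->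
  `|\int[mu]_(x in D) f x| <= \int[mu]_(x in D) g x.
Proof.
move=> mD mf gi fg; have fi := integ_dom mD mf fg gi.
apply: (le_trans (le_normr_Rintegral _ fi)) => //.
by apply: le_Rint => //; exact: (integrable_norm fi).
Qed.

(** [is_derive] is a class, which makes [apply] search for derivatives; this
    synonym is not. *)
Definition has_derive (F : R -> R) (x l : R) : Prop := is_derive x 1 F l.

Lemma hd_eq F (x l l' : R) : has_derive F x l -> l = l' -> has_derive F x l'.
Proof. by move=> ? <-. Qed.

Lemma hd_continuous (F : R -> R) (x l : R) :
  has_derive F x l -> {for x, continuous F}.
Proof.
by move=> [H _]; apply: differentiable_continuous; exact/derivable1_diffP.
Qed.

Lemma hd_id (x : R) : has_derive (fun x => x) x 1. Proof. exact: is_derive_id. Qed.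

Lemma hd_cst (c x : R) : has_derive (fun=> c) x 0. Proof. exact: is_derive_cst. Qed.

Lemma hdD (f g : R -> R) (x df dg : R) : has_derive f x df -> has_derive g x dg ->
  has_derive (fun x => f x + g x) x (df + dg).
Proof. exact: is_deriveD. Qed.

Lemma hdN (f : R -> R) (x df : R) : has_derive f x df ->
  has_derive (fun x => - f x) x (- df).
Proof. exact: is_deriveN. Qed.

Lemma hdB (f g : R -> R) (x df dg : R) : has_derive f x df -> has_derive g x dg ->
  has_derive (fun x => f x - g x) x (df - dg).
Proof. exact: is_deriveB. Qed.

Lemma hdM (f g : R -> R) (x df dg : R) : has_derive f x df -> has_derive g x dg ->
  has_derive (fun x => f x * g x) x (df * g x + f x * dg).
Proof.
move=> hf hg; have H := @is_deriveM _ _ f g x 1 df dg hf hg.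
by apply: (hd_eq H); rewrite /GRing.scale/=; ring.
Qed.

Lemma hdZ (k : R) (f : R -> R) (x df : R) : has_derive f x df ->
  has_derive (fun x => k * f x) x (k * df).
Proof. by move=> H; exact: (@is_deriveZ _ _ _ f k x 1 df H). Qed.

Lemma hdV (f : R -> R) (x df : R) : f x != 0 -> has_derive f x df ->
  has_derive (fun x => (f x)^-1) x (- df / f x ^+ 2).
Proof.
move=> f0 H; have H' := @is_deriveV _ f x df 1 f0 H.
by apply: (hd_eq H'); rewrite /GRing.scale/= !mulNr mulrC.
Qed.

Lemma hd_comp (f g : R -> R) (x df dg : R) : has_derive f (g x) df ->
  has_derive g x dg -> has_derive (fun x => f (g x)) x (df * dg).
Proof. by move=> hf hg; exact: (@is_derive1_comp _ f g x df dg hf hg). Qed.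

Lemma hd_powR (a x : R) : 0 < x ->
  has_derive (fun x => x `^ a) x (a * x `^ (a - 1)).
Proof. by move=> x0; exact: is_derive1_powR. Qed.

Lemma hd_expR (x : R) : has_derive expR x (expR x).
Proof. exact: is_derive_expR. Qed.

Lemma hd_sin (x : R) : has_derive sin x (cos x). Proof. exact: is_derive_sin. Qed.

Lemma hd_cos (x : R) : has_derive cos x (- sin x). Proof. exact: is_derive_cos. Qed.

Lemma continuous_powR (a x : R) : 0 < x -> {for x, continuous (fun x : R => x `^ a)}.
Proof. by move=> x0; apply: hd_continuous; exact: hd_powR. Qed.

Lemma cont_comp (f g : R -> R) (x : R) : {for x, continuous g} ->
  {for g x, continuous f} -> {for x, continuous (fun x => f (g x))}.
Proof. by move=> cg cf; exact: (continuous_comp cg cf). Qed.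

Lemma cvg_cont_comp (T : Type) (F : set_system T) {FF : Filter F} (u : T -> R)
    (f : R -> R) (l : R) : u x @[x --> F] --> l -> {for l, continuous f} ->
  f (u x) @[x --> F] --> f l.
Proof. by move=> ul cf; apply: continuous_cvg. Qed.

Lemma measurable_comp_sub (f : R -> R) : measurable_fun setT f ->
  measurable_fun setT (fun p : R * R => f (p.2 - p.1)).
Proof.
move=> mf; apply: (measurableT_comp mf).
exact: (measurable_funB measurable_snd measurable_fst).
Qed.

Lemma measurable_comp_fst (f : R -> R) : measurable_fun setT f ->
  measurable_fun setT (fun p : R * R => f p.1).
Proof. by move=> mf; apply: (measurableT_comp mf); exact: measurable_fst. Qed.

Lemma measurable_comp_snd (f : R -> R) : measurable_fun setT f ->
  measurable_fun setT (fun p : R * R => f p.2).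
Proof. by move=> mf; apply: (measurableT_comp mf); exact: measurable_snd. Qed.

Lemma cvg_inv_shift k : (n + k).+1%:R^-1 @[n --> \oo] --> (0 : R).
Proof. by rewrite (cvg_shiftn k (fun n => n.+1%:R^-1 : R)); exact: cvg_harmonic. Qed.

(** The segments [a_n, b_n] exhaust D. Integrals over them converge by dominated
    convergence if f is integrable, by monotone convergence if f is nonnegative,
    and integrability of f is then part of the conclusion. *)
Lemma FTC2_exhaust (D : set R) (f F : R -> R) (a_ b_ : nat -> R) (l1 l2 : R) :
  open D -> (forall x, D x -> {for x, continuous f}) ->
  (forall x, D x -> has_derive F x (f x)) ->
  (forall n, a_ n < b_ n) ->
  (forall n, `[a_ n, b_ n]%classic `<=` D) ->
  (forall x, D x -> \forall n \near \oo, a_ n <= x <= b_ n) ->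
  F (a_ n) @[n --> \oo] --> l1 -> F (b_ n) @[n --> \oo] --> l2 ->
  (mu.-integrable D (EFin \o f) \/
   [/\ forall x, D x -> 0 <= f x, nonincreasing_seq a_ & nondecreasing_seq b_]) ->
  mu.-integrable D (EFin \o f) /\ \int[mu]_(x in D) f x = l2 - l1.
Proof.
move=> oD cf dF ab abD ex Fa Fb H.
have mD : measurable D by exact: open_measurable.
have mf : measurable_fun D f.
  by apply: open_continuous_measurable_fun => // x /set_mem; exact: cf.
pose f_ n := f \_ (`[a_ n, b_ n]%classic).
have mf_ n : measurable_fun D (f_ n).
  apply/(measurable_restrict _ _ _) => //.
  by apply: measurable_funS mf => //; apply: subIsetl.
have cvf x : D x -> f_ n x @[n --> \oo] --> f x.
  move=> Dx; apply: cvg_near_cst; near=> n; rewrite /f_ patchE mem_set//= in_itv/=.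
  near: n; exact: ex.
have Ef n : (\int[mu]_(x in D) (f_ n x)%:E = (F (b_ n) - F (a_ n))%:E)%E.
  transitivity (\int[mu]_(x in `[a_ n, b_ n]) (f x)%:E)%E.
    rewrite [in RHS]integral_mkcond [in LHS]integral_mkcond.
    apply: eq_integral => x _; rewrite !patchE /f_ patchE.
    case: ifPn => xD; case: ifPn => // xab.
    by move: xD; rewrite mem_set//; apply: (abD n); exact/set_mem.
  rewrite (@continuous_FTC2 _ _ F)// -?EFinB//.
  - apply: continuous_in_subspaceT => x /set_mem xab; apply: cf; exact: abD xab.
  - split.
    + by move=> x xab; apply: (@ex_derive _ _ _ _ _ _ _ (dF x _)); apply: (abD n);
        exact: subset_itv_oo_cc.
    + apply: cvg_at_right_filter; apply: hd_continuous; apply: (dF (a_ n)).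
      by apply: (abD n); rewrite /= in_itv/= lexx ltW.
    + apply: cvg_at_left_filter; apply: hd_continuous; apply: (dF (b_ n)).
      by apply: (abD n); rewrite /= in_itv/= lexx ltW.
  - move=> x xab; rewrite derive1E; apply: (@derive_val _ _ _ _ _ _ _ (dF x _)).
    by apply: (abD n); exact: subset_itv_oo_cc.
have cF : F (b_ n) - F (a_ n) @[n --> \oo] --> l2 - l1 by exact: cvgB.
have iD : mu.-integrable D (EFin \o f).
  case: H => // -[f0 nia ndb]; apply/integrableP; split; first exact/measurable_EFinP.
  rewrite (_ : (\int[mu]_(x in D) _)%E = (l2 - l1)%:E) ?ltry//.
  transitivity (\int[mu]_(x in D) limn (fun n => (f_ n x)%:E))%E.
    apply: eq_integral => x /set_mem Dx; rewrite /= ger0_norm ?f0//.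
    apply/esym/cvg_lim => //; apply: cvg_EFin; first exact: nearW.
    exact: cvf.
  rewrite monotone_convergence//.
  - under eq_fun do rewrite Ef; apply/cvg_lim => //; apply: cvg_EFin => //; exact: nearW.
  - by move=> n; apply/measurable_EFinP; exact: mf_.
  - by move=> n x Dx; rewrite lee_fin /f_ patchE; case: ifPn => // _; exact: f0.
  - move=> x Dx n m nm; rewrite lee_fin /f_ !patchE; case: ifPn => [|_].
      move=> /set_mem; rewrite /= in_itv/= => /andP[h1 h2].
      rewrite ifT//; apply/mem_set; rewrite /= in_itv/= (le_trans (nia _ _ nm))//=.
      by rewrite (le_trans h2)// ndb.
    by case: ifPn => // _; exact: f0.
split => //.
have [|_] := @Rdominated_cvg R _ _ mu D f_ f (fun x => `|f x|) mD mf_ cvf (integrable_norm iD).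
  by move=> n x Dx; rewrite /f_ patchE; case: ifPn => // _; rewrite normr0.
under eq_fun do rewrite /Rintegral Ef /=.
by move=> c; exact: (cvg_unique _ c cF).
Unshelve. all: end_near. Qed.

Lemma FTC2_oo (a b : R) (f F : R -> R) (l1 l2 : R) : a < b ->
  (forall x, a < x < b -> {for x, continuous f}) ->
  (forall x, a < x < b -> has_derive F x (f x)) ->
  F x @[x --> a^'+] --> l1 -> F x @[x --> b^'-] --> l2 ->
  mu.-integrable `]a, b[ (EFin \o f) \/ (forall x, a < x < b -> 0 <= f x) ->
  mu.-integrable `]a, b[ (EFin \o f) /\ \int[mu]_(x in `]a, b[) f x = l2 - l1.
Proof.
move=> ab cf dF Fa Fb H.
pose e n : R := (b - a) / (n + 2).+1%:R.
have ba : 0 < b - a by rewrite subr_gt0.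
have e0 n : 0 < e n by rewrite divr_gt0.
have ce : e n @[n --> \oo] --> (0 : R).
  rewrite -(mulr0 (b - a)); apply: cvgM; first exact: cvg_cst.
  exact: cvg_inv_shift.
have eb n : 2 * e n < b - a.
  rewrite /e mulrA ltr_pdivrMr// mulrC ltr_pM2l//.
  by rewrite ltr_nat addn2.
apply: (@FTC2_exhaust _ _ F (fun n => a + e n) (fun n => b - e n)).
- exact: interval_open.
- by move=> x /=; rewrite in_itv/=; exact: cf.
- by move=> x /=; rewrite in_itv/=; exact: dF.
- by move=> n; move: (eb n) => h; lra.
- move=> n x /=; rewrite !in_itv/= => /andP[h1 h2]; have := e0 n.
  by move=> h; apply/andP; split; lra.
- move=> x /=; rewrite in_itv/= => /andP[h1 h2].
  have d0 : 0 < Num.min (x - a) (b - x) by rewrite lt_min !subr_gt0 h1 h2.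
  have /cvgrPdist_lt /(_ _ d0) := ce; apply: filterS => n.
  by rewrite sub0r normrN gtr0_norm// lt_min => /andP[h3 h4]; apply/andP; split; lra.
- move/cvg_at_rightP : Fa; apply; split; first by move=> n; rewrite ltrDl.
  rewrite -[X in _ --> X]addr0; apply: cvgD => //; exact: cvg_cst.
- move/cvg_at_leftP : Fb; apply; split; first by move=> n; rewrite gtrBl.
  rewrite -[X in _ --> X]subr0; apply: cvgB => //; exact: cvg_cst.
- case: H => [?|f0]; [by left|right]; split.
  + by move=> x /=; rewrite in_itv/=; exact: f0.
  + by move=> n m nm; rewrite lerD2l ler_pM2l// lef_pV2 ?posrE// ler_nat !ltnS leq_add2r.
  + by move=> n m nm; rewrite lerD2l lerN2 ler_pM2l// lef_pV2 ?posrE// ler_nat !ltnS leq_add2r.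
Unshelve. all: end_near. Qed.

Lemma FTC2_0y (f F : R -> R) (l1 l2 : R) :
  (forall x : R, 0 < x -> {for x, continuous f}) ->
  (forall x : R, 0 < x -> has_derive F x (f x)) ->
  F x @[x --> 0^'+] --> l1 -> F x @[x --> +oo] --> l2 ->
  mu.-integrable `]0, +oo[ (EFin \o f) \/ (forall x, 0 < x -> 0 <= f x) ->
  mu.-integrable `]0, +oo[ (EFin \o f) /\ \int[mu]_(x in `]0, +oo[) f x = l2 - l1.
Proof.
move=> cf dF Fa Fb H.
have ce : (n + 1).+1%:R^-1 @[n --> \oo] --> (0 : R).
  exact: cvg_inv_shift.
apply: (@FTC2_exhaust _ _ F (fun n => (n + 1).+1%:R^-1) (fun n => (n + 1).+1%:R)).
- exact: interval_open.
- by move=> x /=; rewrite in_itv/= andbT; exact: cf.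
- by move=> x /=; rewrite in_itv/= andbT; exact: dF.
- by move=> n; rewrite (@lt_trans _ _ 1)// ?invf_lt1// ltr1n addn1.
- by move=> n x /=; rewrite !in_itv/= andbT => /andP[h1 h2]; rewrite (lt_le_trans _ h1).
- move=> x /=; rewrite in_itv/= andbT => x0.
  near=> n; apply/andP; split; near: n.
    have /cvgrPdist_lt /(_ _ x0) := ce; apply: filterS => n.
    by rewrite sub0r normrN gtr0_norm// => /ltW.
  exists (Num.truncn x) => // n /= nx; rewrite ltW// (lt_le_trans (truncnS_gt _))//.
  by rewrite ler_nat ltnS addn1 (leq_trans nx).
- by move/cvg_at_rightP : Fa; apply; split.
- apply: cvg_comp Fb.
  rewrite (_ : (fun n => (n + 1).+1%:R) = (fun n => (n + 2)%:R)).
    by rewrite (cvg_shiftn 2 (fun n => n%:R : R)); exact: cvgr_idn.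
  by apply/funext => n; rewrite addn1 addn2.
- case: H => [?|f0]; [by left|right]; split.
  + by move=> x /=; rewrite in_itv/= andbT; exact: f0.
  + by move=> n m nm; rewrite lef_pV2 ?posrE// ler_nat !ltnS leq_add2r.
  + by move=> n m nm; rewrite ler_nat !ltnS leq_add2r.
Unshelve. all: end_near. Qed.

Lemma integral_powR (a t : R) : 0 < a -> 0 < t ->
  mu.-integrable `]0, t[ (EFin \o (fun s => s `^ (a - 1))) /\
  \int[mu]_(s in `]0, t[) (s `^ (a - 1)) = t `^ a / a.
Proof.
move=> a0 t0; rewrite -[t `^ a / a]subr0.
apply: (@FTC2_oo 0 t (fun s => s `^ (a - 1)) (fun s => s `^ a / a)) => //.
- by move=> x /andP[x0 _]; exact: continuous_powR.
- move=> x /andP[x0 _]; apply: hd_eq; first exact: hdM (hd_powR a x0) (hd_cst _ x).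
  by rewrite mulr0 addr0 mulrAC divff ?mul1r// gt_eqF.
- rewrite -[X in _ --> X](mul0r a^-1); apply: cvgM; last exact: cvg_cst.
  exact: powR_cvg0.
- apply: cvg_at_left_filter; apply: cvgM; last exact: cvg_cst.
  exact: continuous_powR.
- by right => x _; exact: powR_ge0.
Qed.

End calculus.

(** * Gamma and Beta integrals *)

Section gamma.
Context {R : realType}.
Notation mu := (@lebesgue_measure R).

Lemma Rintegral_support d (T : measurableType d) (m : {measure set T -> \bar R})
    (A B : set T) (f : T -> R) : A `<=` B ->
  (forall x, B x -> ~ A x -> f x = 0) ->
  \int[m]_(x in B) f x = \int[m]_(x in A) f x.
Proof.
move=> AB f0; rewrite Rintegral_mkcond [RHS]Rintegral_mkcond.
congr (Rintegral _ _ _); apply/funext => x; rewrite !patchE.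
case: ifPn => [/set_mem xB|/negP nB]; case: ifPn => [/set_mem xA|/negP nA] //.
- by apply: f0 => // Ax; apply: nA; rewrite mem_set.
- by exfalso; apply: nB; rewrite mem_set//; exact: AB.
Qed.

Lemma integrable_support d (T : measurableType d) (m : {measure set T -> \bar R})
    (A B : set T) (f : T -> R) : measurable A -> measurable B -> A `<=` B ->
  (forall x, B x -> ~ A x -> f x = 0) ->
  m.-integrable A (EFin \o f) -> m.-integrable B (EFin \o f).
Proof.
move=> mA mB AB f0 /(integrable_mkcond _ mA) iA.
apply/(integrable_mkcond _ mB); apply: eq_integrable iA => // x _.
rewrite !patchE; case: ifPn => [/set_mem xA|/negP nA]; case: ifPn => [/set_mem xB|/negP nB] //=.
- by exfalso; apply: nB; rewrite mem_set//; exact: AB.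
- by rewrite f0// => Ax; apply: nA; rewrite mem_set.
Qed.

Lemma Rintegral_le_subset d (T : measurableType d) (m : {measure set T -> \bar R})
    (A B : set T) (f : T -> R) : measurable A -> measurable B -> A `<=` B ->
  (forall x, B x -> 0 <= f x) -> m.-integrable B (EFin \o f) ->
  \int[m]_(x in A) f x <= \int[m]_(x in B) f x.
Proof.
move=> mA mB AB f0 iB; rewrite /Rintegral fine_le//.
- by apply: integrable_fin_num => //; exact: integrableS iB.
- exact: integrable_fin_num.
- apply: ge0_subset_integral => //; first by case/integrableP : iB.
Qed.

Lemma Rint_support (A B : set R) (f : R -> R) : A `<=` B ->
  (forall x, B x -> ~ A x -> f x = 0) ->
  \int[mu]_(x in B) f x = \int[mu]_(x in A) f x.
Proof. by move=> AB f0; apply: Rintegral_support. Qed.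

Lemma integ_support (A B : set R) (f : R -> R) : measurable A -> measurable B ->
  A `<=` B -> (forall x, B x -> ~ A x -> f x = 0) ->
  mu.-integrable A (EFin \o f) -> mu.-integrable B (EFin \o f).
Proof. by move=> mA mB AB f0; apply: integrable_support. Qed.

Lemma Rint_le_subset (A B : set R) (f : R -> R) : measurable A -> measurable B ->
  A `<=` B -> (forall x, B x -> 0 <= f x) -> mu.-integrable B (EFin \o f) ->
  \int[mu]_(x in A) f x <= \int[mu]_(x in B) f x.
Proof. by move=> mA mB AB f0 fi; apply: Rintegral_le_subset. Qed.

(** The m-th power of 1 + s <= m e^(s / m). It makes the Gamma integrand integrable
    at infinity. *)
Lemma powR_expR_bound (m s : R) : 1 <= m -> 0 <= s ->
  (1 + s) `^ m <= m `^ m * expR s.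
Proof.
move=> m1 s0; have m0 : 0 < m by rewrite (lt_le_trans _ m1).
have -> : expR s = (expR (s / m)) `^ m by rewrite -expRM divfK// gt_eqF.
rewrite -powRM ?(ltW m0) ?expR_ge0//.
apply: ge0_ler_powR; rewrite ?nnegrE ?(ltW m0)//.
- by rewrite addr_ge0.
- by rewrite mulr_ge0 ?(ltW m0)// expR_ge0.
rewrite (@le_trans _ _ (m * (1 + s / m)))//.
  by rewrite mulrDr mulr1 mulrCA divff ?gt_eqF// mulr1 lerD2r.
by rewrite ler_pM2l// expR_ge1Dx.
Qed.

Lemma expRN_bound (m s : R) : 1 <= m -> 0 <= s ->
  expR (- s) <= m `^ m * (1 + s) `^ (- m).
Proof.
move=> m1 s0; rewrite expRN powRN.
have s1 : 0 < 1 + s by rewrite ltr_pwDl.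
by rewrite ler_pdivlMr ?powR_gt0// mulrC ler_pdivrMr ?expR_gt0// powR_expR_bound.
Qed.

Lemma cvg_inv1D : (1 + s)^-1 @[s --> +oo] --> (0 : R).
Proof.
apply/cvgrPdist_lt => e e0; near=> s.
have s0 : 0 < s by [].
rewrite sub0r normrN gtr0_norm ?invr_gt0 ?addr_gt0//.
rewrite invf_plt ?posrE ?addr_gt0//.
rewrite (@lt_trans _ _ s)//; last lra.
near: s; apply: nbhs_pinfty_gt; exact: num_real.
Unshelve. all: end_near. Qed.

(** The integrand of [Gamma]. *)
Definition gammaf (z s : R) : R := s `^ (z - 1) * expR (- s).

Lemma continuous_gammaf (z : R) (s : R) : 0 < s -> {for s, continuous (gammaf z)}.
Proof.
move=> s0; apply: continuousM; first exact: continuous_powR.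
apply: continuous_comp; [exact: continuousN|exact: continuous_expR].
Qed.

Lemma measurable_gammaf (z : R) (D : set R) : measurable_fun D (gammaf z).
Proof.
apply: measurable_funM; first exact: measurableT_comp (measurable_powR _) _.
by apply: measurableT_comp => //; exact: measurableT_comp.
Qed.

Lemma gammaf_ge0 (z : R) (s : R) : 0 <= gammaf z s.
Proof. by rewrite mulr_ge0 ?powR_ge0 ?expR_ge0. Qed.

Lemma gammaf_integrable (z : R) : 0 < z -> mu.-integrable `]0, +oo[ (EFin \o gammaf z).
Proof.
move=> z0; pose g (s : R) := s / (1 + s).
pose h (s : R) := g s `^ (z - 1) * (1 + s) ^- 2.
pose C := (z + 1) `^ (z + 1).
have C0 : 0 <= C by exact: powR_ge0.
have s1 (s : R) : 0 < s -> 0 < 1 + s by move=> ?; lra.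
have dg (s : R) : 0 < s -> has_derive g s ((1 + s) ^- 2).
  move=> s0; have n0 : 1 + s != 0 by rewrite gt_eqF// s1.
  apply: hd_eq.
    exact: hdM (hd_id s) (hdV n0 (hdD (hd_cst 1 s) (hd_id s))).
  by rewrite /=; field.
have [ih _] : mu.-integrable `]0, +oo[ (EFin \o h) /\
    \int[mu]_(x in `]0, +oo[) h x = z^-1 - 0.
  apply: (@FTC2_0y R h (fun s => z^-1 * g s `^ z) 0 z^-1).
  - move=> s s0; apply: continuousM.
      have : {for s, continuous g} by apply: hd_continuous; exact: dg.
      move=> cg; apply: (@cont_comp R (fun x => x `^ (z - 1)) g s cg).
      by apply: continuous_powR; rewrite divr_gt0// s1.
    apply: continuousV; first by rewrite expf_neq0// gt_eqF// s1.
    apply: (@cont_comp R (fun x => x ^+ 2) (fun x => 1 + x)); last exact: exprn_continuous.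
    exact: hd_continuous (hdD (hd_cst 1 s) (hd_id s)).
  - move=> s s0.
    apply: hd_eq; first exact: hdZ (@hd_comp R (fun x => x `^ z) g s _ _ (hd_powR z (divr_gt0 s0 (s1 _ s0))) (dg _ s0)).
    by rewrite !mulrA mulVf ?mul1r// gt_eqF.
  - rewrite -[X in _ --> X](mulr0 z^-1); apply: cvgM; first exact: cvg_cst.
    apply: (@squeeze_cvgr _ _ _ _ (cst 0) (fun s => s `^ z)); last 2 first.
    + exact: cvg_cst.
    + exact: powR_cvg0.
    near=> s; have s0 : 0 < s by [].
    rewrite powR_ge0/= ge0_ler_powR ?nnegrE ?(ltW z0)//.
    + by rewrite ltW// divr_gt0// s1.
    + by rewrite ler_pdivrMr ?s1// ler_pMr//; lra.
  - rewrite -[X in _ --> X](mulr1 z^-1); apply: cvgM; first exact: cvg_cst.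
    have -> : (1 : R) = 1 `^ z by rewrite powR1.
    suff c1 : g x @[x --> +oo] --> (1 : R) by exact: (cvg_cont_comp c1 (continuous_powR ltr01)).
    have c2 : (fun s : R => 1 - (1 + s)^-1) s @[s --> +oo] --> (1 - 0 : R).
      by apply: cvgB; [exact: cvg_cst|exact: cvg_inv1D].
    rewrite subr0 in c2; apply: cvg_trans c2; apply: near_eq_cvg; near=> s.
    have s0 : 0 < s by [].
    by rewrite /g; field; rewrite gt_eqF// s1.
  - by right => s s0; rewrite mulr_ge0 ?powR_ge0// invr_ge0 exprn_ge0// ltW// s1.
apply: (@integ_dom R _ _ (fun s => C * h s)) => //.
- exact: measurable_gammaf.
- move=> s /=; rewrite in_itv/= andbT => s0.
  rewrite ger0_norm ?gammaf_ge0// /gammaf.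
  have h1 := @expRN_bound (z + 1) s (ltac:(lra)) (ltW s0).
  rewrite (le_trans (ler_wpM2l (powR_ge0 _ _) h1))//.
  have hE : h s = s `^ (z - 1) * (1 + s) `^ (- (z + 1)).
    have p1 := s1 _ s0; rewrite /h /g powRM; [|exact: ltW|by rewrite invr_ge0 ltW].
    rewrite -(powR_inv1 (ltW p1)) -powRrM -(powR_invn 2 (ltW p1)) -mulrA.
    rewrite -powRD ?(gt_eqF p1) ?implybT//; congr (_ * _ `^ _); ring.
  by rewrite hE mulrCA.
- exact: integZ.
Unshelve. all: end_near. Qed.

Lemma GammaE (z : R) : Gamma z = \int[mu]_(s in `]0, +oo[) gammaf z s.
Proof. by []. Qed.

Lemma Gamma_gt0 (z : R) : 0 < z -> 0 < Gamma z.
Proof.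
move=> z0; rewrite GammaE.
have [i1 e1] := integral_powR z0 (@ltr01 R).
have i2 := gammaf_integrable z0.
have S : `]0, 1[%classic `<=` (`]0, +oo[%classic : set R).
  by move=> x /=; rewrite !in_itv/= andbT => /andP[].
apply: (@lt_le_trans _ _ (\int[mu]_(s in `]0, 1[) gammaf z s)); last first.
  apply: Rint_le_subset => //; by move=> x _; exact: gammaf_ge0.
apply: (@lt_le_trans _ _ (\int[mu]_(s in `]0, 1[) (expR (-1) * s `^ (z - 1)))).
  by rewrite RintegralZl// e1 mulr_gt0 ?expR_gt0// divr_gt0// powR_gt0.
apply: le_Rintegral => //.
- exact: integZ.
- exact: integrableS i2.
- move=> s /=; rewrite in_itv/= => /andP[s0 s1].
  by rewrite mulrC ler_wpM2l ?powR_ge0// ler_expR lerN2 ltW.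
Qed.

Lemma GammaS (z : R) : 0 < z -> Gamma (z + 1) = z * Gamma z.
Proof.
move=> z0; rewrite !GammaE.
have i1 := gammaf_integrable z0.
have i2 := gammaf_integrable (addr_gt0 z0 ltr01).
have E (s : R) : gammaf (z + 1) s = s `^ z * expR (- s) by rewrite /gammaf addrK.
have [_] : mu.-integrable `]0, +oo[ (EFin \o (fun s => z * gammaf z s - gammaf (z + 1) s)) /\
   \int[mu]_(x in `]0, +oo[) (z * gammaf z x - gammaf (z + 1) x) = 0 - 0 :> R.
  apply: (@FTC2_0y R (fun s => z * gammaf z s - gammaf (z + 1) s) (gammaf (z + 1)) 0 0).
  - move=> s s0; apply: continuousB; last exact: continuous_gammaf.
    by apply: continuousM; [exact: cvg_cst|exact: continuous_gammaf].
  - move=> s s0.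
    rewrite (_ : gammaf (z + 1) = (fun s => s `^ z * expR (- s))); last exact/funext/E.
    apply: hd_eq; first exact: hdM (hd_powR z s0) (hd_comp (hd_expR (- s)) (hdN (hd_id s))).
    by rewrite /gammaf; ring.
  - under eq_fun do rewrite E.
    apply: (@squeeze_cvgr _ _ _ _ (cst 0) (fun s => s `^ z)); last 2 first.
    + exact: cvg_cst.
    + exact: powR_cvg0.
    near=> s; have s0 : 0 < s by [].
    rewrite mulr_ge0 ?powR_ge0 ?expR_ge0//= ler_piMr ?powR_ge0//.
    by rewrite expR_le1 oppr_le0 ltW.
  - under eq_fun do rewrite E.
    pose C := (z + 1) `^ (z + 1).
    apply: (@squeeze_cvgr _ _ _ _ (cst 0) (fun s => C * (1 + s)^-1)); last 2 first.
    + exact: cvg_cst.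
    + rewrite -[X in _ --> X](mulr0 C); apply: cvgM; first exact: cvg_cst.
      exact: cvg_inv1D.
    near=> s; have s0 : 0 < s by [].
    have s1 : 0 < 1 + s by lra.
    rewrite mulr_ge0 ?powR_ge0 ?expR_ge0//=.
    have h1 := @expRN_bound (z + 1) s (ltac:(lra)) (ltW s0).
    rewrite (le_trans (ler_wpM2l (powR_ge0 _ _) h1))// mulrCA ler_wpM2l ?powR_ge0//.
    rewrite (@le_trans _ _ ((1 + s) `^ z * (1 + s) `^ (- (z + 1))))//.
      rewrite ler_wpM2r ?powR_ge0// ge0_ler_powR ?nnegrE ?ltW//; lra.
    rewrite -powRD ?(gt_eqF s1) ?implybT// opprD addNKr.
    by rewrite powR_inv1// ltW.
  - by left; apply: integB => //; exact: integZ.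
rewrite subr0 RintegralB//; last exact: integZ.
by rewrite RintegralZl// => /eqP; rewrite subr_eq0 => /eqP.
Unshelve. all: end_near. Qed.

Lemma Gamma1 : Gamma 1 = 1 :> R.
Proof.
rewrite GammaE.
have E (s : R) : gammaf 1 s = expR (- s) by rewrite /gammaf subrr powRr0 mul1r.
have [_ ->] : mu.-integrable `]0, +oo[ (EFin \o (gammaf 1)) /\
   \int[mu]_(x in `]0, +oo[) (gammaf 1 x) = 0 - (-1) :> R; last by rewrite sub0r opprK.
  apply: (@FTC2_0y R (gammaf 1) (fun s => - expR (- s)) (-1) 0).
  - by move=> s s0; exact: continuous_gammaf.
  - move=> s s0; rewrite E.
    by apply: hd_eq; [exact: hdN (hd_comp (hd_expR (- s)) (hdN (hd_id s)))|ring].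
  - apply: cvg_at_right_filter; apply: cvgN; rewrite -expR0 -[in X in _ --> expR X]oppr0.
    apply: continuous_comp; [exact: continuousN|exact: continuous_expR].
  - by rewrite -oppr0; apply: cvgN; exact: cvgr_expR.
  - by right => s _; exact: gammaf_ge0.
Qed.

Lemma Gamma_nat n : Gamma n.+1%:R = n`!%:R :> R.
Proof.
elim: n => [|n IH]; first by rewrite Gamma1.
by rewrite -[n.+2]addn1 natrD GammaS// IH factS natrM.
Qed.

Lemma preimage_rev (t : R) : (fun x => -1 * x + t) @^-1` `]0, t[ = `]0, t[%classic.
Proof.
by apply/seteqP; split => x /=; rewrite !in_itv/= => /andP[? ?]; apply/andP; split; lra.
Qed.

Lemma Rintegral_rev (t : R) (f : R -> R) : mu.-integrable `]0, t[ (EFin \o f) ->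
  mu.-integrable `]0, t[ (EFin \o (fun s => f (t - s))) /\
  \int[mu]_(s in `]0, t[) f s = \int[mu]_(s in `]0, t[) f (t - s).
Proof.
move=> fi; have n1 : -1 != 0 :> R by rewrite oppr_eq0 oner_eq0.
have E (x : R) : -1 * x + t = t - x by rewrite mulN1r addrC.
have := integrable_affine t n1 (measurable_itv `]0, t[) fi.
have := Rintegral_affine t n1 (measurable_itv `]0, t[) fi.
rewrite preimage_rev normrN1 mul1r => -> ifr; split.
  by apply: eq_integ ifr => // x _; rewrite E.
by apply: eq_Rint => x _; rewrite E.
Qed.

Lemma preimage_scale (t : R) : 0 < t -> (fun x => t * x + 0) @^-1` `]0, t[ = `]0, 1[%classic.
Proof.
move=> t0; apply/seteqP; split => x /=; rewrite !in_itv/= addr0 pmulr_rgt0//;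
  by rewrite -[X in (t * x < X) ]mulr1 ltr_pM2l.
Qed.

Lemma Rintegral_scale (t : R) (f : R -> R) : 0 < t -> mu.-integrable `]0, t[ (EFin \o f) ->
  \int[mu]_(s in `]0, t[) f s = t * \int[mu]_(s in `]0, 1[) f (t * s).
Proof.
move=> t0 fi.
have := Rintegral_affine 0 (lt0r_neq0 t0) (measurable_itv `]0, t[) fi.
rewrite preimage_scale// gtr0_norm// => ->; congr (_ * _).
by apply: eq_Rint => x _; rewrite addr0.
Qed.

(** The Beta integrand on ]0, t[, the product of two power kernels that the
    convolution of singular functions brings in. *)
Definition betaf (a b t s : R) : R := (t - s) `^ (a - 1) * s `^ (b - 1).

Lemma measurable_betaf (a : R) (b : R) (t : R) (D : set R) : measurable_fun D (betaf a b t).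
Proof.
apply: measurable_funM; last exact: measurableT_comp (measurable_powR _) _.
by apply: (measurableT_comp (measurable_powR _)); exact: measurable_funB.
Qed.

Lemma betaf_integrable (a : R) (b : R) (t : R) : 0 < a -> 0 < b -> 0 < t ->
  mu.-integrable `]0, t[ (EFin \o betaf a b t).
Proof.
move=> a0 b0 t0.
pose C (c : R) := Num.max ((t / 2) `^ (c - 1)) (t `^ (c - 1)).
have t2 : 0 < t / 2 by rewrite divr_gt0.
have CP (c s : R) : t / 2 <= s -> s <= t -> s `^ (c - 1) <= C c.
  move=> s1 s2; rewrite /C le_max; have [c1|c1] := leP 0 (c - 1).
    by rewrite [X in _ || X]ge0_ler_powR ?orbT// nnegrE ltW//; lra.
  rewrite -[c - 1]opprK !(powRN _ (- (c - 1))).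
  rewrite lef_pV2 ?posrE ?powR_gt0//; last by lra.
  by rewrite ge0_ler_powR// ?nnegrE; lra.
have C0 c : 0 <= C c by rewrite /C le_max powR_ge0.
have [ia _] := integral_powR a0 t0.
have [ib _] := integral_powR b0 t0.
have [ia' _] := Rintegral_rev ia.
apply: (@integ_dom R _ _ (fun s => C a * s `^ (b - 1) + C b * (t - s) `^ (a - 1))) => //.
- exact: measurable_betaf.
- move=> s /=; rewrite in_itv/= => /andP[s0 st].
  rewrite ger0_norm ?mulr_ge0 ?powR_ge0// /betaf.
  have [h|h] := leP s (t / 2).
    rewrite (@le_trans _ _ (C a * s `^ (b - 1)))//; last first.
      by rewrite lerDl mulr_ge0 ?powR_ge0.
    by rewrite ler_wpM2r ?powR_ge0// CP//; lra.
  rewrite (@le_trans _ _ (C b * (t - s) `^ (a - 1)))//; last first.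
    by rewrite lerDr mulr_ge0 ?powR_ge0.
  by rewrite mulrC ler_wpM2r ?powR_ge0// CP//; lra.
- by apply: integD => //; exact: integZ.
Qed.

Lemma betaf_scale (a : R) (b : R) (t : R) : 0 < a -> 0 < b -> 0 < t ->
  \int[mu]_(s in `]0, t[) betaf a b t s =
  t `^ (a + b - 1) * \int[mu]_(s in `]0, 1[) betaf a b 1 s.
Proof.
move=> a0 b0 t0; rewrite (Rintegral_scale t0 (betaf_integrable a0 b0 t0)).
have i1 := betaf_integrable a0 b0 (@ltr01 R).
have -> : t `^ (a + b - 1) = t * t `^ (a + b - 2).
  by rewrite -{2}[t]powRr1 ?(ltW t0)// -powRD ?(gt_eqF t0) ?implybT//; congr (_ `^ _); ring.
rewrite -mulrA; congr (_ * _); rewrite -RintegralZl//.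
apply: eq_Rint => x /=; rewrite in_itv/= => /andP[x0 x1].
rewrite /betaf -{1}[t]mulr1 -mulrBr !powRM ?(ltW t0) ?(ltW x0) ?subr_ge0 ?(ltW x1)//.
rewrite mulrACA -powRD ?(gt_eqF t0) ?implybT//; congr (_ `^ _ * _); ring.
Qed.

(** The product of the two Gamma integrals is the integral of
    (z - y)^(a-1) y^(b-1) e^(-z) over 0 < y < z; integrating first in y produces
    the Beta integral and a Gamma integrand of parameter a + b. *)
Lemma Gamma_Beta (a : R) (b : R) : 0 < a -> 0 < b ->
  Gamma a * Gamma b = Gamma (a + b) * \int[mu]_(s in `]0, 1[) betaf a b 1 s.
Proof.
move=> a0 b0.
pose fa := gammaf a \_ `]0, +oo[.
have fa0 x : ~ 0 < x -> fa x = 0.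
  by move=> x0; rewrite /fa patchE memNset//= in_itv/= andbT.
have faE x : 0 < x -> fa x = gammaf a x.
  by move=> x0; rewrite /fa patchE mem_set//= in_itv/= andbT.
have mfa : measurable_fun setT fa.
  by apply/(measurable_restrictT _ _).1 => //; exact: measurable_gammaf.
have ifa : mu.-integrable setT (EFin \o fa).
  exact: integ_patch (gammaf_integrable a0).
have Ifa : \int[mu]_x fa x = Gamma a.
  by rewrite GammaE [RHS]Rintegral_mkcond.
have shift y : mu.-integrable setT (EFin \o (fun z => fa (z - y))) /\
    \int[mu]_z fa (z - y) = Gamma a.
  have E (x : R) : 1 * x - y = x - y by rewrite mul1r.
  have := integrable_affine (- y) (oner_neq0 R) measurableT ifa.
  have := Rintegral_affine (- y) (oner_neq0 R) measurableT ifa.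
  rewrite preimage_setT normr1 mul1r Ifa.
  move=> e1 e2; split; first by apply: eq_integ e2 => // x _; rewrite E.
  by rewrite e1; apply: eq_Rint => x _; rewrite E.
pose f (p : R * R) := fa (p.2 - p.1) * gammaf b p.1.
have inner z : 0 < z ->
    mu.-integrable `]0, z[ (EFin \o (fun y => f (y, z))) /\
    \int[mu]_(y in `]0, z[) f (y, z) =
    gammaf (a + b) z * \int[mu]_(s in `]0, 1[) betaf a b 1 s.
  move=> z0; have ib := betaf_integrable a0 b0 z0.
  have H y : 0 < y < z -> expR (- z) * betaf a b z y = f (y, z).
    move=> /andP[y0 yz]; rewrite /f /= faE ?subr_gt0// /gammaf /betaf.
    have -> : - z = - (z - y) + - y by ring.
    by rewrite expRD; ring.
  split.
    by apply: eq_integ (integZ (expR (- z)) (measurable_itv _) ib) => // y /=;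
      rewrite in_itv/= => h; rewrite H.
  rewrite /gammaf mulrAC -betaf_scale// mulrC -RintegralZl//.
  by apply: eq_Rint => y /=; rewrite in_itv/= => h; rewrite H.
have inner0 z y : ~ y < z -> f (y, z) = 0.
  by move=> yz; rewrite /f /= fa0 ?mul0r// subr_gt0.
have F := @RFubini R `]0, +oo[ setT f (fun y => Gamma a * gammaf b y).
have -> : Gamma a * Gamma b = \int[mu]_(y in `]0, +oo[) \int[mu]_z f (y, z).
  rewrite (GammaE b) -(RintZ _ (measurable_itv _) (gammaf_integrable b0)).
  apply: eq_Rint => y _; have [i1 <-] := shift y.
  rewrite mulrC -(RintZ _ measurableT i1).
  by apply: eq_Rint => z _; rewrite mulrC.
rewrite {F}(F (measurable_itv _) measurableT); last 5 first.
- apply: measurable_funTS; apply: measurable_funM.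
    exact: measurable_comp_sub.
  have mg : measurable_fun setT (gammaf b) by exact: measurable_gammaf.
  exact: measurable_comp_fst.
- move=> y _; have [i1 _] := shift y.
  apply: (eq_integ measurableT _ (integZ (gammaf b y) measurableT i1)) => z _.
  exact: mulrC.
- move=> z _; have [z0|z0] := ltP 0 z.
    have [iz _] := inner z z0; apply: (integ_support (measurable_itv _) (measurable_itv _) _ _ iz).
      by move=> x /=; rewrite !in_itv/= andbT => /andP[].
    move=> y /=; rewrite !in_itv/= andbT => y0 h; apply: inner0 => yz.
    by apply: h; rewrite y0.
  apply: (@integ_support set0) => //; last exact: integrable_set0.
  move=> y /=; rewrite in_itv/= andbT => y0 _; apply: inner0; apply/negP.
  by rewrite -leNgt (le_trans z0)// ltW.
- exact: integZ (gammaf_integrable b0).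
- move=> y _; have [i1 <-] := shift y.
  rewrite mulrC -(RintZ _ measurableT i1).
  rewrite le_eqVlt; apply/orP; left; apply/eqP; apply: eq_Rint => z _.
  rewrite mulrC ger0_norm// mulr_ge0 ?gammaf_ge0// /fa patchE.
  by case: ifPn => // _; exact: gammaf_ge0.
rewrite GammaE mulrC -(RintZ _ (measurable_itv _) (gammaf_integrable (addr_gt0 a0 b0))).
transitivity (\int[mu]_(z in `]0, +oo[) \int[mu]_(y in `]0, +oo[) f (y, z)).
  apply: Rint_support => // z _ /=; rewrite in_itv/= andbT => z0.
  rewrite (@Rint_support set0) ?Rintegral_set0//.
  move=> y /=; rewrite in_itv/= andbT => y0 _; apply: inner0 => yz.
  by apply: z0; rewrite (lt_trans y0).
apply: eq_Rint => z /=; rewrite in_itv/= andbT => z0.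
have [_] := inner z z0; rewrite mulrC => <-.
apply: Rint_support.
  by move=> x /=; rewrite !in_itv/= andbT => /andP[].
move=> y /=; rewrite !in_itv/= andbT => y0 h; apply: inner0 => yz.
by apply: h; rewrite y0.
Qed.

Lemma Beta_Gamma (a : R) (b : R) (t : R) : 0 < a -> 0 < b -> 0 < t ->
  \int[mu]_(s in `]0, t[) betaf a b t s =
  t `^ (a + b - 1) * (Gamma a * Gamma b / Gamma (a + b)).
Proof.
move=> a0 b0 t0; rewrite betaf_scale// Gamma_Beta// mulrAC divff ?mul1r//.
by rewrite gt_eqF// Gamma_gt0// addr_gt0.
Qed.

End gamma.

(** * Sine series of Hoelder functions *)

Section sines.
Context {R : realType}.
Notation mu := (@lebesgue_measure R).
Notation I := (`]0, pi[%classic : set R).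

Lemma hd_sinM (k x : R) : has_derive (fun x => sin (k * x)) x (k * cos (k * x)).
Proof.
apply: hd_eq; first exact: hd_comp (hd_sin (k * x)) (hdZ k (hd_id x)).
by rewrite mulr1 mulrC.
Qed.

Lemma hd_cosM (k x : R) : has_derive (fun x => cos (k * x)) x (- (k * sin (k * x))).
Proof.
apply: hd_eq; first exact: hd_comp (hd_cos (k * x)) (hdZ k (hd_id x)).
by rewrite mulr1 mulNr mulrC.
Qed.

Lemma continuous_sinM (k : R) : continuous (fun x => sin (k * x)).
Proof. by move=> x; apply: hd_continuous; exact: hd_sinM. Qed.

Lemma continuous_cosM (k : R) : continuous (fun x => cos (k * x)).
Proof. by move=> x; apply: hd_continuous; exact: hd_cosM. Qed.

Lemma sin_natpi (n : nat) : sin (n%:R * pi) = 0 :> R.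
Proof.
elim: n => [|n IH]; first by rewrite mul0r sin0.
by rewrite -[n.+1]addn1 natrD mulrDl mul1r sinDpi IH oppr0.
Qed.

Lemma cos_natpi (n : nat) : cos (n%:R * pi) = (-1) ^+ n :> R.
Proof.
elim: n => [|n IH]; first by rewrite mul0r cos0.
by rewrite -[n.+1]addn1 natrD mulrDl mul1r cosDpi IH addn1 exprS mulN1r.
Qed.

Lemma in_Ioo (a b x : R) : (`]a, b[%classic x) = (a < x < b).
Proof. by rewrite /= in_itv. Qed.

Lemma integ_bounded (a b M : R) (g : R -> R) : measurable_fun `]a, b[ g ->
  (forall x, a < x < b -> `|g x| <= M) -> mu.-integrable `]a, b[ (EFin \o g).
Proof.
move=> mg gM; apply: (@integ_dom R _ _ (fun=> M)) => //.
apply: measurable_bounded_integrable => //.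
- suff : (lebesgue_measure `]a, b[%classic < +oo :> \bar R)%E by [].
  rewrite lebesgue_measure_itv /=; case: ifPn => // _.
  by rewrite -EFinB ltry.
- exists `|M|; split; first exact: num_real.
  by move=> y My z _ /=; rewrite ltW.
Qed.

Lemma measurable_cont (a b : R) (g : R -> R) :
  (forall x, a < x < b -> {for x, continuous g}) -> measurable_fun `]a, b[ g.
Proof.
move=> cg; apply: open_continuous_measurable_fun; first exact: interval_open.
by move=> x /set_mem; rewrite in_Ioo; exact: cg.
Qed.

Lemma Rint_cst_oo (a b c : R) : a <= b -> \int[mu]_(x in `]a, b[) c = c * (b - a).
Proof.
move=> ab; rewrite Rintegral_cst//; congr (_ * _).
transitivity (fine (lebesgue_measure `]a, b[%classic)); first by [].
rewrite lebesgue_measure_itv /= lte_fin.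
case: ltP => //= ba; have -> : a = b by apply/eqP; rewrite eq_le ab ba.
by rewrite subrr.
Qed.

Lemma Rint_norm_le (a b M : R) (g : R -> R) : a <= b -> measurable_fun `]a, b[ g ->
  (forall x, a < x < b -> `|g x| <= M) -> `|\int[mu]_(x in `]a, b[) g x| <= M * (b - a).
Proof.
move=> ab mg gM; rewrite -Rint_cst_oo//; apply: le_norm_Rint => //.
  by apply: (@integ_bounded _ _ `|M|) => //.
Qed.

Lemma cont_seg_bounded (a b : R) (g : R -> R) : {within `[a, b], continuous g} ->
  exists M, 0 <= M /\ forall x, a <= x <= b -> `|g x| <= M.
Proof.
move=> cg; have [ab|ba] := leP a b; last first.
  by exists 0; split => // x /andP[h1 h2]; exfalso; lra.
have [c _ H] := EVT_max ab cg; have [d _ H'] := EVT_min ab cg.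
exists (`|g c| + `|g d|); split => [|x xab]; first by rewrite addr_ge0.
have := H x; have := H' x; rewrite in_itv/= => /(_ xab) h1 /(_ xab) h2.
rewrite ler_norml; apply/andP; split.
  by have := ler_norm (- g d); rewrite normrN; have := normr_ge0 (g c); lra.
by have := ler_norm (g c); have := normr_ge0 (g d); lra.
Qed.

Lemma cont_seg_interior (a b : R) (g : R -> R) : {within `[a, b], continuous g} ->
  forall x, a < x < b -> {for x, continuous g}.
Proof.
move=> /continuous_within_itvP cg x axb.
have ab : a < b by case/andP: axb => h1 h2; exact: lt_trans h2.
by have [+ _ _] := cg ab; apply.
Qed.

Lemma cont_seg_integ (a b : R) (g : R -> R) : {within `[a, b], continuous g} ->
  mu.-integrable `]a, b[ (EFin \o g).
Proof.
move=> cg; have [M [M0 gM]] := cont_seg_bounded cg.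
apply: (@integ_bounded _ _ M).
  exact: measurable_cont (cont_seg_interior cg).
by move=> x /andP[h1 h2]; rewrite gM// !ltW.
Qed.

Lemma cont_seg_limits (a b : R) (g : R -> R) : a < b -> {within `[a, b], continuous g} ->
  g x @[x --> a^'+] --> g a /\ g x @[x --> b^'-] --> g b.
Proof. by move=> ab /continuous_within_itvP => /(_ ab) []. Qed.

Lemma FTC2_seg (a b : R) (f F : R -> R) : a < b -> continuous f ->
  (forall x, has_derive F x (f x)) -> \int[mu]_(x in `]a, b[) f x = F b - F a.
Proof.
move=> ab cf dF.
have cF x : {for x, continuous F} by apply: hd_continuous; exact: dF.
have fi : mu.-integrable `]a, b[ (EFin \o f).
  by apply: cont_seg_integ; exact: continuous_subspaceT.
have [//|//|//|||_ //] := @FTC2_oo R a b f F (F a) (F b) ab.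
- by move=> x _; exact: cf.
- by apply: cvg_at_right_filter; exact: cF.
- by apply: cvg_at_left_filter; exact: cF.
- by left.
Qed.

Notation J := (`](- (pi / 2)), (3 * (pi / 2))[%classic : set R).

Let pih0 : - (pi / 2) < 3 * (pi / 2) :> R.
Proof. by have := pi_gt0 R => ?; lra. Qed.

Lemma Rint_cos_period (n : nat) : (0 < n)%N -> \int[mu]_(x in J) cos (n%:R * x) = 0.
Proof.
move=> n0; have nn : (n%:R : R) != 0 by rewrite pnatr_eq0 -lt0n.
rewrite (@FTC2_seg _ _ _ (fun x => n%:R^-1 * sin (n%:R * x)) pih0).
- have -> : n%:R * (3 * (pi / 2)) = n%:R * - (pi / 2) + (pi *+ 2) *+ n :> R.
    by rewrite -[X in _ + X]mulr_natr mulr2n; field.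
  by rewrite (periodicn (@sinD2pi R)) subrr.
- exact: continuous_cosM.
- move=> x; apply: hd_eq; first exact: hdZ (hd_sinM _ _).
  by rewrite mulrA mulVf// mul1r.
Qed.

Lemma Rint_cos_cos (j k : nat) : (0 < j)%N -> (0 < k)%N ->
  \int[mu]_(x in J) (cos (j%:R * x) * cos (k%:R * x)) = if j == k then pi else 0.
Proof.
wlog jk : j k / (j <= k)%N.
  move=> H j0 k0; have [jk|/ltnW kj] := leqP j k; first exact: H.
  rewrite eq_sym -H//; apply: eq_Rint => x _; exact: mulrC.
move=> j0 k0.
have E x : cos (j%:R * x) * cos (k%:R * x) =
    2^-1 * (cos ((j + k)%:R * x) + cos ((k - j)%:R * x)).
  have -> : (j + k)%:R * x = j%:R * x + k%:R * x by rewrite natrD mulrDl.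
  have -> : (k - j)%:R * x = k%:R * x - j%:R * x by rewrite natrB// mulrBl.
  by rewrite cosD cosB; field.
have ci n : mu.-integrable J (EFin \o (fun x => cos (n%:R * x))).
  by apply: cont_seg_integ; apply: continuous_subspaceT; exact: continuous_cosM.
under eq_Rintegral do rewrite E.
rewrite (RintZ _ (measurable_itv _)); last by apply: integD.
rewrite (RintD (measurable_itv _)) // Rint_cos_period ?addn_gt0 ?j0// add0r.
case: eqVneq => [->|njk]; last first.
  by rewrite Rint_cos_period ?mulr0// subn_gt0 ltn_neqAle njk.
rewrite subnn (@eq_Rint R _ _ (fun=> 1)); last by move=> x _; rewrite mul0r cos0.
rewrite Rint_cst_oo; first by field.
exact: ltW.
Qed.

Lemma Rint0 (D : set R) : \int[mu]_(x in D) (0 : R) = 0.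
Proof. by rewrite /Rintegral integral0. Qed.

Lemma integ_sum_n (D : set R) (F : nat -> R -> R) (m n : nat) : measurable D ->
  (forall i, mu.-integrable D (EFin \o F i)) ->
  mu.-integrable D (EFin \o (fun x => \sum_(m <= i < n) F i x)) /\
  \int[mu]_(x in D) (\sum_(m <= i < n) F i x) = \sum_(m <= i < n) \int[mu]_(x in D) F i x.
Proof.
move=> mD Fi; elim: n => [|n [IH1 IH2]].
  split; last by rewrite big_geq// (@eq_Rint R _ _ (fun=> 0)) ?Rint0// => x _; rewrite big_geq.
  apply: (@eq_integ R _ (fun=> 0)) => //; first by move=> x _; rewrite big_geq.
  exact: integrable0.
have [mn|nm] := leqP m n; last first.
  split; last by rewrite big_geq// (@eq_Rint R _ _ (fun=> 0)) ?Rint0// => x _; rewrite big_geq.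
  apply: (@eq_integ R _ (fun=> 0)) => //; first by move=> x _; rewrite big_geq.
  exact: integrable0.
have E x : \sum_(m <= i < n.+1) F i x = \sum_(m <= i < n) F i x + F n x by rewrite big_nat_recr.
split.
  by apply: (eq_integ mD _ (integD mD IH1 (Fi n))) => x _; rewrite E.
under eq_Rintegral do rewrite E.
by rewrite RintD// IH2 big_nat_recr.
Qed.

(** The cosines are orthogonal with squared norm pi over the period J, so D minus
    its projection on them has a nonnegative square integral. The period starts at
    - pi / 2 so that a function supported in ]0, pi[ can be shifted by up to pi / 4
    inside it. *)
Lemma bessel_cos (D : R -> R) (M : R) (m n : nat) : (0 < m)%N ->
  measurable_fun J D -> (forall x, J x -> `|D x| <= M) ->
  \sum_(m <= k < n) (\int[mu]_(x in J) (D x * cos (k%:R * x))) ^+ 2 <=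
  pi * \int[mu]_(x in J) (D x ^+ 2).
Proof.
move=> m0 mD DM.
have mJ : measurable J by exact: measurable_itv.
pose d k := \int[mu]_(x in J) (D x * cos (k%:R * x)).
have mc k : measurable_fun J (fun x : R => cos (k * x)).
  by apply: measurable_cont => x _; exact: continuous_cosM.
have M0 : 0 <= M.
  apply: (le_trans (normr_ge0 (D 0))); apply: DM; rewrite in_Ioo.
  by have := pi_gt0 R => ?; lra.
have iDc k : mu.-integrable J (EFin \o (fun x => D x * cos (k%:R * x))).
  apply: (@integ_bounded _ _ M); first by apply: measurable_funM.
  move=> x; rewrite -in_Ioo => Jx; rewrite normrM -[M]mulr1 ler_pM// ?DM//.
  exact: cos_max.
have iD2 : mu.-integrable J (EFin \o (fun x => D x ^+ 2)).
  apply: (@integ_bounded _ _ (M ^+ 2)); first exact: measurable_funX.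
  move=> x; rewrite -in_Ioo => Jx; rewrite normrX.
  by rewrite lerXn2r ?nnegrE//; exact: DM.
have icc j k : mu.-integrable J (EFin \o (fun x => cos (j%:R * x) * cos (k%:R * x))).
  apply: (@integ_bounded _ _ 1); first by apply: measurable_funM.
  by move=> x _; rewrite normrM -[1]mulr1 ler_pM// cos_max.
pose S x := \sum_(m <= k < n) (d k * cos (k%:R * x)).
have iDS' k : mu.-integrable J (EFin \o (fun x => d k * (D x * cos (k%:R * x)))) by exact: integZ.
have [iDS IDS] := integ_sum_n m n mJ iDS'.
have EDS x : D x * S x = \sum_(m <= k < n) (d k * (D x * cos (k%:R * x))).
  by rewrite /S big_distrr/=; apply: eq_bigr => k _; rewrite mulrCA.
have {}iDS : mu.-integrable J (EFin \o (fun x => D x * S x)).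
  by apply: (eq_integ mJ _ iDS) => x _; rewrite EDS.
have {}IDS : \int[mu]_(x in J) (D x * S x) = \sum_(m <= k < n) d k ^+ 2.
  under eq_Rintegral do rewrite EDS.
  by rewrite IDS; apply: eq_bigr => k _; rewrite RintZ// expr2.
have icS j : mu.-integrable J (EFin \o (fun x => cos (j%:R * x) * S x)) /\
   ((m <= j < n)%N -> \int[mu]_(x in J) (cos (j%:R * x) * S x) = pi * d j).
  have i1 k : mu.-integrable J (EFin \o (fun x => d k * (cos (j%:R * x) * cos (k%:R * x)))).
    exact: integZ.
  have [i2 I2] := integ_sum_n m n mJ i1.
  have E x : cos (j%:R * x) * S x = \sum_(m <= k < n) (d k * (cos (j%:R * x) * cos (k%:R * x))).
    by rewrite /S big_distrr/=; apply: eq_bigr => k _; rewrite mulrCA.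
  split; first by apply: (eq_integ mJ _ i2) => x _; rewrite E.
  move=> mjn; under eq_Rintegral do rewrite E.
  have /andP[mj jn] := mjn.
  rewrite I2 (bigD1_seq j) ?mem_index_iota ?iota_uniq//= RintZ//.
  rewrite Rint_cos_cos ?(leq_trans m0)// eqxx mulrC.
  rewrite big1_seq ?addr0// => k /andP[kj]; rewrite mem_index_iota => /andP[mk _].
  by rewrite RintZ// Rint_cos_cos ?(leq_trans m0)// eq_sym (negbTE kj) mulr0.
have i1 k : mu.-integrable J (EFin \o (fun x => d k * (cos (k%:R * x) * S x))).
  by apply: integZ => //; have [] := icS k.
have [iSS ISS] := integ_sum_n m n mJ i1.
have ESS x : S x * S x = \sum_(m <= k < n) (d k * (cos (k%:R * x) * S x)).
  by rewrite {1}/S big_distrl/=; apply: eq_bigr => k _; rewrite mulrA.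
have {}iSS : mu.-integrable J (EFin \o (fun x => S x * S x)).
  by apply: (eq_integ mJ _ iSS) => x _; rewrite ESS.
have {}ISS : \int[mu]_(x in J) (S x * S x) = pi * \sum_(m <= k < n) d k ^+ 2.
  under eq_Rintegral do rewrite ESS.
  rewrite ISS big_distrr/=; apply: eq_big_nat => k mkn.
  by rewrite RintZ//; [rewrite (icS k).2//; ring|have [] := icS k].
have : 0 <= \int[mu]_(x in J) ((D x ^+ 2 - 2 / pi * (D x * S x)) + pi ^- 2 * (S x * S x)).
  have pn0 : (pi : R) != 0 by rewrite gt_eqF// pi_gt0.
  have K (p u v : R) : p != 0 ->
      u ^+ 2 - 2 / p * (u * v) + p ^- 2 * (v * v) = (u - v / p) ^+ 2.
    by move=> ?; field.
  apply: Rintegral_ge0 => x _.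
  rewrite K//.
  exact: sqr_ge0.
rewrite RintD//; [|by apply: integB => //; exact: integZ|exact: integZ].
rewrite RintB//; last exact: integZ.
rewrite !RintZ// IDS ISS -/d.
set X := \sum_(_ <= _ < _) _; set Y := Rintegral _ _ _.
have p0 := pi_gt0 R.
have K2 (p u v : R) : p != 0 -> v - 2 / p * u + p ^- 2 * (p * u) = (p * v - u) / p.
  by move=> ?; field.
rewrite K2 ?gt_eqF//.
by rewrite pmulr_lge0 ?invr_gt0// subr_ge0.
Qed.

Definition fsin (g : R -> R) (n : nat) : R :=
  2 / pi * \int[mu]_(x in I) (g x * sin (n%:R * x)).

Lemma fsin0 g : fsin g 0 = 0.
Proof.
rewrite /fsin (@eq_Rint R _ _ (fun=> 0)) ?Rint0 ?mulr0// => x _.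
by rewrite mul0r sin0 mulr0.
Qed.

(** A function vanishing outside ]0, pi[ can be translated, at no cost in the
    Hoelder constant when it vanishes at both ends. *)
Definition zext (g : R -> R) : R -> R := g \_ I.

Lemma zext_in g x : 0 < x < pi -> zext g x = g x.
Proof. by move=> x0; rewrite /zext patchE mem_set// in_Ioo. Qed.

Lemma zext_out g x : ~ (0 < x < pi) -> zext g x = 0.
Proof. by move=> x0; rewrite /zext patchE memNset// in_Ioo. Qed.

Definition holder (a C : R) (g : R -> R) : Prop :=
  forall x y, 0 <= x <= pi -> 0 <= y <= pi -> `|g x - g y| <= C * `|x - y| `^ a.

(** A segment leaving [0, pi] crosses an end, where g vanishes, and the part of it
    inside is shorter. *)
Lemma zext_holder a C g : 0 < a -> 0 <= C -> g 0 = 0 -> g pi = 0 -> holder a C g ->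
  forall x y, `|zext g x - zext g y| <= C * `|x - y| `^ a.
Proof.
move=> a0 C0 g0 gp gh.
have p0 := pi_gt0 R.
have mono (u v : R) : 0 <= u -> u <= v -> C * u `^ a <= C * v `^ a.
  move=> u0 uv; rewrite ler_wpM2l// ge0_ler_powR ?nnegrE ?(ltW a0)//.
  exact: le_trans uv.
have main x y : x <= y -> `|zext g x - zext g y| <= C * `|x - y| `^ a.
  move=> xy; pose u := Num.max 0 (Num.min x pi); pose v := Num.max 0 (Num.min y pi).
  have clamp (z : R) : zext g z = g (Num.max 0 (Num.min z pi)).
    have [/andP[z0 zp]|nz] := pselect (0 < z < pi).
      by rewrite zext_in ?z0// min_l ?(ltW zp)// max_r// ltW.
    rewrite zext_out//; have [z0|z0] := leP z 0.
      by rewrite min_l ?max_l// (le_trans z0)// ltW.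
    have zp : pi <= z by rewrite leNgt; apply/negP => zp; apply: nz; rewrite z0.
    by rewrite min_r// max_r// ltW.
  rewrite !clamp -/u -/v.
  have cl (z : R) : 0 <= Num.max 0 (Num.min z pi) <= pi.
    by rewrite le_max lexx/= ge_max (ltW p0) ge_min lexx orbT.
  apply: (le_trans (gh _ _ (cl x) (cl y))); apply: mono => //.
  rewrite -/u -/v (ler0_norm (x := x - y)) ?subr_le0//.
  have uv : u <= v.
    rewrite /u /v ge_max le_max lexx/=; rewrite le_max; apply/orP; right.
    by rewrite le_min !ge_min xy lexx orbT.
  rewrite ler0_norm ?subr_le0// !opprB.
  rewrite /u /v /Num.max /Num.min; do 4?case: ifPn; rewrite -?leNgt => *; lra.
move=> x y; have [xy|/ltW yx] := leP x y; first exact: main.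
by rewrite distrC [X in X `^ _]distrC; exact: main.
Qed.

Lemma measurable_zext g : measurable_fun I g -> measurable_fun setT (zext g).
Proof. by move=> mg; apply/(measurable_restrictT _ _).1. Qed.

Lemma Rint_shift (f : R -> R) (h : R) : mu.-integrable setT (EFin \o f) ->
  mu.-integrable setT (EFin \o (fun x => f (x + h))) /\
  \int[mu]_x f (x + h) = \int[mu]_x f x.
Proof.
move=> fi; have E (x : R) : 1 * x + h = x + h by rewrite mul1r.
have := integrable_affine h (oner_neq0 R) measurableT fi.
have := Rintegral_affine h (oner_neq0 R) measurableT fi.
rewrite preimage_setT normr1 mul1r => -> e2; split.
  by apply: (eq_integ measurableT _ e2) => x _; rewrite E.
by apply: eq_Rint => x _; rewrite E.
Qed.

(** Let D be the difference of the two translates of g by h = pi / (4 N). Its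
    cosine coefficients are 2 sin (k h) times the sine coefficients of g, and
    sin (k h)^2 >= 1/2 on the dyadic block. The claim is the inequality of Bessel
    for D, which is bounded by the Hoelder condition. *)
Lemma bernstein_block (a C : R) (g : R -> R) (N : nat) : 0 < a -> 0 < C -> (0 < N)%N ->
  measurable_fun I g -> g 0 = 0 -> g pi = 0 -> holder a C g ->
  \sum_(N <= k < N.*2) (\int[mu]_(x in I) (g x * sin (k%:R * x))) ^+ 2 <=
  pi ^+ 2 * (C * (pi / (2 * N%:R)) `^ a) ^+ 2.
Proof.
move=> a0 C0 N0 mg g0 gp gh; have p0 := pi_gt0 R.
have NR : 0 < N%:R :> R by rewrite ltr0n.
have N1 : 1 <= N%:R :> R by rewrite ler1n.
pose h : R := pi / (4 * N%:R).
have h0 : 0 < h by rewrite divr_gt0// mulr_gt0.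
have hp : h <= pi / 4.
  by rewrite ler_pM2l// lef_pV2 ?posrE// ?mulr_gt0// ler_peMr.
pose z := zext g.
have zh := zext_holder a0 (ltW C0) g0 gp gh.
pose K := C * (pi / (2 * N%:R)) `^ a.
pose D x := z (x + h) - z (x - h).
have DK x : `|D x| <= K.
  apply: (le_trans (zh _ _)); rewrite /K.
  have -> : x + h - (x - h) = pi / (2 * N%:R) by rewrite /h; field; rewrite gt_eqF.
  by rewrite gtr0_norm// divr_gt0// mulr_gt0.
have mz : measurable_fun setT z by exact: measurable_zext.
have msh (c : R) : measurable_fun setT (fun x : R => z (x + c)).
  by apply: (measurableT_comp mz); exact: measurable_funD.
have mD : measurable_fun setT D by apply: measurable_funB; exact: msh.
have zM x : `|z x| <= C * pi `^ a.
  have := zh x 0; rewrite [zext g 0]zext_out ?subr0; last by rewrite ltxx.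
  have [xp|nx] := pselect (0 < x < pi); last first.
    by move=> _; rewrite /z zext_out// normr0 mulr_ge0 ?powR_ge0 ?ltW.
  move/le_trans; apply; rewrite ler_wpM2l ?(ltW C0)//; case/andP: xp => x0 xp.
  by apply: ge0_ler_powR; rewrite ?nnegrE ?(ltW a0) ?(ltW p0)// gtr0_norm// ltW.
pose d k := \int[mu]_(x in I) (g x * sin (k%:R * x)).
(* translation turns cos (k (x - h)) - cos (k (x + h)) into 2 sin (k h) sin (k x) *)
have key k : \int[mu]_(x in J) (D x * cos (k%:R * x)) = 2 * sin (k%:R * h) * d k.
  have zi (t : R -> R) : continuous t -> (forall x, `|t x| <= 1) ->
      mu.-integrable setT (EFin \o (fun x => z x * t x)).
    move=> ct t1; apply: (@integ_support _ I) => //.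
      by move=> x _; rewrite in_Ioo => nx; rewrite /z zext_out// mul0r.
    apply: (@integ_bounded _ _ (C * pi `^ a)).
      apply: measurable_funM; first exact: measurable_funTS.
      by apply: measurable_cont => x _; exact: ct.
    by move=> x _; rewrite normrM -[C * _]mulr1 ler_pM.
  have ccos c : continuous (fun x : R => cos (k%:R * (x + c))).
    move=> x; apply: hd_continuous.
    exact: hd_comp (hd_cos _) (hdZ _ (hdD (hd_id x) (hd_cst c x))).
  have zc (c : R) : mu.-integrable setT (EFin \o (fun x => z (x + c) * cos (k%:R * x))) /\
     \int[mu]_x (z (x + c) * cos (k%:R * x)) = \int[mu]_x (z x * cos (k%:R * (x - c))).
    have [|e1 e2] := @Rint_shift (fun x => z x * cos (k%:R * (x - c))) c.
      by apply: zi => [|x]; [exact: ccos|exact: cos_max].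
    split; first by apply: (eq_integ measurableT _ e1) => x _; rewrite addrK.
    by rewrite -e2; apply: eq_Rint => x _; rewrite addrK.
  have [i1 e1] := zc h; have [i2 e2] := zc (- h).
  transitivity (\int[mu]_x (z (x + h) * cos (k%:R * x) - z (x - h) * cos (k%:R * x))).
    symmetry; rewrite (@Rint_support _ J setT)//.
      by apply: eq_Rint => x _; rewrite mulrBl.
    move=> x _; rewrite in_Ioo => nx.
    have out c : - h <= c <= h -> z (x + c) = 0.
      by move=> /andP[c1 c2]; apply: zext_out => /andP[x1 x2]; apply: nx; apply/andP; split; lra.
    by rewrite !out ?mul0r ?subrr//; lra.
  rewrite RintB// e1 e2 -RintB//; last 2 first.
  - by apply: zi => [|x]; [exact: ccos|exact: cos_max].
  - by apply: zi => [|x]; [exact: ccos|exact: cos_max].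
  have isn : mu.-integrable I (EFin \o (fun x => g x * sin (k%:R * x))).
    have := zi _ (@continuous_sinM k%:R) (fun x => sin_max _) => iz.
    apply: (eq_integ _ _ (integ_sub measurableT (measurable_itv _) (@subsetT _ _) iz)) => //.
    by move=> x; rewrite in_Ioo => xI; rewrite /z zext_in.
  rewrite -RintZ//; rewrite (@Rint_support _ I setT)//.
    apply: eq_Rint => x; rewrite in_Ioo => xI; rewrite /z zext_in//.
    by rewrite opprK mulrBr mulrDr cosB cosD; ring.
  by move=> x _; rewrite in_Ioo => nx; rewrite /z zext_out// !mul0r subrr.
have sh k : (N <= k < N.*2)%N -> 2^-1 <= sin (k%:R * h) ^+ 2.
  move=> /andP[Nk kN].
  have Nk' : N%:R <= k%:R :> R by rewrite ler_nat.
  have kN' : k%:R <= 2 * N%:R :> R by rewrite -natrM mul2n ler_nat ltnW.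
  have c0 : cos (2 * (k%:R * h)) <= 0.
    have -> : 2 * (k%:R * h) = (2 * (k%:R * h) - pi / 2) + pi / 2 by ring.
    rewrite cosDpihalf oppr_le0; apply: sin_ge0_pi; apply/andP; split.
      have : N%:R * h <= k%:R * h by rewrite ler_pM2r.
      have -> : N%:R * h = pi / 4 by rewrite /h; field; rewrite gt_eqF.
      lra.
    have : k%:R * h <= 2 * N%:R * h by rewrite ler_pM2r.
    have -> : 2 * N%:R * h = pi / 2 by rewrite /h; field; rewrite gt_eqF.
    lra.
  have e1 : cos (2 * (k%:R * h)) = 2 * cos (k%:R * h) ^+ 2 - 1.
    by rewrite [2 * (k%:R * h)]mulr_natl cos_mulr2n [2 * _ ^+ 2]mulr_natl.
  by rewrite sin2cos2; lra.
have := @bessel_cos D K N N.*2 N0 (measurable_funTS mD) (fun x _ => DK x).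
have i2 : \int[mu]_(x in J) (D x ^+ 2) <= K ^+ 2 * (2 * pi).
  have -> : 2 * pi = 3 * (pi / 2) - - (pi / 2) :> R by field.
  apply: (le_trans (ler_norm _)); apply: Rint_norm_le.
  - by apply: ltW.
  - by apply: measurable_funX; exact: measurable_funTS.
  - move=> x _; rewrite normrX lerXn2r ?nnegrE//.
    by rewrite mulr_ge0 ?powR_ge0 ?ltW.
move=> B; have := le_trans B (ler_wpM2l (ltW p0) i2).
have : \sum_(N <= k < N.*2) (2 * d k ^+ 2) <=
    \sum_(N <= k < N.*2) (\int[mu]_(x in J) (D x * cos (k%:R * x))) ^+ 2.
  rewrite !big_nat; apply: ler_sum => k kN; rewrite key !exprMn.
  by rewrite ler_wpM2r ?sqr_ge0//; have := sh k kN; lra.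
move=> H1 H2; have := le_trans H1 H2; rewrite -big_distrr /=.
rewrite -/K -/(d _) => H; lra.
Qed.

(** Cauchy-Schwarz on a block of N terms, written as 2 |d| <= d^2 / l + l with the
    optimal l. *)
Lemma bernstein_block_l1 (a C : R) (g : R -> R) (N : nat) : 0 < a -> 0 < C -> (0 < N)%N ->
  measurable_fun I g -> g 0 = 0 -> g pi = 0 -> holder a C g ->
  \sum_(N <= k < N.*2) `|fsin g k| <= C * (2 * (pi / 2) `^ a) * N%:R `^ (2^-1 - a).
Proof.
move=> a0 C0 N0 mg g0 gp gh; have p0 := pi_gt0 R.
have NR : 0 < N%:R :> R by rewrite ltr0n.
have B := bernstein_block a0 C0 N0 mg g0 gp gh.
pose d k := \int[mu]_(x in I) (g x * sin (k%:R * x)).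
pose K := C * (pi / (2 * N%:R)) `^ a.
have K0 : 0 < K by rewrite mulr_gt0// powR_gt0// divr_gt0// mulr_gt0.
pose s := N%:R `^ (2^-1) : R.
have s0 : 0 < s by rewrite powR_gt0.
have ss : s * s = N%:R.
  rewrite /s -powRD ?gt_eqF ?implybT//.
  have -> : 2^-1 + 2^-1 = 1 :> R by field.
  by rewrite powRr1// ltW.
pose l := pi * K / s.
have l0 : 0 < l by rewrite divr_gt0// mulr_gt0.
have dk k : `|fsin g k| <= pi^-1 * (l^-1 * d k ^+ 2 + l).
  rewrite /fsin -/(d k) normrM gtr0_norm ?divr_gt0//.
  have : 2 * `|d k| <= l^-1 * d k ^+ 2 + l.
    rewrite -subr_ge0.
    have -> : l^-1 * d k ^+ 2 + l - 2 * `|d k| = l^-1 * (`|d k| - l) ^+ 2.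
      by rewrite -[d k ^+ 2]real_normK ?num_real//; field; rewrite gt_eqF.
    by rewrite mulr_ge0 ?sqr_ge0// invr_ge0 ltW.
  move=> H; rewrite mulrAC [X in X <= _]mulrC ler_wpM2l// invr_ge0 ltW//.
apply: (@le_trans _ _ (\sum_(N <= k < N.*2) (pi^-1 * (l^-1 * d k ^+ 2 + l)))).
  by apply: ler_sum => k _.
rewrite -big_distrr/= big_split/= -big_distrr/= sumr_const_nat -addnn addnK.
have H : l^-1 * \sum_(N <= k < N + N) d k ^+ 2 <= l^-1 * (pi ^+ 2 * K ^+ 2).
  by rewrite addnn ler_wpM2l ?invr_ge0 ?(ltW l0).
rewrite (@le_trans _ _ (pi^-1 * (l^-1 * (pi ^+ 2 * K ^+ 2) + l *+ N)))//.
  by rewrite ler_wpM2l ?invr_ge0 ?(ltW p0)// lerD2r.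
rewrite -mulr_natr -[X in l * X]ss.
have -> : pi^-1 * (l^-1 * (pi ^+ 2 * K ^+ 2) + l * (s * s)) = 2 * K * s.
  rewrite /l; have pn : pi != 0 :> R by rewrite gt_eqF.
  have K3 (p u v : R) : p != 0 -> u != 0 -> v != 0 ->
    p^-1 * ((p * u / v)^-1 * (p ^+ 2 * u ^+ 2) + p * u / v * (v * v)) = 2 * u * v.
    by move=> ? ? ?; field; apply/and3P; split.
  by rewrite K3 ?gt_eqF.
rewrite /K; have -> : pi / (2 * N%:R) = (pi / 2) * N%:R^-1 :> R by rewrite invfM mulrA.
rewrite powRM ?divr_ge0 ?invr_ge0 ?(ltW p0)//.
rewrite -(powR_inv1 (ltW NR)) -powRrM mulN1r /s.
rewrite powRD; last by rewrite (gt_eqF NR) implybT.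
by rewrite le_eqVlt; apply/orP; left; apply/eqP; ring.
Qed.

(** Bernstein's theorem: the sine series of a Hoelder function of exponent
    greater than 1/2 converges absolutely, with a little room to spare. The
    tails are controlled uniformly over the Hoelder ball. *)
Lemma bernstein (a e : R) : 0 < e -> e < a - 2^-1 ->
  exists tau : nat -> R, [/\ tau @ \oo --> 0, (forall N, 0 <= tau N) &
  forall (C : R) (g : R -> R), 0 < C -> measurable_fun I g -> g 0 = 0 -> g pi = 0 -> holder a C g ->
  forall N n, \sum_(N <= k < n) (k%:R `^ e * `|fsin g k|) <= C * tau N].
Proof.
move=> e0 ea; have a0 : 0 < a by lra.
have p0 := pi_gt0 R.
pose q : R := 2 `^ (2^-1 - a + e).
have q0 : 0 < q by rewrite powR_gt0.
have q1 : q < 1 by rewrite -(powRr0 2) /q /powR gt_eqF// ltr_expR ltr_pM2r ?ln_gt0 ?ltr1n//; lra.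
pose K1 : R := 2 * (pi / 2) `^ a * 2 `^ e.
have K10 : 0 <= K1 by rewrite !mulr_ge0 ?powR_ge0.
(* a dyadic block contributes q^m, and N lies in the block of its binary logarithm *)
pose tau N := K1 / (1 - q) * q ^+ (trunc_log 2 N).
have K1q : 0 <= K1 / (1 - q) by rewrite divr_ge0// subr_ge0 ltW.
exists tau; split.
- rewrite -[X in _ --> X](mulr0 (K1 / (1 - q))); apply: cvgM; first exact: cvg_cst.
  apply/cvgrPdist_lt => d d0.
  have /cvgrPdist_lt /(_ _ d0) [M _ HM] : q ^+ n @[n --> \oo] --> (0 : R).
    by apply: cvg_expr; rewrite ger0_norm// ltW.
  exists (2 ^ M)%N => // N /= MN; apply: HM => /=.
  by apply: trunc_log_max.
- by move=> N; rewrite mulr_ge0// exprn_ge0// ltW.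
move=> C g C0 mg g0 gp gh.
pose t k := k%:R `^ e * `|fsin g k|.
have t0 k : 0 <= t k by rewrite mulr_ge0 ?powR_ge0.
have block m : \sum_(2 ^ m <= k < 2 ^ m.+1) t k <= C * K1 * q ^+ m.
  have N0 : (0 < 2 ^ m)%N by rewrite expn_gt0.
  apply: (@le_trans _ _ (\sum_(2 ^ m <= k < 2 ^ m.+1) ((2 ^ m.+1)%:R `^ e * `|fsin g k|))).
    rewrite !big_nat; apply: ler_sum => k /andP[_ k2]; rewrite ler_wpM2r//.
    by apply: ge0_ler_powR; rewrite ?nnegrE ?(ltW e0)// ler_nat ltnW.
  rewrite -big_distrr/= expnS mul2n.
  rewrite (le_trans (ler_wpM2l (powR_ge0 _ _) (bernstein_block_l1 a0 C0 N0 mg g0 gp gh)))//.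
  rewrite -mul2n natrM powRM// /K1 /q.
  have -> : 2 `^ (2^-1 - a + e) ^+ m = (2 ^ m)%:R `^ (2^-1 - a) * (2 ^ m)%:R `^ e :> R.
    have e2 (x : R) : 2 `^ x ^+ m = (2 ^ m)%:R `^ x.
      rewrite -powR_mulrn ?powR_ge0// -powRrM mulrC powRrM.
      by rewrite powR_mulrn// natrX.
    rewrite -!e2 -exprMn -powRD//.
    by rewrite pnatr_eq0 implybT.
  by rewrite le_eqVlt; apply/orP; left; apply/eqP; ring.
have blocks m p : \sum_(2 ^ m <= k < 2 ^ (m + p)) t k <= C * K1 / (1 - q) * (q ^+ m - q ^+ (m + p)).
  elim: p => [|p IH]; first by rewrite addn0 big_geq// subrr mulr0.
  rewrite addnS (@big_cat_nat _ _ _ (2 ^ (m + p)))/=; last 2 first.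
  - by rewrite leq_exp2l// leq_addr.
  - by rewrite leq_exp2l.
  rewrite (le_trans (lerD IH (block _)))// le_eqVlt; apply/orP; left; apply/eqP.
  by rewrite exprS; field; rewrite subr_eq0 eq_sym lt_eqF.
have main N n : (0 < N)%N -> \sum_(N <= k < n) t k <= C * tau N.
  move=> N0; pose m := trunc_log 2 N.
  have [nN|Nn] := leqP n N.
    by rewrite big_geq// mulr_ge0 ?(ltW C0)// mulr_ge0// exprn_ge0// ltW.
  have mN : (2 ^ m <= N)%N by exact: trunc_logP.
  have np : (n <= 2 ^ (m + n))%N.
    by rewrite (leq_trans (ltnW (ltn_expl n (ltnSn 1))))// leq_exp2l// leq_addl.
  apply: (@le_trans _ _ (\sum_(2 ^ m <= k < 2 ^ (m + n)) t k)).
    rewrite (@big_cat_nat _ _ _ N (2 ^ m) (2 ^ (m + n)))//=; last by rewrite (leq_trans (ltnW Nn)).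
    rewrite (@big_cat_nat _ _ _ n N (2 ^ (m + n)))//=; last exact: ltnW.
    rewrite addrCA lerDl addr_ge0// sumr_ge0//.
  apply: (le_trans (blocks _ _)); rewrite /tau -/m.
  rewrite -(mulrA C) -(mulrA C); apply: ler_wpM2l; first exact: ltW.
  apply: ler_wpM2l => //.
  by rewrite gerBl exprn_ge0// ltW.
move=> [|N] n; last exact: main.
have -> : tau 0%N = tau 1%N by rewrite /tau trunc_log0 trunc_log1.
case: n => [|n]; first by rewrite big_geq// mulr_ge0 ?(ltW C0)// mulr_ge0// exprn_ge0// ltW.
by rewrite big_ltn//= fsin0 normr0 mulr0 add0r; exact: main.
Qed.

(** Two integrations by parts; the boundary terms vanish because the sines and f
    do. *)
Lemma fsin_dd (f f1 f2 : R -> R) n :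
  (forall x, 0 < x < pi -> has_derive f x (f1 x)) ->
  (forall x, 0 < x < pi -> has_derive f1 x (f2 x)) ->
  {within `[0, pi], continuous f} -> {within `[0, pi], continuous f1} ->
  {within `[0, pi], continuous f2} -> f 0 = 0 -> f pi = 0 ->
  fsin f2 n = - (n%:R ^+ 2 * fsin f n).
Proof.
move=> d1 d2 cf cf1 cf2 f0 fp; have p0 := pi_gt0 R.
pose F x := f1 x * sin (n%:R * x) - n%:R * (f x * cos (n%:R * x)).
pose G x := f2 x * sin (n%:R * x) + n%:R ^+ 2 * (f x * sin (n%:R * x)).
have cs := @continuous_sinM n%:R; have cc := @continuous_cosM n%:R.
have iM (u t : R -> R) : {within `[0, pi], continuous u} -> continuous t ->
    {within `[0, pi], continuous (fun x => u x * t x)}.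
  by move=> cu ct x; apply: cvgM; [exact: cu|exact: continuous_subspaceT].
have i2 : mu.-integrable I (EFin \o (fun x => f2 x * sin (n%:R * x))).
  by apply: cont_seg_integ; exact: iM.
have i0 : mu.-integrable I (EFin \o (fun x => f x * sin (n%:R * x))).
  by apply: cont_seg_integ; exact: iM.
have [|||||_ GE] := @FTC2_oo R 0 pi G F 0 0 p0.
- move=> x xI; apply: cvgD.
    by apply: cvgM; [exact: (cont_seg_interior cf2 xI)|exact: cs].
  by apply: cvgM; [exact: cvg_cst|apply: cvgM; [exact: (cont_seg_interior cf xI)|exact: cs]].
- move=> x xI; apply: hd_eq.
    exact: hdB (hdM (d2 _ xI) (hd_sinM _ _)) (hdZ _ (hdM (d1 _ xI) (hd_cosM _ _))).
  by rewrite /G; ring.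
- have [c0 _] := cont_seg_limits p0 cf; have [c1 _] := cont_seg_limits p0 cf1.
  rewrite [X in _ --> X](_ : 0 = f1 0 * sin (n%:R * 0) - n%:R * (f 0 * cos (n%:R * 0))); last first.
    by rewrite f0 mulr0 sin0; ring.
  apply: cvgB; first by apply: cvgM => //; apply: cvg_at_right_filter; exact: cs.
  apply: cvgM; first exact: cvg_cst.
  by apply: cvgM => //; apply: cvg_at_right_filter; exact: cc.
- have [_ c0] := cont_seg_limits p0 cf; have [_ c1] := cont_seg_limits p0 cf1.
  rewrite [X in _ --> X](_ : 0 = f1 pi * sin (n%:R * pi) - n%:R * (f pi * cos (n%:R * pi))); last first.
    by rewrite fp sin_natpi; ring.
  apply: cvgB; first by apply: cvgM => //; apply: cvg_at_left_filter; exact: cs.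
  apply: cvgM; first exact: cvg_cst.
  by apply: cvgM => //; apply: cvg_at_left_filter; exact: cc.
- by left; apply: integD => //; exact: integZ.
move: GE; rewrite RintD//; last exact: integZ.
rewrite RintZ// subrr => /eqP; rewrite addr_eq0 => /eqP GE.
by rewrite /fsin GE; ring.
Qed.

(** The cosine separates a point of ]0, pi[ from the complement of any of its
    neighbourhoods. *)
Lemma cos_separates (x0 d : R) : 0 < x0 < pi -> 0 < d ->
  exists2 eta : R, 0 < eta <= 1 &
    forall x, 0 < x < pi -> `|cos x - cos x0| < eta -> `|x0 - x| < d.
Proof.
move=> /andP[x00 x0p] d0.
pose m := Num.min d (Num.min x0 (pi - x0)).
have [md mx mp] : [/\ m <= d, m <= x0 & m <= pi - x0].
  by rewrite /m !ge_min !lexx !orbT.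
have m0 : 0 < m by rewrite !lt_min d0 x00 subr_gt0.
move: m md mx mp m0 => m md mx mp m0.
have inI (x : R) : 0 <= x -> x <= pi -> x \in `[0, pi]%R by rewrite in_itv/= => -> ->.
have [p1 p2 p3 p4] : [/\ 0 <= x0 - m / 2, x0 - m / 2 <= pi, 0 <= x0 + m / 2 & x0 + m / 2 <= pi].
  by split; lra.
have [c1 c2] : cos x0 < cos (x0 - m / 2) /\ cos (x0 + m / 2) < cos x0.
  have i0 : x0 \in `[0, pi]%R by apply: inI; exact: ltW.
  have i1 := inI _ p1 p2; have i2 := inI _ p3 p4.
  by split; rewrite ltr_cos//; lra.
pose e1 := cos (x0 - m / 2) - cos x0; pose e2 := cos x0 - cos (x0 + m / 2).
exists (Num.min 1 (Num.min e1 e2)).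
  by rewrite !lt_min ltr01 !subr_gt0 c1 c2 ge_min lexx.
move=> x /andP[xp0 xp]; rewrite !lt_min => /and3P[_]; rewrite !ltr_norml.
move=> /andP[_ h1] /andP[h2 _].
have ix : x \in `[0, pi]%R by apply: inI; exact: ltW.
have : cos x < cos (x0 - m / 2) by move: h1; rewrite /e1; clear; lra.
rewrite (ltr_cos (inI _ p1 p2) ix) => h3.
have : cos (x0 + m / 2) < cos x by move: h2; rewrite /e2; clear; lra.
rewrite (ltr_cos ix (inI _ p3 p4)) => h4.
by apply/andP; split; move: h3 h4 md m0; clear; lra.
Qed.

(** Completeness of the sines: polynomials in [cos x] peaking at [x0] detect the
    sign of a continuous function near [x0]. *)
Lemma fsin_complete (g : R -> R) : {within `[0, pi], continuous g} ->
  (forall n, fsin g n = 0) -> forall x, 0 < x < pi -> g x = 0.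
Proof.
move=> cg; wlog pos : g cg / exists2 x0, 0 < x0 < pi & 0 < g x0.
  move=> H gn x xI; have [gx|gx|//] := ltgtP (g x) 0; last by apply: H => //; exists x.
  apply/eqP; rewrite -oppr_eq0; apply/eqP.
  apply: (H (fun x => - g x)) => //; first by move=> z; apply: cvgN; exact: cg.
    by exists x => //; rewrite oppr_gt0.
  move=> n; have := gn n; rewrite /fsin => /eqP; rewrite mulf_eq0 gt_eqF ?divr_gt0 ?pi_gt0//=.
  move=> /eqP e; rewrite (@eq_Rint R _ _ (fun x => -1 * (g x * sin (n%:R * x)))).
    rewrite RintZ ?e ?mulr0//; apply: cont_seg_integ => z; apply: cvgM; first exact: cg.
    exact: (continuous_subspaceT (@continuous_sinM n%:R)).
  by move=> z _; ring.
move=> gn; exfalso; have [x0 pos0 gx0] := pos; have /andP[x00 x0p] := pos0.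
have p0 := pi_gt0 R.
have [M [M0 gM]] := cont_seg_bounded cg.
have cgI := cont_seg_interior cg.
(* g h has zero sine coefficients: this class of h contains the polynomials in cos x *)
pose orth h := continuous h /\ forall n : nat, \int[mu]_(x in I) (g x * h x * sin (n%:R * x)) = 0.
have ig (h : R -> R) : continuous h -> mu.-integrable I (EFin \o (fun x => g x * h x)).
  move=> ch; apply: cont_seg_integ => z; apply: cvgM; first exact: cg.
  exact: continuous_subspaceT.
have igs h n : continuous h -> mu.-integrable I (EFin \o (fun x => g x * h x * sin (n%:R * x))).
  move=> ch; have chs : continuous (fun x => h x * sin (n%:R * x)).
    by move=> x; apply: cvgM; [exact: ch|exact: continuous_sinM].
  by apply: (eq_integ _ _ (ig _ chs)) => // x _; rewrite mulrA.
have orthE h k : (forall x, h x = k x) -> orth h -> orth k.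
  by move=> e; rewrite (_ : h = k)//; apply/funext.
have orth1 : orth (fun=> 1).
  split; first by move=> x; exact: cvg_cst.
  move=> n; have := gn n; rewrite /fsin => /eqP; rewrite mulf_eq0 gt_eqF ?divr_gt0//= => /eqP e.
  rewrite (@eq_Rint R _ _ (fun x => g x * sin (n%:R * x)))//.
  by move=> x _; rewrite mulr1.
have orthC h : orth h -> orth (fun x => cos x * h x).
  move=> [ch oh]; split; first by move=> x; apply: cvgM; [exact: continuous_cos|exact: ch].
  move=> n; rewrite (@eq_Rint R _ _ (fun x => 2^-1 *
      (g x * h x * sin (n.+1%:R * x) + g x * h x * sin (n%:R * x - x)))); last first.
    move=> x _; have -> : n.+1%:R * x = n%:R * x + x by rewrite -addn1 natrD mulrDl mul1r.
    by rewrite sinD sinB; field.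
  have [i2 e2] : mu.-integrable I (EFin \o (fun x => g x * h x * sin (n%:R * x - x))) /\
      \int[mu]_(x in I) (g x * h x * sin (n%:R * x - x)) = 0.
    case: n => [|n].
      have E x : -1 * (g x * h x * sin (1%:R * x)) = g x * h x * sin (0%:R * x - x).
        by rewrite mul0r add0r sinN mul1r; ring.
      split; first by apply: (eq_integ _ _ (integZ (-1) _ (igs h 1%N ch))) => // x _; rewrite E.
      by under eq_Rintegral do rewrite -E; rewrite RintZ ?oh ?mulr0//; exact: igs.
    have E x : n.+1%:R * x - x = n%:R * x by rewrite -addn1 natrD mulrDl mul1r addrK.
    split; first by apply: (eq_integ _ _ (igs h n ch)) => // x _; rewrite E.
    by under eq_Rintegral do rewrite E; exact: oh.
  rewrite RintZ//; last by apply: integD => //; exact: igs.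
  by rewrite RintD ?oh ?e2 ?addr0 ?mulr0//; exact: igs.
have orthL c h k : orth h -> orth k -> orth (fun x => h x + c * k x).
  move=> [ch oh] [ck ok]; split.
    by move=> x; apply: cvgD; [exact: ch|apply: cvgM; [exact: cvg_cst|exact: ck]].
  move=> n; rewrite (@eq_Rint R _ _ (fun x => g x * h x * sin (n%:R * x) +
      c * (g x * k x * sin (n%:R * x)))); last by move=> x _; ring.
  rewrite RintD//; [|exact: igs|by apply: integZ => //; exact: igs].
  by rewrite RintZ ?oh ?ok ?mulr0 ?addr0//; exact: igs.
(* the powers of A peak at x0 *)
pose A x := 1 - (cos x - cos x0) ^+ 2 / 4.
have orthA j : orth (fun x => A x ^+ j).
  elim: j => [|j IH]; first by rewrite (_ : (fun x => _) = (fun=> 1)).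
  have := orthL (- (4^-1)) _ _ (orthL (cos x0 / 2) _ _ (orthL (- (cos x0 ^+ 2 / 4)) _ _ IH IH)
    (orthC _ IH)) (orthC _ (orthC _ IH)).
  have K (b c c0 : R) : b + - (c0 ^+ 2 / 4) * b + c0 / 2 * (c * b) + - 4^-1 * (c * (c * b)) =
      (1 - (c - c0) ^+ 2 / 4) * b by field.
  move=> H; apply: orthE H => x; rewrite [RHS]exprS; exact: K.
have A01 x : 0 <= A x <= 1.
  have := cos_geN1 x; have := cos_le1 x; have := cos_geN1 x0; have := cos_le1 x0.
  move=> *; rewrite /A; have s0 := sqr_ge0 (cos x - cos x0); apply/andP; split; last by lra.
  have : (cos x - cos x0) ^+ 2 <= 2 ^+ 2; last by rewrite -natrX; lra.
  by rewrite -real_normK ?num_real// lerXn2r ?nnegrE// ler_norml; apply/andP; split; lra.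
have Z j : \int[mu]_(x in I) (g x * A x ^+ j * sin x) = 0.
  have [_ /(_ 1%N) e] := orthA j.
  rewrite (@eq_Rint R _ _ (fun x => g x * A x ^+ j * sin (1%:R * x)))//.
  by move=> x _; rewrite mul1r.
(* near x0 the integrand g A^j sin is at least c s0 q2^j; where the cosines are
   further than eta apart, A <= q1 < q2 *)
pose c := g x0 / 2.
have c0 : 0 < c by rewrite divr_gt0.
have [d d0 gd] : exists2 d, 0 < d & forall x, `|x0 - x| < d -> c < g x.
  have /cvgrPdist_lt /(_ _ c0) : g x @[x --> x0] --> g x0 by apply: cgI; rewrite x00.
  move=> /nbhs_ballP [d d0 H]; exists d => // x /H /=; rewrite ltr_distl => /andP[_].
  by rewrite /c; lra.
have [d1 d10 sd] : exists2 d, 0 < d & forall x, `|x0 - x| < d -> sin x0 / 2 < sin x.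
  have sx0 : 0 < sin x0 / 2 by rewrite divr_gt0// sin_gt0_pi// x00.
  have /cvgrPdist_lt /(_ _ sx0) : sin x @[x --> x0] --> sin x0 by exact: continuous_sin.
  move=> /nbhs_ballP [d' d0' H]; exists d' => // x /H /=; rewrite ltr_distl => /andP[_].
  by lra.
have [eta /andP[eta0 eta1] near_x0] := cos_separates pos0 d0.
have [d2 d20 cd] : exists2 d, 0 < d & forall x, `|x0 - x| < d -> `|cos x - cos x0| < eta / 2.
  have e2 : 0 < eta / 2 by rewrite divr_gt0.
  have /cvgrPdist_lt /(_ _ e2) : cos x @[x --> x0] --> cos x0 by exact: continuous_cos.
  by move=> /nbhs_ballP [d' d0' H]; exists d' => // x /H /=; rewrite distrC.
have [w [w0 wx wp w1 [w2 wd]]] : exists w, [/\ 0 < w, w <= x0, w <= pi - x0, w <= d1 & w <= d2 /\ w <= d].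
  exists (Num.min (Num.min x0 (pi - x0)) (Num.min d1 (Num.min d2 d))).
  by rewrite !lt_min x00 subr_gt0 x0p d10 d20 !ge_min !lexx !orbT.
have eta2 : 0 < eta ^+ 2 by rewrite exprn_gt0.
have eta21 : eta ^+ 2 <= 1 by rewrite expr_le1// ltW.
pose q1 := 1 - eta ^+ 2 / 4; pose q2 := 1 - eta ^+ 2 / 16.
have [q10 q12 q20] : [/\ 0 <= q1, q1 < q2 & 0 < q2].
  by rewrite /q1 /q2; move: eta2 eta21; clear; split; lra.
pose N := (`]x0 - w, x0 + w[%classic : set R).
have NI : N `<=` I.
  move=> x; rewrite /N !in_Ioo => /andP[]; move: wx wp; clear.
  by move=> ? ? ? ?; apply/andP; split; lra.
pose s0 := sin x0 / 2.
have s00 : 0 < s0 by rewrite divr_gt0// sin_gt0_pi// x00.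
(* wherever g may be negative, A is at most q1 *)
have lb j x : I x -> c * s0 * q2 ^+ j * (\1_N x) - M * q1 ^+ j <= g x * A x ^+ j * sin x.
  rewrite in_Ioo => xI; have /andP[A0 A1] := A01 x.
  have sx : 0 <= sin x by rewrite ltW// sin_gt0_pi.
  have Mq : 0 <= M * q1 ^+ j by rewrite mulr_ge0// exprn_ge0.
  have [xN|xN] := pselect (N x).
    rewrite indicE mem_set// mulr1.
    have xw : `|x0 - x| < w.
      move: xN; rewrite /N in_Ioo ltr_norml => /andP[]; clear.
      by move=> ? ?; apply/andP; split; lra.
    have gx : c < g x by apply: gd; exact: lt_le_trans wd.
    have sxx : s0 < sin x by apply: sd; exact: lt_le_trans w1.
    have Ax : q2 <= A x.
      have := cd x (lt_le_trans xw w2) => h.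
      have : (cos x - cos x0) ^+ 2 <= (eta / 2) ^+ 2.
        rewrite -real_normK ?num_real//; apply: lerXn2r; rewrite ?nnegrE ?(ltW h)//.
        by rewrite divr_ge0// ltW.
      rewrite /A /q2 expr_div_n => h2.
      have e4 : 2 ^+ 2 = 4 :> R by ring.
      by move: h2; rewrite e4; clear; lra.
    have h1 : q2 ^+ j <= A x ^+ j by rewrite lerXn2r ?nnegrE// ltW.
    have h2 : c * s0 * q2 ^+ j <= g x * A x ^+ j * sin x; last by lra.
    rewrite mulrAC; apply: ler_pM; rewrite ?(ltW s00) ?(ltW sxx)//.
      by rewrite mulr_ge0 ?(ltW c0)// exprn_ge0// ltW.
    by apply: ler_pM; rewrite ?(ltW c0) ?(ltW gx)// exprn_ge0// ltW.
  rewrite indicE memNset// mulr0 sub0r.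
  have [h|h] := ltP `|cos x - cos x0| eta.
    have gx : c < g x by apply: gd; exact: near_x0.
    rewrite (@le_trans _ _ 0)// ?oppr_le0// !mulr_ge0// ?exprn_ge0//.
    by rewrite ltW// (lt_trans c0).
  have Ax : A x <= q1.
    have : eta ^+ 2 <= (cos x - cos x0) ^+ 2.
      by rewrite -[leRHS]real_normK ?num_real// lerXn2r ?nnegrE// ltW.
    by rewrite /A /q1; lra.
  have h1 : A x ^+ j <= q1 ^+ j by rewrite lerXn2r ?nnegrE.
  have gMx : `|g x| <= M by apply: gM; case/andP: xI => ? ?; rewrite !ltW.
  rewrite lerNl (le_trans (ler_norm _))// normrN !normrM (ger0_norm sx) (ger0_norm (exprn_ge0 _ A0)).
  rewrite -[leRHS]mulr1; apply: ler_pM; rewrite ?sin_le1//.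
    by rewrite mulr_ge0// exprn_ge0.
  by rewrite ler_pM ?exprn_ge0.
have ineq j : c * s0 * (2 * w) * q2 ^+ j <= M * pi * q1 ^+ j.
  have i1 : mu.-integrable I (EFin \o (fun x => (\1_N x : R))).
    apply: (@integ_bounded _ _ 1); first by apply: measurable_indic; exact: measurable_itv.
    by move=> x _; rewrite indicE; case: (_ \in _); rewrite ?normr1 ?normr0.
  have icst (k : R) : mu.-integrable I (EFin \o (fun=> k)).
    by apply: (@integ_bounded _ _ `|k|).
  have iA : mu.-integrable I (EFin \o (fun x => g x * A x ^+ j * sin x)).
    have [cA _] := orthA j.
    by apply: (eq_integ _ _ (igs _ 1%N cA)) => // x _; rewrite mul1r.
  have := le_Rint (measurable_itv _) (integB (measurable_itv _) (integZ (c * s0 * q2 ^+ j) (measurable_itv _) i1) (icst (M * q1 ^+ j))) iA (lb j).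
  rewrite Z (RintB (measurable_itv _) (integZ _ (measurable_itv _) i1) (icst _)).
  rewrite (RintZ _ (measurable_itv _) i1) Rint_cst_oo ?(ltW p0)// (Rint_support NI); last first.
    by move=> x _ nx; rewrite indicE memNset.
  rewrite (@eq_Rint R N _ (fun=> 1)); last by move=> x xN; rewrite indicE mem_set.
  rewrite Rint_cst_oo; last by move: w0; clear; lra.
  move: (q2 ^+ j) (q1 ^+ j) => u v; clear => H.
  rewrite -subr_le0; have -> : c * s0 * (2 * w) * u - M * pi * v =
    c * s0 * u * (1 * (x0 + w - (x0 - w))) - M * v * (pi - 0) by ring.
  exact: H.
(* q2^j cannot stay below a multiple of q1^j *)
have csw : 0 < c * s0 * (2 * w) by apply: mulr_gt0; [exact: mulr_gt0|exact: mulr_gt0].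
move: (c * s0 * (2 * w)) (M * pi) csw q10 q12 q20 ineq => u v u0 h1 h2 h3 H.
clear -u0 h1 h2 h3 H.
have r0 : 0 <= q1 / q2 by rewrite divr_ge0// ltW.
have r1 : `|q1 / q2| < 1 by rewrite ger0_norm// ltr_pdivrMr// mul1r.
have cr : v / u * (q1 / q2) ^+ n @[n --> \oo] --> v / u * 0.
  by apply: cvgM; [exact: cvg_cst|exact: cvg_expr].
move: cr; rewrite mulr0 => /cvgrPdist_lt /(_ 1 ltr01) [n _ /(_ n (leqnn _))] /=.
rewrite sub0r normrN; apply/negP; rewrite -leNgt; apply: le_trans (ler_norm _).
by rewrite expr_div_n mulrAC mulrA ler_pdivlMr// mul1r ler_pdivlMr ?exprn_gt0.
Qed.

End sines.

(** * Series with controlled tails *)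

Section series.
Context {R : realType}.
Notation mu := (@lebesgue_measure R).
Notation I := (`]0, pi[%classic : set R).

(** The sum is meant for absolutely convergent series; the limit of the partial
    sums makes it total. *)
Definition tsum (a : nat -> R) : R := lim (series a @ \oo).

(** Absolute convergence with an explicit rate. A common rate tau for a family of
    series expresses uniform convergence. *)
Definition tails (a : nat -> R) (tau : nat -> R) : Prop :=
  forall N n, \sum_(N <= k < n) `|a k| <= tau N.

Lemma tails_ge0 a tau N : tails a tau -> 0 <= tau N.
Proof. by move=> /(_ N N); rewrite big_geq. Qed.

Lemma tails_le (a b : nat -> R) tau : tails b tau -> (forall k, `|a k| <= `|b k|) -> tails a tau.
Proof. by move=> tb ab N n; apply: le_trans (tb N n); exact: ler_sum. Qed.

Lemma tails_sum (a : nat -> R) tau N n : tails a tau -> (N <= n)%N ->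
  `|series a n - series a N| <= tau N.
Proof.
move=> ta Nn; rewrite /series/= (@big_cat_nat _ _ _ N 0 n)//= addrAC subrr add0r.
by apply: le_trans (ta N n); exact: ler_norm_sum.
Qed.

Lemma tails_cvg a tau : tails a tau -> tau @ \oo --> 0 -> series a @ \oo --> tsum a.
Proof.
move=> ta t0; apply/cauchy_cvgP/cauchy_exP => e e0.
have /cvgrPdist_lt /(_ _ e0) [N _ /(_ N (leqnn N))] := t0.
rewrite sub0r normrN => tN; exists (series a N); exists N => // n /= Nn.
rewrite /ball/= distrC (le_lt_trans (tails_sum ta Nn))//.
by rewrite (le_lt_trans (ler_norm _)).
Qed.

Lemma tails_tsum a tau N : tails a tau -> tau @ \oo --> 0 -> `|tsum a - series a N| <= tau N.
Proof.
move=> ta t0; have c := tails_cvg ta t0.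
have c2 : `|series a n - series a N| @[n --> \oo] --> `|tsum a - series a N|.
  by apply: cvg_norm; apply: cvgB => //; exact: cvg_cst.
rewrite -(cvg_lim _ c2)//; apply: limr_le; first exact: cvgP c2.
by exists N => // n /= Nn; exact: tails_sum.
Qed.

Lemma tails_norm a tau : tails a tau -> tau @ \oo --> 0 -> `|tsum a| <= tau 0%N.
Proof.
by move=> ta /(tails_tsum 0 ta); rewrite /series/= big_geq// subr0.
Qed.

Lemma tsum_eq a l : series a @ \oo --> l -> tsum a = l.
Proof. by move=> /cvg_lim; apply. Qed.

Lemma eq_tsum a b : (forall k, a k = b k) -> tsum a = tsum b.
Proof. by move=> ab; congr tsum; apply/funext. Qed.

Lemma tsum0 : tsum (fun=> 0) = 0.
Proof.
apply: tsum_eq; rewrite (_ : series _ = fun=> 0); first exact: cvg_cst.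
by apply/funext => n; rewrite /series/= big1.
Qed.

Lemma series_lin (c : R) a b l m : series a @ \oo --> l -> series b @ \oo --> m ->
  series (fun k => a k + c * b k) @ \oo --> l + c * m.
Proof.
move=> ca cb; rewrite (_ : series _ = fun n => series a n + c * series b n).
  by apply: cvgD => //; apply: cvgM => //; exact: cvg_cst.
by apply/funext => n; rewrite /series/= big_split/= big_distrr.
Qed.

Lemma tsum_lin (c : R) a b : cvg (series a @ \oo) -> cvg (series b @ \oo) ->
  tsum (fun k => a k + c * b k) = tsum a + c * tsum b.
Proof. by move=> ca cb; apply: tsum_eq; exact: series_lin. Qed.

Lemma tsumZ (c : R) a : cvg (series a @ \oo) -> tsum (fun k => c * a k) = c * tsum a.
Proof.
move=> ca; rewrite -[RHS]add0r -tsum0 -tsum_lin//; last first.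
  by rewrite (_ : series _ = fun=> 0); [exact: is_cvg_cst|apply/funext => n; rewrite /series/= big1].
by apply: eq_tsum => k; rewrite add0r.
Qed.

(** Tannery's theorem: up to an error 2 tau N, common to all the series, only N
    terms have to converge. *)
Lemma tannery (T : Type) (F : set_system T) {FF : Filter F} (a : nat -> T -> R) (l : nat -> R) tau :
  tau @ \oo --> 0 -> (\forall x \near F, tails (a^~ x) tau) -> tails l tau ->
  (forall k, a k x @[x --> F] --> l k) ->
  tsum (a^~ x) @[x --> F] --> tsum l.
Proof.
move=> t0 ta tl al; apply/cvgrPdist_lt => e e0.
have e3 : 0 < e / 3 by rewrite divr_gt0.
have /cvgrPdist_lt /(_ _ e3) [N _ /(_ N (leqnn N))] := t0.
rewrite sub0r normrN => tN.
have tN' : tau N < e / 3 by rewrite (le_lt_trans (ler_norm _)).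
have cs : series (a^~ x) N @[x --> F] --> series l N.
  elim: (N) => [|m IH].
    rewrite (_ : (fun x => _) = fun=> 0); last by apply/funext => x; rewrite /series/= big_geq.
    by rewrite /series/= big_geq//; exact: cvg_cst.
  rewrite (_ : (fun x => _) = fun x => series (a^~ x) m + a m x).
    by rewrite seriesSr; apply: cvgD => //; exact: al.
  by apply/funext => x; rewrite seriesSr.
have /cvgrPdist_lt /(_ _ e3) cs' := cs.
near=> x.
have tx : tails (a^~ x) tau by near: x.
have h1 := tails_tsum N tl t0; have h2 := tails_tsum N tx t0.
have h3 : `|series l N - series (a^~ x) N| < e / 3 by near: x.
have -> : tsum l - tsum (a^~ x) = (tsum l - series l N) + (series l N - series (a^~ x) N)
   - (tsum (a^~ x) - series (a^~ x) N) by ring.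
rewrite (le_lt_trans (ler_normB _ _))//.
have := ler_normD (tsum l - series l N) (series l N - series (a^~ x) N).
move: h1 h2 h3 tN'; set A := `|_|; set B := `|_|; set C := `|_|; set D := `|_|.
by clear; lra.
Unshelve. all: by end_near. Qed.

Lemma has_derive_lipschitz (f f' : R -> R) (M : R) : (forall x, has_derive f x (f' x)) ->
  (forall x, `|f' x| <= M) -> forall x y, `|f y - f x| <= M * `|y - x|.
Proof.
move=> df fM x y; wlog xy : x y / x <= y.
  by move=> H; have [/H//|/ltW /H] := leP x y; rewrite distrC [X in M * X]distrC.
have cf : {within `[x, y], continuous f}.
  by apply: continuous_subspaceT => z; apply: hd_continuous; exact: df.
have [c _ ->] := MVT_segment xy (fun z _ => df z) cf.
by rewrite normrM ler_wpM2r.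
Qed.

Lemma has_derive_quot (f : R -> R) (x l : R) :
  has_derive f x l <-> (h^-1 * (f (h + x) - f x)) @[h --> 0^'] --> l.
Proof.
split=> [[d e]|c].
  move: d; rewrite /derivable => d; rewrite -e /derive.
  have E : (fun h : R => h^-1 *: (f (h *: (1:R) + x) - f x)) = (fun h => h^-1 * (f (h + x) - f x)).
    by apply/funext => h; rewrite /GRing.scale/= mulr1.
  move: d; rewrite /shift/=; rewrite (_ : (fun h : R => _) = (fun h => h^-1 * (f (h + x) - f x))).
    by move=> d; rewrite (_ : (fun h : R => h^-1 *: _) = (fun h => h^-1 * (f (h + x) - f x))).
  exact: E.
have E : (fun h : R => h^-1 *: ((f \o shift x) (h *: (1:R)) - f x)) = (fun h => h^-1 * (f (h + x) - f x)).
  by apply/funext => h; rewrite /shift/= /GRing.scale/= mulr1.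
split; first by rewrite /derivable E; apply/cvg_ex; exists l.
by rewrite /derive E; apply: cvg_lim.
Qed.

(** By the mean value inequality the difference quotients of the terms have the
    common tail bound of the derivatives, and Tannery applies as the increment
    tends to 0. *)
Lemma termwise_derive (a b : nat -> R -> R) (M : nat -> R) tau (x : R) :
  tau @ \oo --> 0 -> (forall k y, has_derive (a k) y (b k y)) ->
  (forall k y, `|b k y| <= M k) -> tails M tau ->
  (forall y, cvg (series (a^~ y) @ \oo)) ->
  has_derive (fun y => tsum (a^~ y)) x (tsum (b^~ x)).
Proof.
move=> t0 da bM tM ca; apply/has_derive_quot.
have M0 k : `|M k| = M k by apply: ger0_norm; apply: le_trans (bM k x).
pose q k h := h^-1 * (a k (h + x) - a k x).
have E h : h^-1 * (tsum (a^~ (h + x)) - tsum (a^~ x)) = tsum (q^~ h).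
  have -> : tsum (a^~ (h + x)) - tsum (a^~ x) = tsum (a^~ (h + x)) + -1 * tsum (a^~ x) by ring.
  rewrite -tsum_lin// -tsumZ; first by apply: eq_tsum => k; rewrite /q; ring.
  apply/cvg_ex; eexists; apply: series_lin; [exact: ca|exact: ca].
under eq_cvg do rewrite E.
apply: (tannery t0).
- near=> h; apply: tails_le tM _ => k; rewrite M0 /q normrM normfV.
  have h0 : h != 0 by near: h; exact: nbhs_dnbhs_neq.
  rewrite ler_pdivrMl ?normr_gt0// mulrC.
  have := has_derive_lipschitz (da k) (bM k) x (h + x).
  by rewrite addrK.
- by apply: tails_le tM _ => k; rewrite M0.
- by move=> k; apply/has_derive_quot; exact: da.
Unshelve. all: by end_near. Qed.

Lemma Rint_sin_sin (j k : nat) : (0 < j)%N -> (0 < k)%N ->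
  \int[mu]_(x in I) (sin (j%:R * x) * sin (k%:R * x)) = if j == k then pi / 2 else 0.
Proof.
wlog jk : j k / (j <= k)%N.
  move=> H j0 k0; have [jk|/ltnW kj] := leqP j k; first exact: H.
  rewrite eq_sym -H//; apply: eq_Rint => x _; exact: mulrC.
move=> j0 k0.
have E (x : R) : sin (j%:R * x) * sin (k%:R * x) =
    2^-1 * (cos ((k - j)%:R * x) - cos ((j + k)%:R * x)).
  have -> : (j + k)%:R * x = j%:R * x + k%:R * x by rewrite natrD mulrDl.
  have -> : (k - j)%:R * x = k%:R * x - j%:R * x by rewrite natrB// mulrBl.
  by rewrite cosB cosD; field.
have ci n : mu.-integrable I (EFin \o (fun x => cos (n%:R * x))).
  by apply: cont_seg_integ; apply: continuous_subspaceT; exact: continuous_cosM.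
have I0 n : (0 < n)%N -> \int[mu]_(x in I) cos (n%:R * x) = 0.
  move=> n0; have nn : (n%:R : R) != 0 by rewrite pnatr_eq0 -lt0n.
  rewrite (@FTC2_seg _ _ _ _ (fun x => n%:R^-1 * sin (n%:R * x)) (pi_gt0 R)).
  - by rewrite sin_natpi !mulr0 sin0 mulr0 subrr.
  - exact: continuous_cosM.
  - move=> x; apply: hd_eq; first exact: hdZ (hd_sinM _ _).
    by rewrite mulrA mulVf// mul1r.
under eq_Rintegral do rewrite E.
rewrite (RintZ _ (measurable_itv _)); last by apply: integB.
rewrite (RintB (measurable_itv _)) // (I0 (j + k)%N) ?addn_gt0 ?j0// subr0.
case: eqVneq => [->|njk]; last first.
  by rewrite I0 ?mulr0// subn_gt0 ltn_neqAle njk.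
rewrite subnn (@eq_Rint R _ _ (fun=> 1)); last by move=> x _; rewrite mul0r cos0.
by rewrite Rint_cst_oo ?(ltW (pi_gt0 R))//; field.
Qed.

Lemma tails_sin (c : nat -> R) tau x : tails c tau -> tails (fun k => c k * sin (k%:R * x)) tau.
Proof.
move=> tc; apply: tails_le tc _ => k; rewrite normrM ler_piMr//; exact: sin_max.
Qed.

(** A continuous function with summable sine coefficients is the sum of its
    sine series: the difference has zero coefficients. *)
Lemma sine_expansion (g : R -> R) tau : {within `[0, pi], continuous g} ->
  g 0 = 0 -> g pi = 0 -> tau @ \oo --> 0 -> tails (fsin g) tau ->
  forall x, 0 <= x <= pi -> g x = tsum (fun k => fsin g k * sin (k%:R * x)).
Proof.
move=> cg g0 gp t0 tg.
pose c := fsin g; pose h x := tsum (fun k => c k * sin (k%:R * x)).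
have ts x := tails_sin x tg.
have p0 := pi_gt0 R.
have ch : continuous h.
  move=> x; apply: (tannery t0); first by near=> y; exact: ts.
    exact: ts.
  by move=> k; apply: cvgM; [exact: cvg_cst|exact: continuous_sinM].
have cgh : {within `[0, pi], continuous (fun x => g x - h x)}.
  by move=> x; apply: cvgB; [exact: cg|exact: continuous_subspaceT].
have isn (u : R -> R) n : {within `[0, pi], continuous u} -> mu.-integrable I (EFin \o (fun x => u x * sin (n%:R * x))).
  move=> cu; apply: cont_seg_integ => x; apply: cvgM; first exact: cu.
  exact: (continuous_subspaceT (@continuous_sinM R n%:R)).
have hI n : (0 < n)%N -> \int[mu]_(x in I) (h x * sin (n%:R * x)) = pi / 2 * c n.
  move=> n0.
  pose F k x := c k * (sin (k%:R * x) * sin (n%:R * x)).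
  have iss k : mu.-integrable I (EFin \o (fun x => sin (k%:R * x) * sin (n%:R * x))).
    by apply: isn; exact: (continuous_subspaceT (@continuous_sinM R k%:R)).
  have iF k : mu.-integrable I (EFin \o F k) by exact: integZ.
  have IF k : \int[mu]_(x in I) F k x = if k == n then pi / 2 * c n else 0.
    rewrite RintZ//; case: k => [|k].
      by rewrite /c fsin0 mul0r; case: eqP => // <-; rewrite fsin0 mulr0.
    by rewrite Rint_sin_sin//; case: eqP => [->|_]; [exact: mulrC|exact: mulr0].
  pose S m x := \sum_(0 <= k < m) F k x.
  have := @Rdominated_cvg R _ _ mu I S (fun x => h x * sin (n%:R * x)) (fun=> tau 0%N) (measurable_itv _).
  case.
  - by move=> m; have [+ _] := integ_sum_n 0 m (measurable_itv _) iF; move/integrableP => [/measurable_EFinP].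
  - move=> x _; have cv := tails_cvg (ts x) t0.
    rewrite (_ : (fun m => S m x) = fun m => series (fun k => fsin g k * sin (k%:R * x)) m * sin (n%:R * x)).
      by apply: cvgM; [exact: cv|exact: cvg_cst].
    apply/funext => m; rewrite /S /series/= /F big_distrl/=.
    by apply: eq_bigr => k _; rewrite /c; ring.
  - by apply: (@integ_bounded _ _ _ `|tau 0%N|).
  - move=> m x _; rewrite /S (le_trans (ler_norm_sum _ _ _))// (le_trans _ (tg 0%N m))//.
    apply: ler_sum => k _; rewrite !normrM -[leRHS]mulr1 ler_wpM2l// -[leRHS]mulr1.
    by rewrite ler_pM// sin_max.
  move=> _ /cvg_lim <-//; apply: (@lim_near_cst R) => //.
  exists n.+1 => // m /= nm.
  have [_ ->] := integ_sum_n 0 m (measurable_itv _) iF.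
  under eq_bigr do rewrite IF.
  rewrite -big_mkcond/= big_mkord.
  have nm' : (n < m)%N by [].
  by rewrite (big_pred1 (Ordinal nm')).
have z n : fsin (fun x => g x - h x) n = 0.
  case: n => [|n]; first exact: fsin0.
  rewrite /fsin (@eq_Rint R _ _ (fun x => g x * sin (n.+1%:R * x) - h x * sin (n.+1%:R * x))).
    rewrite RintB//; [|exact: isn|by apply: isn; exact: continuous_subspaceT].
    have K (p u : R) : p != 0 -> 2 / p * (u - p / 2 * (2 / p * u)) = 0 by move=> ?; field.
    by rewrite hI// /c /fsin K// lt0r_neq0.
  by move=> x _; rewrite mulrBl.
have hz x : (forall k, sin (k%:R * x) = 0) -> h x = 0.
  by move=> H; rewrite /h -[RHS]tsum0; apply: eq_tsum => k; rewrite H mulr0.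
move=> x /andP[]; rewrite le_eqVlt => /predU1P[<- _|x0].
  by rewrite g0 -/(h 0) hz// => k; rewrite mulr0 sin0.
rewrite le_eqVlt => /predU1P[->|xp].
  by rewrite gp -/(h pi) hz// => k; exact: sin_natpi.
apply/eqP; rewrite -subr_eq0; apply/eqP.
by apply: (fsin_complete cgh z); rewrite x0.
Unshelve. all: by end_near. Qed.

End series.

(** * The reflection formula *)

Section reflection.
Context {R : realType}.
Notation mu := (@lebesgue_measure R).

Lemma Rint_split (a c b : R) (f : R -> R) : a < c < b -> mu.-integrable `]a, b[ (EFin \o f) ->
  \int[mu]_(x in `]a, b[) f x = \int[mu]_(x in `]a, c[) f x + \int[mu]_(x in `]c, b[) f x.
Proof.
move=> /andP[ac cb] fi.
have i1 : mu.-integrable `]a, c[ (EFin \o f).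
  by apply: integ_sub fi => //; apply: subset_itvl; rewrite bnd_simp ltW.
rewrite [X in X + _](@Rintegral_itv_bndo_bndc R (BRight a) c f)//.
have := @Rintegral_itvB R f (BRight a) (BLeft b) c fi.
rewrite !bnd_simp => /(_ (ltW ac)) /(_ cb) <-.
by rewrite addrC subrK.
Qed.

Let h2 : 0 < 2^-1 :> R. Proof. by rewrite invr_gt0. Qed.
Let h21 : 2^-1 < 1 :> R. Proof. by rewrite invf_lt1// ltr1n. Qed.

(** Halves of the Beta integrand with exponents adding up to 1. The substitution
    s -> 1 - s maps one half of B(x, 1 - x) to the other with x replaced by 1 - x. *)
Definition bhalf (y s : R) : R := s `^ (y - 1) * (1 - s) `^ (- y).
(** The derivative of (s / (1 - s))^y / y. *)
Definition ehalf (y s : R) : R := s `^ (y - 1) * (1 - s) `^ (- y - 1).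

Lemma continuous_powR1B (c s : R) : s < 1 -> {for s, continuous (fun s : R => (1 - s) `^ c)}.
Proof.
move=> s1; apply: (@cont_comp R (fun x => x `^ c)); last by apply: continuous_powR; rewrite subr_gt0.
by apply: cvgB; [exact: cvg_cst|exact: cvg_id].
Qed.

Lemma ehalf_int (y : R) : 0 < y ->
  mu.-integrable `]0, 2^-1[ (EFin \o ehalf y) /\
  \int[mu]_(s in `]0, 2^-1[) ehalf y s = y^-1.
Proof.
move=> y0; pose F s := y^-1 * (s `^ y * (1 - s) `^ (- y)).
have hF (s : R) : 0 < s -> s < 1 -> has_derive F s (ehalf y s).
  move=> s0 s1; have u0 : 0 < 1 - s by rewrite subr_gt0.
  apply: hd_eq.
    apply: hdZ; apply: hdM; first exact: hd_powR.
    by apply: (@hd_comp _ (fun x => x `^ (- y))); [exact: hd_powR|exact: hdB (hd_cst _ _) (hd_id _)].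
  rewrite /ehalf.
  have -> : s `^ y = s * s `^ (y - 1) by rewrite powRB// ?(gt_eqF s0) ?implybT//; rewrite powRr1 ?ltW// mulrC divfK// gt_eqF.
  have -> : (1 - s) `^ (- y) = (1 - s) * (1 - s) `^ (- y - 1).
    by rewrite powRB// ?(gt_eqF u0) ?implybT//; rewrite powRr1 ?ltW// mulrC divfK// gt_eqF.
  by field; rewrite gt_eqF.
have [|||||i e] := @FTC2_oo R 0 2^-1 (ehalf y) F 0 y^-1 h2.
- move=> s /andP[s0 s1]; apply: cvgM; first exact: continuous_powR.
  by apply: continuous_powR1B; apply: lt_trans s1 h21.
- by move=> s /andP[s0 s1]; apply: hF => //; apply: lt_trans s1 h21.
- rewrite [X in _ --> X](_ : 0 = y^-1 * (0 * (1 - 0) `^ (- y))); last by ring.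
  apply: cvgM; first exact: cvg_cst.
  apply: cvgM; first by apply: powR_cvg0.
  by apply: cvg_at_right_filter; exact: continuous_powR1B.
- rewrite [X in _ --> X](_ : y^-1 = F 2^-1).
    apply: cvg_at_left_filter; apply: hd_continuous; exact: hF.
  rewrite /F; have -> : 1 - 2^-1 = 2^-1 :> R by field.
  have n2 : (2^-1 : R) != 0 by rewrite gt_eqF.
  by rewrite -powRD ?n2 ?implybT// subrr powRr0 mulr1.
- by right=> s _; rewrite mulr_ge0 ?powR_ge0.
by rewrite e subr0.
Qed.

Lemma bhalf_int (y : R) : 0 < y ->
  mu.-integrable `]0, 2^-1[ (EFin \o bhalf y) /\
  0 <= \int[mu]_(s in `]0, 2^-1[) bhalf y s <= y^-1.
Proof.
move=> y0; have [ie ee] := ehalf_int y0.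
have b0 (s : R) : 0 <= bhalf y s by rewrite mulr_ge0 ?powR_ge0.
have be (s : R) : 0 < s < 2^-1 -> bhalf y s <= ehalf y s.
  move=> /andP[s0 s1]; rewrite /bhalf /ehalf ler_wpM2l ?powR_ge0//.
  have u0 : 0 < 1 - s by rewrite subr_gt0 (lt_trans s1).
  rewrite powRB ?(gt_eqF u0) ?implybT// powRr1 ?(ltW u0)//.
  by rewrite ler_peMr ?powR_ge0// invf_ge1// gerBl ltW.
have mb : measurable_fun (`]0, 2^-1[%classic : set R) (bhalf y).
  apply: measurable_cont => s /andP[s0 s1]; apply: cvgM; first exact: continuous_powR.
  by apply: continuous_powR1B; apply: lt_trans s1 h21.
have ib : mu.-integrable `]0, 2^-1[ (EFin \o bhalf y).
  apply: (integ_dom _ mb _ ie) => // s; rewrite in_Ioo => sI.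
  by rewrite ger0_norm// be.
split=> //; rewrite Rintegral_ge0//= -ee; apply: le_Rint => // s; rewrite in_Ioo; exact: be.
Qed.

(** Multiplication of [ehalf] by 1 - s + s = 1. Iterated, it expands the half Beta
    integral into an alternating series. *)
Lemma bhalf_rec (y : R) : 0 < y ->
  \int[mu]_(s in `]0, 2^-1[) bhalf y s =
  y^-1 - \int[mu]_(s in `]0, 2^-1[) bhalf (y + 1) s.
Proof.
move=> y0; have [ie ee] := ehalf_int y0; have [ib _] := bhalf_int y0.
have [ib1 _] := @bhalf_int (y + 1) (addr_gt0 y0 ltr01).
apply/eqP; rewrite eq_sym subr_eq -ee -RintD//; apply/eqP/eq_Rint => s; rewrite in_Ioo => /andP[s0 s1].
have u0 : 0 < 1 - s by rewrite subr_gt0 (lt_trans s1).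
rewrite /bhalf /ehalf addrK opprD.
have -> : s `^ y = s * s `^ (y - 1) by rewrite powRB// ?(gt_eqF s0) ?implybT//; rewrite powRr1 ?ltW// mulrC divfK// gt_eqF.
have -> : (1 - s) `^ (- y) = (1 - s) * (1 - s) `^ (- y - 1).
  by rewrite powRB// ?(gt_eqF u0) ?implybT//; rewrite powRr1 ?ltW// mulrC divfK// gt_eqF.
by ring.
Qed.

Lemma bhalf_series (x : R) : 0 < x ->
  series (fun k => (-1) ^+ k / (k%:R + x)) @ \oo --> \int[mu]_(s in `]0, 2^-1[) bhalf x s.
Proof.
move=> x0; pose h y := \int[mu]_(s in `]0, 2^-1[) bhalf y s.
have kx k : 0 < k%:R + x by rewrite ltr_wpDl.
have E n : series (fun k => (-1) ^+ k / (k%:R + x)) n = h x - (-1) ^+ n * h (n%:R + x).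
  elim: n => [|n IH]; first by rewrite /series/= big_geq// mul1r add0r subrr.
  rewrite seriesSr IH /h (bhalf_rec (kx n)).
  have -> : n%:R + x + 1 = n.+1%:R + x by rewrite -addn1 natrD; ring.
  by rewrite exprS; ring.
rewrite (_ : series _ = fun n => h x - (-1) ^+ n * h (n%:R + x)); last by apply/funext => n; exact: E.
rewrite -[X in _ --> X]subr0; apply: cvgB; first exact: cvg_cst.
apply/norm_cvg0P; apply: (@squeeze_cvgr _ _ _ _ (fun=> 0) (fun n => (n%:R + x)^-1)).
- near=> n; have [_ /andP[h0 h1]] := bhalf_int (kx n).
  by rewrite normr_ge0/= normrM normrX normrN1 expr1n mul1r ger0_norm.
- exact: cvg_cst.
- apply/gtr0_cvgV0; first by near=> n; exact: kx.
  apply/cvgryPge => M; near=> n.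
  rewrite -[leLHS]addr0; apply: lerD; last exact: ltW.
  by near: n; exact: nbhs_infty_ger.
Unshelve. all: by end_near. Qed.

Lemma Gamma_reflection_series (x : R) : 0 < x < 1 ->
  series (fun k => (-1) ^+ k / (k%:R + x) + (-1) ^+ k / (k%:R + (1 - x))) @ \oo -->
  Gamma x * Gamma (1 - x).
Proof.
move=> /andP[x0 x1]; have y0 : 0 < 1 - x by rewrite subr_gt0.
have -> : Gamma x * Gamma (1 - x) =
    \int[mu]_(s in `]0, 2^-1[) bhalf x s + \int[mu]_(s in `]0, 2^-1[) bhalf (1 - x) s.
  rewrite (mulrC (Gamma x)) (Gamma_Beta y0 x0) (subrK x 1) Gamma1 mul1r.
  have bi := betaf_integrable y0 x0 ltr01.
  have h012 : 0 < (2^-1 : R) < 1 by apply/andP; split; [exact: h2|exact: h21].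
  rewrite (Rint_split h012 bi).
  have -> : \int[mu]_(s in `]0, 2^-1[) betaf (1 - x) x 1 s = \int[mu]_(s in `]0, 2^-1[) bhalf x s.
    apply: eq_Rint => s _; rewrite /betaf /bhalf mulrC.
    by rewrite (_ : 1 - x - 1 = - x)//; ring.
  apply: (congr1 (fun z => _ + z)).
  have bi2 : mu.-integrable `]2^-1, 1[ (EFin \o betaf (1 - x) x 1).
    by apply: integ_sub bi => //; apply: subset_itvr; rewrite bnd_simp ltW.
  have n1 : (-1 : R) != 0 by rewrite oppr_eq0 oner_eq0.
  rewrite (Rintegral_affine 1 n1 (measurable_itv _) bi2).
  rewrite normrN1 mul1r.
  have -> : (fun s : R => -1 * s + 1) @^-1` `]2^-1, 1[ = `]0, 2^-1[%classic.
    apply/funext => s; rewrite /preimage/= !in_itv/=; apply/propext.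
    have e : 2^-1 + 2^-1 = 1 :> R by field.
    by split=> /andP[? ?]; apply/andP; split; lra.
  apply: eq_Rint => s _; rewrite /betaf /bhalf.
  by congr (_ `^ _ * _ `^ _); ring.
rewrite (_ : series _ = fun n => series (fun k => (-1) ^+ k / (k%:R + x)) n + series (fun k => (-1) ^+ k / (k%:R + (1 - x))) n).
  by apply: cvgD; exact: bhalf_series.
by apply/funext => n; rewrite /series/= big_split.
Qed.

Lemma fsin_lin (f g : R -> R) (c : R) n : {within `[0, pi], continuous f} ->
  {within `[0, pi], continuous g} ->
  fsin (fun x => f x + c * g x) n = fsin f n + c * fsin g n.
Proof.
move=> cf cg.
have isn (u : R -> R) : {within `[0, pi], continuous u} ->
    mu.-integrable `]0, pi[ (EFin \o (fun x => u x * sin (n%:R * x))).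
  move=> cu; apply: cont_seg_integ => x; apply: cvgM; first exact: cu.
  exact: (continuous_subspaceT (@continuous_sinM R n%:R)).
have i1 := isn _ cf; have i2 := isn _ cg.
rewrite /fsin (@eq_Rint R _ _ (fun x => f x * sin (n%:R * x) + c * (g x * sin (n%:R * x)))).
  rewrite (RintD (measurable_itv _) i1 (integZ c (measurable_itv _) i2)).
  by rewrite (RintZ c (measurable_itv _) i2); ring.
by move=> x _; ring.
Qed.

Lemma fsin_id n : (0 < n)%N -> fsin (fun x : R => x) n = - (2 * (-1) ^+ n / n%:R).
Proof.
move=> n0; have nn : (n%:R : R) != 0 by rewrite pnatr_eq0 -lt0n.
have p0 := pi_gt0 R.
rewrite /fsin (@FTC2_seg R _ _ _ (fun x => n%:R ^- 2 * sin (n%:R * x) - n%:R^-1 * (x * cos (n%:R * x))) p0).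
- have K (p e : R) : p != 0 -> 2 / p * (n%:R ^- 2 * 0 - n%:R^-1 * (p * e) - (n%:R ^- 2 * 0 - n%:R^-1 * (0 * 1))) =
      - (2 * e / n%:R) by move=> pn; field; rewrite nn.
  by rewrite !mulr0 sin0 cos0 sin_natpi cos_natpi K// gt_eqF.
- by move=> x; apply: cvgM; [exact: cvg_id|exact: continuous_sinM].
- move=> x; apply: hd_eq; first exact: hdB (hdZ _ (hd_sinM _ _)) (hdZ _ (hdM (hd_id _) (hd_cosM _ _))).
  by rewrite /=; field.
Qed.

Lemma tails_inv_sq (C : R) : 0 <= C ->
  tails (fun k => C * k%:R ^- 2) (fun N => C * (6 * N.+1%:R^-1)).
Proof.
move=> C0 N n.
have [Nn|/ltnW nN] := leqP N n; last by rewrite big_geq// !mulr_ge0.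
apply: (@le_trans _ _ (\sum_(N <= k < n) (C * (6 * (k.+1%:R^-1 - k.+2%:R^-1))))); last first.
  rewrite -big_distrr/= -big_distrr/= ler_wpM2l// ler_wpM2l//.
  under eq_bigr do rewrite -opprB.
  by rewrite sumrN telescope_sumr// opprB gerBl.
apply: ler_sum => k _; rewrite ger0_norm ?mulr_ge0 ?invr_ge0 ?exprn_ge0//.
rewrite ler_wpM2l//; case: k => [|k].
  by rewrite expr0n invr0 mulr_ge0// subr_ge0 lef_pV2 ?posrE// ler_nat.
have k0 : 0 <= k%:R :> R by [].
rewrite -[k.+3]addn3 -[k.+2]addn2 -[k.+1]addn1 !natrD.
move: (k%:R : R) k0 => y y0.
have [h1 h3] : 0 < y + 1 /\ 0 < (y + 2) * (y + 3) by split; [lra|apply: mulr_gt0; lra].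
have -> : 6 * ((y + 2)^-1 - (y + 3)^-1) = 6 / ((y + 2) * (y + 3)).
  by field; apply/andP; split; apply: lt0r_neq0; lra.
rewrite ler_pdivlMr// mulrC ler_pdivrMr ?exprn_gt0//.
have : 0 <= y * y by rewrite mulr_ge0.
by rewrite expr2; lra.
Qed.

Lemma cvg_tau_inv (C : R) : C * (6 * N.+1%:R^-1) @[N --> \oo] --> (0 : R).
Proof.
rewrite -[X in _ --> X](mulr0 C); apply: cvgM; first exact: cvg_cst.
rewrite -[X in _ --> X](mulr0 6); apply: cvgM; first exact: cvg_cst.
exact: cvg_harmonic.
Qed.

Lemma at_right_dnbhs (f : R -> R) (x l : R) : f y @[y --> x^'] --> l -> f y @[y --> x^'+] --> l.
Proof.
move=> c; apply/cvgrPdist_lt => e e0; have /cvgrPdist_lt /(_ _ e0) := c.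
rewrite !near_withinE; apply: filterS => y H xy; apply: H.
by rewrite gt_eqF.
Qed.

(** The terms of pi / sin (pi x) as a sum of partial fractions over the integers,
    those of n and - n being taken together. *)
Definition csc_term (x : R) (n : nat) : R :=
  if n is 0%N then x^-1 else (-1) ^+ n * ((n%:R + x)^-1 - (n%:R - x)^-1).

(** Partial fractions of pi / sin (pi x), read off from the derivative at 0 of
    the sine series of sin (x t) - (t / pi) sin (pi x). *)
Lemma pi_sin_series (x : R) : 0 < x < 1 -> exists2 l,
  series (csc_term x) @ \oo --> l & pi = sin (pi * x) * l.
Proof.
move=> /andP[x0 x1]; have p0 := pi_gt0 R.
pose s := sin (x * pi).
pose q t := sin (x * t) - s / pi * t.
have sq : x ^+ 2 < 1 by rewrite expr_lt1// ltW.
have nx n : (0 < n)%N -> 0 < n%:R ^+ 2 - x ^+ 2.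
  move=> n0; have : 1 <= n%:R ^+ 2 :> R by rewrite -natrX ler1n expn_gt0 n0.
  by move: sq; clear; lra.
have cont (f f' : R -> R) : (forall t, has_derive f t (f' t)) -> {within `[0, pi], continuous f}.
  by move=> d; apply: continuous_subspaceT => t; apply: hd_continuous; exact: d.
have d1 t : has_derive q t (x * cos (x * t) - s / pi).
  by apply: hd_eq; first exact: hdB (hd_sinM _ _) (hdZ _ (hd_id _)); rewrite mulr1.
have d2 t : has_derive (fun t => x * cos (x * t) - s / pi) t (- (x ^+ 2 * sin (x * t))).
  by apply: hd_eq; first exact: hdB (hdZ _ (hd_cosM _ _)) (hd_cst _ _); ring.
have d3 t : has_derive (fun t => - (x ^+ 2 * sin (x * t))) t (- (x ^+ 2 * (x * cos (x * t)))).
  by apply: hdN; apply: hdZ; exact: hd_sinM.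
have q0 : q 0 = 0 by rewrite /q !mulr0 sin0 subr0.
have qp : q pi = 0 by rewrite /q divfK ?subrr// gt_eqF.
have csx : {within `[0, pi], continuous (fun t => sin (x * t))} := cont _ _ (fun t => hd_sinM x t).
have cid : {within `[0, pi], continuous (fun t : R => t)} := cont _ _ (fun t => hd_id t).
have bn n : (0 < n)%N -> n%:R * fsin q n = s * x / pi * csc_term x n.
  move=> n0; have nn : (n%:R : R) != 0 by rewrite pnatr_eq0 -lt0n.
  have dd := fsin_dd n (fun t _ => d1 t) (fun t _ => d2 t) (cont _ _ d1) (cont _ _ d2) (cont _ _ d3) q0 qp.
  have E1 : fsin (fun t => - (x ^+ 2 * sin (x * t))) n = - x ^+ 2 * fsin (fun t => sin (x * t)) n.
    have := fsin_lin (- x ^+ 2) n (cont _ _ (fun t => hd_cst 0 t)) csx.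
    rewrite (_ : fsin (fun=> 0) n = 0) ?add0r; last first.
      by rewrite /fsin (@eq_Rint R _ _ (fun=> 0)) ?Rint0 ?mulr0// => t _; rewrite mul0r.
    by move<-; congr fsin; apply/funext => t; ring.
  have E2 : fsin q n = fsin (fun t => sin (x * t)) n + - (s / pi) * - (2 * (-1) ^+ n / n%:R).
    rewrite -fsin_id// -fsin_lin//; congr fsin; apply/funext => t; rewrite /q; ring.
  move: dd E2; rewrite E1; move: (fsin q n) (fsin _ n) (nx n n0) => b s0 h1.
  have -> : csc_term x n = (-1) ^+ n * ((n%:R + x)^-1 - (n%:R - x)^-1) by case: (n) n0.
  have pn : pi != 0 :> R by rewrite gt_eqF.
  move: (n%:R : R) ((-1) ^+ n : R) (s : R) (pi : R) nn pn h1.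
  move=> N e s' p nn pn h1 dd E2.
  have [h2' h3] : N - x != 0 /\ N + x != 0.
    by move: h1; rewrite subr_sqr => /lt0r_neq0; rewrite mulf_eq0 negb_or => /andP[].
  have E : (N ^+ 2 - x ^+ 2) * b = - x ^+ 2 * (s' / p) * (2 * e / N).
    have h : N ^+ 2 * b = x ^+ 2 * s0 by rewrite -[LHS]opprK -dd; ring.
    by rewrite mulrBl h E2; ring.
  have -> : b = - x ^+ 2 * (s' / p) * (2 * e / N) / (N ^+ 2 - x ^+ 2).
    by rewrite -E mulrC mulKf// lt0r_neq0.
  by rewrite subr_sqr; field; rewrite pn nn h2' h3.
pose C := 2 / (1 - x ^+ 2) : R.
have C0 : 0 <= C by rewrite divr_ge0// subr_ge0 ltW.
pose tau N := C * (6 * N.+1%:R^-1).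
have t0 : tau @ \oo --> 0 by exact: cvg_tau_inv.
have cb n : (0 < n)%N -> `|csc_term x n| <= C * n%:R ^- 2.
  move=> n0; have h1 := nx n n0.
  have -> : csc_term x n = (-1) ^+ n * ((n%:R + x)^-1 - (n%:R - x)^-1) by case: (n) n0.
  rewrite normrM normrX normrN1 expr1n mul1r.
  have h : 1 <= n%:R :> R by rewrite ler1n.
  move: (n%:R : R) h h1 => N N1 h1.
  have [h2' h3] : N - x != 0 /\ N + x != 0.
    by move: h1; rewrite subr_sqr => /lt0r_neq0; rewrite mulf_eq0 negb_or => /andP[].
  have -> : (N + x)^-1 - (N - x)^-1 = - (2 * x) / (N ^+ 2 - x ^+ 2).
    by rewrite subr_sqr; field; rewrite h2' h3.
  rewrite mulNr normrN ger0_norm; last by rewrite divr_ge0 ?(ltW h1)// mulr_ge0// ltW.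
  rewrite ler_pdivrMr// /C.
  have N2 : 1 <= N ^+ 2 by rewrite exprn_ege1.
  have -> : 2 / (1 - x ^+ 2) * N ^- 2 * (N ^+ 2 - x ^+ 2) = 2 * ((N ^+ 2 - x ^+ 2) / ((1 - x ^+ 2) * N ^+ 2)).
    have K (u v w : R) : 2 / u * w^-1 * v = 2 * (v / (u * w)) by rewrite invfM; ring.
    exact: K.
  apply: ler_wpM2l => //; apply: le_trans (ltW x1) _.
  rewrite ler_pdivlMr; last by apply: mulr_gt0; [rewrite subr_gt0|exact: lt_le_trans N2].
  have : 0 <= x ^+ 2 * (N ^+ 2 - 1) by rewrite mulr_ge0 ?sqr_ge0// subr_ge0.
  by rewrite mul1r; clear; lra.
pose D k := if k is 0%N then 0 else csc_term x k.
have tD : tails D tau.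
  apply: tails_le (tails_inv_sq C0) _ => -[|k]; first by rewrite normr0.
  exact: le_trans (cb k.+1 (ltn0Sn k)) (ler_norm _).
have nb n : n%:R * fsin q n = s * x / pi * D n.
  by case: n => [|n]; [rewrite fsin0 /D !mulr0|exact: bn].
exists (x^-1 + tsum D).
  rewrite (_ : series _ = fun n => (if n is 0%N then 0 else x^-1) + series D n).
    apply: cvgD; last exact: tails_cvg tD t0.
    by apply/cvgrPdist_lt => e e0; exists 1%N => // -[//|n] _ /=; rewrite subrr normr0.
  apply/funext => -[|n]; first by rewrite /series/= !big_geq// add0r.
  rewrite /series/= !big_nat_recl//= add0r; congr (_ + _).
pose K : R := `|s * x / pi|.
have t1 : (fun N => K * tau N) @ \oo --> 0.
  by rewrite -[X in _ --> X](mulr0 K); apply: cvgM; [exact: cvg_cst|exact: t0].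
have tb : tails (fun n => n%:R * fsin q n) (fun N => K * tau N).
  move=> N n; apply: (@le_trans _ _ (\sum_(N <= k < n) K * `|D k|)).
    by apply: ler_sum => k _; rewrite nb normrM.
  by rewrite -mulr_sumr; apply: ler_wpM2l; [exact: normr_ge0|exact: tD].
have tb' : tails (fsin q) (fun N => K * tau N).
  apply: tails_le tb _ => -[|n]; first by rewrite fsin0 mulr0.
  rewrite [leRHS]normrM; apply: ler_peMl; first exact: normr_ge0.
  by rewrite ger0_norm// ler1n.
have h' := @termwise_derive R (fun k t => fsin q k * sin (k%:R * t)) (fun k t => fsin q k * (k%:R * cos (k%:R * t)))
  (fun k => `|k%:R * fsin q k|) _ 0 t1.
have {h'} h' : has_derive (fun t => tsum (fun k => fsin q k * sin (k%:R * t))) 0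
   (tsum (fun k => k%:R * fsin q k)).
  apply: hd_eq; first apply: h'.
  - by move=> k y; apply: hdZ; exact: hd_sinM.
  - move=> k y; rewrite mulrCA mulrA normrM -[leRHS]mulr1 ler_wpM2l//; exact: cos_max.
  - by apply: tails_le tb _ => k; rewrite normr_id.
  - by move=> y; apply/cvg_ex; eexists; apply: tails_cvg t1; exact: tails_sin.
  by apply: eq_tsum => k; rewrite mulr0 cos0 mulr1 mulrC.
have e1 := at_right_dnbhs ((has_derive_quot _ _ _).1 h').
have e2 := at_right_dnbhs ((has_derive_quot _ _ _).1 (d1 0)).
have : tsum (fun k => k%:R * fsin q k) = x * cos (x * 0) - s / pi.
  apply: (cvg_unique (@Rhausdorff R) e1).
  apply: cvg_trans e2; apply: near_eq_cvg; near=> t.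
  have tI : 0 <= t <= pi.
    apply/andP; split; first by near: t; exact: nbhs_right_ge.
    by near: t; exact: nbhs_right_le.
  rewrite !addr0 (sine_expansion (cont _ _ d1) q0 qp t1 tb' tI).
  rewrite (sine_expansion (cont _ _ d1) q0 qp t1 tb')//.
  by rewrite lexx ltW.
rewrite mulr0 cos0 mulr1 (eq_tsum nb) tsumZ; last by apply/cvg_ex; eexists; exact: tails_cvg tD t0.
rewrite -/s -(mulrC x pi) -/s.
have pn : pi != 0 :> R by rewrite gt_eqF.
have xn : x != 0 by rewrite gt_eqF.
move: (tsum D) (pi : R) (s : R) pn => d p s' pn H.
have : p * x = s' + s' * x * d.
  have -> : s' * x * d = p * (s' * x / p * d) by field.
  by rewrite H; field.
move=> {}H; apply: (mulIf xn); rewrite H; by field.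
Unshelve. all: by end_near. Qed.

(** Both sides of Gamma x Gamma (1 - x) = pi / sin (pi x) are sums of the same
    partial fractions, grouped differently. *)
Lemma Gamma_reflection (x : R) : 0 < x < 1 -> sin (pi * x) * (Gamma x * Gamma (1 - x)) = pi.
Proof.
move=> x01; have [l cl el] := pi_sin_series x01.
have cg := Gamma_reflection_series x01.
rewrite [RHS]el; congr (_ * _).
have /andP[x0 x1] := x01.
pose e n : R := (-1) ^+ n.+1 / (n.+1%:R - x).
have E n : series (fun k => (-1) ^+ k / (k%:R + x) + (-1) ^+ k / (k%:R + (1 - x))) n.+1 =
    series (csc_term x) n.+1 - e n.
  elim: n => [|n IH].
    by rewrite /series/= !big_nat1 /e expr0 expr1 !add0r /=; ring.
  rewrite seriesSr IH [in RHS]seriesSr /e /csc_term.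
  have -> : n.+1%:R + (1 - x) = n.+2%:R - x by rewrite -[n.+2]addn1 natrD; ring.
  by rewrite [in RHS](exprS _ n.+1); ring.
have ce : e n @[n --> \oo] --> 0.
  apply/norm_cvg0P; apply: (@squeeze_cvgr _ _ _ _ (fun=> 0) (fun n => (n.+1%:R - x)^-1)).
  - near=> n; rewrite normr_ge0/= /e normrM normrX normrN1 expr1n mul1r ger0_norm//.
    by rewrite invr_ge0 subr_ge0 (le_trans (ltW x1))// ler1n.
  - exact: cvg_cst.
  - apply/gtr0_cvgV0; first by near=> n; rewrite subr_gt0 (lt_le_trans x1)// ler1n.
    apply/cvgryPge => M; near=> n.
    rewrite lerBrDr; apply: (@le_trans _ _ (n%:R)); last by rewrite ler_nat.
    by near: n; exact: nbhs_infty_ger.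
have c1 := cvg_comp (addn^~ 1%N) _ (cvg_addnr 1) cg.
have c2 := cvg_comp (addn^~ 1%N) _ (cvg_addnr 1) cl.
apply: (cvg_unique (@Rhausdorff R) c1).
rewrite (_ : _ \o _ = fun n => series (csc_term x) (n + 1)%N - e n); last first.
  by apply/funext => n; rewrite /= addn1; exact: E.
by have c3 := cvgB c2 ce; rewrite subr0 in c3; exact: c3.
Unshelve. all: by end_near. Qed.

End reflection.

(** * Moments of Kanter's function *)

Section kanter.
Context {R : realType}.
Notation mu := (@lebesgue_measure R).

Lemma binom_step (f : nat -> R) m :
  \sum_(j < m.+2) 'C(m.+1, j)%:R * f j =
  \sum_(j < m.+1) 'C(m, j)%:R * f j + \sum_(j < m.+1) 'C(m, j)%:R * f j.+1.
Proof.
rewrite big_ord_recl /= bin0 mul1r.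
under eq_bigr => i _ do rewrite /bump/= add1n binS natrD mulrDl.
rewrite big_split /= addrA; congr (_ + _).
rewrite big_ord_recr/= bin_small// mul0r addr0 [RHS]big_ord_recl/= bin0 mul1r.
by congr (_ + _).
Qed.

(** Partial fractions of 1 / (z (z + 1) ... (z + m)), by induction on m through the
    recursion of the binomial coefficients. *)
Lemma partial_fractions (z : R) m : (forall j, (j <= m)%N -> z + j%:R != 0) ->
  \sum_(j < m.+1) 'C(m, j)%:R * ((-1) ^+ j / (z + j%:R)) = m`!%:R / \prod_(j < m.+1) (z + j%:R).
Proof.
elim: m z => [|m IH] z zj.
  by rewrite !big_ord_recl !big_ord0 /= bin0 fact0 expr0 addr0 mulr1 !mul1r.
rewrite (binom_step (fun j => (-1) ^+ j / (z + j%:R))) IH => [|j jm]; last by apply: zj; exact: leqW.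
have E : \sum_(j < m.+1) 'C(m, j)%:R * ((-1) ^+ j.+1 / (z + j.+1%:R)) =
   - (\sum_(j < m.+1) 'C(m, j)%:R * ((-1) ^+ j / (z + 1 + j%:R))).
  rewrite -sumrN; apply: eq_bigr => j _.
  rewrite exprS; have -> : z + j.+1%:R = z + 1 + j%:R by rewrite -addn1 natrD; ring.
  by ring.
have zj1 j : (j <= m)%N -> z + 1 + j%:R != 0.
  by move=> jm; have := zj j.+1 jm; rewrite -addn1 natrD addrA addrAC.
rewrite E (IH _ zj1) big_ord_recl [in X in _ = X]big_ord_recl big_ord_recr/= addr0.
have P : \prod_(i < m.+1) (z + 1 + i%:R) = \prod_(i < m) (z + 1 + i%:R) * (z + 1 + m%:R).
  by rewrite big_ord_recr.
have Q k : \prod_(i < k) (z + (bump 0 i)%:R) = \prod_(i < k) (z + 1 + i%:R).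
  by apply: eq_bigr => i _; rewrite /bump/= add1n -addn1 natrD addrA addrAC.
rewrite !Q P; have p0 : \prod_(i < m) (z + 1 + i%:R) != 0.
  by apply/prodf_neq0 => i _; apply: zj1; exact: ltnW.
have z0 : z != 0 by have := zj 0%N isT; rewrite addr0.
have zm : z + 1 + m%:R != 0 by exact: zj1.
rewrite [in X in _ = X]factS natrM -[m.+1]addn1 natrD /=.
by move: (\prod_(i < m) _) p0 => p p0; field; rewrite p0 z0 zm.
Qed.

Lemma Gamma_prod (x : R) n : 0 < x -> Gamma (x + n%:R) = Gamma x * \prod_(j < n) (x + j%:R).
Proof.
move=> x0; elim: n => [|n IH]; first by rewrite addr0 big_ord0 mulr1.
rewrite big_ord_recr/= mulrA -IH -addn1 natrD addrA GammaS; first by rewrite mulrC.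
by rewrite ltr_wpDr.
Qed.

Variable rho : R.
Hypothesis rho01 : 0 < rho < 1.

Let rho0 : 0 < rho. Proof. by case/andP: rho01. Qed.
Let rho1 : rho < 1. Proof. by case/andP: rho01. Qed.
Let sig0 : 0 < 1 - rho. Proof. by rewrite subr_gt0. Qed.

(** With R = kR and L = kL one has 1 + R e^(i t) = L e^(i rho t): a triangle with
    angles rho t, (1 - rho) t and pi - t. *)
Definition kD (t : R) := sin ((1 - rho) * t).
Definition kR (t : R) := sin (rho * t) / kD t.
Definition kL (t : R) := sin t / kD t.
(** Kanter's function sin t / (sin (rho t)^rho sin ((1 - rho) t)^(1 - rho)) on
    ]0, pi[, the angular factor in his representation of one-sided stable laws. *)
Definition kanter (t : R) := kL t * kR t `^ (- rho).

Lemma sin_frac_gt0 (c t : R) : 0 < c < 1 -> 0 < t <= pi -> 0 < sin (c * t).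
Proof.
move=> /andP[c0 c1] /andP[t0 tp]; apply: sin_gt0_pi; rewrite mulr_gt0//=.
by rewrite (lt_le_trans _ tp)// gtr_pMl.
Qed.

Lemma kD_gt0 t : 0 < t <= pi -> 0 < kD t.
Proof. by apply: sin_frac_gt0; rewrite sig0 gtrBl. Qed.

Lemma kR_gt0 t : 0 < t <= pi -> 0 < kR t.
Proof. by move=> ti; rewrite divr_gt0 ?kD_gt0// sin_frac_gt0. Qed.

Lemma kL_gt0 t : 0 < t < pi -> 0 < kL t.
Proof.
move=> /andP[t0 tp]; rewrite divr_gt0 ?kD_gt0 ?t0 ?ltW//.
by rewrite sin_gt0_pi ?t0.
Qed.

Lemma kanter_gt0 t : 0 < t < pi -> 0 < kanter t.
Proof.
move=> ti; have /andP[t0 tp] := ti; rewrite mulr_gt0 ?kL_gt0// powR_gt0// kR_gt0//.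
by rewrite t0 ltW.
Qed.

Lemma kR_pi : kR pi = 1.
Proof.
rewrite /kR /kD; have -> : (1 - rho) * pi = - (rho * pi) + pi by ring.
rewrite sinDpi sinN opprK divff// gt_eqF// sin_frac_gt0// pi_gt0 lexx//.
Qed.

Lemma hd_kR t : 0 < t <= pi -> exists r', has_derive kR t r'.
Proof.
move=> ti; have d0 := kD_gt0 ti.
eexists; apply: hdM; first exact: hd_sinM.
by apply: hdV; [rewrite gt_eqF|exact: hd_sinM].
Qed.

Lemma continuous_kanter t : 0 < t < pi -> {for t, continuous kanter}.
Proof.
move=> /andP[t0 tp]; have ti : 0 < t <= pi by rewrite t0 ltW.
apply: cvgM.
  apply: cvgM; first exact: continuous_sin.
  apply: cvgV; first by rewrite gt_eqF// kD_gt0.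
  exact: continuous_sinM.
have [r' d] := hd_kR ti.
apply: (@cont_comp R (fun x => x `^ (- rho))); first exact: hd_continuous d.
by apply: continuous_powR; exact: kR_gt0.
Qed.

(** The real part of e^(i phi) (1 + R e^(i t))^m = L^m e^(i (m rho t + phi)). *)
Lemma kanter_cos t m phi : 0 < t <= pi ->
  \sum_(j < m.+1) 'C(m, j)%:R * (kR t ^+ j * cos (j%:R * t + phi)) =
  kL t ^+ m * cos (m%:R * rho * t + phi).
Proof.
move=> ti; have d0 := kD_gt0 ti.
have e1 : 1 + kR t * cos t = kL t * cos (rho * t).
  rewrite /kR /kL; have : kD t = sin t * cos (rho * t) - cos t * sin (rho * t).
    by rewrite /kD mulrBl mul1r sinB.
  move: (kD t) d0 => d d0 e; have dn := lt0r_neq0 d0.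
  have -> : 1 + sin (rho * t) / d * cos t = (d + sin (rho * t) * cos t) / d by field.
  by rewrite e; ring.
have e2 : kR t * sin t = kL t * sin (rho * t) by rewrite /kR /kL; ring.
elim: m phi => [|m IH] phi.
  by rewrite big_ord_recl big_ord0 /= !expr0 !mul0r addr0 !mul1r.
rewrite (binom_step (fun j => kR t ^+ j * cos (j%:R * t + phi))) IH.
have -> : \sum_(j < m.+1) 'C(m, j)%:R * (kR t ^+ j.+1 * cos (j.+1%:R * t + phi)) =
    kR t * \sum_(j < m.+1) 'C(m, j)%:R * (kR t ^+ j * cos (j%:R * t + (t + phi))).
  rewrite mulr_sumr; apply: eq_bigr => j _.
  have -> : j.+1%:R * t + phi = j%:R * t + (t + phi) by rewrite -addn1 natrD; ring.
  by rewrite exprS; ring.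
rewrite IH; set psi := m%:R * rho * t + phi.
have -> : m%:R * rho * t + (t + phi) = psi + t by rewrite /psi; ring.
have -> : m.+1%:R * rho * t + phi = psi + rho * t by rewrite /psi -addn1 natrD; ring.
rewrite (cosD psi t) (cosD psi (rho * t)) exprSr.
transitivity (kL t ^+ m * (cos psi * (1 + kR t * cos t) - sin psi * (kR t * sin t))); first by ring.
by rewrite e1 e2; ring.
Qed.

(** Its derivative in t is cos (y t), also for y = 0. *)
Definition sinc (y t : R) := if y == 0 then t else sin (y * t) / y.

Lemma hd_sinc y t : has_derive (sinc y) t (cos (y * t)).
Proof.
rewrite /sinc; case: eqVneq => [->|y0]; first by rewrite mul0r cos0; exact: hd_id.
apply: hd_eq; first exact: hdM (hd_sinM y t) (hd_cst _ _).
by rewrite mulr0 addr0 mulrAC divff// mul1r.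
Qed.

Lemma mul_sinc y t : y * sinc y t = sin (y * t).
Proof.
rewrite /sinc; case: eqVneq => [->|y0]; first by rewrite !mul0r sin0.
by rewrite mulrCA divff// mulr1.
Qed.

(** An explicit primitive of the m-th power of [kanter]. *)
Definition kanter_prim m t := \sum_(j < m.+1) 'C(m, j)%:R *
  (kR t `^ (j%:R - rho * m%:R) * sinc (j%:R - rho * m%:R) t).

Lemma hd_sum (n : nat) (f f' : nat -> R -> R) (x : R) : (forall i, has_derive (f i) x (f' i x)) ->
  has_derive (fun x => \sum_(i < n) f i x) x (\sum_(i < n) f' i x).
Proof.
move=> df; elim: n => [|n IH].
  rewrite big_ord0 (_ : (fun x => _) = fun=> 0); first exact: hd_cst.
  by apply/funext => y; rewrite big_ord0.
rewrite big_ord_recr (_ : (fun x => _) = fun x => \sum_(i < n) f i x + f n x).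
  exact: hdD.
by apply/funext => y; rewrite big_ord_recr.
Qed.

(** By [kanter_cos] the terms with the derivative of R add up to
    sin (m rho t - rho m t) = 0, and the others to L^m R^(- rho m). *)
Lemma hd_kanter_prim m t : 0 < t < pi -> has_derive (kanter_prim m) t (kanter t ^+ m).
Proof.
move=> tI; have /andP[t0 tp] := tI; have ti : 0 < t <= pi by rewrite t0 ltW.
have [r' dr] := hd_kR ti; have r0 := kR_gt0 ti.
pose y j := j%:R - rho * m%:R : R.
apply: hd_eq.
  apply: (@hd_sum m.+1 (fun j t => 'C(m, j)%:R * (kR t `^ y j * sinc (y j) t))
    (fun j t => 'C(m, j)%:R * (y j * kR t `^ (y j - 1) * r' * sinc (y j) t + kR t `^ (y j) * cos (y j * t))) t _).
  move=> j; apply: hdZ; apply: hdM; last exact: hd_sinc.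
  by apply: (@hd_comp _ (fun x => x `^ (y j))) => //; exact: hd_powR.
pose c := - (rho * m%:R * t).
have yt j : y j * t = j%:R * t + c by rewrite /y /c; ring.
have pw j e : kR t `^ (y j - e) = kR t `^ (- (rho * m%:R) - e) * kR t ^+ j.
  rewrite -powR_mulrn ?(ltW r0)// -powRD; last by rewrite (gt_eqF r0) implybT.
  by congr (_ `^ _); rewrite /y; ring.
transitivity (kR t `^ (- (rho * m%:R) - 1) * r' *
   (\sum_(j < m.+1) 'C(m, j)%:R * (kR t ^+ j * cos (j%:R * t + (c - pi / 2)))) +
   kR t `^ (- (rho * m%:R) - 0) *
   (\sum_(j < m.+1) 'C(m, j)%:R * (kR t ^+ j * cos (j%:R * t + c)))).
  rewrite !mulr_sumr -big_split/=; apply: eq_bigr => j _.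
  have -> : kR t `^ y j = kR t `^ (- (rho * m%:R) - 0) * kR t ^+ j by rewrite -pw subr0.
  rewrite pw yt (addrA (j%:R * t)) (cosB (j%:R * t + c) (pi / 2)) cos_pihalf sin_pihalf mulr0 add0r mulr1.
  have -> : y j * (kR t `^ (- (rho * m%:R) - 1) * kR t ^+ j) * r' * sinc (y j) t =
    (kR t `^ (- (rho * m%:R) - 1) * kR t ^+ j) * r' * (y j * sinc (y j) t) by ring.
  rewrite mul_sinc yt.
  by ring.
rewrite !kanter_cos// addrA (cosB (_ + c) (pi / 2)) cos_pihalf sin_pihalf mulr0 add0r mulr1.
have -> : m%:R * rho * t + c = 0 by rewrite /c; ring.
rewrite sin0 cos0 !mulr0 add0r mulr1 subr0 mulrC [RHS]exprMn.
by rewrite -[X in _ = _ * X]powR_mulrn ?powR_ge0// -powRrM mulNr.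
Qed.

Lemma cvg_sumn (T : Type) (F : set_system T) {FF : Filter F} (n : nat) (f : nat -> T -> R)
    (l : nat -> R) : (forall i, f i x @[x --> F] --> l i) ->
  \sum_(i < n) f i x @[x --> F] --> \sum_(i < n) l i.
Proof.
move=> fl; elim: n => [|n IH].
  rewrite big_ord0 (_ : (fun x => _) = fun=> 0); first exact: cvg_cst.
  by apply/funext => y; rewrite big_ord0.
rewrite big_ord_recr (_ : (fun x => _) = fun x => \sum_(i < n) f i x + f n x).
  by apply: cvgD.
by apply/funext => y; rewrite big_ord_recr.
Qed.

Lemma sinM_cvg0 (c : R) : t^-1 * sin (c * t) @[t --> 0^'+] --> c.
Proof.
have := at_right_dnbhs ((has_derive_quot _ _ _).1 (hd_sinM c 0)).
rewrite mulr0 cos0 mulr1; apply: cvg_trans; apply: near_eq_cvg; near=> t.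
by rewrite addr0 sin0 subr0.
Unshelve. all: by end_near. Qed.

Lemma kR_cvg0 : kR t @[t --> 0^'+] --> rho / (1 - rho).
Proof.
have q := sinM_cvg0.
have h : (t^-1 * sin (rho * t)) * (t^-1 * sin ((1 - rho) * t))^-1 @[t --> 0^'+] --> rho / (1 - rho).
  by apply: cvgM; [exact: q|apply: cvgV; [exact: lt0r_neq0|exact: q]].
apply: cvg_trans h; apply: near_eq_cvg; near=> t.
have t0 : t != 0 by rewrite gt_eqF//; near: t; exact: nbhs_right_gt.
by rewrite /kR /kD /= invfM invrK mulrACA mulVf// mul1r.
Unshelve. all: by end_near. Qed.

Lemma kL_cvg0 : kL t @[t --> 0^'+] --> (1 - rho)^-1.
Proof.
have h : (t^-1 * sin (1 * t)) * (t^-1 * sin ((1 - rho) * t))^-1 @[t --> 0^'+] --> 1 / (1 - rho).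
  by apply: cvgM; [exact: sinM_cvg0|apply: cvgV; [exact: lt0r_neq0|exact: sinM_cvg0]].
rewrite -[X in _ --> X]mul1r; apply: cvg_trans h; apply: near_eq_cvg; near=> t.
have t0 : t != 0 by rewrite gt_eqF//; near: t; exact: nbhs_right_gt.
by rewrite /kL /kD /= mul1r invfM invrK mulrACA mulVf// mul1r.
Unshelve. all: by end_near. Qed.

Lemma kanter_le : exists2 K : R, 0 < K & forall t, 0 < t < pi -> kanter t <= K.
Proof.
have p0 := pi_gt0 R.
pose l := (1 - rho)^-1 * (rho / (1 - rho)) `^ (- rho).
pose At t := if t == 0 then l else kanter t.
have AE t : 0 < t -> At t = kanter t by move=> t0; rewrite /At gt_eqF.
have near_eq (F : set_system R) (FF : Filter F) (m : R) :
    (\forall t \near F, 0 < t) -> kanter t @[t --> F] --> m -> At t @[t --> F] --> m.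
  move=> F0; apply: cvg_trans; apply: near_eq_cvg; near=> t; rewrite AE//.
  by near: t.
have cA : {within `[0, pi], continuous At}.
  apply/(continuous_within_itvP _ p0); split.
  - move=> t; rewrite in_itv/= => /andP[t0 tp].
    rewrite /continuous_at AE//; apply: near_eq; first by near=> s; near: s; exact: lt_nbhsr.
    by apply: continuous_kanter; rewrite t0.
  - rewrite /At eqxx; apply: near_eq; first by near=> s; near: s; exact: nbhs_right_gt.
    apply: cvgM; first exact: kL_cvg0.
    apply: (@cvg_cont_comp _ _ _ _ kR (fun x => x `^ (- rho))); first exact: kR_cvg0.
    by apply: continuous_powR; rewrite divr_gt0.
  - rewrite AE//; apply: near_eq; first by near=> s; near: s; exact: nbhs_left_gt.
    apply: cvg_at_left_filter; have ppi : 0 < (pi : R) <= pi by rewrite p0 lexx.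
    have [r' d] := hd_kR ppi.
    apply: cvgM.
      apply: cvgM; first exact: continuous_sin.
      by apply: cvgV; [rewrite gt_eqF// kD_gt0|exact: continuous_sinM].
    apply: (@cont_comp R (fun x => x `^ (- rho))); first exact: hd_continuous d.
    by apply: continuous_powR; exact: kR_gt0.
have [M [M0 AM]] := cont_seg_bounded cA.
exists (M + 1) => [|t /andP[t0 tp]]; first by rewrite ltr_wpDl.
rewrite -AE// (le_trans (ler_norm _))// (le_trans (AM _ _)) ?lerDl//.
by rewrite !ltW.
Unshelve. all: by end_near. Qed.

(** The primitive vanishes at 0, and R = 1 at pi. *)
Lemma kanter_moment_sum m :
  mu.-integrable `]0, pi[ (EFin \o (fun t => kanter t ^+ m)) /\
  \int[mu]_(t in `]0, pi[) (kanter t ^+ m) =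
  \sum_(j < m.+1) 'C(m, j)%:R * sinc (j%:R - rho * m%:R) pi.
Proof.
have p0 := pi_gt0 R.
have [|||||i e] := @FTC2_oo R 0 pi (fun t => kanter t ^+ m) (kanter_prim m) 0
  (\sum_(j < m.+1) 'C(m, j)%:R * sinc (j%:R - rho * m%:R) pi) p0.
- move=> t ti; apply: (@cont_comp R (fun x => x ^+ m)); first exact: continuous_kanter.
  exact: exprn_continuous.
- exact: hd_kanter_prim.
- rewrite [X in _ --> X](_ : 0 = \sum_(j < m.+1) 'C(m, j)%:R *
    ((rho / (1 - rho)) `^ (j%:R - rho * m%:R) * 0)); last first.
    by rewrite big1// => j _; rewrite !mulr0.
  apply: (@cvg_sumn _ _ _ m.+1 (fun j t => 'C(m, j)%:R * (kR t `^ (j%:R - rho * m%:R) * sinc (j%:R - rho * m%:R) t))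
    (fun j => 'C(m, j)%:R * ((rho / (1 - rho)) `^ (j%:R - rho * m%:R) * 0))) => j.
  apply: cvgM; first exact: cvg_cst.
  apply: cvgM.
    apply: (@cvg_cont_comp _ _ _ _ kR (fun x => x `^ _)); first exact: kR_cvg0.
    by apply: continuous_powR; rewrite divr_gt0.
  rewrite [X in _ --> X](_ : 0 = sinc (j%:R - rho * m%:R) 0).
    by apply: cvg_at_right_filter; apply: hd_continuous; exact: hd_sinc.
  by rewrite /sinc; case: eqP => // _; rewrite mulr0 sin0 mul0r.
- rewrite [X in _ --> X](_ : _ = kanter_prim m pi).
    apply: cvg_at_left_filter.
    apply: (@cvg_sumn _ _ _ m.+1 (fun j t => 'C(m, j)%:R * (kR t `^ (j%:R - rho * m%:R) * sinc (j%:R - rho * m%:R) t))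
      (fun j => 'C(m, j)%:R * (kR pi `^ (j%:R - rho * m%:R) * sinc (j%:R - rho * m%:R) pi))) => j.
    apply: cvgM; first exact: cvg_cst.
    have ppi : 0 < (pi : R) <= pi by rewrite p0 lexx.
    have [r' d] := hd_kR ppi.
    apply: cvgM; last by apply: hd_continuous; exact: hd_sinc.
    apply: (@cont_comp R (fun x => x `^ _)); first exact: hd_continuous d.
    by apply: continuous_powR; exact: kR_gt0.
  by apply: eq_bigr => j _; rewrite kR_pi powR1 mul1r.
- by right=> t ti; rewrite exprn_ge0// ltW// kanter_gt0.
by rewrite e subr0.
Qed.

Lemma sin_addnpi (x : R) n : sin (x + n%:R * pi) = (-1) ^+ n * sin x.
Proof. by rewrite sinD sin_natpi cos_natpi mulr0 addr0 mulrC. Qed.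

(** The sines sin ((j - rho m) pi) differ only by a sign, so the sum is
    sin (pi xi) times a partial fraction expansion, xi being the fractional part of
    rho m. The product in its denominator splits at the sign change into two
    shifted factorials, and the reflection formula completes them to Gamma values.
    If rho m is an integer l, only the term j = l remains. *)
Lemma kanter_moment m : (0 < m)%N ->
  \int[mu]_(t in `]0, pi[) (kanter t ^+ m) =
  pi * m`!%:R / (Gamma (1 + rho * m%:R) * Gamma (1 + (1 - rho) * m%:R)).
Proof.
move=> m0; have [_ ->] := kanter_moment_sum m.
have mR : 0 < m%:R :> R by rewrite ltr0n.
have rm0 : 0 <= rho * m%:R by rewrite mulr_ge0// ltW.
pose l := Num.truncn (rho * m%:R).
have /andP[l1 l2] : l%:R <= rho * m%:R < l.+1%:R by exact: truncn_itv.
have lm : (l < m)%N by rewrite -(ltr_nat R) (le_lt_trans l1)// gtr_pMl.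
pose xi := rho * m%:R - l%:R.
have xi0 : 0 <= xi by rewrite subr_ge0.
have xi1 : xi < 1 by rewrite ltrBlDl -natr1 in l2 *.
have rE : rho * m%:R = l%:R + xi by rewrite /xi; ring.
have sE : (1 - rho) * m%:R = (m - l)%:R - xi by rewrite natrB ?(ltnW lm)// /xi; ring.
rewrite rE sE.
have [x0|xn] := eqVneq xi 0.
  rewrite x0 addr0 subr0.
  have lm1 : (l < m.+1)%N by exact: ltnW.
  rewrite (bigD1 (Ordinal lm1))//= big1 => [|j jl]; last first.
    rewrite /sinc; case: eqVneq => [|_].
      by move/eqP; rewrite subr_eq0 eqr_nat => /eqP jl'; case/eqP: jl; exact: val_inj.
    have -> : sin ((j%:R - l%:R) * pi) = 0 :> R.
      by rewrite mulrBl sinB !sin_natpi mul0r mulr0 subr0.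
    by rewrite mul0r mulr0.
  rewrite addr0 /sinc subrr eqxx.
  rewrite !nat1r !Gamma_nat -(bin_fact (ltnW lm)) !natrM.
  have n1 : (l`!%:R : R) != 0 by rewrite pnatr_eq0 -lt0n fact_gt0.
  have n2 : ((m - l)`!%:R : R) != 0 by rewrite pnatr_eq0 -lt0n fact_gt0.
  by field; rewrite n1 n2.
have {}xi0 : 0 < xi by rewrite lt_neqAle eq_sym xn.
have x01 : 0 < xi < 1 by rewrite xi0.
have yi0 : 0 < 1 - xi by rewrite subr_gt0.
have zj j : - (l%:R + xi) + j%:R != 0.
  rewrite addrC subr_eq0; apply/negP => /eqP jE.
  have : l%:R < j%:R :> R by rewrite jE ltrDl.
  have : j%:R < l.+1%:R :> R by rewrite jE -natr1 ltrD2l.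
  by rewrite !ltr_nat ltnS => /leq_ltn_trans h /h; rewrite ltnn.
transitivity (- ((-1) ^+ l * sin (pi * xi)) *
   (\sum_(j < m.+1) 'C(m, j)%:R * ((-1) ^+ j / (- (l%:R + xi) + j%:R)))).
  rewrite mulr_sumr; apply: eq_bigr => j _.
  have E : j%:R - (l%:R + xi) = - (l%:R + xi) + j%:R by ring.
  rewrite E /sinc (negbTE (zj j)).
  have -> : (- (l%:R + xi) + j%:R) * pi = - (pi * xi + l%:R * pi) + j%:R * pi by ring.
  by rewrite sin_addnpi sinN sin_addnpi; ring.
rewrite partial_fractions//.
have -> : \prod_(j < m.+1) (- (l%:R + xi) + j%:R) =
   (-1) ^+ l.+1 * \prod_(j < l.+1) (xi + j%:R) * \prod_(j < m - l) (1 - xi + j%:R).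
  have -> : m.+1 = (l.+1 + (m - l))%N by rewrite addSn subnKC// ltnW.
  rewrite big_split_ord/=; congr (_ * _).
    rewrite (reindex_inj rev_ord_inj)/= -[X in (-1) ^+ X]card_ord -prodrN.
    apply: eq_bigr => j _; rewrite subSS natrB; first by ring.
    by rewrite -ltnS.
  by apply: eq_bigr => j _; rewrite natrD -natr1; ring.
have <- : Gamma xi * \prod_(j < l.+1) (xi + j%:R) = Gamma (1 + (l%:R + xi)).
  by rewrite -Gamma_prod//; congr Gamma; rewrite -natr1; ring.
have <- : Gamma (1 - xi) * \prod_(j < m - l) (1 - xi + j%:R) = Gamma (1 + ((m - l)%:R - xi)).
  by rewrite -Gamma_prod//; congr Gamma; ring.
have n1 : \prod_(j < l.+1) (xi + j%:R) != 0.
  by apply/prodf_neq0 => j _; rewrite gt_eqF// ltr_pwDl.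
have n2 : \prod_(j < m - l) (1 - xi + j%:R) != 0.
  by apply/prodf_neq0 => j _; rewrite gt_eqF// ltr_pwDl.
have g1 := lt0r_neq0 (Gamma_gt0 xi0); have g2 := lt0r_neq0 (Gamma_gt0 yi0).
rewrite -[X in _ = X * _ / _](Gamma_reflection x01) exprS.
have sg : (-1) ^+ l * (-1) ^+ l = 1 :> R by rewrite -expr2 sqrr_sign.
move: (sin _) (Gamma xi) (Gamma (1 - xi)) g1 g2 n1 n2 sg.
move: (\prod_(j < l.+1) _) (\prod_(j < m - l) _) ((-1) ^+ l : R) (m`!%:R : R).
move=> P Q e f s G1 G2 g1 g2 n1 n2 ee.
have en : e != 0 by apply/eqP => e0; move: ee; rewrite e0 mul0r => /eqP; rewrite eq_sym oner_eq0.
by field; rewrite n1 n2 g1 g2 en.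
Qed.

End kanter.

(** * Exponential generating functions *)

Section egf.
Context {R : realType}.

Definition egf_partial (u : nat -> R) N (s : R) : R := \sum_(0 <= n < N) (u n / n`!%:R * s ^+ n).

Definition geom_bd (K M : R) (u : nat -> R) : Prop := forall n, `|u n| <= K * M ^+ n.

Definition egf (u : nat -> R) (s : R) : R := tsum (fun n => u n / n`!%:R * s ^+ n).

Lemma egf_dom K M u s n : 0 <= K -> 0 <= M -> geom_bd K M u ->
  `|u n / n`!%:R * s ^+ n| <= K * exp_coeff (M * `|s|) n.
Proof.
move=> K0 M0 uM; rewrite !normrM normfV (ger0_norm (x := n`!%:R))// normrX /exp_coeff/=.
rewrite exprMn mulrAC [leRHS]mulrA ler_pM2r ?invr_gt0 ?ltr0n ?fact_gt0//.
by rewrite mulrA ler_wpM2r// exprn_ge0.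
Qed.

Lemma exp_partial (x : R) N : 0 <= x -> \sum_(0 <= n < N) exp_coeff x n <= expR x.
Proof.
move=> x0; apply: (nondecreasing_cvgn_le _ (is_cvg_series_exp_coeff x)).
by apply/nondecreasing_seqP => n; rewrite seriesSr lerDl exp_coeff_ge0.
Qed.

Lemma egf_partial_bound K M u s N : 0 <= K -> 0 <= M -> geom_bd K M u -> 0 <= s ->
  `|egf_partial u N s| <= K * expR (M * s).
Proof.
move=> K0 M0 uM s0; rewrite (le_trans (ler_norm_sum _ _ _))//.
apply: (@le_trans _ _ (\sum_(0 <= n < N) K * exp_coeff (M * `|s|) n)).
  by apply: ler_sum => n _; exact: egf_dom.
rewrite -mulr_sumr ler_wpM2l// ger0_norm// exp_partial// mulr_ge0//.
Qed.

Lemma egf_cvg K M u s : 0 <= K -> 0 <= M -> geom_bd K M u ->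
  egf_partial u N s @[N --> \oo] --> egf u s.
Proof.
move=> K0 M0 uM; suff : cvg (series (fun n => u n / n`!%:R * s ^+ n) @ \oo) by [].
apply: normed_cvg.
apply: (@series_le_cvg _ _ (fun n => K * exp_coeff (M * `|s|) n)) => [n|n|n|].
- exact: normr_ge0.
- by rewrite mulr_ge0// exp_coeff_ge0// mulr_ge0.
- exact: egf_dom.
apply/cvg_ex; exists (K * expR (M * `|s|)).
rewrite (_ : series _ = fun N => K * series (exp_coeff (M * `|s|)) N).
  by apply: cvgM; [exact: cvg_cst|exact: is_cvg_series_exp_coeff].
by apply/funext => N; rewrite /series/= mulr_sumr.
Qed.

Lemma geom_bd_shift K M u : 0 <= M -> geom_bd K M u -> geom_bd (K * M) M (fun n => u n.+1).
Proof. by move=> M0 uM n; rewrite -mulrA -exprS. Qed.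

(** Termwise differentiation is justified by the exponential bound on the terms. *)
Lemma hd_egf K M u s : 0 <= K -> 0 <= M -> geom_bd K M u ->
  has_derive (egf u) s (egf (fun n => u n.+1) s).
Proof.
move=> K0 M0 uM.
have D (v : nat -> R) : pseries_diffs (fun n => v n / n`!%:R) = fun n => v n.+1 / n`!%:R.
  apply/funext => n; rewrite /pseries_diffs factS natrM.
  have n1 : (n`!%:R : R) != 0 by rewrite pnatr_eq0 -lt0n fact_gt0.
  have n2 : (n.+1%:R : R) != 0 by rewrite pnatr_eq0.
  move: (n.+1%:R : R) (n`!%:R : R) n1 n2 => a b bn an.
  by field; rewrite ?an ?bn.
have KM := mulr_ge0 K0 M0.
have c0 (x : R) := @egf_cvg K M u x K0 M0 uM.
have c1 (x : R) := @egf_cvg _ _ _ x KM M0 (geom_bd_shift M0 uM).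
have c2 (x : R) := @egf_cvg _ _ _ x (mulr_ge0 KM M0) M0 (geom_bd_shift M0 (geom_bd_shift M0 uM)).
have := @pseries_snd_diffs R (fun n => u n / n`!%:R) (`|s| + 1) s.
rewrite !D; apply.
- by apply/cvg_ex; eexists; exact: c0.
- by apply/cvg_ex; eexists; exact: c1.
- by apply/cvg_ex; eexists; exact: c2.
- by rewrite [ltRHS]ger0_norm ?addr_ge0// ltrDl.
Qed.

Lemma egf0 (u : nat -> R) : egf u 0 = u 0%N.
Proof.
apply: tsum_eq; apply/cvgrPdist_lt => e e0; exists 1%N => // -[//|n] _ /=.
rewrite /series/= big_nat_recl// expr0 mulr1 fact0 divr1 big1 ?addr0 ?subrr ?normr0//.
by move=> i _; rewrite exprS mul0r mulr0.
Qed.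

Lemma egf_lin K1 K2 M' (c : R) a b s : 0 <= K1 -> 0 <= K2 -> 0 <= M' ->
  geom_bd K1 M' a -> geom_bd K2 M' b ->
  egf (fun n => a n + c * b n) s = egf a s + c * egf b s.
Proof.
move=> K10 K20 M'0 ab bb.
rewrite /egf -tsum_lin.
- by apply: eq_tsum => n; ring.
- by apply/cvg_ex; eexists; exact: (egf_cvg K10 M'0 ab).
- by apply/cvg_ex; eexists; exact: (egf_cvg K20 M'0 bb).
Qed.

End egf.

(** * Subordination *)

Section kernels.
Context {R : realType}.
Notation mu := (@lebesgue_measure R).
Variable rho : R.
Hypothesis rho01 : 0 < rho < 1.

Let rho0 : 0 < rho. Proof. by case/andP: rho01. Qed.
Let rho1 : rho < 1. Proof. by case/andP: rho01. Qed.
Let sig0 : 0 < 1 - rho. Proof. by rewrite subr_gt0. Qed.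

(** The kernel g_b of fractional integration of order b. *)
Definition gk (b t : R) : R := t `^ (b - 1) / Gamma b.

Notation A := (kanter rho).
Notation P0y := (`]0, +oo[%classic : set R).
Notation I := (`]0, pi[%classic : set R).

Lemma in_0y (x : R) : P0y x = (0 < x).
Proof. by rewrite /= in_itv/= andbT. Qed.

(** The mean of a profile against e^(-w) w^(1-rho): a power s^n becomes x^n times a
    Gamma value. *)
Definition gamma_mean (W : R -> R) (x : R) : R :=
  \int[mu]_(w in P0y) (gammaf (2 - rho) w * W (x * w `^ (1 - rho))).

(** Its moments in w and in the angle th cancel two of the three Gamma values of
    Kanter's moments, which leaves s^n / n! -> g_(rho (n+1)). *)
Definition subord (W : R -> R) (t : R) : R :=
  t `^ (rho - 1) * (rho / pi * \int[mu]_(th in I) (A th * gamma_mean W (t `^ rho * A th))).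

Definition gamma_mean_coef n : R := Gamma (1 + (1 - rho) * n.+1%:R) / n`!%:R.

Lemma gamma_mean_arg_gt0 n : 0 < 1 + (1 - rho) * n.+1%:R.
Proof. by rewrite addr_gt0// mulr_gt0. Qed.

Lemma gamma_mean_int_mono n (x w : R) : 0 < w ->
  gammaf (2 - rho) w * (x * w `^ (1 - rho)) ^+ n =
  x ^+ n * gammaf (1 + (1 - rho) * n.+1%:R) w.
Proof.
move=> w0; rewrite exprMn mulrCA; congr (_ * _).
rewrite /gammaf -powR_mulrn ?powR_ge0// -powRrM mulrAC -powRD; last by rewrite (gt_eqF w0) implybT.
by congr (_ `^ _ * _); rewrite -natr1; ring.
Qed.

Lemma gamma_mean_int_egf_partial u N (x w : R) : 0 < w ->
  gammaf (2 - rho) w * egf_partial u N (x * w `^ (1 - rho)) =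
  \sum_(0 <= n < N) (u n / n`!%:R * x ^+ n * gammaf (1 + (1 - rho) * n.+1%:R) w).
Proof.
move=> w0; rewrite /egf_partial mulr_sumr; apply: eq_bigr => n _.
by rewrite mulrCA gamma_mean_int_mono// mulrA.
Qed.

Lemma gamma_mean_egf_partial u N x :
  mu.-integrable P0y (EFin \o (fun w => gammaf (2 - rho) w * egf_partial u N (x * w `^ (1 - rho)))) /\
  gamma_mean (egf_partial u N) x = \sum_(0 <= n < N) (u n * gamma_mean_coef n * x ^+ n).
Proof.
have iF n : mu.-integrable P0y (EFin \o (fun w => u n / n`!%:R * x ^+ n * gammaf (1 + (1 - rho) * n.+1%:R) w)).
  by apply: integZ => //; apply: gammaf_integrable; exact: gamma_mean_arg_gt0.
have [i e] := integ_sum_n 0 N (measurable_itv _) iF.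
split.
  by apply: (eq_integ (measurable_itv _) _ i) => w; rewrite in_0y => w0; rewrite gamma_mean_int_egf_partial.
rewrite /gamma_mean (@eq_Rint R _ _ (fun w => \sum_(0 <= n < N) (u n / n`!%:R * x ^+ n * gammaf (1 + (1 - rho) * n.+1%:R) w))).
  rewrite e; apply: eq_bigr => n _; rewrite RintZ//; last exact: gammaf_integrable (gamma_mean_arg_gt0 n).
  by rewrite -GammaE /gamma_mean_coef; ring.
by move=> w; rewrite in_0y => w0; rewrite gamma_mean_int_egf_partial.
Qed.

Lemma measurable_kanterX n : measurable_fun I (fun th => A th ^+ n).
Proof.
apply: measurable_cont => th ti; apply: (@cont_comp R (fun x => x ^+ n)).
  exact: continuous_kanter.
exact: exprn_continuous.
Qed.

Lemma gk_gamma_mean_coef n (t : R) : 0 < t ->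
  gk (rho * n.+1%:R) t = t `^ (rho - 1) * (t `^ rho) ^+ n / Gamma (rho * n.+1%:R).
Proof.
move=> t0; rewrite /gk -powR_mulrn ?powR_ge0// -powRrM -powRD; last by rewrite (gt_eqF t0) implybT.
by congr (_ `^ _ / _); rewrite -natr1; ring.
Qed.

Lemma subord_egf_partial u N (t : R) : 0 < t ->
  subord (egf_partial u N) t = \sum_(0 <= n < N) (u n * gk (rho * n.+1%:R) t).
Proof.
move=> t0; rewrite /subord.
pose c n := u n * gamma_mean_coef n * (t `^ rho) ^+ n.
rewrite (@eq_Rint R _ _ (fun th => \sum_(0 <= n < N) (c n * A th ^+ n.+1))); last first.
  move=> th _; rewrite (gamma_mean_egf_partial _ _ _).2 mulr_sumr; apply: eq_bigr => n _.
  by rewrite exprMn /c exprS; ring.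
have iA n : mu.-integrable I (EFin \o (fun th => c n * A th ^+ n.+1)).
  by apply: integZ => //; exact: (kanter_moment_sum rho01 n.+1).1.
rewrite (integ_sum_n 0 N (measurable_itv _) iA).2 !mulr_sumr; apply: eq_bigr => n _.
rewrite RintZ//; last exact: (kanter_moment_sum rho01 n.+1).1.
rewrite kanter_moment// gk_gamma_mean_coef// /c /gamma_mean_coef.
have y0 : 0 < rho * n.+1%:R by rewrite mulr_gt0.
rewrite (addrC 1 (rho * _)) GammaS// factS natrM.
have g1 := lt0r_neq0 (Gamma_gt0 y0); have g2 := lt0r_neq0 (Gamma_gt0 (gamma_mean_arg_gt0 n)).
have n1 : (n`!%:R : R) != 0 by rewrite pnatr_eq0 -lt0n fact_gt0.
have n2 : (n.+1%:R : R) != 0 by rewrite pnatr_eq0.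
have pn : (pi : R) != 0 by rewrite gt_eqF// pi_gt0.
have rn := lt0r_neq0 rho0.
move: (Gamma _) g1 (Gamma _) g2 => g1 gn1 g2 gn2.
move: (n.+1%:R : R) (n`!%:R : R) n1 n2 (pi : R) pn => a b bn an p pn.
by field; rewrite bn an pn gn1 gn2 rn.
Qed.

(** The mean of an exponential, which dominates those of all exponentially bounded
    profiles. *)
Definition exp_mean (y : R) : R := \int[mu]_(w in P0y) (gammaf (2 - rho) w * expR (y * w `^ (1 - rho))).

(** A power of exponent less than one lies below a line of slope 1/2, up to a
    constant: the exponential in [exp_mean] is absorbed by half of e^(-w). *)
Lemma powR_young (y w : R) : 0 <= y -> 0 <= w ->
  y * w `^ (1 - rho) <= w / 2 + y * (2 * y) `^ ((1 - rho) / rho).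
Proof.
move=> y0 w0; set X := (2 * y) `^ (rho^-1).
have [wX|Xw] := leP w X.
  have : y * w `^ (1 - rho) <= y * (2 * y) `^ ((1 - rho) / rho).
    rewrite ler_wpM2l// (mulrC _ rho^-1) powRrM; apply: ge0_ler_powR; rewrite ?nnegrE ?powR_ge0//.
    exact: ltW.
  have : 0 <= w / 2 by rewrite divr_ge0.
  by lra.
have w1 : 0 < w by rewrite (le_lt_trans _ Xw)// powR_ge0.
have : y * w `^ (1 - rho) <= w / 2.
  rewrite ler_pdivlMr// (_ : y * _ * 2 = w `^ (1 - rho) * (2 * y)); last by ring.
  have h : 2 * y <= w `^ rho.
    have -> : 2 * y = X `^ rho by rewrite /X -powRrM mulVf ?gt_eqF// powRr1// mulr_ge0.
    by apply: ge0_ler_powR; rewrite ?nnegrE ?powR_ge0// ltW.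
  have e : w = w `^ (1 - rho) * w `^ rho.
    by rewrite -powRD ?subrK ?powRr1// (gt_eqF w1) implybT.
  by rewrite [leRHS]e ler_wpM2l ?powR_ge0.
have : 0 <= y * (2 * y) `^ ((1 - rho) / rho) by rewrite mulr_ge0 ?powR_ge0.
by lra.
Qed.

Lemma exp_mean_integrable y : 0 <= y ->
  mu.-integrable P0y (EFin \o (fun w => gammaf (2 - rho) w * expR (y * w `^ (1 - rho)))).
Proof.
move=> y0; have z0 : 0 < 2 - rho by rewrite subr_gt0 (lt_trans rho1)// ltr1n.
have h2 : (2^-1 : R) != 0 by rewrite invr_eq0.
have := integrable_affine 0 h2 (measurable_itv _) (gammaf_integrable z0).
have -> : (fun w : R => 2^-1 * w + 0) @^-1` P0y = P0y.
  apply/funext => w; rewrite /preimage/= !in_itv/= !andbT addr0 pmulr_rgt0//.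
move=> ig; pose C := y * (2 * y) `^ ((1 - rho) / rho).
apply: (@integ_dom R _ _ (fun w => expR C * 2 `^ (1 - rho) * gammaf (2 - rho) (2^-1 * w + 0))) => //.
- apply: measurable_funM; first exact: measurable_gammaf.
  apply: measurableT_comp => //; apply: measurable_funM => //.
  by apply: measurable_funTS; exact: measurable_powR.
- move=> w; rewrite in_0y => w0; rewrite ger0_norm; last by rewrite mulr_ge0 ?gammaf_ge0// expR_ge0.
  rewrite addr0 /gammaf.
  have -> : 2 - rho - 1 = 1 - rho by ring.
  have -> : (2^-1 * w) `^ (1 - rho) = (2 `^ (1 - rho))^-1 * w `^ (1 - rho).
    by rewrite powRM ?invr_ge0// ?(ltW w0)// -powR_inv1// -powRrM mulN1r powRN.
  have -> : expR C * 2 `^ (1 - rho) * ((2 `^ (1 - rho))^-1 * w `^ (1 - rho) * expR (- (2^-1 * w))) =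
     w `^ (1 - rho) * expR (- (2^-1 * w) + C).
    rewrite expRD; have := lt0r_neq0 (@powR_gt0 R 2 (1 - rho) ltac:(by [])).
    by move: (2 `^ _) => a an; field.
  rewrite -mulrA ler_wpM2l ?powR_ge0// -expRD ler_expR.
  by have := powR_young y0 (ltW w0); rewrite -/C; lra.
- by apply: integZ.
Qed.

Lemma exp_mean_mono x y : 0 <= x -> x <= y -> exp_mean x <= exp_mean y.
Proof.
move=> x0 xy; apply: le_Rint => //; [exact: exp_mean_integrable|by apply: exp_mean_integrable; exact: le_trans xy|].
move=> w _; rewrite ler_wpM2l ?gammaf_ge0// ler_expR ler_wpM2r ?powR_ge0//.
Qed.

Lemma gamma_mean_cvg K M u x : 0 <= K -> 0 <= M -> geom_bd K M u -> 0 <= x ->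
  [/\ mu.-integrable P0y (EFin \o (fun w => gammaf (2 - rho) w * egf u (x * w `^ (1 - rho)))),
      gamma_mean (egf_partial u N) x @[N --> \oo] --> gamma_mean (egf u) x &
      forall N, `|gamma_mean (egf_partial u N) x| <= K * exp_mean (M * x)].
Proof.
move=> K0 M0 uM x0.
pose g w := K * (gammaf (2 - rho) w * expR (M * x * w `^ (1 - rho))).
have ig : mu.-integrable P0y (EFin \o g).
  by apply: integZ => //; apply: exp_mean_integrable; rewrite mulr_ge0.
have dom N w : P0y w -> `|gammaf (2 - rho) w * egf_partial u N (x * w `^ (1 - rho))| <= g w.
  move=> _; rewrite normrM ger0_norm ?gammaf_ge0// /g mulrCA ler_wpM2l ?gammaf_ge0// -mulrA.
  by apply: egf_partial_bound => //; rewrite mulr_ge0 ?powR_ge0.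
have mN N : measurable_fun P0y (fun w => gammaf (2 - rho) w * egf_partial u N (x * w `^ (1 - rho))).
  by have [/integrableP[/measurable_EFinP]] := gamma_mean_egf_partial u N x.
have cw w : P0y w -> gammaf (2 - rho) w * egf_partial u N (x * w `^ (1 - rho)) @[N --> \oo] -->
    gammaf (2 - rho) w * egf u (x * w `^ (1 - rho)).
  by move=> _; apply: cvgM; [exact: cvg_cst|exact: (@egf_cvg R K M)].
have [i c] := @Rdominated_cvg R _ _ mu P0y (fun N w => gammaf (2 - rho) w * egf_partial u N (x * w `^ (1 - rho)))
  (fun w => gammaf (2 - rho) w * egf u (x * w `^ (1 - rho))) g (measurable_itv _) mN cw ig dom.
split => // N; rewrite /exp_mean -RintZ//; last by apply: exp_mean_integrable; rewrite mulr_ge0.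
by apply: (le_norm_Rint (measurable_itv _) (mN N) ig) => w; exact: dom.
Qed.

(** The coefficients of a series of Mittag-Leffler type, to which an exponential
    generating function is transformed. *)
Definition rgamma n : R := (Gamma (rho * n.+1%:R))^-1.

Lemma rgamma_ge0 n : 0 <= rgamma n.
Proof. by rewrite invr_ge0 ltW// Gamma_gt0// mulr_gt0. Qed.

Lemma subord_cvg K M u t : 0 <= K -> 0 <= M -> geom_bd K M u -> 0 < t ->
  exists B, [/\ mu.-integrable I (EFin \o (fun th => A th * gamma_mean (egf u) (t `^ rho * A th))),
   subord (egf_partial u N) t @[N --> \oo] --> subord (egf u) t &
   forall N, `|subord (egf_partial u N) t| <= B].
Proof.
move=> K0 M0 uM t0; have p0 := pi_gt0 R.
have [A0 A00 Ale] := kanter_le rho01.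
have A_ge0 th : I th -> 0 <= A th by rewrite in_Ioo => ti; rewrite ltW// kanter_gt0.
pose B := A0 * (K * exp_mean (M * (t `^ rho * A0))).
have iB : mu.-integrable I (EFin \o (fun=> B)).
  by apply: (@integ_bounded R _ _ `|B|).
have dom N th : I th -> `|A th * gamma_mean (egf_partial u N) (t `^ rho * A th)| <= B.
  move=> ti; have a0 := A_ge0 th ti; have xa : 0 <= t `^ rho * A th by rewrite mulr_ge0 ?powR_ge0.
  rewrite normrM (ger0_norm a0) ler_pM//; first by apply: Ale; rewrite -in_Ioo.
  have [_ _ /(_ N) h] := gamma_mean_cvg K0 M0 uM xa.
  apply: (le_trans h); rewrite ler_wpM2l//; apply: exp_mean_mono; first by rewrite mulr_ge0.
  rewrite ler_wpM2l// ler_wpM2l ?powR_ge0//.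
  by apply: Ale; rewrite -in_Ioo.
have mN N : measurable_fun I (fun th => A th * gamma_mean (egf_partial u N) (t `^ rho * A th)).
  apply: (eq_measurable_fun (fun th => \sum_(0 <= n < N) (u n * gamma_mean_coef n * (t `^ rho) ^+ n * A th ^+ n.+1))).
    have E (a b c : R) n : c * b ^+ n * a ^+ n.+1 = a * (c * (b * a) ^+ n).
      by rewrite exprMn exprS; ring.
    move=> th _; rewrite (gamma_mean_egf_partial _ _ _).2 mulr_sumr; apply: eq_bigr => n _.
    exact: E.
  apply: measurable_sum => n; apply: measurable_funM => //.
  exact: measurable_kanterX.
have cN th : I th -> A th * gamma_mean (egf_partial u N) (t `^ rho * A th) @[N --> \oo] -->
    A th * gamma_mean (egf u) (t `^ rho * A th).
  move=> ti; have xa : 0 <= t `^ rho * A th by rewrite mulr_ge0 ?powR_ge0// A_ge0.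
  by have [_ c _] := gamma_mean_cvg K0 M0 uM xa; apply: cvgM; [exact: cvg_cst|exact: c].
have [i c] := @Rdominated_cvg R _ _ mu I (fun N th => A th * gamma_mean (egf_partial u N) (t `^ rho * A th))
  (fun th => A th * gamma_mean (egf u) (t `^ rho * A th)) (fun=> B) (measurable_itv _) mN cN iB dom.
exists (t `^ (rho - 1) * (rho / pi * (B * (pi - 0)))); split => //.
  by apply: cvgM; [exact: cvg_cst|apply: cvgM; [exact: cvg_cst|exact: c]].
move=> N; rewrite /subord normrM ger0_norm ?powR_ge0// ler_wpM2l ?powR_ge0//.
rewrite normrM ger0_norm ?divr_ge0 ?(ltW rho0) ?(ltW p0)// ler_wpM2l ?divr_ge0 ?(ltW rho0) ?(ltW p0)//.
apply: Rint_norm_le; [exact: ltW|exact: mN|].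
by move=> th; rewrite -in_Ioo; exact: dom.
Qed.

(** Bounds on the subordinated partial sums already contain the convergence of the
    series, so that no asymptotics of Gamma is needed. *)
Lemma rgamma_sum_bd z : 0 <= z -> exists2 B, 0 <= B & forall N, \sum_(0 <= n < N) (rgamma n * z ^+ n) <= B.
Proof.
move=> z0; have zz : geom_bd 1 z (fun n => z ^+ n).
  by move=> n; rewrite mul1r ger0_norm// exprn_ge0.
have [B [_ _ hB]] := subord_cvg ler01 z0 zz ltr01.
exists B; first exact: le_trans (hB 0%N).
move=> N; rewrite (le_trans _ (hB N))// subord_egf_partial// (le_trans _ (ler_norm _))//.
by rewrite le_eqVlt; apply/orP; left; apply/eqP/eq_bigr => n _; rewrite /gk powR1 mul1r mulrC.
Qed.

Definition ml_series (u : nat -> R) (z : R) : R := tsum (fun n => u n * rgamma n * z ^+ n).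

Lemma ml_series_tails K M u Z : 0 <= K -> 0 <= M -> geom_bd K M u -> 0 <= Z ->
  exists tau, tau @ \oo --> 0 /\
    forall z, `|z| <= Z -> tails (fun n => u n * rgamma n * z ^+ n) tau.
Proof.
move=> K0 M0 uM Z0; have h0 : 0 <= 2 * (M * Z) by rewrite mulr_ge0// mulr_ge0.
have [B B0 hB] := rgamma_sum_bd h0.
have term n : rgamma n * (2 * (M * Z)) ^+ n <= B.
  apply: le_trans (hB n.+1); rewrite big_nat_recr//= lerDr sumr_ge0// => k _.
  by rewrite mulr_ge0 ?rgamma_ge0// exprn_ge0.
exists (fun N => K * B * 2 * 2^-1 ^+ N); split.
  rewrite -[X in _ --> X](mulr0 (K * B * 2)); apply: cvgM; first exact: cvg_cst.
  by apply: cvg_expr; rewrite ger0_norm ?invr_ge0// invf_lt1// ltr1n.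
move=> z zZ N n; have [Nn|/ltnW nN] := leqP N n; last first.
  by rewrite big_geq// !mulr_ge0// exprn_ge0// invr_ge0.
apply: (@le_trans _ _ (\sum_(N <= k < n) (K * B * 2 * (2^-1 ^+ k - 2^-1 ^+ k.+1)))).
  apply: ler_sum => k _; rewrite !normrM normrX (ger0_norm (rgamma_ge0 k)).
  have -> : 2^-1 ^+ k - 2^-1 ^+ k.+1 = 2^-1 * 2^-1 ^+ k :> R by rewrite exprS; field.
  apply: (@le_trans _ _ (K * M ^+ k * rgamma k * Z ^+ k)).
    apply: ler_pM; rewrite ?mulr_ge0 ?rgamma_ge0 ?exprn_ge0//.
      by rewrite ler_wpM2r ?rgamma_ge0.
    by rewrite lerXn2r ?nnegrE.
  have -> : K * M ^+ k * rgamma k * Z ^+ k = K * (rgamma k * (2 * (M * Z)) ^+ k) * 2^-1 ^+ k.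
    rewrite !exprMn exprVn; have : (2 ^+ k : R) != 0 by rewrite expf_neq0.
    by move: (2 ^+ k : R) => e en; field.
  rewrite [leRHS]mulrA ler_wpM2r ?exprn_ge0 ?invr_ge0//.
  by rewrite mulfK// ler_wpM2l.
rewrite -mulr_sumr ler_wpM2l ?mulr_ge0//.
under eq_bigr do rewrite -opprB.
by rewrite sumrN telescope_sumr// opprB gerBl exprn_ge0// invr_ge0.
Qed.

Lemma continuous_ml_series K M u : 0 <= K -> 0 <= M -> geom_bd K M u -> continuous (ml_series u).
Proof.
move=> K0 M0 uM z; have Z0 : 0 <= `|z| + 1 by rewrite addr_ge0.
have [tau [t0 ht]] := ml_series_tails K0 M0 uM Z0.
apply: (tannery t0).
- near=> y; apply: ht.
  have : `|z - y| < 1 by near: y; exact: cvgr_dist_lt.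
  have := ler_normB z (z - y); rewrite opprB addrC subrK => h1 h2.
  by rewrite (le_trans h1)// lerD2l ltW.
- by apply: ht; rewrite lerDl.
- move=> k; apply: cvgM; first exact: cvg_cst.
  exact: exprn_continuous.
Unshelve. all: by end_near. Qed.

Lemma subord_ml_series K M u t : 0 <= K -> 0 <= M -> geom_bd K M u -> 0 < t ->
  subord (egf u) t = t `^ (rho - 1) * ml_series u (t `^ rho).
Proof.
move=> K0 M0 uM t0; have [B [_ c _]] := subord_cvg K0 M0 uM t0.
have [tau [ta0 ht]] := ml_series_tails K0 M0 uM (powR_ge0 t rho).
have ct : `|t `^ rho| <= t `^ rho by rewrite ger0_norm ?powR_ge0.
have c2 : t `^ (rho - 1) * series (fun n => u n * rgamma n * (t `^ rho) ^+ n) N @[N --> \oo] -->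
    t `^ (rho - 1) * ml_series u (t `^ rho).
  by apply: cvgM; [exact: cvg_cst|exact: (tails_cvg (ht _ ct) ta0)].
apply: (cvg_unique (@Rhausdorff R) c); apply: cvg_trans c2; apply: near_eq_cvg.
near=> N; rewrite subord_egf_partial// /series/= mulr_sumr; apply: eq_bigr => n _.
by rewrite gk_gamma_mean_coef// /rgamma; ring.
Unshelve. all: by end_near. Qed.

Lemma gamma_mean_bound K M u B x : 0 <= K -> 0 <= M -> geom_bd K M u -> 0 <= x ->
  (forall s, 0 <= s -> `|egf u s| <= B) -> `|gamma_mean (egf u) x| <= B * Gamma (2 - rho).
Proof.
move=> K0 M0 uM x0 uB; have [i _ _] := gamma_mean_cvg K0 M0 uM x0.
have z0 : 0 < 2 - rho by rewrite subr_gt0 (lt_trans rho1)// ltr1n.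
have ig := gammaf_integrable z0.
rewrite GammaE -RintZ//; apply: (le_norm_Rint (measurable_itv _) _ (integZ B (measurable_itv _) ig)).
  by move: i => /integrableP[/measurable_EFinP].
move=> w _; rewrite normrM (ger0_norm (gammaf_ge0 _ _)) mulrC ler_wpM2r ?gammaf_ge0//.
by apply: uB; rewrite mulr_ge0 ?powR_ge0.
Qed.

Lemma gammaf1E (w : R) : 0 < w -> gammaf 1 w = expR (- w).
Proof. by move=> w0; rewrite /gammaf subrr powRr0 mul1r. Qed.

Lemma gammaf2E (w : R) : 0 < w -> gammaf 2 w = w * expR (- w).
Proof.
move=> w0; rewrite /gammaf (_ : 2 - 1 = 1) ?powRr1 ?(ltW w0)//.
by ring.
Qed.

Lemma cvg_wexpN : w * expR (- w) @[w --> +oo] --> (0 : R).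
Proof.
apply: (@squeeze_cvgr _ _ _ _ (fun=> 0) (fun w : R => 4 * (1 + w)^-1)).
- near=> w; have w0 : 0 <= w by near: w; exact: nbhs_pinfty_ge.
  rewrite mulr_ge0 ?expR_ge0//=.
  have := @expRN_bound R 2 w ltac:(by rewrite ler1n) w0.
  have w1 : 0 < 1 + w by rewrite ltr_wpDr.
  rewrite powRN !powR_mulrn ?(ltW w1)// => /(ler_wpM2l w0) h; apply: (le_trans h).
  have -> : 2 ^+ 2 = 4 :> R by ring.
  rewrite mulrCA ler_wpM2l// expr2 invfM mulrA ler_piMl ?invr_ge0 ?(ltW w1)//.
  by rewrite ler_pdivrMr// mul1r lerDr.
- exact: cvg_cst.
- by rewrite -[X in _ --> X](mulr0 4); apply: cvgM; [exact: cvg_cst|exact: cvg_inv1D].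
Unshelve. all: by end_near. Qed.

(** The function w e^(-w) v(x w^(1-rho)) vanishes at both ends, and the derivative of
    its last factor is the integrand times (1 - rho) x. The gain of 1 / x is what
    turns the bound on the primitive v into decay of the kernels. *)
Lemma gamma_mean_ibp K M u v B x : 0 <= K -> 0 <= M -> geom_bd K M u -> 0 < x ->
  (forall s, has_derive v s (egf u s)) ->
  (forall s, 0 <= s -> `|v s| <= B) -> `|gamma_mean (egf u) x| <= 2 * B / ((1 - rho) * x).
Proof.
move=> K0 M0 uM x0 dv vB; have [i _ _] := gamma_mean_cvg K0 M0 uM (ltW x0).
have B0 : 0 <= B by apply: le_trans (vB 0 (lexx _)).
pose g w := x * w `^ (1 - rho).
have g0 w : 0 <= g w by rewrite mulr_ge0 ?powR_ge0// ltW.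
pose q (w : R) := (1 - w) * expR (- w).
pose F w := w * expR (- w) * v (g w).
pose f w := q w * v (g w) + x * (1 - rho) * (gammaf (2 - rho) w * egf u (g w)).
have cv : continuous v by move=> s; apply: hd_continuous; exact: dv.
have cu : continuous (egf u) by move=> s; apply: hd_continuous; apply: (@hd_egf R K M).
have cg w : 0 < w -> {for w, continuous g}.
  by move=> w0; apply: cvgM; [exact: cvg_cst|exact: continuous_powR].
have cexp : continuous (fun w : R => expR (- w)).
  by move=> w; apply: (@cont_comp R expR); [apply: cvgN; exact: cvg_id|exact: continuous_expR].
have cq : continuous q.
  move=> w; apply: cvgM; last exact: cexp.
  by apply: cvgB; [exact: cvg_cst|exact: cvg_id].
have dF w : 0 < w -> has_derive F w (f w).
  move=> w0; apply: hd_eq.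
    apply: hdM.
      apply: hdM; first exact: hd_id.
      by apply: (@hd_comp _ expR); [exact: hd_expR|apply: hdN; exact: hd_id].
    apply: (@hd_comp _ v); first exact: dv.
    by apply: hdZ; exact: hd_powR.
  rewrite /f /q /gammaf.
  have -> : w `^ (2 - rho - 1) = w * w `^ (1 - rho - 1).
    rewrite -{2}(powRr1 (ltW w0)) -powRD; last by rewrite (gt_eqF w0) implybT.
    by congr (_ `^ _); ring.
  by ring.
have qB w : 0 < w -> `|q w * v (g w)| <= B * (gammaf 1 w + gammaf 2 w).
  move=> w0; rewrite normrM mulrC; apply: ler_pM => //; first exact: vB.
  rewrite gammaf1E// gammaf2E// /q normrM (ger0_norm (expR_ge0 _)) -[X in _ <= X + _]mul1r -mulrDl.
  by rewrite ler_wpM2r ?expR_ge0// (le_trans (ler_normB _ _))// normr1 gtr0_norm.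
have i12 : mu.-integrable P0y (EFin \o (fun w => B * (gammaf 1 w + gammaf 2 w))).
  by apply: integZ => //; apply: integD => //; exact: gammaf_integrable.
have iq : mu.-integrable P0y (EFin \o (fun w => q w * v (g w))).
  apply: (integ_dom (measurable_itv _) _ _ i12); last by move=> w; rewrite in_0y; exact: qB.
  apply: open_continuous_measurable_fun; first exact: interval_open.
  move=> w /set_mem; rewrite in_0y => w0; apply: cvgM; first exact: cq.
  by apply: (@cont_comp R v); [exact: cg|exact: cv].
have i' : mu.-integrable P0y (EFin \o (fun w => x * (1 - rho) * (gammaf (2 - rho) w * egf u (g w)))).
  exact: integZ.
have FB (G : set_system R) (FG : Filter G) : (\forall w \near G, 0 < w) ->
    w * expR (- w) @[w --> G] --> 0 -> F w @[w --> G] --> 0.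
  move=> G0 cG; apply/norm_cvg0P.
  apply: (@squeeze_cvgr _ _ _ _ (fun=> 0) (fun w : R => (w * expR (- w)) * B)).
  - near=> w; have w0 : 0 < w by near: w.
    rewrite normr_ge0/= /F normrM ger0_norm ?mulr_ge0 ?expR_ge0 ?(ltW w0)//.
    by rewrite ler_wpM2l ?mulr_ge0 ?expR_ge0 ?(ltW w0)//; exact: vB.
  - exact: cvg_cst.
  - by rewrite -[X in _ --> X](mul0r B); apply: cvgM => //; exact: cvg_cst.
have [|||||_ FE] := @FTC2_0y R f F 0 0.
- move=> w w0; apply: cvgD.
    by apply: cvgM; [exact: cq|apply: (@cont_comp R v); [exact: cg|exact: cv]].
  apply: cvgM; first exact: cvg_cst.
  apply: cvgM; first exact: continuous_gammaf.
  by apply: (@cont_comp R (egf u)); [exact: cg|exact: cu].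
- exact: dF.
- apply: FB; first by near=> w; near: w; exact: nbhs_right_gt.
  apply: cvg_at_right_filter.
  have c0 : w * expR (- w) @[w --> (0 : R)] --> 0 * expR (- (0 : R)).
    by apply: cvgM; [exact: cvg_id|exact: cexp].
  by rewrite mul0r in c0; exact: c0.
- apply: FB; first by near=> w; near: w; exact: nbhs_pinfty_gt.
  exact: cvg_wexpN.
- by left; exact: integD.
move: FE; rewrite subrr RintD// (RintZ _ (measurable_itv _) i) -/(gamma_mean _ _).
have h : `|\int[mu]_(w in P0y) (q w * v (g w))| <= 2 * B.
  have -> : 2 * B = \int[mu]_(w in P0y) (B * (gammaf 1 w + gammaf 2 w)).
    rewrite RintZ//; last by apply: integD => //; exact: gammaf_integrable.
    rewrite RintD//; [|exact: gammaf_integrable|exact: gammaf_integrable].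
    rewrite -!GammaE Gamma1.
    have -> : Gamma 2 = 1 :> R by rewrite (@Gamma_nat R 1%N).
    by ring.
  apply: (le_norm_Rint (measurable_itv _) _ i12); last by move=> w; rewrite in_0y; exact: qB.
  by move: iq => /integrableP[/measurable_EFinP].
move=> /eqP; rewrite addr_eq0 => /eqP E; move: h; rewrite E normrN.
have xr : 0 < x * (1 - rho) by rewrite mulr_gt0.
rewrite normrM (gtr0_norm xr) => h.
by rewrite ler_pdivlMr ?mulr_gt0// mulrC (mulrC (1 - rho)).
Unshelve. all: by end_near. Qed.

Lemma subord_bound K M u t B : 0 <= K -> 0 <= M -> geom_bd K M u -> 0 < t ->
  (forall th, I th -> `|A th * gamma_mean (egf u) (t `^ rho * A th)| <= B) ->
  `|ml_series u (t `^ rho)| <= rho * B.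
Proof.
move=> K0 M0 uM t0 dB; have p0 := pi_gt0 R.
have [C [i _ _]] := subord_cvg K0 M0 uM t0.
have -> : ml_series u (t `^ rho) = rho / pi * \int[mu]_(th in I) (A th * gamma_mean (egf u) (t `^ rho * A th)).
  have := subord_ml_series K0 M0 uM t0; rewrite /subord => /mulfI -> //.
  by rewrite gt_eqF// powR_gt0.
have mi : measurable_fun I (fun th => A th * gamma_mean (egf u) (t `^ rho * A th)).
  by move: i => /integrableP[/measurable_EFinP].
have h : `|\int[mu]_(th in I) (A th * gamma_mean (egf u) (t `^ rho * A th))| <= B * (pi - 0).
  apply: Rint_norm_le; [exact: ltW|exact: mi|].
  by move=> th; rewrite -in_Ioo; exact: dB.
have rp : 0 <= rho / pi by rewrite divr_ge0// ltW.
rewrite normrM (ger0_norm rp).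
have K' (p : R) : p != 0 -> rho * B = rho / p * (B * (p - 0)) by move=> pn; field.
rewrite (K' pi); last by rewrite gt_eqF.
by rewrite ler_wpM2l.
Qed.

End kernels.

(** * Profiles of the telegraph modes *)

Section telegraph.
Context {R : realType}.
Variables (al k : R).
Hypotheses (al0 : 0 < al) (k1 : 1 <= k).

(** Taylor coefficients at 0 of the solution of P'' + 2 al P' + k^2 P = 0 with
    P(0) = 0 and P'(0) = 1. *)
Fixpoint useq (n : nat) : R :=
  if n is n1.+1 then
    if n1 is n2.+1 then - (2 * al * useq n1) - k ^+ 2 * useq n2 else 1
  else 0.

(** Taylor coefficients of the primitive of that solution. *)
Definition vseq (n : nat) : R := if n is n1.+1 then useq n1 else 0.

Let M := 2 * al + k ^+ 2 + 1.
Let M1 : 1 <= M.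
Proof. by rewrite /M lerDr addr_ge0// ?sqr_ge0// mulr_ge0// ltW. Qed.
Let M0 : 0 <= M. Proof. exact: le_trans M1. Qed.

Lemma useq_bd : geom_bd 1 M useq.
Proof.
move=> n; rewrite mul1r.
suff : `|useq n| <= M ^+ n /\ `|useq n.+1| <= M ^+ n.+1 by case.
elim: n => [|n [IH1 IH2]].
  by rewrite /= normr0 normr1 expr0 expr1.
split=> //; rewrite [useq n.+2]/= -/(useq n.+1).
rewrite (le_trans (ler_normB _ _))// normrN [X in X + _]normrM [X in _ + X]normrM normrM.
rewrite (ger0_norm (sqr_ge0 k)) (gtr0_norm al0) (ger0_norm (x := 2))//.
have h : `|useq n| <= M ^+ n.+1 by rewrite (le_trans IH1)// exprS ler_peMl// exprn_ge0.
apply: (@le_trans _ _ (2 * al * M ^+ n.+1 + k ^+ 2 * M ^+ n.+1)).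
  by apply: lerD; apply: ler_wpM2l; rewrite ?sqr_ge0// mulr_ge0// ltW.
rewrite -mulrDl [leRHS]exprS ler_wpM2r ?exprn_ge0//.
by rewrite /M lerDl.
Qed.

Lemma vseq_bd : geom_bd 1 M vseq.
Proof.
case=> [|n]; first by rewrite /= normr0 expr0 mulr1.
by rewrite /= mul1r (le_trans (useq_bd n))// mul1r exprS ler_peMl// exprn_ge0.
Qed.

Lemma useq1_bd : geom_bd M M (fun n => useq n.+1).
Proof. by have := geom_bd_shift M0 useq_bd; rewrite mul1r. Qed.

Notation U := (egf useq).
Notation U1 := (egf (fun n => useq n.+1)).
Notation V := (egf vseq).

Lemma hd_U s : has_derive U s (U1 s). Proof. exact: (hd_egf _ ler01 M0 useq_bd). Qed.
Lemma hd_V s : has_derive V s (U s). Proof. exact: (hd_egf _ ler01 M0 vseq_bd). Qed.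

Lemma hd_U1 s : has_derive U1 s (- (2 * al * U1 s) - k ^+ 2 * U s).
Proof.
apply: hd_eq; first exact: (hd_egf _ M0 M0 useq1_bd).
have b1 : geom_bd (2 * al * M) M (fun n => - (2 * al) * useq n.+1).
  move=> n; have a2 : 0 <= 2 * al by rewrite mulr_ge0// ltW.
  rewrite normrM normrN (ger0_norm a2) -[leRHS]mulrA; apply: ler_wpM2l => //.
  exact: useq1_bd.
have c1 : 0 <= 2 * al * M by rewrite mulr_ge0// mulr_ge0// ltW.
rewrite (_ : (fun n => useq n.+2) = (fun n => - (2 * al) * useq n.+1 + - k ^+ 2 * useq n)).
  rewrite (egf_lin _ _ c1 ler01 M0 b1 useq_bd).
  have b0 : geom_bd 0 M (fun=> 0) by move=> n; rewrite normr0 mul0r.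
  rewrite (_ : (fun n => - (2 * al) * useq n.+1) = (fun n => 0 + - (2 * al) * useq n.+1)).
    rewrite (egf_lin _ _ (lexx 0) M0 M0 b0 useq1_bd).
    have -> : egf (fun=> 0) s = 0 :> R.
      by rewrite /egf -[RHS](@tsum0 R); apply: eq_tsum => n; rewrite !mul0r.
    by ring.
  by apply/funext => n; rewrite add0r.
by apply/funext => n /=; ring.
Qed.

(** The derivative of the energy is - 4 al P'^2. *)
Lemma energy s : 0 <= s -> U1 s ^+ 2 + k ^+ 2 * U s ^+ 2 <= 1.
Proof.
rewrite le_eqVlt => /predU1P[<-|s0].
  by rewrite !egf0 /= expr1n expr0n mulr0 addr0.
pose E s := U1 s * U1 s + k ^+ 2 * (U s * U s).
have dE x : has_derive E x (- (4 * al * U1 x ^+ 2)).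
  apply: hd_eq; first exact: hdD (hdM (hd_U1 x) (hd_U1 x)) (hdZ _ (hdM (hd_U x) (hd_U x))).
  by ring.
have cE : {within `[0, s], continuous E}.
  by apply: continuous_subspaceT => x; apply: hd_continuous; exact: dE.
have [c _ h] := MVT_segment (ltW s0) (fun x _ => dE x) cE.
have E0 : E 0 = 1 by rewrite /E !egf0 /=; ring.
have : E s <= 1.
  rewrite -E0 -subr_le0 h subr0 mulNr oppr_le0 mulr_ge0 ?(ltW s0)//.
  by rewrite mulr_ge0 ?sqr_ge0// mulr_ge0// ltW.
by rewrite /E !expr2.
Qed.

Let k0 : 0 < k. Proof. exact: lt_le_trans k1. Qed.

Lemma U1_le s : 0 <= s -> `|U1 s| <= 1.
Proof.
move=> /energy h; rewrite -(@expr_le1 _ 2)//.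
have := mulr_ge0 (sqr_ge0 k) (sqr_ge0 (U s)); move: h.
rewrite (_ : `|U1 s| ^+ 2 = U1 s ^+ 2); last by rewrite real_normK ?num_real.
by lra.
Qed.

Lemma U_le s : 0 <= s -> `|U s| <= k^-1.
Proof.
move=> /energy h; rewrite -[k^-1]mul1r ler_pdivlMr// -[X in _ * X](gtr0_norm k0) -normrM.
rewrite -(@expr_le1 _ 2)// real_normK ?num_real// exprMn mulrC.
by have := sqr_ge0 (U1 s); lra.
Qed.

(** Integrating the equation once, k^2 V = 1 - P' - 2 al P. *)
Lemma V_le s : 0 <= s -> `|V s| <= (2 + 2 * al) / k ^+ 2.
Proof.
move=> s0; have E : k ^+ 2 * V s = 1 - U1 s - 2 * al * U s.
  pose D x := k ^+ 2 * V x + U1 x + 2 * al * U x.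
  have dD x : has_derive D x 0.
    apply: hd_eq; first exact: hdD (hdD (hdZ _ (hd_V x)) (hd_U1 x)) (hdZ _ (hd_U x)).
    by ring.
  have : D s = D 0.
    have z : forall x : R, `|0 : R| <= 0 by move=> _; rewrite normr0.
    have := has_derive_lipschitz dD z 0 s.
    by rewrite mul0r normr_le0 subr_eq0 => /eqP.
  by rewrite /D !egf0 /= => H; apply/eqP; rewrite -subr_eq0; apply/eqP; lra.
rewrite ler_pdivlMr ?exprn_gt0// -[X in _ * X](ger0_norm (sqr_ge0 k)) -normrM mulrC E.
have h1 := U1_le s0.
have h2 : `|U s| <= 1 by rewrite (le_trans (U_le s0))// invf_le1.
rewrite (le_trans (ler_normB _ _))//; apply: lerD.
  rewrite (le_trans (ler_normB _ _))// normr1; have -> : 2 = 1 + 1 :> R by ring.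
  by rewrite lerD2l.
have a2 : 0 <= 2 * al by rewrite mulr_ge0// ltW.
by rewrite normrM (ger0_norm a2) ler_piMr.
Qed.

End telegraph.

(** * Convolution of singular functions *)

Section convolution.
Context {R : realType}.
Notation mu := (@lebesgue_measure R).
Notation U01 := (`]0, 1[%classic : set R).

Lemma measurable_continuous (f : R -> R) (D : set R) : continuous f -> measurable_fun D f.
Proof.
by move=> cf; apply: measurable_funTS; exact: continuous_measurable_fun.
Qed.

Lemma continuous_seq (f : R -> R) (x : R) :
  (forall u : nat -> R, u @ \oo --> x -> f (u n) @[n --> \oo] --> f x) ->
  {for x, continuous f}.
Proof.
move=> H; have := @cvg_within_seq R R setT x f (f x) (fun u _ => H u).
move=> c; apply/cvgrPdist_lt => e e0; have /cvgrPdist_lt /(_ _ e0) := c.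
by rewrite near_withinE; apply: filterS => y; apply.
Qed.

Lemma cont_compR (f g : R -> R) : continuous g -> continuous f -> continuous (fun x => f (g x)).
Proof. by move=> cg cf x; apply: (@cont_comp R f g); [exact: cg|exact: cf]. Qed.

Lemma cont_cst (c : R) : continuous (fun _ : R => c).
Proof. by move=> x; exact: cvg_cst. Qed.

Lemma cont_Ml (c : R) : continuous (fun x : R => c * x).
Proof. by move=> x; apply: cvgM; [exact: cvg_cst|exact: cvg_id]. Qed.

Lemma cont_Mr (c : R) : continuous (fun x : R => x * c).
Proof. by move=> x; apply: cvgM; [exact: cvg_id|exact: cvg_cst]. Qed.

Lemma cont_Bl (c : R) : continuous (fun x : R => c - x).
Proof. by move=> x; apply: cvgB; [exact: cvg_cst|exact: cvg_id]. Qed.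

Lemma cont_MB (c d : R) : continuous (fun x : R => c * (d - x)).
Proof. by move=> x; apply: cvgM; [exact: cvg_cst|exact: cont_Bl]. Qed.

Lemma cvg_bounded (u : nat -> R) (x : R) : u @ \oo --> x -> exists2 Z, 0 <= Z & forall n, `|u n| <= Z.
Proof.
move=> ux; have [Z [_ hZ]] := cvg_seq_bounded (cvgP _ ux).
exists (`|Z| + 1) => [|n]; first by rewrite addr_ge0.
by apply: hZ => //; rewrite (le_lt_trans (ler_norm _))// ltrDl.
Qed.

Lemma continuous_bounded (q : R -> R) (Z : R) : continuous q ->
  exists2 M, 0 <= M & forall x, `|x| <= Z -> `|q x| <= M.
Proof.
move=> cq; have cs : {within `[- Z, Z], continuous q} by exact: continuous_subspaceT.
have [M [M0 hM]] := cont_seg_bounded cs.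
by exists M => // x; rewrite ler_norml; exact: hM.
Qed.

Lemma integ_mul_bounded (D : set R) (f g : R -> R) (M : R) : measurable D ->
  mu.-integrable D (EFin \o f) -> measurable_fun D g ->
  (forall x, D x -> `|g x| <= M) -> mu.-integrable D (EFin \o (fun x => f x * g x)).
Proof.
move=> mD fi mg gM.
have mf : measurable_fun D f by move: fi => /integrableP[/measurable_EFinP].
have fa : mu.-integrable D (EFin \o (fun x => `|f x|)).
  by move: (integrable_norm fi); apply: eq_integrable.
apply: (integ_dom mD _ _ (integZ M mD fa)); first exact: measurable_funM.
by move=> x Dx; rewrite normrM mulrC ler_wpM2r// gM.
Qed.

(** Dominated convergence along sequences of parameters. *)
Lemma continuous_param (w : R -> R) (F : R -> R -> R) :
  mu.-integrable U01 (EFin \o w) ->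
  (forall s, U01 s -> continuous (F^~ s)) -> (forall t, measurable_fun U01 (F t)) ->
  (forall Z, exists M, forall t s, `|t| <= Z -> U01 s -> `|F t s| <= M) ->
  continuous (fun t => \int[mu]_(s in U01) (w s * F t s)).
Proof.
move=> wi cF mF bF t; apply: continuous_seq => u ut.
have [Z Z0 uZ] := cvg_bounded ut; have [M hM] := bF Z.
have mw : measurable_fun U01 w by move: wi => /integrableP[/measurable_EFinP].
have wa : mu.-integrable U01 (EFin \o (fun x => `|w x|)).
  by move: (integrable_norm wi); apply: eq_integrable.
have ig : mu.-integrable U01 (EFin \o (fun s => M * `|w s|)) by exact: integZ.
have [] := @Rdominated_cvg R _ _ mu U01 (fun n s => w s * F (u n) s) (fun s => w s * F t s)
  (fun s => M * `|w s|) (measurable_itv _) _ _ ig _ => //.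
- by move=> n; apply: (measurable_funM mw); exact: mF.
- move=> s sI; apply: cvgM; first exact: cvg_cst.
  by apply: (@cvg_cont_comp R _ _ _ u (F^~ s) t ut); exact: cF.
- by move=> n s sI; rewrite normrM mulrC ler_wpM2r//; exact: hM.
Qed.

Definition conv (k h : R -> R) (t : R) : R := \int[mu]_(s in `]0, t[) (k (t - s) * h s).

Lemma conv_ext (k k' h h' : R -> R) t : (forall s, 0 < s < t -> k s = k' s) ->
  (forall s, 0 < s < t -> h s = h' s) -> conv k h t = conv k' h' t.
Proof.
move=> kk hh; apply: eq_Rint => s; rewrite in_Ioo => /andP[s0 st].
rewrite hh ?s0// kk// subr_gt0 st ltrBlDr ltrDl//.
Qed.

(** A function that may be singular at 0, given by its exponent and its symbol q;
    [conv_sg] computes the symbol of a convolution. *)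
Definition sg (a : R) (q : R -> R) (t : R) : R := t `^ (a - 1) * q t.

Lemma measurable_sg a q : continuous q -> measurable_fun setT (sg a q).
Proof.
move=> cq; apply: measurable_funM; last exact: measurable_continuous.
exact: measurable_powR.
Qed.

Lemma continuous_sg a q t : continuous q -> 0 < t -> {for t, continuous (sg a q)}.
Proof. by move=> cq t0; apply: cvgM; [exact: continuous_powR|exact: cq]. Qed.

Lemma sg_bound a q T : continuous q ->
  exists2 M, 0 <= M & forall t, 0 < t <= T -> `|sg a q t| <= M * t `^ (a - 1).
Proof.
move=> cq; have [M M0 hM] := continuous_bounded T cq.
exists M => // t /andP[t0 tT]; rewrite normrM (ger0_norm (powR_ge0 _ _)) mulrC.
by rewrite ler_wpM2r ?powR_ge0// hM// gtr0_norm.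
Qed.

(** The substitution s -> t s carries the singularities of a convolution into a
    fixed Beta weight. *)
Definition conv_symbol (a b : R) (p q : R -> R) (t : R) : R :=
  \int[mu]_(s in U01) (betaf a b 1 s * (p (t * (1 - s)) * q (t * s))).

Lemma conv_sg_integrable (a b : R) (p q : R -> R) (t : R) : 0 < a -> 0 < b -> 0 < t -> continuous p -> continuous q ->
  mu.-integrable `]0, t[ (EFin \o (fun s => sg a p (t - s) * sg b q s)).
Proof.
move=> a0 b0 t0 cp cq.
have [Mp Mp0 hp] := continuous_bounded t cp; have [Mq Mq0 hq] := continuous_bounded t cq.
have E s : sg a p (t - s) * sg b q s = betaf a b t s * (p (t - s) * q s).
  by rewrite /sg /betaf; ring.
have cpt : continuous (fun s : R => p (t - s)) by apply: cont_compR cp; exact: cont_Bl.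
apply: (@eq_integ R _ (fun s => betaf a b t s * (p (t - s) * q s))) => //.
apply: (@integ_mul_bounded _ _ _ (Mp * Mq)) => //; first exact: betaf_integrable.
- by apply: measurable_funM; exact: measurable_continuous.
- move=> s; rewrite in_Ioo => /andP[s0 st]; rewrite normrM ler_pM//.
    by apply: hp; rewrite ger0_norm ?subr_ge0 ?(ltW st)// gerBl ltW.
  by apply: hq; rewrite gtr0_norm// ltW.
Qed.

Lemma conv_sg (a b : R) (p q : R -> R) (t : R) : 0 < a -> 0 < b -> 0 < t -> continuous p -> continuous q ->
  conv (sg a p) (sg b q) t = sg (a + b) (conv_symbol a b p q) t.
Proof.
move=> a0 b0 t0 cp cq; have ii := conv_sg_integrable a0 b0 t0 cp cq.
rewrite /conv (Rintegral_scale t0 ii) /sg /conv_symbol.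
have -> : t `^ (a + b - 1) = t * (t `^ (a - 1) * t `^ (b - 1)).
  rewrite -{2}(powRr1 (ltW t0)) -!powRD; last 2 first.
  - by rewrite (gt_eqF t0) implybT.
  - by rewrite (gt_eqF t0) implybT.
  by congr (_ `^ _); ring.
rewrite -mulrA; congr (_ * _).
have cpt : continuous (fun s : R => p (t * (1 - s))) by apply: cont_compR cp; exact: cont_MB.
have cqt : continuous (fun s : R => q (t * s)) by apply: cont_compR cq; exact: cont_Ml.
have [Mp Mp0 hp] := continuous_bounded 1 cpt; have [Mq Mq0 hq] := continuous_bounded 1 cqt.
rewrite -RintZ//; last first.
  apply: (@integ_mul_bounded _ _ _ (Mp * Mq)) => //; first exact: betaf_integrable.
  - by apply: measurable_funM; exact: measurable_continuous.
  - move=> s; rewrite in_Ioo => /andP[s0 st]; rewrite normrM ler_pM//.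
      by apply: hp; rewrite gtr0_norm// ltW.
    by apply: hq; rewrite gtr0_norm// ltW.
apply: eq_Rint => s; rewrite in_Ioo => /andP[s0 s1].
have -> : t - t * s = t * (1 - s) by ring.
rewrite powRM ?(ltW t0) ?subr_ge0 ?(ltW s1)// powRM ?(ltW t0) ?(ltW s0)//.
by rewrite /betaf; ring.
Qed.

Lemma continuous_conv_symbol (a b : R) (p q : R -> R) : 0 < a -> 0 < b -> continuous p -> continuous q ->
  continuous (conv_symbol a b p q).
Proof.
move=> a0 b0 cp cq; apply: continuous_param.
- exact: betaf_integrable.
- move=> s _ t; apply: cvgM.
    by apply: (cont_compR (g := fun x => x * (1 - s)) _ cp); exact: cont_Mr.
  by apply: (cont_compR (g := fun x => x * s) _ cq); exact: cont_Mr.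
- move=> t; apply: measurable_funM; apply: measurable_continuous.
    by apply: (cont_compR (g := fun x => t * (1 - x)) _ cp); exact: cont_MB.
  by apply: (cont_compR (g := fun x => t * x) _ cq); exact: cont_Ml.
- move=> Z; have [Mp Mp0 hp] := continuous_bounded Z cp; have [Mq Mq0 hq] := continuous_bounded Z cq.
  exists (Mp * Mq) => t s tZ; rewrite in_Ioo => /andP[s0 s1]; rewrite normrM ler_pM//.
    apply: hp; rewrite normrM (le_trans _ tZ)// ler_piMr// ger0_norm ?subr_ge0 ?(ltW s1)//.
    by rewrite gerBl ltW.
  by apply: hq; rewrite normrM (le_trans _ tZ)// ler_piMr// gtr0_norm// ltW.
Qed.

Lemma convC_sg (a b : R) (p q : R -> R) (t : R) : 0 < a -> 0 < b -> 0 < t -> continuous p -> continuous q ->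
  conv (sg a p) (sg b q) t = conv (sg b q) (sg a p) t.
Proof.
move=> a0 b0 t0 cp cq; have ii := conv_sg_integrable a0 b0 t0 cp cq.
rewrite /conv (Rintegral_rev ii).2; apply: eq_Rint => s _.
have -> : t - (t - s) = s by ring.
exact: mulrC.
Qed.

(** Fubini on the triangle 0 < y < s < t, inside the square because the functions
    are extended by 0. *)
Lemma convA_sg (a b c : R) (p q r : R -> R) (t : R) : 0 < a -> 0 < b -> 0 < c -> 0 < t ->
  continuous p -> continuous q -> continuous r ->
  conv (conv (sg a p) (sg b q)) (sg c r) t = conv (sg a p) (conv (sg b q) (sg c r)) t.
Proof.
move=> a0 b0 c0 t0 cp cq cr.
pose hp x := (sg b q \_ `]0, +oo[%classic) x.
have hpE x : 0 < x -> hp x = sg b q x.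
  by move=> x0; rewrite /hp patchE mem_set//= in_itv/= x0.
have hp0 x : x <= 0 -> hp x = 0.
  by move=> x0; rewrite /hp patchE memNset//= in_itv/= andbT; apply/negP; rewrite -leNgt.
have mhp : measurable_fun setT hp.
  by apply/(measurable_restrictT _ _).1 => //; apply: measurable_funTS; exact: measurable_sg.
pose f (z : R * R) := sg a p (t - z.1) * hp (z.1 - z.2) * sg c r z.2.
have mf : measurable_fun setT f.
  apply: measurable_funM; last exact: measurable_comp_snd (measurable_sg _ cr).
  apply: measurable_funM.
    apply: (measurable_comp_fst (f := fun x => sg a p (t - x))).
    by apply: (measurableT_comp (measurable_sg _ cp)); exact: measurable_funB.
  by apply: (measurableT_comp mhp); apply: measurable_funB.
have [Mp Mp0 bp] := sg_bound a t cp.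
have [Mq Mq0 bq] := sg_bound b t cq.
have [Mr Mr0 br] := sg_bound c t cr.
have i1 s : 0 < s -> s < t -> mu.-integrable `]0, t[ (EFin \o (fun y => f (s, y))).
  move=> s0 st; apply: (@integ_support R `]0, s[ `]0, t[) => //.
  - by apply: subset_itvl; rewrite bnd_simp ltW.
  - move=> y; rewrite !in_Ioo => /andP[y0 yt] ny; rewrite /f/= hp0 ?mulr0 ?mul0r//.
    by rewrite subr_le0 leNgt; apply/negP => ys; apply: ny; rewrite y0.
  apply: (@eq_integ R _ (fun y => sg a p (t - s) * (sg b q (s - y) * sg c r y))) => //.
    by move=> y; rewrite in_Ioo => /andP[y0 ys]; rewrite /f/= hpE ?subr_gt0// mulrA.
  by apply: integZ => //; exact: conv_sg_integrable.
have shift (x : R) (g : R -> R) : 0 < x -> x < t -> mu.-integrable `]0, t - x[ (EFin \o g) ->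
    mu.-integrable `]x, t[ (EFin \o (fun s => g (s - x))) /\
    \int[mu]_(s in `]x, t[) g (s - x) = \int[mu]_(s in `]0, t - x[) g s.
  move=> x0 xt gi.
  have pre : (fun s : R => 1 * s + - x) @^-1` `]0, t - x[ = `]x, t[%classic.
    apply/funext => s; rewrite /preimage/= !in_itv/= mul1r; apply/propext.
    by rewrite subr_gt0 ltrD2r.
  have := integrable_affine (- x) (oner_neq0 R) (measurable_itv _) gi.
  have := Rintegral_affine (- x) (oner_neq0 R) (measurable_itv _) gi.
  rewrite pre normr1 mul1r => -> j; split.
    by apply: (eq_integ _ _ j) => // s _; rewrite mul1r.
  by apply: eq_Rint => s _; rewrite mul1r.
have inner y : 0 < y -> y < t ->
    mu.-integrable `]y, t[ (EFin \o (fun s => sg a p (t - s) * sg b q (s - y))) /\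
    \int[mu]_(s in `]y, t[) (sg a p (t - s) * sg b q (s - y)) = conv (sg a p) (sg b q) (t - y).
  move=> y0 yt; have ty : 0 < t - y by rewrite subr_gt0.
  have [j e] := shift y _ y0 yt (conv_sg_integrable a0 b0 ty cp cq).
  have E s : t - y - (s - y) = t - s by ring.
  split; first by apply: (eq_integ _ _ j) => // s _; rewrite E.
  by rewrite /conv -e; apply: eq_Rint => s _; rewrite E.
have supp y s : 0 < s < t -> ~ (y < s < t) -> hp (s - y) = 0.
  move=> /andP[s0 st] ny; apply: hp0; rewrite subr_le0 leNgt; apply/negP => ys.
  by apply: ny; rewrite ys.
have i2 y : 0 < y -> y < t -> mu.-integrable `]0, t[ (EFin \o (fun s => f (s, y))).
  move=> y0 yt; apply: (@integ_support R `]y, t[ `]0, t[) => //.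
  - by apply: subset_itvr; rewrite bnd_simp ltW.
  - by move=> s; rewrite !in_Ioo => sI ny; rewrite /f/= (supp y s)// mulr0 mul0r.
  have [j _] := inner y y0 yt.
  apply: (@eq_integ R _ (fun s => sg c r y * (sg a p (t - s) * sg b q (s - y)))) => //.
    by move=> s; rewrite in_Ioo => /andP[ys st]; rewrite /f/= hpE ?subr_gt0// mulrC.
  exact: integZ.
pose B := \int[mu]_(s in U01) betaf b c 1 s.
pose g s := Mp * (Mq * Mr * B) * betaf a (b + c) t s.
have := @RFubini R `]0, t[ `]0, t[ f g (measurable_itv _) (measurable_itv _) (measurable_funTS mf).
have F1 : \int[mu]_(s in `]0, t[) \int[mu]_(y in `]0, t[) f (s, y) =
    conv (sg a p) (conv (sg b q) (sg c r)) t.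
  apply: eq_Rint => s; rewrite in_Ioo => /andP[s0 st].
  rewrite (@Rint_support R `]0, s[); last 2 first.
  - by apply: subset_itvl; rewrite bnd_simp ltW.
  - move=> y; rewrite !in_Ioo => /andP[y0 yt] ny; rewrite /f/= hp0 ?mulr0 ?mul0r//.
    by rewrite subr_le0 leNgt; apply/negP => ys; apply: ny; rewrite y0.
  rewrite /conv -RintZ//; last exact: conv_sg_integrable.
  by apply: eq_Rint => y; rewrite in_Ioo => /andP[y0 ys]; rewrite /f/= hpE ?subr_gt0// mulrA.
have F2 : \int[mu]_(y in `]0, t[) \int[mu]_(s in `]0, t[) f (s, y) =
    conv (conv (sg a p) (sg b q)) (sg c r) t.
  apply: eq_Rint => y; rewrite in_Ioo => /andP[y0 yt].
  have [j e] := inner y y0 yt.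
  rewrite -e mulrC -RintZ// (@Rint_support R `]y, t[); last 2 first.
  - by apply: subset_itvr; rewrite bnd_simp ltW.
  - by move=> s; rewrite !in_Ioo => sI ny; rewrite /f/= (supp y s)// mulr0 mul0r.
  by apply: eq_Rint => s; rewrite in_Ioo => /andP[ys st]; rewrite /f/= hpE ?subr_gt0// mulrC.
rewrite F1 F2 => H; symmetry; apply: H.
- by move=> s; rewrite in_Ioo => /andP[]; exact: i1.
- by move=> y; rewrite in_Ioo => /andP[]; exact: i2.
- by apply: integZ => //; apply: betaf_integrable => //; exact: addr_gt0.
move=> s; rewrite in_Ioo => /andP[s0 st].
have ib : mu.-integrable `]0, s[ (EFin \o (fun y => Mp * (t - s) `^ (a - 1) * (Mq * Mr) * betaf b c s y)).
  by apply: integZ => //; exact: betaf_integrable.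
rewrite (@Rint_support R `]0, s[); last 2 first.
- by apply: subset_itvl; rewrite bnd_simp ltW.
- move=> y; rewrite !in_Ioo => /andP[y0 yt] ny; rewrite /f/= hp0 ?mulr0 ?mul0r ?normr0//.
  by rewrite subr_le0 leNgt; apply/negP => ys; apply: ny; rewrite y0.
apply: (@le_trans _ _ (\int[mu]_(y in `]0, s[) (Mp * (t - s) `^ (a - 1) * (Mq * Mr) * betaf b c s y))).
  apply: le_Rint => //.
    have i1' : mu.-integrable `]0, s[ (EFin \o (fun y => f (s, y))).
      by apply: integ_sub (i1 s s0 st) => //; apply: subset_itvl; rewrite bnd_simp ltW.
    by move: (integrable_norm i1'); apply: eq_integrable.
  move=> y; rewrite in_Ioo => /andP[y0 ys].
  rewrite /f/= normrM [X in X * _]normrM hpE ?subr_gt0//.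
  have h1 : `|sg a p (t - s)| <= Mp * (t - s) `^ (a - 1).
    by apply: bp; rewrite subr_gt0 st gerBl ltW.
  have h2 : `|sg b q (s - y)| <= Mq * (s - y) `^ (b - 1).
    by apply: bq; rewrite subr_gt0 ys lerBlDr (le_trans (ltW st))// lerDl ltW.
  have h3 : `|sg c r y| <= Mr * y `^ (c - 1) by apply: br; rewrite y0 (le_trans (ltW ys))// ltW.
  apply: le_trans (ler_pM _ _ (ler_pM _ _ h1 h2) h3) _; rewrite ?mulr_ge0//.
  by rewrite /betaf le_eqVlt; apply/orP; left; apply/eqP; ring.
rewrite RintZ//; last exact: betaf_integrable.
by rewrite betaf_scale// -/B /g /betaf le_eqVlt; apply/orP; left; apply/eqP; ring.
Qed.

(** The kernel p(t - s) (t - s)^(a-1) times the common bound B s^(b-1) is integrable. *)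
Lemma conv_dct (a : R) (p : R -> R) (f_ : nat -> R -> R) (f : R -> R) (b B t : R) : 0 < a -> 0 < b -> 0 < t -> continuous p ->
  (forall n, measurable_fun (`]0, t[%classic : set R) (f_ n)) ->
  (forall n s, 0 < s < t -> `|f_ n s| <= B * s `^ (b - 1)) ->
  (forall s, 0 < s < t -> f_ n s @[n --> \oo] --> f s) ->
  mu.-integrable `]0, t[ (EFin \o (fun s => sg a p (t - s) * f s)) /\
  conv (sg a p) (f_ n) t @[n --> \oo] --> conv (sg a p) f t.
Proof.
move=> a0 b0 t0 cp mf bf cf.
have [Mp Mp0 bp] := sg_bound a t cp.
have ig : mu.-integrable `]0, t[ (EFin \o (fun s => Mp * B * betaf a b t s)).
  by apply: integZ => //; exact: betaf_integrable.
apply: (@Rdominated_cvg R _ _ mu `]0, t[ (fun n s => sg a p (t - s) * f_ n s)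
  (fun s => sg a p (t - s) * f s) (fun s => Mp * B * betaf a b t s) (measurable_itv _)) => //.
- move=> n; apply: measurable_funM; last exact: mf.
  apply: measurable_funTS; apply: (measurableT_comp (measurable_sg _ cp)); exact: measurable_funB.
- move=> s; rewrite in_Ioo => sI; apply: cvgM; first exact: cvg_cst.
  exact: cf.
- move=> n s; rewrite in_Ioo => sI; have /andP[s0 st] := sI; rewrite normrM.
  have h1 : `|sg a p (t - s)| <= Mp * (t - s) `^ (a - 1).
    by apply: bp; rewrite subr_gt0 st gerBl ltW.
  apply: le_trans (ler_pM _ _ h1 (bf n s sI)) _ => //.
  by rewrite /betaf le_eqVlt; apply/orP; left; apply/eqP; ring.
Qed.

(** Away from 0 the integrand is continuous; the part of the integral near 0 is a
    constant. *)
Lemma hd_conv1 (b : R) (q : R -> R) (t : R) : 0 < b -> 0 < t -> continuous q ->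
  has_derive (conv (fun=> 1) (sg b q)) t (sg b q t).
Proof.
move=> b0 t0 cq; have t1 : t < t + 1 by rewrite ltrDl.
have t10 : 0 < t + 1 by rewrite addr_gt0.
have ii : mu.-integrable `]0, t + 1[ (EFin \o sg b q).
  have := conv_sg_integrable ltr01 b0 t10 (@cont_cst 1) cq.
  apply: eq_integ => // s; rewrite in_Ioo => /andP[s0 s1].
  by rewrite /sg subrr powRr0 !mul1r.
have ii2 : mu.-integrable `]0, t + 2^-1] (EFin \o sg b q).
  by apply: integ_sub ii => //; apply: subset_itvl; rewrite bnd_simp ltrD2l invf_lt1// ltr1n.
have th : t < t + 2^-1 by rewrite ltrDl invr_gt0.
have [|d e] := @continuous_FTC1 R (sg b q) (BRight 0) t (t + 2^-1) th ii2 _ (@continuous_sg b q t cq t0).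
  by rewrite /Order.lt/= t0.
have D : has_derive (fun y => \int[mu]_(s in `]0, y]) sg b q s) t (sg b q t).
  by apply: DeriveDef; [exact: d|rewrite -derive1E; exact: e].
have D2 := (has_derive_quot _ _ _).1 D; apply/has_derive_quot.
have E y : 0 < y -> y < t + 1 -> conv (fun=> 1) (sg b q) y = \int[mu]_(s in `]0, y]) sg b q s.
  move=> y0 yt; rewrite /conv (@eq_Rint R _ _ (sg b q)); last by move=> s _; rewrite mul1r.
  apply: (@Rintegral_itv_bndo_bndc R (BRight 0) y).
  by apply: integ_sub ii => //; apply: subset_itvl; rewrite bnd_simp ltW.
apply: cvg_trans D2; apply: near_eq_cvg; near=> h.
have [h1 h2] : 0 < h + t /\ h + t < t + 1.
  have ht : `|h| < Num.min t 1.
    near: h; apply: dnbhs0_lt; by rewrite lt_min t0 ltr01.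
  move: ht; rewrite lt_min !ltr_norml => /andP[/andP[? ?] /andP[? ?]].
  by split; lra.
by rewrite /= !E.
Unshelve. all: by end_near. Qed.

End convolution.

(** * Kernels of the modes *)

Section mlconv.
Context {R : realType}.
Notation mu := (@lebesgue_measure R).
Variable rho : R.
Hypothesis rho01 : 0 < rho < 1.
Let rho0 : 0 < rho. Proof. by case/andP: rho01. Qed.
Let rho1 : rho < 1. Proof. by case/andP: rho01. Qed.

(** The power t^rho, extended continuously to the whole line. *)
Definition abs_pow (t : R) : R := `|t| `^ rho.

Lemma abs_pow_gt0E t : 0 < t -> abs_pow t = t `^ rho.
Proof. by move=> t0; rewrite /abs_pow gtr0_norm. Qed.

Lemma abs_pow_ge0 t : 0 <= abs_pow t. Proof. exact: powR_ge0. Qed.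

Lemma zr0 : abs_pow 0 = 0.
Proof. by rewrite /abs_pow normr0 powR0// gt_eqF. Qed.

Lemma continuous_abs_pow : continuous abs_pow.
Proof.
move=> t; have [->|t0] := eqVneq t 0; last first.
  apply: (@cont_comp R (fun x => x `^ rho)); first exact: norm_continuous.
  by apply: continuous_powR; rewrite normr_gt0.
rewrite /continuous_at zr0; apply/cvgrPdist_lt => e e0.
have e1 : 0 < e `^ rho^-1 by rewrite powR_gt0.
near=> x; rewrite sub0r normrN /abs_pow ger0_norm ?powR_ge0//.
have xe : `|x| < e `^ rho^-1.
  rewrite -normrN -[- x]add0r; near: x; exact: cvgr_dist_lt.
have -> : e = (e `^ rho^-1) `^ rho by rewrite -powRrM mulVf ?gt_eqF// powRr1// ltW.
by apply: gt0_ltr_powR; rewrite ?nnegrE ?powR_ge0.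
Unshelve. all: by end_near. Qed.

(** The kernel [gk] in the form of a singular function. *)
Definition gker (b : R) : R -> R := sg b (fun=> (Gamma b)^-1).

Lemma gkerE b t : gker b t = gk b t. Proof. by []. Qed.

(** The semigroup property g_b * g_c = g_(b + c) is the Beta integral. *)
Lemma conv_gk b c t : 0 < b -> 0 < c -> 0 < t -> conv (gker b) (gker c) t = gk (b + c) t.
Proof.
move=> b0 c0 t0; rewrite conv_sg//; [|exact: cont_cst|exact: cont_cst].
rewrite /sg /conv_symbol /gk; congr (_ * _).
rewrite (@eq_Rint R _ _ (fun s => (Gamma b)^-1 * (Gamma c)^-1 * betaf b c 1 s)); last by move=> s _; ring.
rewrite RintZ//; last exact: betaf_integrable.
rewrite Beta_Gamma// powR1 mul1r.
have g1 := lt0r_neq0 (Gamma_gt0 b0); have g2 := lt0r_neq0 (Gamma_gt0 c0).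
by move: (Gamma b) (Gamma c) (Gamma (b + c))^-1 g1 g2 => x y z xn yn; field; rewrite xn yn.
Qed.

Section profile.
Variables (K M : R) (u : nat -> R).
Hypotheses (K0 : 0 <= K) (M0 : 0 <= M) (uM : geom_bd K M u).

(** The symbol of the subordinated profile, sum of u_n t^(rho n) / Gamma (rho (n+1)). *)
Definition ml_symbol (t : R) : R := ml_series rho u (abs_pow t).

Lemma continuous_ml_symbol : continuous ml_symbol.
Proof.
apply: (cont_compR continuous_abs_pow); exact: (continuous_ml_series rho01 K0 M0 uM).
Qed.

Lemma ml_symbol_partial T : exists2 B, 0 <= B & forall N s, 0 < s <= T ->
  `|\sum_(0 <= n < N) (u n * gk (rho * n.+1%:R) s)| <= B * s `^ (rho - 1).
Proof.
have [tau [t0 ht]] := ml_series_tails rho01 K0 M0 uM (abs_pow_ge0 T).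
have B0 : 0 <= tau 0%N.
  by apply: tails_ge0 (ht 0 _); rewrite normr0 abs_pow_ge0.
exists (tau 0%N) => // N s /andP[s0 sT].
have sz : `|s `^ rho| <= abs_pow T.
  rewrite ger0_norm ?powR_ge0// abs_pow_gt0E ?(lt_le_trans s0)//.
  by apply: ge0_ler_powR; rewrite ?nnegrE ?(ltW rho0) ?(ltW s0)// (le_trans _ sT)// ltW.
have -> : \sum_(0 <= n < N) (u n * gk (rho * n.+1%:R) s) =
    s `^ (rho - 1) * \sum_(0 <= n < N) (u n * rgamma rho n * (s `^ rho) ^+ n).
  by rewrite mulr_sumr; apply: eq_bigr => n _; rewrite gk_gamma_mean_coef// /rgamma; ring.
rewrite normrM ger0_norm ?powR_ge0// mulrC ler_wpM2r ?powR_ge0//.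
by rewrite (le_trans (ler_norm_sum _ _ _))//; exact: ht.
Qed.

Lemma ml_symbol_cvg s : 0 < s ->
  \sum_(0 <= n < N) (u n * gk (rho * n.+1%:R) s) @[N --> \oo] --> sg rho ml_symbol s.
Proof.
move=> s0; have [tau [t0 ht]] := ml_series_tails rho01 K0 M0 uM (abs_pow_ge0 s).
have sz : `|s `^ rho| <= abs_pow s by rewrite ger0_norm ?powR_ge0// abs_pow_gt0E.
have c : s `^ (rho - 1) * series (fun n => u n * rgamma rho n * (s `^ rho) ^+ n) N @[N --> \oo] -->
    s `^ (rho - 1) * ml_series rho u (s `^ rho).
  by apply: cvgM; [exact: cvg_cst|exact: (tails_cvg (ht _ sz) t0)].
rewrite /sg /ml_symbol abs_pow_gt0E//; apply: cvg_trans c; apply: near_eq_cvg; near=> N.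
by rewrite /series/= mulr_sumr; apply: eq_bigr => n _; rewrite gk_gamma_mean_coef// /rgamma; ring.
Unshelve. all: by end_near. Qed.

(** Convolution with g_b adds b to every order; the partial sums are dominated by a
    multiple of s^(rho-1). *)
Lemma conv_ml_symbol b t : 0 < b -> 0 < t ->
  \sum_(0 <= n < N) (u n * gk (b + rho * n.+1%:R) t) @[N --> \oo] -->
  conv (gker b) (sg rho ml_symbol) t.
Proof.
move=> b0 t0; have [B B0 hB] := ml_symbol_partial t.
have y0 n : 0 < rho * n.+1%:R by rewrite mulr_gt0.
pose F n (s : R) := u n * gker (rho * n.+1%:R) s.
have iF n : mu.-integrable `]0, t[ (EFin \o (fun s => gker b (t - s) * F n s)).
  apply: (@eq_integ R _ (fun s => u n * (gker b (t - s) * gker (rho * n.+1%:R) s))) => //.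
    by move=> s _; rewrite /F; ring.
  by apply: integZ => //; apply: conv_sg_integrable => //; exact: cont_cst.
have E N : conv (gker b) (fun s => \sum_(0 <= n < N) F n s) t =
    \sum_(0 <= n < N) (u n * gk (b + rho * n.+1%:R) t).
  rewrite /conv (@eq_Rint R _ _ (fun s => \sum_(0 <= n < N) (gker b (t - s) * F n s))); last first.
    by move=> s _; rewrite mulr_sumr.
  rewrite (integ_sum_n 0 N (measurable_itv _) iF).2; apply: eq_bigr => n _.
  rewrite (@eq_Rint R _ _ (fun s => u n * (gker b (t - s) * gker (rho * n.+1%:R) s))); last first.
    by move=> s _; rewrite /F; ring.
  rewrite RintZ//; last by apply: conv_sg_integrable => //; exact: cont_cst.
  by rewrite -conv_gk.
have [|||_ c] := @conv_dct R b (fun=> (Gamma b)^-1) (fun N s => \sum_(0 <= n < N) F n s)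
   (sg rho ml_symbol) rho B t b0 rho0 t0 (@cont_cst R _).
- move=> N; apply: measurable_sum => n; apply: measurable_funM => //.
  by apply: measurable_funTS; apply: measurable_sg; exact: cont_cst.
- by move=> N s /andP[s0 st]; apply: hB; rewrite s0 ltW.
- by move=> s /andP[s0 _]; exact: ml_symbol_cvg.
by move: c; rewrite (_ : (fun n => _) = fun N => \sum_(0 <= n < N) (u n * gk (b + rho * n.+1%:R) t));
  last (by apply/funext => N; exact: E).
Qed.

End profile.

End mlconv.

Section modes.
Context {R : realType}.
Notation mu := (@lebesgue_measure R).
Variables rho al : R.
Hypothesis rho01 : 0 < rho < 1.
Hypothesis al0 : 0 < al.
Let rho0 : 0 < rho. Proof. by case/andP: rho01. Qed.
Let rho1 : rho < 1. Proof. by case/andP: rho01. Qed.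
Let sig0 : 0 < 1 - rho. Proof. by rewrite subr_gt0. Qed.

(** Symbols of the kernels G and H, the images of the profile P and of P'. *)
Definition symG (k : R) : R -> R := ml_symbol rho (useq al k).
Definition symH (k : R) : R -> R := ml_symbol rho (fun n => useq al k n.+1).

Section onemode.
Variable k : R.
Hypothesis k1 : 1 <= k.
Let k0 : 0 < k. Proof. exact: lt_le_trans k1. Qed.
Let M := 2 * al + k ^+ 2 + 1.
Let M0 : 0 <= M.
Proof. by rewrite /M addr_ge0// addr_ge0 ?sqr_ge0// mulr_ge0// ltW. Qed.

Lemma continuous_symG : continuous (symG k).
Proof. exact: (continuous_ml_symbol rho01 ler01 M0 (useq_bd k al0)). Qed.

Lemma continuous_symH : continuous (symH k).
Proof. exact: (continuous_ml_symbol rho01 M0 M0 (useq1_bd k al0)). Qed.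

(** Convolution with g_(1-rho) changes the orders rho (n+1) to 1 + rho n. Since P
    starts with the term n = 1, this is the series of 1 * H. *)
Lemma conv_g_symG t : 0 < t ->
  conv (gker (1 - rho)) (sg rho (symG k)) t = conv (gker 1) (sg rho (symH k)) t.
Proof.
move=> t0; have c1 := conv_ml_symbol rho01 ler01 M0 (useq_bd k al0) sig0 t0.
have c2 := conv_ml_symbol rho01 M0 M0 (useq1_bd k al0) ltr01 t0.
have c3 := cvg_comp (addn^~ 1%N) _ (cvg_addnr 1) c1.
apply: (cvg_unique (@Rhausdorff R) c3); apply: cvg_trans c2; apply: near_eq_cvg; near=> N.
rewrite /= addn1 big_nat_recl//= mul0r add0r; apply: eq_bigr => n _.
by congr (_ * gk _ _); rewrite -[n.+2]addn1 natrD; ring.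
Unshelve. all: by end_near. Qed.

(** The same shift; the term n = 0 gives 1, and the recursion of [useq] expresses the
    others by the two kernels. *)
Lemma conv_g_symH t : 0 < t ->
  conv (gker (1 - rho)) (sg rho (symH k)) t =
  1 - 2 * al * conv (gker 1) (sg rho (symH k)) t - k ^+ 2 * conv (gker 1) (sg rho (symG k)) t.
Proof.
move=> t0; have c1 := conv_ml_symbol rho01 M0 M0 (useq1_bd k al0) sig0 t0.
have c2 := conv_ml_symbol rho01 M0 M0 (useq1_bd k al0) ltr01 t0.
have c4 := conv_ml_symbol rho01 ler01 M0 (useq_bd k al0) ltr01 t0.
have c3 := cvg_comp (addn^~ 1%N) _ (cvg_addnr 1) c1.
apply: (cvg_unique (@Rhausdorff R) c3).
have c5 : 1 - 2 * al * (\sum_(0 <= n < N) (useq al k n.+1 * gk (1 + rho * n.+1%:R) t)) -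
   k ^+ 2 * (\sum_(0 <= n < N) (useq al k n * gk (1 + rho * n.+1%:R) t)) @[N --> \oo] -->
  1 - 2 * al * conv (gker 1) (sg rho (symH k)) t - k ^+ 2 * conv (gker 1) (sg rho (symG k)) t.
  apply: cvgB; last by apply: cvgM; [exact: cvg_cst|exact: c4].
  apply: cvgB; first exact: cvg_cst.
  by apply: cvgM; [exact: cvg_cst|exact: c2].
apply: cvg_trans c5; apply: near_eq_cvg; near=> N.
rewrite /= addn1 big_nat_recl//= !mulr_sumr mul1r.
have -> : gk (1 - rho + rho * 1%:R) t = 1.
  by rewrite mulr1 subrK /gk subrr powRr0 Gamma1 divr1.
rewrite -addrA -opprD -big_split/= -sumrN; congr (_ + _); apply: eq_bigr => n _.
have -> : 1 - rho + rho * n.+2%:R = 1 + rho * n.+1%:R by rewrite -[n.+2]addn1 natrD; ring.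
by ring.
Unshelve. all: by end_near. Qed.

End onemode.

Lemma abs_pow_surj z : 0 < z -> exists2 t, 0 < t & z = t `^ rho.
Proof.
move=> z0; exists (z `^ rho^-1); first exact: powR_gt0.
by rewrite -powRrM mulVf ?gt_eqF// powRr1// ltW.
Qed.

Lemma abs_pow_gt0 t : t != 0 -> 0 < abs_pow rho t.
Proof. by move=> t0; rewrite powR_gt0// normr_gt0. Qed.

(** The bounds on P', P and the primitive of P pass through the subordination
    integral. The last one has gained k^-2 but lost the factor t^rho. At t = 0 the
    symbols have explicit values. *)
Lemma mode_bounds : exists2 C, 0 < C & forall k t, 1 <= k ->
  [/\ `|symH k t| <= C, k * `|symG k t| <= C & k ^+ 2 * (abs_pow rho t * `|symG k t|) <= C].
Proof.
have [A0 A00 Ale] := kanter_le rho01.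
have G0 : 0 < Gamma (2 - rho) by apply: Gamma_gt0; rewrite subr_gt0 (lt_trans rho1)// ltr1n.
pose C1 := rho * (A0 * Gamma (2 - rho)).
pose C2 := rho * (2 * (2 + 2 * al) / (1 - rho)).
have C10 : 0 <= C1 by rewrite !mulr_ge0// ltW.
have C20 : 0 <= C2.
  by rewrite mulr_ge0 ?(ltW rho0)// divr_ge0 ?(ltW sig0)// mulr_ge0// addr_ge0// mulr_ge0// ltW.
have r0 := rgamma_ge0 rho01 0.
exists (C1 + C2 + rgamma rho 0 + 1); first by rewrite ltr_wpDl// !addr_ge0.
move=> k t k1; have k0 : 0 < k := lt_le_trans ltr01 k1.
pose M := 2 * al + k ^+ 2 + 1.
have M0 : 0 <= M by rewrite /M addr_ge0// addr_ge0 ?sqr_ge0// mulr_ge0// ltW.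
have ml_series0 (v : nat -> R) : ml_series rho v 0 = v 0%N * rgamma rho 0.
  apply: tsum_eq; apply/cvgrPdist_lt => e e0; exists 1%N => // -[//|n] _ /=.
  rewrite /series/= big_nat_recl// expr0 mulr1 big1 ?addr0 ?subrr ?normr0//.
  by move=> i _; rewrite exprS mul0r mulr0.
have [->|tn] := eqVneq t 0.
  rewrite /symH /symG /ml_symbol zr0// !ml_series0 /= mul1r mul0r !normr0 !(mul0r, mulr0).
  have h : 0 <= C1 + C2 + rgamma rho 0 + 1 by rewrite !addr_ge0.
  split=> //; rewrite ger0_norm//; lra.
have z0 := abs_pow_gt0 tn; have [s s0 zE] := abs_pow_surj z0.
rewrite /symH /symG /ml_symbol zE.
have thr th : `]0, pi[%classic th -> 0 < kanter rho th by rewrite in_Ioo => ti; exact: kanter_gt0.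
have thA th : `]0, pi[%classic th -> kanter rho th <= A0 by rewrite in_Ioo; exact: Ale.
have ta th : `]0, pi[%classic th -> 0 < s `^ rho * kanter rho th.
  by move=> ti; rewrite mulr_gt0 ?powR_gt0// thr.
have gen (v : nat -> R) (K B : R) : 0 <= K -> geom_bd K M v ->
    (forall x, 0 <= x -> `|egf v x| <= B) -> `|ml_series rho v (s `^ rho)| <= C1 * B.
  move=> K0 vM vB; have B0 : 0 <= B by apply: le_trans (vB 0 (lexx _)).
  have -> : C1 * B = rho * (A0 * (B * Gamma (2 - rho))) by rewrite /C1; ring.
  apply: (subord_bound rho01 K0 M0 vM s0) => th ti.
  rewrite normrM (gtr0_norm (thr _ ti)); apply: ler_pM => //; [exact/ltW/thr|exact: thA|].
  exact: (gamma_mean_bound rho01 K0 M0 vM (ltW (ta _ ti))).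
have b1 := gen _ _ _ M0 (useq1_bd k al0) (U1_le k al0).
have b2 := gen _ _ _ ler01 (useq_bd k al0) (U_le al0 k1).
have b3 : `|ml_series rho (useq al k) (s `^ rho)| <=
    rho * (2 * ((2 + 2 * al) / k ^+ 2) / ((1 - rho) * s `^ rho)).
  apply: (subord_bound rho01 ler01 M0 (useq_bd k al0) s0) => th ti.
  have h := gamma_mean_ibp rho01 ler01 M0 (useq_bd k al0) (ta _ ti) (hd_V k al0) (V_le al0 k1).
  rewrite normrM (gtr0_norm (thr _ ti)).
  apply: le_trans (ler_wpM2l (ltW (thr _ ti)) h) _.
  have a1 := lt0r_neq0 (thr _ ti); have a2 := lt0r_neq0 (powR_gt0 rho s0).
  have a3 := lt0r_neq0 sig0; have a4 := lt0r_neq0 k0.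
  move: (kanter rho th) (s `^ rho) (1 - rho) a1 a2 a3 => x y w xn yn wn.
  by rewrite le_eqVlt; apply/orP; left; apply/eqP; field; rewrite xn yn wn a4.
split.
- by apply: (le_trans b1); rewrite mulr1; lra.
- rewrite mulrC -ler_pdivlMr//; apply: (le_trans b2).
  by rewrite ler_wpM2r ?invr_ge0 ?(ltW k0)//; lra.
- have y0 : 0 < s `^ rho := powR_gt0 rho s0.
  have h : s `^ rho * `|ml_series rho (useq al k) (s `^ rho)| <= C2 / k ^+ 2.
    rewrite mulrC -ler_pdivlMr//; apply: (le_trans b3).
    have a2 := lt0r_neq0 y0; have a3 := lt0r_neq0 sig0; have a4 := lt0r_neq0 k0.
    rewrite /C2; move: (s `^ rho) (1 - rho) a2 a3 => y w yn wn.
    by rewrite le_eqVlt; apply/orP; left; apply/eqP; field; rewrite yn wn a4.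
  rewrite mulrC -ler_pdivlMr ?exprn_gt0//; apply: (le_trans h).
  by rewrite ler_wpM2r ?invr_ge0 ?exprn_ge0 ?(ltW k0)//; lra.
Qed.

(** If k t^rho >= 1 the second bound is used, otherwise the first one. *)
Lemma symG_interp (C e k t : R) : 0 < e < 1 -> 1 <= k -> t != 0 ->
  k * `|symG k t| <= C -> k ^+ 2 * (abs_pow rho t * `|symG k t|) <= C ->
  k ^+ 2 * `|symG k t| <= C * k `^ e * (abs_pow rho t) `^ (e - 1).
Proof.
move=> /andP[e0 e1] k1 tn h1 h2; have k0 : 0 < k := lt_le_trans ltr01 k1.
have z0 := abs_pow_gt0 tn.
have C0 : 0 <= C by apply: le_trans h1; rewrite mulr_ge0// ltW.
set z := abs_pow rho t in z0 h2 *; set q := `|symG k t| in h1 h2 *.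
have [kz|kz] := leP 1 (k * z).
  have : k ^+ 2 * q <= C * z^-1 by rewrite ler_pdivlMr// mulrAC -mulrA.
  move=> h; apply: (le_trans h); rewrite -mulrA ler_wpM2l//.
  have -> : z^-1 = z `^ (- e) * z `^ (e - 1).
    rewrite -powRD; last by rewrite (gt_eqF z0) implybT.
    by rewrite (_ : - e + (e - 1) = -1) ?powR_inv1 ?(ltW z0)//; ring.
  rewrite ler_wpM2r ?powR_ge0// powRN -[leLHS]mul1r ler_pdivrMr ?(powR_gt0 e z0)//.
  rewrite -powRM ?(ltW k0) ?(ltW z0)//.
  have : 1 `^ e <= (k * z) `^ e; last by rewrite powR1.
  by apply: ge0_ler_powR; rewrite ?nnegrE ?(ltW e0)// mulr_ge0 ?(ltW k0) ?(ltW z0).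
have : k ^+ 2 * q <= C * k by rewrite expr2 -mulrA mulrC ler_wpM2r// ltW.
move=> h; apply: (le_trans h); rewrite -mulrA ler_wpM2l//.
have e1' : 0 <= 1 - e by rewrite subr_ge0 ltW.
have kE : k = k `^ e * k `^ (1 - e).
  by rewrite -powRD ?[e + _]addrC ?subrK ?powRr1 ?(ltW k0)// (gt_eqF k0) implybT.
rewrite {1}kE ler_wpM2l ?powR_ge0// -[e - 1]opprB powRN -[leRHS]mul1r ler_pdivlMr ?(powR_gt0 _ z0)//.
rewrite -powRM ?(ltW k0) ?(ltW z0)//.
have : (k * z) `^ (1 - e) <= 1 `^ (1 - e); last by rewrite powR1.
by apply: ge0_ler_powR; rewrite ?nnegrE ?(ltW kz)// mulr_ge0 ?(ltW k0) ?(ltW z0).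
Qed.

End modes.

(** * The convolution algebra and the Duhamel formula *)

Section algebra.
Context {R : realType}.
Notation mu := (@lebesgue_measure R).
Implicit Types (k h l : R -> R) (t : R).

(** This class contains the kernels and the solutions, and is closed under
    convolution; on it convolution is associative and commutative. *)
Definition sing k : Prop := exists a q,
  [/\ 0 < a, continuous q & forall t, 0 < t -> k t = sg a q t].

(** The convolution integral converges absolutely. *)
Definition cint k h t : Prop := mu.-integrable `]0, t[ (EFin \o (fun s => k (t - s) * h s)).

Lemma sing_sg (a : R) (q : R -> R) : 0 < a -> continuous q -> sing (sg a q).
Proof. by move=> a0 cq; exists a, q. Qed.

Lemma sing_ext k h : (forall t, 0 < t -> k t = h t) -> sing k -> sing h.
Proof. by move=> e [a [q [a0 cq kE]]]; exists a, q; split=> // t t0; rewrite -e// kE. Qed.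

Lemma sing_cint k h t : sing k -> sing h -> 0 < t -> cint k h t.
Proof.
move=> [a [p [a0 cp kE]]] [b [q [b0 cq hE]]] t0.
apply: (eq_integ _ _ (conv_sg_integrable a0 b0 t0 cp cq)) => // s.
by rewrite in_Ioo => /andP[s0 st]; rewrite kE ?subr_gt0// hE.
Qed.

Lemma sing_conv k h : sing k -> sing h -> sing (conv k h).
Proof.
move=> [a [p [a0 cp kE]]] [b [q [b0 cq hE]]].
exists (a + b), (conv_symbol a b p q); split; first exact: addr_gt0.
  exact: continuous_conv_symbol.
move=> t t0; rewrite -conv_sg//; apply: conv_ext => s /andP[s0 _]; [exact: kE|exact: hE].
Qed.

Lemma convA k h l t : sing k -> sing h -> sing l -> 0 < t ->
  conv (conv k h) l t = conv k (conv h l) t.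
Proof.
move=> [a [p [a0 cp kE]]] [b [q [b0 cq hE]]] [c [r [c0 cr lE]]] t0.
transitivity (conv (conv (sg a p) (sg b q)) (sg c r) t).
  apply: conv_ext => s /andP[s0 _]; last exact: lE.
  by apply: conv_ext => x /andP[x0 _]; [exact: kE|exact: hE].
rewrite (convA_sg a0 b0 c0 t0 cp cq cr); symmetry.
apply: conv_ext => s /andP[s0 _]; first exact: kE.
by apply: conv_ext => x /andP[x0 _]; [exact: hE|exact: lE].
Qed.

Lemma convC k h t : sing k -> sing h -> 0 < t -> conv k h t = conv h k t.
Proof.
move=> [a [p [a0 cp kE]]] [b [q [b0 cq hE]]] t0.
transitivity (conv (sg a p) (sg b q) t).
  by apply: conv_ext => s /andP[s0 _]; [exact: kE|exact: hE].
rewrite (convC_sg a0 b0 t0 cp cq); symmetry.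
by apply: conv_ext => s /andP[s0 _]; [exact: hE|exact: kE].
Qed.

Lemma conv_addr (c : R) k h l t : cint k h t -> cint k l t ->
  conv k (fun s => h s + c * l s) t = conv k h t + c * conv k l t /\
  cint k (fun s => h s + c * l s) t.
Proof.
move=> i1 i2; have E s : k (t - s) * (h s + c * l s) = k (t - s) * h s + c * (k (t - s) * l s).
  by ring.
have i3 := integZ c (measurable_itv _) i2.
split; last by apply: (eq_integ _ _ (integD (measurable_itv _) i1 i3)) => // s _; rewrite E.
rewrite /conv (@eq_Rint R _ _ (fun s => k (t - s) * h s + c * (k (t - s) * l s))); last by move=> s _.
by rewrite (RintD (measurable_itv _) i1 i3) (RintZ c (measurable_itv _) i2).
Qed.

Lemma conv_addl (c : R) k h l t : cint h k t -> cint l k t ->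
  conv (fun s => h s + c * l s) k t = conv h k t + c * conv l k t /\
  cint (fun s => h s + c * l s) k t.
Proof.
move=> i1 i2; have E s : (h (t - s) + c * l (t - s)) * k s = h (t - s) * k s + c * (l (t - s) * k s).
  by ring.
have i3 := integZ c (measurable_itv _) i2.
split; last by apply: (eq_integ _ _ (integD (measurable_itv _) i1 i3)) => // s _; rewrite E.
rewrite /conv (@eq_Rint R _ _ (fun s => h (t - s) * k s + c * (l (t - s) * k s))); last by move=> s _.
by rewrite (RintD (measurable_itv _) i1 i3) (RintZ c (measurable_itv _) i2).
Qed.

Lemma sing_gker (b : R) : 0 < b -> sing (gker b).
Proof. by move=> b0; apply: sing_sg => //; exact: cont_cst. Qed.

Lemma gker1E t : gker 1 t = 1 :> R.
Proof. by rewrite gkerE /gk subrr powRr0 Gamma1 divr1. Qed.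

Lemma conv_lin3 (kk l1 l2 l3 : R -> R) (c1 c2 t : R) :
  cint kk l1 t -> cint kk l2 t -> cint kk l3 t ->
  conv kk (fun s => c1 * l1 s + (c2 * l2 s + l3 s)) t =
  c1 * conv kk l1 t + (c2 * conv kk l2 t + conv kk l3 t) /\
  cint kk (fun s => c1 * l1 s + (c2 * l2 s + l3 s)) t.
Proof.
move=> i1 i2 i3.
have [e2 j2] := conv_addr c2 i3 i2; have [e1 j1] := conv_addr c1 j2 i1.
have E : (fun s => c1 * l1 s + (c2 * l2 s + l3 s)) = (fun s => l3 s + c2 * l2 s + c1 * l1 s).
  by apply/funext => s; ring.
rewrite E; split=> //; rewrite e1 e2.
by move: (conv kk l1 t) (conv kk l2 t) (conv kk l3 t) => x y z; ring.
Qed.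

(** Both identities result from the two equations of the kernels by moving g onto G
    and H. They are stated for arbitrary functions, so that the concrete kernels
    stay folded in the computation. *)
Lemma mode_algebra (g one G H F : R -> R) (c m a0 a1 t : R) :
  sing g -> sing one -> sing G -> sing H -> sing F -> 0 < t ->
  (forall s, 0 < s -> one s = 1) ->
  (forall s, 0 < s -> conv g G s = conv one H s) ->
  (forall s, 0 < s -> conv g H s = 1 - c * conv one H s - m * conv one G s) ->
  conv g (fun s => (a0 + c * a1) * G s + (a1 * H s + conv G F s)) t =
    a1 + conv one (fun s => a0 * H s + (- (m * a1) * G s + conv H F s)) t /\
  conv g (fun s => a0 * H s + (- (m * a1) * G s + conv H F s)) t =
    a0 + conv one (fun s => - c * (a0 * H s + (- (m * a1) * G s + conv H F s)) +
      (- m * ((a0 + c * a1) * G s + (a1 * H s + conv G F s)) + F s)) t.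
Proof.
move=> sg1 s1 sG sH sF t0 E1 gG gH.
have sGF := sing_conv sG sF; have sHF := sing_conv sH sF.
have s1H := sing_conv s1 sH; have s1G := sing_conv s1 sG.
have [L1 _] := conv_lin3 (a0 + c * a1) a1 (sing_cint sg1 sG t0) (sing_cint sg1 sH t0) (sing_cint sg1 sGF t0).
have [L2 iZ] := conv_lin3 a0 (- (m * a1)) (sing_cint s1 sH t0) (sing_cint s1 sG t0) (sing_cint s1 sHF t0).
have [L3 _] := conv_lin3 a0 (- (m * a1)) (sing_cint sg1 sH t0) (sing_cint sg1 sG t0) (sing_cint sg1 sHF t0).
have [L4 iY] := conv_lin3 (a0 + c * a1) a1 (sing_cint s1 sG t0) (sing_cint s1 sH t0) (sing_cint s1 sGF t0).
have [L5 _] := conv_lin3 (- c) (- m) iZ iY (sing_cint s1 sF t0).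
have gGF : conv g (conv G F) t = conv one (conv H F) t.
  rewrite -(convA sg1 sG sF t0) -(convA s1 sH sF t0).
  by apply: conv_ext => s /andP[s0 _]; [exact: gG|].
have gHF : conv g (conv H F) t =
   conv one F t - c * conv one (conv H F) t - m * conv one (conv G F) t.
  rewrite -(convA sg1 sH sF t0).
  have i1 := sing_cint s1 sF t0; have i2 := sing_cint s1H sF t0; have i3 := sing_cint s1G sF t0.
  have [e2 j2] := conv_addl (- c) i1 i2; have [e1 _] := conv_addl (- m) j2 i3.
  transitivity (conv (fun s => one s + - c * conv one H s + - m * conv one G s) F t).
    apply: conv_ext => s /andP[s0 _]; last by [].
    by rewrite gH// E1//; ring.
  by rewrite e1 e2 (convA s1 sH sF t0) (convA s1 sG sF t0); ring.
split.
  rewrite L1 L2 (gG t t0) (gH t t0) gGF.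
  by move: (conv one H t) (conv one G t) (conv one (conv H F) t) => x y v; ring.
rewrite L5 L2 L3 L4 (gG t t0) (gH t t0) gHF.
move: (conv one H t) (conv one G t) (conv one (conv H F) t) (conv one F t) (conv one (conv G F) t).
by move=> x y v b d; ring.
Qed.

End algebra.

Section onemode.
Context {R : realType}.
Notation mu := (@lebesgue_measure R).
Variables rho al : R.
Hypothesis rho01 : 0 < rho < 1.
Hypothesis al0 : 0 < al.
Let rho0 : 0 < rho. Proof. by case/andP: rho01. Qed.
Let rho1 : rho < 1. Proof. by case/andP: rho01. Qed.
Let sig0 : 0 < 1 - rho. Proof. by rewrite subr_gt0. Qed.

Variables (k a0 a1 : R) (f : R -> R).
Hypothesis cf : continuous f.

(** Symbols of the coefficients of u, of its first and of its second fractional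
    derivative, for initial coefficients a1 and a0 and source symbol f. *)
Definition ysym (t : R) : R :=
  a0 * symG rho al k t + a1 * (symH rho al k t + 2 * al * symG rho al k t) +
  abs_pow rho t * conv_symbol rho rho (symG rho al k) f t.
Definition zsym (t : R) : R :=
  a0 * symH rho al k t - k ^+ 2 * a1 * symG rho al k t + abs_pow rho t * conv_symbol rho rho (symH rho al k) f t.
Definition wsym (t : R) : R := f t - 2 * al * zsym t - k ^+ 2 * ysym t.

Let cp : continuous (symG rho al k). Proof. exact: continuous_symG. Qed.
Let ch : continuous (symH rho al k). Proof. exact: continuous_symH. Qed.

Lemma continuous_ysym : continuous ysym.
Proof.
move=> t; apply: cvgD; last first.
  by apply: cvgM; [exact: continuous_abs_pow|exact: continuous_conv_symbol].
apply: cvgD; first by apply: cvgM; [exact: cvg_cst|exact: cp].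
apply: cvgM; first exact: cvg_cst.
by apply: cvgD; [exact: ch|apply: cvgM; [exact: cvg_cst|exact: cp]].
Qed.

Lemma continuous_zsym : continuous zsym.
Proof.
move=> t; apply: cvgD; last first.
  by apply: cvgM; [exact: continuous_abs_pow|exact: continuous_conv_symbol].
by apply: cvgB; apply: cvgM; [exact: cvg_cst|exact: ch|exact: cvg_cst|exact: cp].
Qed.

Lemma continuous_wsym : continuous wsym.
Proof.
move=> t; apply: cvgB; last by apply: cvgM; [exact: cvg_cst|exact: continuous_ysym].
by apply: cvgB; [exact: cf|apply: cvgM; [exact: cvg_cst|exact: continuous_zsym]].
Qed.

Notation G := (sg rho (symG rho al k)).
Notation H := (sg rho (symH rho al k)).
Notation F := (sg rho f).
Notation g := (gker (1 - rho)).
Notation one := (gker (1 : R)).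

Let sG : sing G. Proof. exact: sing_sg. Qed.
Let sH : sing H. Proof. exact: sing_sg. Qed.
Let sF : sing F. Proof. exact: sing_sg. Qed.
Let sg' : sing g. Proof. exact: sing_gker. Qed.
Let s1 : sing one. Proof. exact: sing_gker. Qed.

Lemma sg_abs_pow_conv (p : R -> R) t : 0 < t -> continuous p ->
  sg rho (fun t => abs_pow rho t * conv_symbol rho rho p f t) t = conv (sg rho p) F t.
Proof.
move=> t0 cpp; rewrite conv_sg// /sg abs_pow_gt0E// mulrA -powRD; last by rewrite (gt_eqF t0) implybT.
by congr (_ `^ _ * _); ring.
Qed.

Lemma sg_ysym t : 0 < t -> sg rho ysym t = (a0 + 2 * al * a1) * G t + (a1 * H t + conv G F t).
Proof.
move=> t0; rewrite -sg_abs_pow_conv// /sg /ysym; ring.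
Qed.

Lemma sg_zsym t : 0 < t -> sg rho zsym t = a0 * H t + (- (k ^+ 2 * a1) * G t + conv H F t).
Proof.
move=> t0; rewrite -sg_abs_pow_conv// /sg /zsym; ring.
Qed.

Let alg t (t0 : 0 < t) := mode_algebra a0 a1 sg' s1 sG sH sF t0 (fun s _ => gker1E s)
  (fun s s0 => conv_g_symG rho01 al0 k s0) (fun s s0 => conv_g_symH rho01 al0 k s0).

Lemma mode_first t : 0 < t -> conv g (sg rho ysym) t = a1 + conv one (sg rho zsym) t.
Proof.
move=> t0; have [e _] := alg t0; transitivity (a1 + conv one (fun s => a0 * H s + (- (k ^+ 2 * a1) * G s + conv H F s)) t).
  by rewrite -e; apply: conv_ext => s /andP[s0 _]; [|exact: sg_ysym].
congr (_ + _); apply: conv_ext => s /andP[s0 _]; first by [].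
by symmetry; exact: sg_zsym.
Qed.

Lemma mode_second t : 0 < t -> conv g (sg rho zsym) t = a0 + conv one (sg rho wsym) t.
Proof.
move=> t0; have [_ e] := alg t0.
transitivity (conv g (fun s => a0 * H s + (- (k ^+ 2 * a1) * G s + conv H F s)) t).
  by apply: conv_ext => s /andP[s0 _]; [|exact: sg_zsym].
rewrite e; congr (_ + _); apply: conv_ext => s /andP[s0 _]; first by [].
by rewrite -(sg_ysym s0) -(sg_zsym s0) /sg /wsym; ring.
Qed.

End onemode.

(** * Uniform convergence of the solution series *)

Section tails.
Context {R : realType}.
Notation mu := (@lebesgue_measure R).
Notation U01 := (`]0, 1[%classic : set R).

(** Summation is exchanged with the integral before estimating: the coefficients of
    the source are only summable together, at a fixed time. *)
Lemma sum_conv_symbol_le (a b be t Q S : R) (c e : nat -> R) (p f : nat -> R -> R) (N m : nat) :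
  0 < a -> 0 < b -> 0 < be -> 0 <= Q ->
  (forall n, continuous (p n)) -> (forall n, continuous (f n)) ->
  (forall n, 0 <= c n) ->
  (forall n s, (N <= n < m)%N -> 0 < s < 1 ->
     betaf a b 1 s * (c n * `|p n (t * (1 - s))|) <= Q * e n * betaf be b 1 s) ->
  (forall x, \sum_(N <= n < m) `|e n * f n x| <= S) ->
  \sum_(N <= n < m) (c n * `|conv_symbol a b (p n) (f n) t|) <=
    Q * S * \int[mu]_(s in U01) betaf be b 1 s.
Proof.
move=> a0 b0 be0 Q0 cp cf c0 pe fS.
have bb := betaf_integrable be0 b0 ltr01.
pose F n s := Q * betaf be b 1 s * `|e n * f n (t * s)|.
have cft n : continuous (fun s => `|e n * f n (t * s)|).
  move=> s; apply: (@cvg_norm _ R); apply: cvgM; first exact: cvg_cst.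
  by apply: (cont_compR (g := fun x => t * x) _ (cf n)); exact: cont_Ml.
have iF n : mu.-integrable U01 (EFin \o F n).
  have [M M0 hM] := continuous_bounded 1 (cft n).
  apply: (@integ_mul_bounded R _ _ _ M) => //; first exact: integZ.
    exact: measurable_continuous.
  by move=> s; rewrite in_Ioo => /andP[s0 s1]; apply: hM; rewrite gtr0_norm// ltW.
apply: (@le_trans _ _ (\sum_(N <= n < m) \int[mu]_(s in U01) F n s)).
  rewrite !big_nat; apply: ler_sum => n nI.
  have -> : c n * `|conv_symbol a b (p n) (f n) t| = `|c n * conv_symbol a b (p n) (f n) t|.
    by rewrite normrM (ger0_norm (c0 n)).
  have cpt : continuous (fun s : R => p n (t * (1 - s))) by apply: cont_compR (cp n); exact: cont_MB.
  have cqt : continuous (fun s : R => f n (t * s)) by apply: cont_compR (cf n); exact: cont_Ml.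
  have [Mp Mp0 hp] := continuous_bounded 1 cpt; have [Mq Mq0 hq] := continuous_bounded 1 cqt.
  have mpq : measurable_fun U01 (fun s => p n (t * (1 - s)) * f n (t * s)).
    by apply: measurable_funM; exact: measurable_continuous.
  have i1 : mu.-integrable U01 (EFin \o (fun s => betaf a b 1 s * (p n (t * (1 - s)) * f n (t * s)))).
    apply: (@integ_mul_bounded _ _ _ _ (Mp * Mq)) => //; first exact: betaf_integrable.
    move=> s; rewrite in_Ioo => /andP[s0 s1]; rewrite normrM ler_pM//.
      by apply: hp; rewrite gtr0_norm// ltW.
    by apply: hq; rewrite gtr0_norm// ltW.
  rewrite /conv_symbol -(RintZ _ (measurable_itv _) i1).
  apply: le_norm_Rint => //.
    by have := integZ (c n) (measurable_itv _) i1; move=> /integrableP[/measurable_EFinP].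
  move=> s; rewrite in_Ioo => sI.
  have b1 : 0 <= betaf a b 1 s by rewrite mulr_ge0 ?powR_ge0.
  have -> : c n * (betaf a b 1 s * (p n (t * (1 - s)) * f n (t * s))) =
     betaf a b 1 s * (c n * p n (t * (1 - s))) * f n (t * s) by ring.
  rewrite normrM normrM (ger0_norm b1) normrM (ger0_norm (c0 n)).
  have en : Q * betaf be b 1 s * `|e n * f n (t * s)| >= Q * e n * betaf be b 1 s * `|f n (t * s)|.
    rewrite normrM; have : e n <= `|e n| by exact: ler_norm.
    move=> h; have hh : 0 <= Q * betaf be b 1 s * `|f n (t * s)|.
      by rewrite !mulr_ge0// ?powR_ge0.
    have := ler_wpM2l hh h; move: (betaf be b 1 s) `|f n _| `|e n| => x y z; lra.
  apply: le_trans en; apply: ler_wpM2r => //; exact: pe.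
rewrite -(integ_sum_n N m (measurable_itv _) iF).2 -RintZ//.
apply: le_Rint => //; [exact: (integ_sum_n N m (measurable_itv _) iF).1|exact: integZ|].
move=> s _; rewrite /F -mulr_sumr (_ : Q * S * _ = Q * betaf be b 1 s * S); last by ring.
by apply: ler_wpM2l; [rewrite !mulr_ge0// powR_ge0|exact: fS].
Qed.

Variables rho al T eps : R.
Hypothesis rho01 : 0 < rho < 1.
Hypothesis al0 : 0 < al.
Hypothesis T0 : 0 < T.
Hypothesis eps01 : 0 < eps < 1.
Let rho0 : 0 < rho. Proof. by case/andP: rho01. Qed.

Notation y a0 a1 f := (fun n : nat => ysym rho al n%:R (a0 n) (a1 n) (f n)).
Notation z a0 a1 f := (fun n : nat => zsym rho al n%:R (a0 n) (a1 n) (f n)).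

(** For the initial data n^2 a0 and n^2 a1 are summable and the symbols of G and H
    bounded. In G * F the interpolated bound on n^2 G costs n^eps, which the
    coefficients of the source can afford, and leaves an integrable singularity. *)
Lemma coef_tails : exists2 C, 0 < C &
  forall (a0 a1 : nat -> R) (f : nat -> R -> R) (tau : nat -> R) (C0 C1 Cf : R),
  0 <= C0 -> 0 <= C1 -> 0 <= Cf -> (forall N, 0 <= tau N) ->
  a0 0%N = 0 -> a1 0%N = 0 -> (forall t, f 0%N t = 0) -> (forall n, continuous (f n)) ->
  tails (fun n => n%:R ^+ 2 * a0 n) (fun N => C0 * tau N) ->
  tails (fun n => n%:R ^+ 2 * a1 n) (fun N => C1 * tau N) ->
  (forall t, tails (fun n => n%:R `^ eps * f n t) (fun N => Cf * tau N)) ->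
  forall t, 0 <= t <= T ->
  [/\ tails (fun n => n%:R ^+ 2 * y a0 a1 f n t) (fun N => C * (C0 + C1 + Cf) * tau N),
      tails (fun n => z a0 a1 f n t) (fun N => C * (C0 + C1 + Cf) * tau N) &
      tails (f^~ t) (fun N => C * (C0 + C1 + Cf) * tau N)].
Proof.
have [C C0 hC] := mode_bounds rho01 al0.
have /andP[e0 e1] := eps01.
have re0 : 0 < rho * eps by rewrite mulr_gt0.
pose B1 := \int[mu]_(s in U01) betaf (rho * eps) rho 1 s.
pose B2 := \int[mu]_(s in U01) betaf rho rho 1 s.
have B10 : 0 <= B1 by apply: Rintegral_ge0 => s _; rewrite mulr_ge0 ?powR_ge0.
have B20 : 0 <= B2 by apply: Rintegral_ge0 => s _; rewrite mulr_ge0 ?powR_ge0.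
pose D := 1 + C + 2 * al * C + T `^ (rho * eps) * C * B1 + T `^ rho * C * B2.
have D1 : 0 <= 2 * al * C by rewrite !mulr_ge0// ltW.
have D2 : 0 <= T `^ (rho * eps) * C * B1 by rewrite !mulr_ge0 ?powR_ge0// ltW.
have D3 : 0 <= T `^ rho * C * B2 by rewrite !mulr_ge0 ?powR_ge0// ltW.
exists D; first by rewrite /D; lra.
move=> a0 a1 f tau c0 c1 cf c00 c10 cf0 tau0 a00 a10 f0 cfn ta0 ta1 tf t /andP[t0 tT].
have cp n : continuous (symG rho al n%:R) by exact: continuous_symG.
have ch n : continuous (symH rho al n%:R) by exact: continuous_symH.
have n1 n : (1 : R) <= n.+1%:R by rewrite ler1n.
(* the factor t^rho of the Duhamel term absorbs the singularity of the estimate at t = 0 *)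
have duhG N m : \sum_(N <= n < m) (n%:R ^+ 2 * (abs_pow rho t * `|conv_symbol rho rho (symG rho al n%:R) (f n) t|)) <=
    T `^ (rho * eps) * C * B1 * (cf * tau N).
  have cft : 0 <= cf * tau N by rewrite mulr_ge0.
  have [->|tn] := eqVneq t 0.
    rewrite zr0// big1 => [|n _]; last by rewrite mul0r mulr0.
    exact: mulr_ge0 D2 cft.
  have tp : 0 < t by rewrite lt_neqAle eq_sym tn.
  have h := @sum_conv_symbol_le rho rho (rho * eps) t (C * t `^ (rho * (eps - 1))) (cf * tau N)
    (fun n => n%:R ^+ 2) (fun n => n%:R `^ eps) (fun n => symG rho al n%:R) f N m rho0 rho0 re0.
  have {}h : \sum_(N <= n < m) (n%:R ^+ 2 * `|conv_symbol rho rho (symG rho al n%:R) (f n) t|) <=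
      C * t `^ (rho * (eps - 1)) * (cf * tau N) * B1.
    apply: h => //.
    - by rewrite mulr_ge0 ?powR_ge0// ltW.
    - move=> [|n] s _ /andP[s0 s1].
        rewrite expr0n /= mul0r mulr0 mulr_ge0//; last by rewrite mulr_ge0 ?powR_ge0.
        by rewrite !mulr_ge0 ?powR_ge0// ltW.
      have u0 : 0 < t * (1 - s) by rewrite mulr_gt0// subr_gt0.
      have [_ b2 b3] := hC _ (t * (1 - s)) (n1 n).
      have := symG_interp eps01 (n1 n) (lt0r_neq0 u0) b2 b3.
      rewrite abs_pow_gt0E// => b4.
      have bb : 0 <= betaf rho rho 1 s by rewrite mulr_ge0 ?powR_ge0.
      apply: (le_trans (ler_wpM2l bb b4)).
      have s1' : 0 < 1 - s by rewrite subr_gt0.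
      rewrite -powRrM powRM ?(ltW tp) ?(ltW s1')// /betaf.
      have -> : (1 - s) `^ (rho * eps - 1) = (1 - s) `^ (rho - 1) * (1 - s) `^ (rho * (eps - 1)).
        by rewrite -powRD ?(gt_eqF s1') ?implybT//; congr (_ `^ _); ring.
      by rewrite le_eqVlt; apply/orP; left; apply/eqP; ring.
    - by move=> x; exact: tf.
  have -> : \sum_(N <= n < m) (n%:R ^+ 2 * (abs_pow rho t * `|conv_symbol rho rho (symG rho al n%:R) (f n) t|)) =
     abs_pow rho t * \sum_(N <= n < m) (n%:R ^+ 2 * `|conv_symbol rho rho (symG rho al n%:R) (f n) t|).
    by rewrite mulr_sumr; apply: eq_bigr => n _; rewrite mulrCA.
  apply: (le_trans (ler_wpM2l (abs_pow_ge0 _ _) h)).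
  rewrite abs_pow_gt0E//.
  have -> : t `^ rho * (C * t `^ (rho * (eps - 1)) * (cf * tau N) * B1) = t `^ (rho * eps) * (C * B1 * (cf * tau N)).
    have -> : t `^ (rho * eps) = t `^ rho * t `^ (rho * (eps - 1)).
      by rewrite -powRD ?(gt_eqF tp) ?implybT//; congr (_ `^ _); ring.
    by ring.
  have -> : T `^ (rho * eps) * C * B1 * (cf * tau N) = T `^ (rho * eps) * (C * B1 * (cf * tau N)) by ring.
  rewrite ler_wpM2r//; first by rewrite !mulr_ge0// ltW.
  by apply: ge0_ler_powR; rewrite ?nnegrE ?(ltW re0) ?(ltW T0).
have tf1 x : tails (f^~ x) (fun N => cf * tau N).
  apply: tails_le (tf x) _ => -[|n]; first by rewrite f0 normr0.
  rewrite normrM ler_peMl// ger0_norm ?powR_ge0//.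
  have := @ge0_ler_powR R eps (ltW e0) 1 n.+1%:R; rewrite powR1 !nnegrE; apply => //.
have duhH N m : \sum_(N <= n < m) (abs_pow rho t * `|conv_symbol rho rho (symH rho al n%:R) (f n) t|) <=
    T `^ rho * C * B2 * (cf * tau N).
  have cft : 0 <= cf * tau N by rewrite mulr_ge0.
  have h := @sum_conv_symbol_le rho rho rho t C (cf * tau N)
    (fun n => if n is 0%N then 0 else 1) (fun n => 1) (fun n => symH rho al n%:R) f N m rho0 rho0 rho0.
  have {}h : \sum_(N <= n < m) ((if n is 0%N then 0 else 1) * `|conv_symbol rho rho (symH rho al n%:R) (f n) t|) <=
      C * (cf * tau N) * B2.
    apply: h => //.
    - exact: ltW.
    - by case.
    - move=> [|n] s _ _; have bb : 0 <= betaf rho rho 1 s by rewrite mulr_ge0 ?powR_ge0.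
        by rewrite mul0r mulr0 mulr1 mulr_ge0// ltW.
      have [b1 _ _] := hC _ (t * (1 - s)) (n1 n).
      by rewrite mul1r mulr1 mulrC ler_wpM2r.
    - by move=> x; have := tf1 x N m; under eq_bigr do rewrite -[f _ _]mul1r.
  have z0 : conv_symbol rho rho (symH rho al 0%:R) (f 0%N) t = 0.
    by rewrite /conv_symbol (@eq_Rint R _ _ (fun=> 0)) ?Rint0// => s _; rewrite f0 !mulr0.
  have -> : \sum_(N <= n < m) (abs_pow rho t * `|conv_symbol rho rho (symH rho al n%:R) (f n) t|) =
     abs_pow rho t * \sum_(N <= n < m) ((if n is 0%N then 0 else 1) * `|conv_symbol rho rho (symH rho al n%:R) (f n) t|).
    by rewrite mulr_sumr; apply: eq_bigr => -[|n] _; rewrite ?z0 ?normr0 ?mulr0 ?mul1r.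
  apply: (le_trans (ler_wpM2l (abs_pow_ge0 _ _) h)).
  have -> : T `^ rho * C * B2 * (cf * tau N) = T `^ rho * (C * (cf * tau N) * B2) by ring.
  rewrite ler_wpM2r//; first by rewrite !mulr_ge0// ltW.
  rewrite /abs_pow ger0_norm//.
  by apply: ge0_ler_powR; rewrite ?nnegrE ?(ltW rho0) ?(ltW T0).
have fin (X0 X1 Xf N : R) : 0 <= N -> 0 <= X0 -> X0 <= D -> 0 <= X1 -> X1 <= D -> 0 <= Xf -> Xf <= D ->
    X0 * (c0 * N) + X1 * (c1 * N) + Xf * (cf * N) <= D * (c0 + c1 + cf) * N.
  move=> NN h1 h2 h3 h4 h5 h6.
  have -> : D * (c0 + c1 + cf) * N = D * (c0 * N) + D * (c1 * N) + D * (cf * N) by ring.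
  by apply: lerD; [apply: lerD|]; apply: ler_wpM2r => //; rewrite mulr_ge0.
have C0' := ltW C0.
split=> N m.
- apply: (@le_trans _ _ (\sum_(N <= n < m) (C * `|n%:R ^+ 2 * a0 n| + (C + 2 * al * C) * `|n%:R ^+ 2 * a1 n| +
     n%:R ^+ 2 * (abs_pow rho t * `|conv_symbol rho rho (symG rho al n%:R) (f n) t|)))).
    apply: ler_sum => -[|n] _.
      by rewrite expr0n /= !mul0r normr0 !mulr0 !add0r.
    have [b1 b2 _] := hC _ t (n1 n).
    have b2' : `|symG rho al n.+1%:R t| <= C by apply: le_trans b2; rewrite ler_peMl.
    rewrite /ysym; move: (symG rho al n.+1%:R t) (symH rho al n.+1%:R t) b1 b2' => p h b1 b2'.
    have zr0' := abs_pow_ge0 rho t; move: (abs_pow rho t) zr0' (conv_symbol _ _ _ _ _) => zt zt0 c.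
    move: (n.+1%:R ^+ 2) (exprn_ge0 2 (ler0n R n.+1)) => n2 n20.
    have -> : n2 * (a0 n.+1 * p + a1 n.+1 * (h + 2 * al * p) + zt * c) =
      (n2 * a0 n.+1) * p + (n2 * a1 n.+1) * (h + 2 * al * p) + n2 * (zt * c) by ring.
    apply: (le_trans (ler_normD _ _)); apply: lerD; last first.
      by rewrite normrM (ger0_norm n20) normrM (ger0_norm zt0).
    apply: (le_trans (ler_normD _ _)); apply: lerD.
      by rewrite normrM mulrC ler_wpM2r.
    rewrite normrM mulrC ler_wpM2r// (le_trans (ler_normD _ _))//; apply: lerD => //.
    have a2 : 0 <= 2 * al by rewrite mulr_ge0// ltW.
    by rewrite normrM (ger0_norm a2) ler_wpM2l.
  rewrite !big_split/= -!mulr_sumr.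
  apply: (@le_trans _ _ (C * (c0 * tau N) + (C + 2 * al * C) * (c1 * tau N) + T `^ (rho * eps) * C * B1 * (cf * tau N))).
    apply: lerD; last exact: duhG.
    apply: lerD; apply: ler_wpM2l => //; first exact: addr_ge0.
  by apply: fin => //; rewrite ?addr_ge0//; rewrite /D; lra.
- apply: (@le_trans _ _ (\sum_(N <= n < m) (C * `|n%:R ^+ 2 * a0 n| + C * `|n%:R ^+ 2 * a1 n| +
     abs_pow rho t * `|conv_symbol rho rho (symH rho al n%:R) (f n) t|))).
    apply: ler_sum => -[|n] _.
      rewrite /zsym a00 a10 expr0n /= !(mul0r, mulr0, normr0, oppr0, subr0, add0r).
      by rewrite normrM (ger0_norm (abs_pow_ge0 _ _)).
    have [b1 b2 _] := hC _ t (n1 n).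
    have b2' : `|symG rho al n.+1%:R t| <= C by apply: le_trans b2; rewrite ler_peMl.
    rewrite /zsym; move: (symG rho al n.+1%:R t) (symH rho al n.+1%:R t) b1 b2' => p h b1 b2'.
    have zr0' := abs_pow_ge0 rho t; move: (abs_pow rho t) zr0' (conv_symbol _ _ _ _ _) => zt zt0 c.
    have n20 : 1 <= n.+1%:R ^+ 2 :> R by rewrite exprn_ege1.
    move: (n.+1%:R ^+ 2 : R) n20 => n2 n20.
    apply: (le_trans (ler_normD _ _)); apply: lerD; last first.
      by rewrite normrM (ger0_norm zt0).
    apply: (le_trans (ler_normB _ _)); apply: lerD; last first.
      by rewrite normrM mulrC ler_wpM2r.
    rewrite normrM mulrC; apply: ler_pM => //.
    rewrite normrM ler_peMl// ger0_norm// (le_trans _ n20)//.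
  rewrite !big_split/= -!mulr_sumr.
  apply: (@le_trans _ _ (C * (c0 * tau N) + C * (c1 * tau N) + T `^ rho * C * B2 * (cf * tau N))).
    apply: lerD; last by rewrite mulr_sumr; exact: duhH.
    by apply: lerD; apply: ler_wpM2l.
  by apply: fin => //; rewrite /D; lra.
- apply: (le_trans (tf1 t N m)).
  have -> : cf * tau N = 0 * (c0 * tau N) + 0 * (c1 * tau N) + 1 * (cf * tau N) by ring.
  by apply: fin => //; rewrite /D; lra.
Qed.

End tails.

(** * Continuous extensions from Omega *)

Section plane.
Context {R : realType}.
Notation mu := (@lebesgue_measure R).
Variable T : R.
Hypothesis T0 : 0 < T.

Lemma Omega_barE (x t : R) : Omega_bar T (x, t) <-> 0 <= x <= pi /\ 0 <= t <= T.
Proof. by rewrite /Omega_bar /setX/= !in_itv. Qed.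

Lemma OmegaE (x t : R) : Omega T (x, t) <-> 0 < x < pi /\ 0 < t <= T.
Proof. by rewrite /Omega /setX/= !in_itv. Qed.

Lemma Omega_latE (x t : R) : Omega_lat T (x, t) <-> 0 <= x <= pi /\ 0 < t <= T.
Proof. by rewrite /Omega_lat /setX/= !in_itv. Qed.

Lemma Omega_sub_bar : Omega T `<=` Omega_bar T.
Proof.
move=> [x t] /OmegaE[/andP[x0 xp] /andP[t0 tT]]; apply/Omega_barE.
by rewrite (ltW x0) (ltW xp) (ltW t0) tT.
Qed.

(** A small step from x towards the midpoint leads inside. *)
Lemma inner_seq (b x : R) : 0 < b -> 0 <= x <= b ->
  exists u : nat -> R, (forall n, 0 < u n < b) /\ u @ \oo --> x.
Proof.
move=> b0 /andP[x0 xb].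
pose u n := x + (b / 2 - x) * n.+2%:R^-1.
exists u; split.
  move=> n; rewrite /u.
  have h0 : 0 < (n.+2%:R : R)^-1 by rewrite invr_gt0.
  have h1 : (n.+2%:R : R)^-1 < 1 by rewrite invf_lt1// ltr1n.
  move: (n.+2%:R^-1 : R) h0 h1 => e h0 h1.
  have -> : x + (b / 2 - x) * e = (1 - e) * x + e * (b / 2) by ring.
  have p1 : 0 <= (1 - e) * x by rewrite mulr_ge0// subr_ge0 ltW.
  have p2 : 0 < e * (b / 2) by rewrite mulr_gt0// divr_gt0.
  have p3 : (1 - e) * x <= (1 - e) * b by rewrite ler_wpM2l// subr_ge0 ltW.
  by apply/andP; split; [lra|nra].
rewrite /u -[X in _ --> X]addr0; apply: cvgD; first exact: cvg_cst.
rewrite -[X in _ --> X](mulr0 (b / 2 - x)); apply: cvgM; first exact: cvg_cst.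
have := @cvg_inv_shift R 1; by under eq_fun do rewrite addn1.
Qed.

Lemma cvg_couple (u v : nat -> R) (x t : R) : u @ \oo --> x -> v @ \oo --> t ->
  (u n, v n) @[n --> \oo] --> (x, t).
Proof.
move=> ux vt Q [[A B] /= [Ax Bt] AB].
have uA : \forall n \near \oo, A (u n) := ux _ Ax.
have vB : \forall n \near \oo, B (v n) := vt _ Bt.
by apply: filterS (filterI uA vB) => n [An Bn]; exact: (AB (u n, v n)).
Qed.

(** Omega is dense in its closure, so that [ext] is a limit along a proper filter. *)
Lemma Omega_proper (x t : R) : Omega_bar T (x, t) -> ProperFilter (within (Omega T) (nbhs (x, t))).
Proof.
move=> /Omega_barE[xI tI].
have [u [uI ux]] := inner_seq (pi_gt0 R) xI.
have [v [vI vt]] := inner_seq T0 tI.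
apply: Build_ProperFilter_ex => P; rewrite /within/= => HP.
have : \forall n \near \oo, Omega T (u n, v n) -> P (u n, v n).
  have c : (u n, v n) @[n --> \oo] --> (x, t) := cvg_couple ux vt.
  exact: c HP.
move=> [n _ /(_ n (leqnn n))] H; exists (u n, v n); apply: H; apply/OmegaE; split=> //.
by have /andP[-> /ltW ->] := vI n.
Qed.

Lemma ext_eq (h hb : R -> R -> R) : continuous_on (Omega_bar T) hb ->
  (forall x t, Omega T (x, t) -> h x t = hb x t) ->
  forall x t, Omega_bar T (x, t) -> ext T h x t = hb x t.
Proof.
move=> /subspace_continuousP cb hh x t xt.
have PF := Omega_proper xt.
apply: cvg_lim; first exact: Rhausdorff.
have c := cb _ xt.
have c2 : hb p.1 p.2 @[p --> within (Omega T) (nbhs (x, t))] --> hb x t.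
  apply: cvg_trans c; apply: cvg_app; apply: within_subset; exact: Omega_sub_bar.
apply: cvg_trans c2; apply: near_eq_cvg; near=> p.
have op : Omega T p by near: p; exact: withinT.
by rewrite -hh//; case: (p) op.
Unshelve. all: by end_near. Qed.

(** A continuous function on the closure is the extension of its restriction. *)
Lemma in_Cbar_of (D : set (R * R)) (h hb : R -> R -> R) :
  continuous_on (Omega_bar T) hb -> Omega T `<=` D -> D `<=` Omega_bar T ->
  (forall x t, D (x, t) -> h x t = hb x t) ->
  in_Cbar T D h /\ (forall x t, Omega_bar T (x, t) -> ext T h x t = hb x t).
Proof.
move=> cb OD DO hh.
have E := ext_eq cb (fun x t o => hh x t (OD _ o)).
split=> //; split; last by move=> x t d; rewrite hh// E//; exact: DO.
apply/subspace_continuousP => -[x t] xt.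
have c := (subspace_continuousP _ _).1 cb _ xt.
have c2 : ext T h p.1 p.2 @[p --> within (Omega_bar T) (nbhs (x, t))] --> hb x t.
  apply: cvg_trans c; apply: near_eq_cvg; near=> p.
  have op : Omega_bar T p by near: p; exact: withinT.
  by rewrite E//; case: (p) op.
by rewrite -(E _ _ xt) in c2; exact: c2.
Unshelve. all: by end_near. Qed.

Lemma Cbar_norm_le (h hb : R -> R -> R) (B : R) :
  (forall x t, Omega_bar T (x, t) -> ext T h x t = hb x t) ->
  (forall x t, Omega_bar T (x, t) -> `|hb x t| <= B) -> Cbar_norm T h <= B.
Proof.
move=> E hB; apply: ge_sup.
  exists `|ext T h 0 0|; exists (0, 0) => //=; apply/Omega_barE.
  by rewrite !lexx (ltW T0) (ltW (pi_gt0 R)).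
by move=> _ [[x t] xt <-] /=; rewrite E// hB.
Qed.

Lemma Omega_lat_sub : Omega_lat T `<=` Omega_bar T.
Proof. by move=> [x t] /Omega_latE[xI /andP[t0 tT]]; apply/Omega_barE; rewrite xI (ltW t0). Qed.

Lemma Omega_sub_lat : Omega T `<=` Omega_lat T.
Proof. by move=> [x t] /OmegaE[/andP[x0 xp] tI]; apply/Omega_latE; rewrite tI (ltW x0) (ltW xp). Qed.

(** At t = T the derivative relative to ]0, T] is one-sided; F continues g beyond T. *)
Lemma derive_on_eq (g F : R -> R) (t l : R) : 0 < t <= T -> has_derive F t l ->
  (forall s, 0 < s <= T -> g s = F s) ->
  derivable_on `]0, T] g t /\ derive_on `]0, T] g t = l.
Proof.
move=> tI dF gF; have /andP[t0 tT] := tI.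
have PF : ProperFilter (within (`]0, T]%classic : set R) t^').
  apply: Build_ProperFilter_ex => P; rewrite /within /dnbhs/= => HP.
  have := HP; rewrite /within/= => /nbhs_ballP [e /= e0 H].
  pose d := Num.min e t / 2.
  have d0 : 0 < d by rewrite divr_gt0// lt_min e0.
  have [de dt] : d < e /\ d < t.
    have h1 : Num.min e t <= e by rewrite ge_min lexx.
    have h2 : Num.min e t <= t by rewrite ge_min lexx orbT.
    by rewrite /d; split; lra.
  exists (t - d); apply: H.
  - by rewrite /ball/= opprB addrC subrK gtr0_norm.
  - by rewrite lt_eqF// gtrBl.
  - by rewrite /= in_itv/= subr_gt0 dt/= lerBlDr (le_trans tT)// lerDl ltW.
have c : diff_quot g t y @[y --> within (`]0, T]%classic : set R) t^'] --> l.
  have c1 : diff_quot F t y @[y --> t^'] --> l.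
    have q := (has_derive_quot _ _ _).1 dF.
    have c2 : (y - t) @[y --> t^'] --> 0^'.
      have cs : (y - t) @[y --> t] --> (0 : R).
        rewrite -(subrr t); apply: cvgB; [exact: cvg_id|exact: cvg_cst].
      move=> P HP.
      have HP' : nbhs (0 : R) [set h | h != 0 -> P h] := HP.
      have H1 : nbhs t [set y | y - t != 0 -> P (y - t)] := cs _ HP'.
      have H2 : nbhs t [set y | y != t -> P (y - t)].
        by apply: filterS H1 => y H yt; apply: H; rewrite subr_eq0.
      exact: H2.
    have := cvg_comp _ _ c2 q; apply: cvg_trans; apply: near_eq_cvg; near=> y.
    by rewrite /= subrK /diff_quot mulrC.
  have c3 : diff_quot F t y @[y --> within (`]0, T]%classic : set R) t^'] --> l.
    by apply: cvg_trans c1; apply: cvg_app; exact: cvg_within.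
  apply: cvg_trans c3; apply: near_eq_cvg; near=> y.
  have yI : `]0, T]%classic y by near: y; exact: withinT.
  by rewrite /diff_quot !gF//; move: yI; rewrite /= in_itv.
split; first by apply/cvg_ex; exists l.
by apply: cvg_lim c; exact: Rhausdorff.
Unshelve. all: by end_near. Qed.

End plane.

(** * Riemann-Liouville derivatives of series *)

Section fractional_step.
Context {R : realType}.
Notation mu := (@lebesgue_measure R).
Variable rho : R.
Hypothesis rho01 : 0 < rho < 1.

Lemma rho_gt0 : 0 < rho. Proof. by case/andP: rho01. Qed.
Lemma rhoC_gt0 : 0 < 1 - rho. Proof. by case/andP: rho01; rewrite subr_gt0. Qed.

Lemma frac_kernel (g : R -> R) (t s : R) :
  gker (1 - rho) (t - s) * g s =
  (Gamma (1 - rho))^-1 * (g s / (t - s) `^ (rho - 1 + 1)).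
Proof.
rewrite /gker /sg subrK (_ : 1 - rho - 1 = - rho); last by ring.
by rewrite powRN; ring.
Qed.

Lemma frac_existsE (g : R -> R) (t : R) :
  frac_int_exists (rho - 1) g t <-> cint (gker (1 - rho)) g t.
Proof.
have G0 : Gamma (1 - rho) != 0 by rewrite gt_eqF// Gamma_gt0// rhoC_gt0.
split=> H.
  apply: (eq_integ _ (fun s _ => esym (frac_kernel g t s))); first exact: measurable_itv.
  by apply: integZ => //; exact: measurable_itv.
have H2 := integZ (Gamma (1 - rho)) (measurable_itv _) H.
apply: (eq_integ _ _ H2); first exact: measurable_itv.
by move=> s _ /=; rewrite frac_kernel mulrA mulfV// mul1r.
Qed.

Lemma frac_intE (g : R -> R) (t : R) : frac_int_exists (rho - 1) g t ->
  frac_int (rho - 1) g t = conv (gker (1 - rho)) g t.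
Proof.
move=> H; rewrite /frac_int /conv opprB -(RintZ _ (measurable_itv _) H).
by apply: eq_Rint => s _; rewrite frac_kernel.
Qed.

Lemma conv_one_cvg0 (q : R -> R) : continuous q ->
  conv (gker 1) (sg rho q) t @[t --> 0^'+] --> (0 : R).
Proof.
move=> cq.
have cc := continuous_conv_symbol ltr01 rho_gt0 (@cont_cst R (Gamma 1)^-1) cq.
have c : abs_pow rho t * conv_symbol 1 rho (fun=> (Gamma 1)^-1) q t @[t --> 0^'+] --> (0 : R).
  rewrite -[X in _ --> X](mul0r (conv_symbol 1 rho (fun=> (Gamma 1)^-1) q 0)).
  apply: cvgM; last by apply: cvg_at_right_filter; exact: cc.
  rewrite -[X in _ --> X](zr0 rho01).
  by apply: cvg_at_right_filter; exact: (continuous_abs_pow rho01).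
apply: cvg_trans c; apply: near_eq_cvg; near=> t.
have t0 : 0 < t by near: t; exact: nbhs_right_gt.
rewrite /gker (conv_sg ltr01 rho_gt0 t0 (@cont_cst R _) cq) /sg abs_pow_gt0E//.
by rewrite (_ : 1 + rho - 1 = rho); last by ring.
Unshelve. all: by end_near. Qed.

(** The fractional integral of p equals A + 1 * t^(rho-1) q, whose derivative is the
    integrand and whose second term vanishes at 0. *)
Lemma RL_step (T A : R) (p q : R -> R) : 0 < T -> continuous q ->
  (forall t, 0 < t <= T -> cint (gker (1 - rho)) p t /\
     conv (gker (1 - rho)) p t = A + conv (gker 1) (sg rho q) t) ->
  [/\ RL_exists rho T p, forall t, 0 < t <= T -> RL rho T p t = sg rho q t &
      frac_int (rho - 1) p t @[t --> 0^'+] --> A].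
Proof.
move=> T0 cq H.
have ex t : 0 < t <= T -> frac_int_exists (rho - 1) p t.
  by move=> tI; apply/frac_existsE; exact: (H t tI).1.
have E t : 0 < t <= T -> frac_int (rho - 1) p t = A + conv (gker 1) (sg rho q) t.
  by move=> tI; rewrite (frac_intE (ex t tI)) (H t tI).2.
have one : (gker 1 : R -> R) = fun=> 1 by apply/funext => s; exact: gker1E.
have D t : 0 < t <= T -> has_derive (fun s => A + conv (gker 1) (sg rho q) s) t (sg rho q t).
  move=> /andP[t0 _]; have := hdD (hd_cst A t) (hd_conv1 rho_gt0 t0 cq).
  by rewrite add0r one.
split.
- by move=> t tI; split; [exact: ex|exact: (derive_on_eq tI (D t tI) E).1].
- by move=> t tI; exact: (derive_on_eq tI (D t tI) E).2.
- have c : A + conv (gker 1) (sg rho q) t @[t --> 0^'+] --> A.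
    rewrite -[X in _ --> X]addr0; apply: cvgD; [exact: cvg_cst|exact: conv_one_cvg0].
  apply: cvg_trans c; apply: near_eq_cvg; near=> t.
  by rewrite E//; apply/andP; split; near: t;
    [exact: nbhs_right_gt|exact: nbhs_right_le].
Unshelve. all: by end_near. Qed.

End fractional_step.

Section sine_series.
Context {R : realType}.
Notation mu := (@lebesgue_measure R).
Variables rho T : R.
Hypothesis rho01 : 0 < rho < 1.
Hypothesis T0 : 0 < T.

(** Symbols are only controlled on [0, T]; composition with this retraction makes
    them continuous on the line without changing them on [0, T]. *)
Definition clamp (t : R) : R := Num.max 0 (Num.min t T).

Lemma clampI t : 0 <= clamp t <= T.
Proof.
rewrite /clamp le_max lexx/= ge_max (ltW T0)/=; by rewrite ge_min lexx orbT.
Qed.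

Lemma clamp_id t : 0 <= t <= T -> clamp t = t.
Proof. by move=> /andP[t0 tT]; rewrite /clamp min_l// max_r. Qed.

Lemma continuous_clamp : continuous clamp.
Proof.
move=> t; apply: (@continuous_max R R (fun=> 0) (fun s : R => Num.min s T) t).
  exact: cvg_cst.
apply: (@continuous_min R R (fun s : R => s) (fun=> T) t); [exact: cvg_id|exact: cvg_cst].
Qed.

Definition ser (c : nat -> R -> R) (x t : R) : R := tsum (fun n => c n t * sin (n%:R * x)).

Variables (c : nat -> R -> R) (tau : nat -> R).
Hypothesis tau0 : tau @ \oo --> 0.
Hypothesis cc : forall n, continuous (c n).
Hypothesis ct : forall t, 0 <= t <= T -> tails (c^~ t) tau.

Lemma ser_bound x t : 0 <= t <= T -> `|ser c x t| <= tau 0%N.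
Proof. by move=> tI; apply: tails_norm => //; apply: tails_sin; exact: ct. Qed.

Lemma ser_cvg x t : 0 <= t <= T -> series (fun n => c n t * sin (n%:R * x)) @ \oo --> ser c x t.
Proof. by move=> tI; apply: (tails_cvg (tau := tau)) => //; apply: tails_sin; exact: ct. Qed.

Lemma ser_continuous : continuous_on (Omega_bar T) (ser c).
Proof.
apply/subspace_continuousP => -[x t] xt /=.
have /Omega_barE[xI tI] := xt.
pose F := within (Omega_bar T) (nbhs (x, t)).
have FF : Filter F by exact: within_filter.
have cF : p @[p --> F] --> (x, t) by exact: cvg_within.
have c1 : p.1 @[p --> F] --> x.
  by apply: cvg_comp cF _; exact: cvg_fst.
have c2 : p.2 @[p --> F] --> t.
  by apply: cvg_comp cF _; exact: cvg_snd.
apply: (@tannery R (R * R)%type F FF (fun n p => c n p.2 * sin (n%:R * p.1))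
   (fun n => c n t * sin (n%:R * x)) tau) => //.
- near=> p; apply: tails_sin; apply: ct.
  have : Omega_bar T p by near: p; exact: withinT.
  by case: (p) => y s /Omega_barE[].
- by apply: tails_sin; exact: ct.
- move=> n; apply: cvgM; first by apply: (cvg_cont_comp c2); exact: cc.
  by apply: (@cvg_cont_comp R _ F FF _ (fun y => sin (n%:R * y)) x c1); exact: continuous_sinM.
Unshelve. all: by end_near. Qed.

Lemma ser_clamp_continuous x : continuous (fun s => ser c x (clamp s)).
Proof.
move=> s.
apply: (@tannery R R (nbhs s) _ (fun n s => c n (clamp s) * sin (n%:R * x))
   (fun n => c n (clamp s) * sin (n%:R * x)) tau) => //.
- near=> p; apply: tails_sin; apply: ct; exact: clampI.
- apply: tails_sin; apply: ct; exact: clampI.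
- move=> n; apply: cvgM; last exact: cvg_cst.
  by apply: (cont_comp (@continuous_clamp s)); exact: cc.
Unshelve. all: by end_near. Qed.

Lemma sg_ser_clamp x s : 0 < s <= T -> sg rho (ser c x) s = sg rho (fun s => ser c x (clamp s)) s.
Proof. by move=> /andP[s0 sT]; rewrite /sg clamp_id// (ltW s0). Qed.

Lemma conv_ser_clamp (k : R -> R) x t : 0 < t <= T ->
  conv k (sg rho (ser c x)) t = conv k (sg rho (fun s => ser c x (clamp s))) t.
Proof.
move=> /andP[t0 tT]; apply: conv_ext; first by [].
by move=> s /andP[s0 st]; apply: sg_ser_clamp; rewrite s0 (le_trans (ltW st) tT).
Qed.

(** Dominated convergence: the partial sums are bounded by tau 0 times s^(rho-1). *)
Lemma conv_ser (b x t : R) : 0 < b -> 0 < t <= T ->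
  cint (gker b) (sg rho (ser c x)) t /\
  series (fun n => conv (gker b) (sg rho (c n)) t * sin (n%:R * x)) @ \oo -->
    conv (gker b) (sg rho (ser c x)) t.
Proof.
move=> b0 /andP[t0 tT].
pose f_ N s := \sum_(0 <= n < N) (sin (n%:R * x) * sg rho (c n) s).
have mf N : measurable_fun (`]0, t[%classic : set R) (f_ N).
  apply: measurable_funTS; rewrite /f_; under eq_fun do rewrite big_mkord.
  apply: measurable_sum => i; apply: measurable_funM; first exact: measurable_cst.
  exact: measurable_sg.
have fE N s : f_ N s = s `^ (rho - 1) * series (fun n => c n s * sin (n%:R * x)) N.
  by rewrite /f_ /series/= big_distrr/=; apply: eq_bigr => n _; rewrite /sg; ring.
have sI s : 0 < s < t -> 0 <= s <= T.
  by move=> /andP[s0 st]; rewrite (ltW s0) (le_trans (ltW st) tT).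
have bf N s : 0 < s < t -> `|f_ N s| <= tau 0%N * s `^ (rho - 1).
  move=> st; rewrite fE normrM ger0_norm ?powR_ge0// mulrC ler_wpM2r ?powR_ge0//.
  apply: le_trans (ler_norm_sum _ _ _) _.
  exact: (tails_sin x (ct (sI s st)) 0%N N).
have cf s : 0 < s < t -> f_ n s @[n --> \oo] --> sg rho (ser c x) s.
  move=> st; under eq_fun do rewrite fE.
  by apply: cvgM; [exact: cvg_cst|exact: ser_cvg (sI s st)].
have [i conv_symbol] := conv_dct b0 (rho_gt0 rho01) t0 (@cont_cst R (Gamma b)^-1) mf bf cf.
split; first exact: i.
apply: cvg_trans conv_symbol; apply: near_eq_cvg; near=> N.
rewrite /series/= /conv.
have ci n : mu.-integrable `]0, t[ (EFin \o (fun s => gker b (t - s) * sg rho (c n) s)).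
  by apply: sing_cint => //; [exact: sing_gker|apply: sing_sg => //; exact: rho_gt0].
have ci2 n := integZ (sin (n%:R * x)) (measurable_itv `]0, t[) (ci n).
have := (integ_sum_n 0 N (measurable_itv `]0, t[) ci2).2.
rewrite (eq_bigr (fun n => (\int[mu]_(s in `]0, t[) (gker b (t - s) * sg rho (c n) s)) * sin (n%:R * x))); last first.
  by move=> n _; rewrite (RintZ _ (measurable_itv `]0, t[) (ci n)) mulrC.
move=> <-; apply: eq_Rint => s _; rewrite /f_ big_distrr/=; apply: eq_bigr => n _; exact: mulrCA.
Unshelve. all: by end_near. Qed.

End sine_series.

(** * The solution *)

Section continuity_on.
Context {R : realType}.
Variables rho T : R.
Hypothesis T0 : 0 < T.

Lemma continuous_on_eq (D : set (R * R)) (h k : R -> R -> R) :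
  (forall x t, D (x, t) -> h x t = k x t) -> continuous_on D k -> continuous_on D h.
Proof.
move=> E /subspace_continuousP ck; apply/subspace_continuousP => -[x t] xt.
have c := ck _ xt.
have c2 : h p.1 p.2 @[p --> within D (nbhs (x, t))] --> k x t.
  apply: cvg_trans c; apply: near_eq_cvg; near=> p.
  have op : D (p.1, p.2) by rewrite -surjective_pairing; near: p; exact: withinT.
  by rewrite (E _ _ op).
by rewrite -(E _ _ xt) in c2; exact: c2.
Unshelve. all: by end_near. Qed.

Lemma continuous_on_sg (q : R -> R -> R) : continuous_on (Omega_bar T) q ->
  continuous_on (Omega T) (fun x => sg rho (q x)).
Proof.
move=> /subspace_continuousP cq; apply/subspace_continuousP => -[x t] xt.
have /OmegaE[_ /andP[t0 _]] := xt.
have c := cq _ (Omega_sub_bar xt).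
pose F := within (Omega T) (nbhs (x, t)).
have FF : Filter F by exact: within_filter.
have cF : p @[p --> F] --> (x, t) by exact: cvg_within.
have c2 : p.2 @[p --> F] --> t by apply: cvg_comp cF _; exact: cvg_snd.
apply: (@cvgM R _ F FF (fun p => p.2 `^ (rho - 1)) (fun p => q p.1 p.2)).
  exact: (@cvg_cont_comp R _ F FF _ (fun s => s `^ (rho - 1)) t c2 (continuous_powR t0)).
by apply: cvg_trans c; apply: cvg_app; apply: within_subset; exact: Omega_sub_bar.
Qed.

Lemma tweight_sg (h : R -> R -> R) (q : R -> R) (x t : R) : 0 < t -> h x t = sg rho q t ->
  tweight rho h x t = q t.
Proof.
move=> t0 E; rewrite /tweight E /sg mulrA -powRD; last by rewrite (gt_eqF t0) implybT.
by rewrite (_ : 1 - rho + (rho - 1) = 0) ?powRr0 ?mul1r//; ring.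
Qed.

End continuity_on.

Section assembly.
Context {R : realType}.
Variables rho al T : R.
Hypotheses (rho01 : 0 < rho < 1) (al0 : 0 < al) (T0 : 0 < T).
Variables (a0 a1 : nat -> R) (f : nat -> R -> R) (tau : nat -> R).
Variables (phi0 phi1 : R -> R) (phi u : R -> R -> R).
Hypothesis tau0 : tau @ \oo --> 0.
Hypotheses (a00 : a0 0%N = 0) (a10 : a1 0%N = 0) (f0 : forall t, f 0%N t = 0).
Hypothesis cf : forall n, continuous (f n).

Notation Y := (fun n : nat => ysym rho al n%:R (a0 n) (a1 n) (f n)).
Notation Z := (fun n : nat => zsym rho al n%:R (a0 n) (a1 n) (f n)).
Notation W := (fun n : nat => wsym rho al n%:R (a0 n) (a1 n) (f n)).
Notation Y2 := (fun (n : nat) (t : R) => n%:R ^+ 2 * Y n t).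

Hypothesis tY2 : forall t, 0 <= t <= T -> tails (Y2^~ t) tau.
Hypothesis tZ : forall t, 0 <= t <= T -> tails (Z^~ t) tau.
Hypothesis tf : forall t, 0 <= t <= T -> tails (f^~ t) tau.
Hypothesis e0 : forall x, 0 <= x <= pi ->
  series (fun n => a0 n * sin (n%:R * x)) @ \oo --> phi0 x.
Hypothesis e1 : forall x, 0 <= x <= pi ->
  series (fun n => a1 n * sin (n%:R * x)) @ \oo --> phi1 x.
Hypothesis ef : forall x t, 0 <= x <= pi -> 0 <= t <= T ->
  series (fun n => f n t * sin (n%:R * x)) @ \oo --> phi x t.
Hypothesis uE : forall x t, 0 <= x <= pi -> 0 < t <= T -> u x t = sg rho (ser Y x) t.

Let cY n : continuous (Y n). Proof. by apply: continuous_ysym. Qed.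
Let cZ n : continuous (Z n). Proof. by apply: continuous_zsym. Qed.
Let cW n : continuous (W n). Proof. by apply: continuous_wsym. Qed.
Let cY2 n : continuous (Y2 n).
Proof. by move=> t; apply: cvgM; [exact: cvg_cst|exact: cY]. Qed.

Lemma Y_mode0 t : Y 0%N t = 0.
Proof.
rewrite /ysym a00 a10 !mul0r !add0r /conv_symbol (@eq_Rint R _ _ (fun=> 0)).
  by rewrite Rint0 mulr0.
by move=> s _; rewrite f0 !mulr0.
Qed.

Lemma mode0_le (n : nat) t : `|Y n t| <= `|n%:R * Y n t| <= `|Y2 n t|.
Proof.
case: n => [|n]; first by rewrite Y_mode0 !mulr0 normr0 lexx.
have n1 : 1 <= (n.+1%:R : R) by rewrite ler1n.
have n2 : (n.+1%:R : R) <= n.+1%:R ^+ 2 by rewrite expr2 ler_peMl.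
rewrite (normrM n.+1%:R) (normrM (n.+1%:R ^+ 2)) (ger0_norm (ler0n R _)) (ger0_norm (exprn_ge0 2 (ler0n R n.+1))).
by rewrite ler_peMl//= ler_wpM2r.
Qed.

Lemma tY t : 0 <= t <= T -> tails (Y^~ t) tau.
Proof.
move=> tI; apply: tails_le (tY2 tI) _ => n.
by have /andP[h1 h2] := mode0_le n t; exact: le_trans h1 h2.
Qed.

(** The equation expresses W by the source and the two other series. *)
Lemma tW t : 0 <= t <= T -> tails (W^~ t) (fun N => (2 + 2 * al) * tau N).
Proof.
move=> tI N n.
apply: (@le_trans _ _ (\sum_(N <= k < n) (`|f k t| + (2 * al * `|Z k t| + `|Y2 k t|)))).
  apply: ler_sum => k _; rewrite /wsym.
  apply: le_trans (ler_normB _ _) _; rewrite addrA lerD2r.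
  apply: le_trans (ler_normB _ _) _; rewrite lerD2l.
  by rewrite [leLHS]normrM ger0_norm// mulr_ge0// ltW.
rewrite !big_split/= -big_distrr/=.
have h1 := tf tI N n; have h2 := tZ tI N n; have h3 := tY2 tI N n.
have h4 : 2 * al * \sum_(N <= k < n) `|Z k t| <= 2 * al * tau N.
  by rewrite ler_wpM2l// mulr_ge0// ltW.
apply: le_trans (lerD h1 (lerD h4 h3)) _.
by rewrite le_eqVlt; apply/orP; left; apply/eqP; ring.
Qed.

Let tauW0 : (fun N => (2 + 2 * al) * tau N) @ \oo --> 0.
Proof. by rewrite -(mulr0 (2 + 2 * al)); apply: cvgM => //; exact: cvg_cst. Qed.

Lemma first_step x : 0 <= x <= pi ->
  [/\ RL_exists rho T (u x), forall t, 0 < t <= T -> dt_rho rho T u x t = sg rho (ser Z x) t &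
      frac_int (rho - 1) (u x) t @[t --> 0^'+] --> phi1 x].
Proof.
move=> xI.
have cq := ser_clamp_continuous T0 tau0 cZ tZ (x := x).
have [|H1 H2 H3] := @RL_step R rho rho01 T (phi1 x) (u x) _ T0 cq; last first.
  split; [exact: H1| |exact: H3].
  by move=> t tI; exact: (etrans (H2 t tI) (esym (sg_ser_clamp rho Z x tI))).
move=> t tI; have /andP[t0 tT] := tI.
have [i1 c1] := conv_ser rho01 tau0 cY tY x (rhoC_gt0 rho01) tI.
have [i2 c2] := conv_ser rho01 tau0 cZ tZ x ltr01 tI.
have sI s : 0 < s < t -> 0 < s <= T.
  by move=> /andP[s0 st]; rewrite s0 (le_trans (ltW st)).
split.
  apply: eq_integ i1; first exact: measurable_itv.
  by move=> s /=; rewrite in_itv => /sI sI'; rewrite uE.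
transitivity (conv (gker (1 - rho)) (sg rho (ser Y x)) t).
  by apply: conv_ext => // s /sI sI'; rewrite uE.
transitivity (phi1 x + conv (gker 1) (sg rho (ser Z x)) t); last first.
  by rewrite -(conv_ser_clamp rho Z (gker 1) x tI).
have c3 := series_lin (c := 1) (e1 xI) c2; rewrite mul1r in c3.
apply: (cvg_unique (@Rhausdorff R) c1).
apply: cvg_trans c3; apply: near_eq_cvg; near=> N.
apply: eq_bigr => n _; rewrite (mode_first rho01 al0 _ _ _ (@cf n) t0).
by rewrite mul1r mulrDl.
Unshelve. all: by end_near. Qed.

Lemma second_step x : 0 <= x <= pi ->
  [/\ RL_exists rho T (dt_rho rho T u x),
      forall t, 0 < t <= T -> dt_rho rho T (dt_rho rho T u) x t = sg rho (ser W x) t &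
      frac_int (rho - 1) (dt_rho rho T u x) t @[t --> 0^'+] --> phi0 x].
Proof.
move=> xI; have [_ dE _] := first_step xI.
have cq := ser_clamp_continuous T0 tauW0 cW tW (x := x).
have [|H1 H2 H3] := @RL_step R rho rho01 T (phi0 x) (dt_rho rho T u x) _ T0 cq; last first.
  split; [exact: H1| |exact: H3].
  by move=> t tI; exact: (etrans (H2 t tI) (esym (sg_ser_clamp rho W x tI))).
move=> t tI; have /andP[t0 tT] := tI.
have [i1 c1] := conv_ser rho01 tau0 cZ tZ x (rhoC_gt0 rho01) tI.
have [i2 c2] := conv_ser rho01 tauW0 cW tW x ltr01 tI.
have sI s : 0 < s < t -> 0 < s <= T.
  by move=> /andP[s0 st]; rewrite s0 (le_trans (ltW st)).
split.
  apply: eq_integ i1; first exact: measurable_itv.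
  by move=> s /=; rewrite in_itv => /sI sI'; rewrite dE.
transitivity (conv (gker (1 - rho)) (sg rho (ser Z x)) t).
  by apply: conv_ext => // s /sI sI'; rewrite dE.
transitivity (phi0 x + conv (gker 1) (sg rho (ser W x)) t); last first.
  by rewrite -(conv_ser_clamp rho W (gker 1) x tI).
have c3 := series_lin (c := 1) (e0 xI) c2; rewrite mul1r in c3.
apply: (cvg_unique (@Rhausdorff R) c1).
apply: cvg_trans c3; apply: near_eq_cvg; near=> N.
apply: eq_bigr => n _; rewrite (mode_second rho01 al0 _ _ _ (@cf n) t0).
by rewrite mul1r mulrDl.
Unshelve. all: by end_near. Qed.

(** The derivatives of the terms are bounded by n^2 |Y n|, since n >= 1 whenever the
    n-th term is not zero. *)
Lemma ser_hd2 t : 0 <= t <= T ->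
  (forall x, has_derive (ser Y ^~ t) x (tsum (fun n => Y n t * (n%:R * cos (n%:R * x))))) /\
  (forall x, has_derive (fun x => tsum (fun n => Y n t * (n%:R * cos (n%:R * x)))) x
     (- ser Y2 x t)).
Proof.
move=> tI.
have t1 : tails (fun n => n%:R * Y n t) tau.
  by apply: tails_le (tY2 tI) _ => n; have /andP[] := mode0_le n t.
have n1 : tails (fun n => `|n%:R * Y n t|) tau by apply: tails_le t1 _ => n; rewrite normr_id.
have n2 : tails (fun n => `|Y2 n t|) tau by apply: tails_le (tY2 tI) _ => n; rewrite normr_id.
have b1 (n : nat) (y : R) : `|Y n t * (n%:R * cos (n%:R * y))| <= `|n%:R * Y n t|.
  rewrite mulrCA mulrA [leLHS]normrM ler_piMr ?normr_ge0//; exact: cos_max.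
split=> x.
  apply: (@termwise_derive R (fun n x => Y n t * sin (n%:R * x))
    (fun n x => Y n t * (n%:R * cos (n%:R * x))) (fun n => `|n%:R * Y n t|) tau x tau0 _ b1 n1).
  - by move=> k y; apply: hdZ; exact: hd_sinM.
  - by move=> y; apply/cvg_ex; exists (ser Y y t); have := @ser_cvg R T Y tau tau0 tY y t tI; apply.
have -> : - ser Y2 x t = tsum (fun n => Y n t * (n%:R * (- (n%:R * sin (n%:R * x))))).
  rewrite -mulN1r -tsumZ; last first.
    by apply/cvg_ex; exists (ser Y2 x t); have := @ser_cvg R T Y2 tau tau0 tY2 x t tI; apply.
  by apply: eq_tsum => n; ring.
apply: (@termwise_derive R (fun n x => Y n t * (n%:R * cos (n%:R * x)))
    (fun n x => Y n t * (n%:R * - (n%:R * sin (n%:R * x)))) (fun n => `|Y2 n t|) tau x tau0 _ _ n2).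
- by move=> k y; do 2 apply: hdZ; exact: hd_cosM.
- move=> k y; rewrite (_ : _ * _ = Y2 k t * - sin (k%:R * y)); last by ring.
  by rewrite [leLHS]normrM ler_piMr ?normr_ge0// normrN; exact: sin_max.
- move=> y; apply/cvg_ex; eexists; apply: (tails_cvg (tau := tau)) tau0.
  by apply: tails_le t1 _ => n; exact: b1.
Qed.

Lemma dxx_step x t : 0 < x < pi -> 0 < t <= T ->
  dxx_exists u x t /\ dxx u x t = - sg rho (ser Y2 x) t.
Proof.
move=> xI /andP[t0 tT].
have tI : 0 <= t <= T by rewrite ltW.
have [h1 h2] := ser_hd2 tI.
pose v1 y := t `^ (rho - 1) * tsum (fun n => Y n t * (n%:R * cos (n%:R * y))).
have nx (y : R) : 0 < y < pi -> \forall z \near y, 0 < z < pi.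
  move=> yI; have : nbhs y (`]0, pi[%classic : set R).
    by apply: open_nbhs_nbhs; split; [exact: interval_open|rewrite /= in_itv].
  by apply: filterS => z; rewrite /= in_itv.
have d1 y : 0 < y < pi -> has_derive (u^~ t) y (v1 y).
  move=> yI; have H := hdZ (t `^ (rho - 1)) (h1 y).
  apply: near_eq_is_derive H => //.
  apply: filterS (nx y yI) => z /andP[z0 zp]; rewrite uE// ?(ltW z0) ?(ltW zp)// t0 //.
have d2 : has_derive (derive1 (u^~ t)) x (t `^ (rho - 1) * - ser Y2 x t).
  have H := hdZ (t `^ (rho - 1)) (h2 x).
  apply: near_eq_is_derive H => //.
  apply: filterS (nx x xI) => z zI; rewrite derive1E.
  by have := d1 z zI; rewrite /has_derive => dz; rewrite derive_val.
split; first by split; [exact: (@ex_derive _ _ _ _ _ _ _ (d1 x xI))|exact: (@ex_derive _ _ _ _ _ _ _ d2)].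
rewrite /dxx /= derive1E; have := d2; rewrite /has_derive => dz; rewrite derive_val.
by rewrite mulrN.
Qed.

(** The function u is only required to agree with the series on [0, pi] x ]0, T], so
    that the conclusions apply to every solution once uniqueness is known. *)
Lemma assembled :
  [/\ is_solution rho T al (fun x t => sg rho (phi x) t) phi0 phi1 u,
      in_Cbar T (Omega T) (tweight rho (dt_rho rho T (dt_rho rho T u))),
      in_Cbar T (Omega T) (tweight rho (dxx u)) &
      Cbar_norm T (tweight rho (dt_rho rho T (dt_rho rho T u)))
        + Cbar_norm T (tweight rho (dt_rho rho T u))
        + Cbar_norm T (tweight rho (dxx u)) <= (4 + 2 * al) * tau 0%N].
Proof.
have lat x t : Omega T (x, t) -> 0 <= x <= pi /\ 0 < t <= T.
  by move=> /OmegaE[/andP[x0 xp] tI]; rewrite (ltW x0) (ltW xp).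
have cbY := ser_continuous tau0 cY tY; have cbZ := ser_continuous tau0 cZ tZ.
have cbW := ser_continuous tauW0 cW tW; have cbY2 := ser_continuous tau0 cY2 tY2.
have cbN : continuous_on (Omega_bar T) (fun x t => - ser Y2 x t).
  apply/subspace_continuousP => p xt; apply: cvgN.
  exact: ((subspace_continuousP _ _).1 cbY2 p xt).
have vE x t : 0 <= x <= pi -> 0 < t <= T -> dt_rho rho T u x t = sg rho (ser Z x) t.
  by move=> xI; have [_ H _] := first_step xI; exact: H.
have wE x t : 0 <= x <= pi -> 0 < t <= T ->
    dt_rho rho T (dt_rho rho T u) x t = sg rho (ser W x) t.
  by move=> xI; have [_ H _] := second_step xI; exact: H.
have dE x t : Omega T (x, t) -> dxx u x t = sg rho (fun t => - ser Y2 x t) t.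
  by move=> /OmegaE[xI tI]; rewrite (dxx_step xI tI).2 /sg mulrN.
have [iu _] : in_Cbar T (Omega_lat T) (tweight rho u) /\
    (forall x t, Omega_bar T (x, t) -> ext T (tweight rho u) x t = ser Y x t).
  apply: (in_Cbar_of T0 cbY (@Omega_sub_lat R T) (@Omega_lat_sub R T)).
  move=> x t /Omega_latE[xI tI]; apply: tweight_sg; first by case/andP: tI.
  exact: uE.
have [iv nv] : in_Cbar T (Omega_lat T) (tweight rho (dt_rho rho T u)) /\
    (forall x t, Omega_bar T (x, t) -> ext T (tweight rho (dt_rho rho T u)) x t = ser Z x t).
  apply: (in_Cbar_of T0 cbZ (@Omega_sub_lat R T) (@Omega_lat_sub R T)).
  move=> x t /Omega_latE[xI tI]; apply: tweight_sg; first by case/andP: tI.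
  exact: vE.
have [iw nw] : in_Cbar T (Omega T) (tweight rho (dt_rho rho T (dt_rho rho T u))) /\
    (forall x t, Omega_bar T (x, t) ->
       ext T (tweight rho (dt_rho rho T (dt_rho rho T u))) x t = ser W x t).
  apply: (in_Cbar_of T0 cbW (@subset_refl _ _) (@Omega_sub_bar R T)).
  move=> x t o; have [xI tI] := lat x t o; apply: tweight_sg; first by case/andP: tI.
  exact: wE.
have [ix nx] : in_Cbar T (Omega T) (tweight rho (dxx u)) /\
    (forall x t, Omega_bar T (x, t) -> ext T (tweight rho (dxx u)) x t = - ser Y2 x t).
  apply: (in_Cbar_of T0 cbN (@subset_refl _ _) (@Omega_sub_bar R T)).
  move=> x t o; have [xI tI] := lat x t o.
  apply: (@tweight_sg R rho _ (fun t => - ser Y2 x t)); first by case/andP: tI.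
  exact: dE.
split=> //; last first.
  have -> : (4 + 2 * al) * tau 0%N = (2 + 2 * al) * tau 0%N + tau 0%N + tau 0%N by ring.
  apply: lerD; first apply: lerD.
  - apply: (Cbar_norm_le T0 nw) => x t /Omega_barE[_ tI]; exact: (ser_bound tauW0 tW).
  - apply: (Cbar_norm_le T0 nv) => x t /Omega_barE[_ tI]; exact: (ser_bound tau0 tZ).
  - apply: (Cbar_norm_le T0 nx) => x t /Omega_barE[_ tI]; rewrite normrN; exact: (ser_bound tau0 tY2).
constructor.
- by move=> x xI; have [] := first_step xI.
- move=> x /andP[x0 xp]; have [|H _ _] := @second_step x; last exact: H.
  by rewrite (ltW x0) (ltW xp).
- by move=> x t xI tI; exact: (dxx_step xI tI).1.
- apply: (@continuous_on_eq R (Omega T) _ (fun x => sg rho (ser W x))).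
    by move=> x t o; have [] := lat x t o; exact: wE.
  exact: continuous_on_sg.
- apply: (@continuous_on_eq R (Omega T) _ (fun x => sg rho (ser Z x))).
    by move=> x t o; have [] := lat x t o; exact: vE.
  exact: continuous_on_sg.
- apply: (@continuous_on_eq R (Omega T) _ (fun x => sg rho (fun t => - ser Y2 x t))).
    by move=> x t o; exact: dE.
  exact: continuous_on_sg.
- exact: iv.
- exact: iu.
- move=> x t xI tI.
  have [xI' tI'] : 0 <= x <= pi /\ 0 <= t <= T.
    by case/andP: xI => x0 xp; case/andP: tI => t0 tT; rewrite (ltW x0) (ltW xp) (ltW t0).
  rewrite wE// vE// (dxx_step xI tI).2 opprK.
  have E : ser W x t = phi x t - 2 * al * ser Z x t - ser Y2 x t.
    apply: tsum_eq.
    have c1 := series_lin (c := - (2 * al)) (ef xI' tI') (ser_cvg tau0 tZ (x := x) tI').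
    have c2 := series_lin (c := -1) c1 (ser_cvg tau0 tY2 (x := x) tI').
    rewrite mulN1r mulNr in c2; apply: cvg_trans c2; apply: near_eq_cvg; near=> N.
    by apply: eq_bigr => n _; rewrite /wsym; ring.
  by rewrite /sg E; ring.
- move=> t tI; have p0 := ltW (pi_gt0 R).
  have s0 c : ser c 0 t = 0.
    by rewrite -[RHS]tsum0; apply: eq_tsum => n; rewrite mulr0 sin0 mulr0.
  have sp c : ser c pi t = 0.
    by rewrite -[RHS]tsum0; apply: eq_tsum => n; rewrite sin_natpi mulr0.
  have x0I : 0 <= (0 : R) <= pi by rewrite lexx.
  have xpI : 0 <= (pi : R) <= pi by rewrite p0 lexx.
  by rewrite (uE x0I tI) (uE xpI tI) /sg s0 sp !mulr0.
- by move=> x xI; have [] := second_step xI.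
- by move=> x xI; have [] := first_step xI.
Unshelve. all: by end_near. Qed.

End assembly.

(** * Hoelder data *)

Section one_sided.
Context {R : realType}.
Implicit Types (A : set R) (g : R -> R).

Lemma derivable_on_cvg A g (x : R) : derivable_on A g x ->
  diff_quot g x y @[y --> within A x^'] --> derive_on A g x.
Proof. by []. Qed.

(** g(y) = g(x) + (difference quotient) (y - x). *)
Lemma derivable_on_continuous A g : (forall x, A x -> derivable_on A g x) ->
  {within A, continuous g}.
Proof.
move=> dg; apply/subspace_continuousP => x Ax.
have c := derivable_on_cvg (dg x Ax).
have FF : Filter (within A x^') by exact: within_filter.
have c1 : g x + diff_quot g x y * (y - x) @[y --> within A x^'] --> g x.
  rewrite -[X in _ --> X]addr0 -[X in _ --> _ + X](mulr0 (derive_on A g x)) -[X in _ * X](subrr x).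
  apply: cvgD; first exact: cvg_cst.
  apply: cvgM => //; apply: cvgB; last exact: cvg_cst.
  apply: cvg_trans (@cvg_within _ x^' _ A) _; exact: cvg_within.
have c2 : g y @[y --> within A x^'] --> g x.
  apply: cvg_trans c1; apply: near_eq_cvg; near=> y.
  have yx : y != x by near: y; apply: cvg_within; exact: withinT.
  by rewrite /diff_quot divfK ?subr_eq0// addrC subrK.
move=> P HP.
have h1 : nbhs x [set y | y != x -> A y -> P (g y)] := c2 P HP.
have h2 : nbhs x [set y | A y -> P (g y)].
  apply: filterS h1 => y H Ay; have [->|yx] := eqVneq y x; last exact: H.
  exact: nbhs_singleton.
exact: h2.
Unshelve. all: by end_near. Qed.

Lemma derivable_on_interior (a b : R) A g (x : R) : `]a, b[%classic `<=` A -> a < x < b ->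
  derivable_on A g x -> has_derive g x (derive_on A g x).
Proof.
move=> sA xI /derivable_on_cvg c; apply/has_derive_quot.
have nx : nbhs x (`]a, b[%classic : set R).
  by apply: open_nbhs_nbhs; split; [exact: interval_open|rewrite /= in_itv].
have cs : (h + x) @[h --> (0 : R)] --> x.
  rewrite -[X in _ --> X]add0r; apply: cvgD; [exact: cvg_id|exact: cvg_cst].
have c2 : (h + x) @[h --> (0 : R)^'] --> within A x^'.
  move=> P HP.
  have h1 : nbhs x [set y | y != x -> A y -> P y] := HP.
  have h2 : nbhs (0 : R) [set h | h + x != x -> A (h + x) -> P (h + x)] := cs _ h1.
  have h3 : nbhs (0 : R) [set h | (`]a, b[%classic : set R) (h + x)] := cs _ nx.
  have h4 : nbhs (0 : R) [set h | h != 0 -> P (h + x)].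
    apply: filterS (filterI h2 h3) => h [H1 H2] h0; apply: H1.
      by rewrite -subr_eq0 addrK.
    exact: sA.
  exact: h4.
have c3 := cvg_comp _ _ c2 c; apply: cvg_trans c3; apply: near_eq_cvg; near=> h.
by rewrite /= /diff_quot addrK mulrC.
Unshelve. all: by end_near. Qed.

End one_sided.

Section classes.
Context {R : realType}.
Notation mu := (@lebesgue_measure R).
Notation I := (`]0, pi[%classic : set R).
Variable a : R.
Hypothesis a0 : 0 < a.

(** The modulus at delta = |x - y| bounds the increment; the supremum is finite
    because g is bounded. *)
Lemma Ca_bound_holder (g : R -> R) C : {within `[0, pi], continuous g} ->
  Ca_bound a g C -> holder a C g.
Proof.
move=> cg gC x y xI yI.
have [->|xy] := eqVneq x y; first by rewrite !subrr normr0 powR0 ?gt_eqF// mulr0.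
have d0 : 0 < `|x - y| by rewrite normr_gt0 subr_eq0.
apply: le_trans (gC _ d0); apply: ub_le_sup; last by exists (x, y).
have [M [M0 gM]] := cont_seg_bounded cg.
exists (M + M) => _ [[p q] /= [pI qI _] <-].
by apply: le_trans (ler_normB _ _) _; apply: lerD; exact: gM.
Qed.

Lemma Ca_bound_ge0 (g : R -> R) C : {within `[0, pi], continuous g} ->
  Ca_bound a g C -> 0 <= C.
Proof.
move=> cg gC; have pi0 := pi_gt0 R.
have h := Ca_bound_holder cg gC.
have /h : 0 <= (0 : R) <= pi by rewrite lexx ltW.
move=> /(_ pi); rewrite lexx ltW// => /(_ isT) /(le_trans (normr_ge0 _)).
by rewrite pmulr_lge0// powR_gt0// normr_gt0 sub0r oppr_eq0 gt_eqF.
Qed.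

Lemma measurable_seg (g : R -> R) : {within `[0, pi], continuous g} -> measurable_fun I g.
Proof. by move=> cg; apply: measurable_cont; exact: cont_seg_interior. Qed.

(** A Hoelder constant C = 0 is covered by letting a positive one decrease to it. *)
Lemma bernstein_tails (e C : R) (tau : nat -> R) (g : R -> R) :
  (forall N, 0 <= tau N) ->
  (forall (C : R) (g : R -> R), 0 < C -> measurable_fun I g -> g 0 = 0 -> g pi = 0 -> holder a C g ->
    forall N n, \sum_(N <= k < n) (k%:R `^ e * `|fsin g k|) <= C * tau N) ->
  {within `[0, pi], continuous g} -> g 0 = 0 -> g pi = 0 -> Ca_bound a g C ->
  tails (fun n => n%:R `^ e * fsin g n) (fun N => C * tau N).
Proof.
move=> tau_ge0 B cg g0 gp gC N n.
have C0 := Ca_bound_ge0 cg gC; have hg := Ca_bound_holder cg gC.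
rewrite (eq_bigr (fun k => k%:R `^ e * `|fsin g k|)); last first.
  by move=> k _; rewrite (normrM (k%:R `^ e)) ger0_norm ?powR_ge0.
apply/ler_addgt0Pr => d d0.
have t1 : 0 < tau N + 1 by rewrite ltr_wpDl.
have e0 : 0 < d / (tau N + 1) by rewrite divr_gt0.
have Ce : 0 < C + d / (tau N + 1) by rewrite ltr_wpDl.
apply: le_trans (B _ g Ce (measurable_seg cg) g0 gp _ N n) _.
  move=> x y xI yI; apply: le_trans (hg x y xI yI) _.
  by rewrite ler_wpM2r ?powR_ge0// lerDl ltW.
rewrite mulrDl lerD2l mulrAC ler_pdivrMr// ler_wpM2l ?(ltW d0)// lerDl//.
Qed.

(** Hence n^2 times the coefficients of an initial value are those of its second
    derivative, a Hoelder function. *)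
Lemma fsin_d2 (g : R -> R) n : in_C2a a g -> fsin (d2 g) n = - (n%:R ^+ 2 * fsin g n).
Proof.
move=> [dg [c2 _ _ _] g0 gp].
have inI x : (`[0, pi]%classic : set R) x -> 0 <= x <= pi by rewrite /= in_itv.
have oc (x : R) : 0 < x < pi -> 0 <= x <= pi by move=> /andP[/ltW -> /ltW ->].
apply: (@fsin_dd R g (derive_on `[0, pi] g) (d2 g) n _ _ _ _ c2 g0 gp).
- move=> x xI; apply: (derivable_on_interior (@subset_itv_oo_cc _ _ 0 pi) xI); exact: (dg x (oc x xI)).1.
- move=> x xI; apply: (derivable_on_interior (@subset_itv_oo_cc _ _ 0 pi) xI); exact: (dg x (oc x xI)).2.
- by apply: derivable_on_continuous => x /inI xI; exact: (dg x xI).1.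
- by apply: derivable_on_continuous => x /inI xI; exact: (dg x xI).2.
Qed.

Lemma tails_pow (c : nat -> R) (e : R) tau : 0 < e -> c 0%N = 0 ->
  tails (fun n => n%:R `^ e * c n) tau -> tails c tau.
Proof.
move=> e0 c0 t; apply: tails_le t _ => -[|n]; first by rewrite c0 mulr0.
rewrite [leRHS]normrM ler_peMl// ger0_norm ?powR_ge0//.
have : 1 `^ e <= (n.+1%:R : R) `^ e by rewrite ge0_ler_powR ?nnegrE ?(ltW e0)// ler1n.
by rewrite powR1.
Qed.

Lemma tails_sq (c : nat -> R) tau : c 0%N = 0 ->
  tails (fun n => n%:R ^+ 2 * c n) tau -> tails c tau.
Proof.
move=> c0 t; apply: tails_le t _ => -[|n]; first by rewrite c0 mulr0.
rewrite [leRHS]normrM ler_peMl// ger0_norm ?exprn_ge0// expr2.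
by rewrite (le_trans (_ : 1 <= (n.+1%:R : R))) ?ler_peMl ?ler1n.
Qed.

Lemma initial_expansion (e C : R) (tau : nat -> R) (g : R -> R) : 0 < e ->
  tau @ \oo --> 0 -> (forall N, 0 <= tau N) ->
  (forall (C : R) (g : R -> R), 0 < C -> measurable_fun I g -> g 0 = 0 -> g pi = 0 -> holder a C g ->
    forall N n, \sum_(N <= k < n) (k%:R `^ e * `|fsin g k|) <= C * tau N) ->
  in_C2a a g -> Ca_bound a (d2 g) C ->
  tails (fun n => n%:R ^+ 2 * fsin g n) (fun N => C * tau N) /\
  (forall x, 0 <= x <= pi -> series (fun n => fsin g n * sin (n%:R * x)) @ \oo --> g x).
Proof.
move=> e0 tau0 tau_ge0 B g2 gC; have [dg [c2 d20 d2p _] g0 gp] := g2.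
have t1 := tails_pow e0 (fsin0 _) (bernstein_tails tau_ge0 B c2 d20 d2p gC).
have t2 : tails (fun n => n%:R ^+ 2 * fsin g n) (fun N => C * tau N).
  by apply: tails_le t1 _ => n; rewrite (fsin_d2 n g2) normrN.
have tC : C * tau N @[N --> \oo] --> 0.
  by rewrite -(mulr0 C); apply: cvgM => //; exact: cvg_cst.
have t3 := tails_sq (fsin0 g) t2.
split=> // x xI; rewrite (sine_expansion (tau := fun N => C * tau N) _ g0 gp tC t3 xI).
  exact: (tails_cvg (tails_sin x t3) tC).
apply: derivable_on_continuous => y; rewrite /= in_itv => yI; exact: (dg y yI).1.
Qed.

End classes.

Section source.
Context {R : realType}.
Notation mu := (@lebesgue_measure R).
Notation I := (`]0, pi[%classic : set R).
Variables (a T C : R) (phi : R -> R -> R).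
Hypotheses (a0 : 0 < a) (T0 : 0 < T).
Hypothesis cphi : continuous_on (Omega_bar T) phi.
Hypothesis phi_bd : forall t, 0 <= t <= T -> phi 0 t = 0 /\ phi pi t = 0.
Hypothesis phiC : forall t, 0 <= t <= T -> Ca_bound a (phi^~ t) C.

Lemma slice_continuous t : 0 <= t <= T -> {within `[0, pi], continuous (phi^~ t)}.
Proof.
move=> tI; apply/subspace_continuousP => x; rewrite /= in_itv/= => xI.
apply: (@cvg_within_seq R R (`[0, pi]%classic : set R) x (phi^~ t)) => u uI ux.
have xt : Omega_bar T (x, t) by apply/Omega_barE.
have c := (subspace_continuousP _ _).1 cphi _ xt.
have c2 : (u n, t) @[n --> \oo] --> within (Omega_bar T) (nbhs (x, t)).
  move=> P [[A B] /= [Ax Bt] AB].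
  have uA : \forall n \near \oo, A (u n) := ux _ Ax.
  apply: filterS uA => n An; apply: (AB (u n, t)).
    by split => //=; exact: nbhs_singleton.
  by apply/Omega_barE; split=> //; have := uI n; rewrite /= in_itv.
exact: cvg_comp _ _ c2 c.
Qed.

Lemma slice_bound x t : 0 <= x <= pi -> 0 <= t <= T -> `|phi x t| <= C * pi `^ a.
Proof.
move=> xI tI; have cs := slice_continuous tI.
have h := Ca_bound_holder a0 cs (phiC tI).
have C0 := Ca_bound_ge0 a0 cs (phiC tI).
have p0 := ltW (pi_gt0 R).
have := h x 0 xI; rewrite lexx p0 => /(_ isT).
rewrite (phi_bd tI).1 subr0 => /le_trans; apply.
rewrite ler_wpM2l// ge0_ler_powR ?nnegrE// ?(ltW a0)//.
by rewrite subr0; case/andP: xI => x0 xp; rewrite ger0_norm.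
Qed.

(** Dominated convergence; the Hoelder bound and the boundary values bound phi
    uniformly in time. *)
Lemma fsin_slice_continuous n : continuous (fun t => fsin (phi^~ (clamp T t)) n).
Proof.
move=> t; apply: continuous_seq => u ut; rewrite /fsin.
apply: cvgM; first exact: cvg_cst.
have uc m : 0 <= clamp T (u m) <= T by exact: clampI.
have tc : 0 <= clamp T t <= T by exact: clampI.
have ct : clamp T (u m) @[m --> \oo] --> clamp T t.
  exact: (cvg_cont_comp ut (@continuous_clamp R T t)).
have ms s : 0 <= s <= T -> measurable_fun I (fun x => phi x s * sin (n%:R * x)).
  move=> sI; apply: measurable_funM; first exact: (measurable_seg (slice_continuous sI)).
  by apply: measurable_continuous; exact: continuous_sinM.
have h := @Rdominated_cvg R _ _ mu I (fun m x => phi x (clamp T (u m)) * sin (n%:R * x))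
  (fun x => phi x (clamp T t) * sin (n%:R * x)) (fun=> C * pi `^ a) (measurable_itv _).
apply: (h _ _ _ _).2.
- by move=> m; exact: ms.
- move=> x; rewrite in_Ioo => /andP[x0 xp].
  apply: cvgM; last exact: cvg_cst.
  have xt : Omega_bar T (x, clamp T t) by apply/Omega_barE; rewrite (ltW x0) (ltW xp).
  have c := (subspace_continuousP _ _).1 cphi _ xt.
  have c2 : (x, clamp T (u n)) @[n --> \oo] --> within (Omega_bar T) (nbhs (x, clamp T t)).
    move=> P [[A B] /= [Ax Bt] AB].
    have uB : \forall n \near \oo, B (clamp T (u n)) := ct _ Bt.
    apply: filterS uB => m Bm; apply: (AB (x, clamp T (u m))).
      by split => //=; exact: nbhs_singleton.
    by apply/Omega_barE; rewrite (ltW x0) (ltW xp).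
  exact: cvg_comp _ _ c2 c.
- apply: (@integ_bounded R 0 pi `|C * pi `^ a|); first exact: measurable_cst.
  by [].
- move=> m x; rewrite in_Ioo => /andP[x0 xp].
  rewrite normrM -[leRHS]mulr1; apply: ler_pM => //; last exact: sin_max.
  by apply: slice_bound => //; rewrite (ltW x0) (ltW xp).
Qed.

End source.

(** * Existence *)

Section existence.
Context {R : realType}.
Variables rho T al a : R.
Hypotheses (rho01 : 0 < rho < 1) (T0 : 0 < T) (al0 : 0 < al) (ha : 2^-1 < a).

Lemma is_solution_source (f g : R -> R -> R) phi0 phi1 (u : R -> R -> R) :
  (forall x t, Omega T (x, t) -> f x t = g x t) ->
  is_solution rho T al g phi0 phi1 u -> is_solution rho T al f phi0 phi1 u.
Proof.
move=> E [h1 h2 h3 h4 h5 h6 h7 h8 h9 h10 h11 h12]; constructor=> //.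
by move=> x t xI tI; rewrite h9// E//; apply/OmegaE.
Qed.

Lemma existence : exists2 C, 0 < C & forall (f : R -> R -> R) (phi0 phi1 : R -> R) (C0 C1 Cf : R),
  in_Cax a T (tweight rho f) -> in_C2a a phi0 -> in_C2a a phi1 ->
  Ca_bound a (d2 phi0) C0 -> Ca_bound a (d2 phi1) C1 -> Cax_bound a T (tweight rho f) Cf ->
  exists u0 : R -> R -> R, forall u : R -> R -> R,
    (forall x t, 0 <= x <= pi -> 0 < t <= T -> u x t = u0 x t) ->
    [/\ is_solution rho T al f phi0 phi1 u,
      in_Cbar T (Omega T) (tweight rho (dt_rho rho T (dt_rho rho T u))),
      in_Cbar T (Omega T) (tweight rho (dxx u)) &
      Cbar_norm T (tweight rho (dt_rho rho T (dt_rho rho T u)))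
        + Cbar_norm T (tweight rho (dt_rho rho T u))
        + Cbar_norm T (tweight rho (dxx u)) <= C * (C0 + C1 + Cf)].
Proof.
have a0 : 0 < a by apply: lt_trans ha; rewrite invr_gt0.
(* e < a - 1/2 is needed for the theorem of Bernstein, e < 1 for the interpolation of
   the kernels *)
pose e := Num.min 1 (a - 2^-1) / 2.
have m0 : 0 < Num.min 1 (a - 2^-1) by rewrite lt_min ltr01 subr_gt0.
have e0 : 0 < e by rewrite divr_gt0.
have m1 : Num.min 1 (a - 2^-1) <= 1 by rewrite ge_min lexx.
have m2 : Num.min 1 (a - 2^-1) <= a - 2^-1 by rewrite ge_min lexx orbT.
have e1 : e < 1 by rewrite /e; lra.
have ea : e < a - 2^-1 by rewrite /e; lra.
have [tau [tau0 tau_ge0 B]] := bernstein e0 ea.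
have e01 : 0 < e < 1 by rewrite e0.
have [C C_gt0 H] := @coef_tails R rho al T e rho01 al0 T0 e01.
have K0 : 0 <= (4 + 2 * al) * (C * tau 0%N).
  by apply: mulr_ge0; [rewrite addr_ge0 ?mulr_ge0 ?(ltW al0)|apply: mulr_ge0; [exact: ltW|]].
exists ((4 + 2 * al) * (C * tau 0%N) + 1); first by rewrite ltr_wpDl.
move=> f phi0 phi1 C0 C1 Cf [[cphi phiE] phi_bd _] p0 p1 b0 b1 bf.
pose phi := ext T (tweight rho f).
have [_ [cd0 d00 d0p _] g00 g0p] := p0; have [_ [cd1 d10 d1p _] g10 g1p] := p1.
have TI0 : 0 <= (0 : R) <= T by rewrite lexx ltW.
have C00 := Ca_bound_ge0 a0 cd0 b0; have C10 := Ca_bound_ge0 a0 cd1 b1.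
have Cf0 := Ca_bound_ge0 a0 (slice_continuous cphi TI0) (bf _ TI0).
have [t0 x0] := initial_expansion a0 e0 tau0 tau_ge0 B p0 b0.
have [t1 x1] := initial_expansion a0 e0 tau0 tau_ge0 B p1 b1.
pose F n t := fsin (phi^~ (clamp T t)) n.
have cF n : continuous (F n) by exact: (fsin_slice_continuous a0 T0 cphi phi_bd bf).
have tF t : tails (fun n => n%:R `^ e * F n t) (fun N => Cf * tau N).
  have tI := clampI T0 t; have [q0 qp] := phi_bd _ tI.
  exact: (bernstein_tails a0 tau_ge0 B (slice_continuous cphi tI) q0 qp (bf _ tI)).
have F0 t : F 0%N t = 0 by exact: fsin0.
pose K := C * (C0 + C1 + Cf).
have HK := H (fsin phi0) (fsin phi1) F tau C0 C1 Cf C00 C10 Cf0 tau_ge0 (fsin0 _) (fsin0 _) F0 cF t0 t1 tF.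
have tK : (fun N => K * tau N) @ \oo --> 0.
  by rewrite -(mulr0 K); apply: cvgM => //; exact: cvg_cst.
have S0 : 0 <= C0 + C1 + Cf by rewrite !addr_ge0.
have xF x t : 0 <= x <= pi -> 0 <= t <= T ->
    series (fun n => F n t * sin (n%:R * x)) @ \oo --> phi x t.
  move=> xI tI; have [q0 qp] := phi_bd _ tI.
  have E n : F n t = fsin (phi^~ t) n by rewrite /F clamp_id.
  have tt : tails (fsin (phi^~ t)) (fun N => K * tau N).
    by have [_ _ h] := HK t tI; apply: tails_le h _ => n; rewrite -E.
  have c := tails_cvg (tails_sin x tt) tK.
  rewrite -(sine_expansion (slice_continuous cphi tI) q0 qp tK tt xI) in c.
  apply: cvg_trans c; apply: near_eq_cvg; near=> N.
  by apply: eq_bigr => n _; rewrite -E.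
exists (fun x => sg rho (ser (fun n : nat => ysym rho al n%:R (fsin phi0 n) (fsin phi1 n) (F n)) x)).
move=> u uE.
have [s1 s2 s3 s4] := @assembled R rho al T rho01 al0 T0 (fsin phi0) (fsin phi1) F (fun N => K * tau N)
  phi0 phi1 phi u tK (fsin0 _) (fsin0 _) F0 cF (fun t tI => let: And3 h _ _ := HK t tI in h)
  (fun t tI => let: And3 _ h _ := HK t tI in h) (fun t tI => let: And3 _ _ h := HK t tI in h)
  x0 x1 xF uE.
split=> //.
  apply: is_solution_source s1 => x t o; have o' := Omega_sub_lat o.
  have /OmegaE[_ /andP[t_gt0 _]] := o.
  rewrite /sg /phi phiE// /tweight mulrA -powRD; last by rewrite (gt_eqF t_gt0) implybT.
  by rewrite (_ : rho - 1 + (1 - rho) = 0) ?powRr0 ?mul1r//; ring.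
apply: le_trans s4 _; rewrite (mulrDl ((4 + 2 * al) * (C * tau 0%N)) 1) mul1r /K.
rewrite (_ : (4 + 2 * al) * (C * (C0 + C1 + Cf) * tau 0%N) =
  (4 + 2 * al) * (C * tau 0%N) * (C0 + C1 + Cf)); last by ring.
by rewrite lerDl.
Unshelve. all: by end_near. Qed.

End existence.

(** * Functions of two variables *)

Section plane_measurability.
Context {R : realType}.

Let box (p q r : rat) : set (R * R) :=
  [set z | `|z.1 - ratr p| < ratr r /\ `|z.2 - ratr q| < ratr r].

Lemma rat_near (x e : R) : 0 < e -> exists q : rat, `|x - ratr q| < e.
Proof.
move=> e0; have : x - e < x + e by rewrite ltrBlDr -addrA ltrDl addr_gt0.
move=> /rat_in_itvoo[q]; rewrite in_itv/= => /andP[q1 q2]; exists q.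
by rewrite ltr_norml; apply/andP; split; lra.
Qed.

Lemma measurable_strip (p r : R) : measurable [set x : R | `|x - p| < r].
Proof.
have -> : [set x : R | `|x - p| < r] = `]p - r, p + r[%classic.
  by apply/funext => x; apply/propext; rewrite /= in_itv/= ltr_distl.
exact: measurable_itv.
Qed.

(** A planar open set is a countable union of rational squares. *)
Lemma open_measurable_plane (U : set (R * R)) : open U -> measurable U.
Proof.
move=> oU.
have -> : U = \bigcup_(p : rat) \bigcup_(q : rat) \bigcup_(r : rat)
    (if `[< box p q r `<=` U >] then box p q r else set0).
  apply/seteqP; split=> z.
    move=> Uz; have /nbhs_ballP[e /= e0 eU] : nbhs z U by exact: open_nbhs_nbhs.
    have e4 : 0 < e / 4 by rewrite divr_gt0.
    have [r r1] : exists r : rat, e / 4 < ratr r < e / 2.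
      have : e / 4 < e / 2 by lra.
      by move=> /rat_in_itvoo[q]; rewrite in_itv/= => h; exists q.
    have /andP[r1' r2'] := r1.
    have [p pz] := rat_near z.1 e4; have [q qz] := rat_near z.2 e4.
    exists p => //; exists q => //; exists r => //.
    case: asboolP => [_|nb]; first by split; [exact: lt_trans pz r1'|exact: lt_trans qz r1'].
    case: nb => w [w1 w2]; apply: eU.
    have d (a b c : R) : `|a - c| < e / 4 -> `|b - c| < ratr r -> `|a - b| < e.
      move=> h1 h2; rewrite (_ : a - b = (a - c) - (b - c)); last by ring.
      by apply: le_lt_trans (ler_normB _ _) _; lra.
    by split; rewrite /ball/=; [exact: d pz w1|exact: d qz w2].
  move=> [p _ [q _ [r _]]]; case: asboolP => [bU|_] //; exact: bU.
apply: bigcupT_measurable_rat => p; apply: bigcupT_measurable_rat => q.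
apply: bigcupT_measurable_rat => r; case: asboolP => _ //.
exact: (measurableX (measurable_strip _ _) (measurable_strip _ _)).
Qed.

Lemma measurable_cont_plane (D : set (R * R)) (F : R * R -> R) : open D ->
  (forall p, D p -> {for p, continuous F}) -> measurable_fun D F.
Proof.
move=> oD cF; apply: (measurability _ (RGenOInfty.measurableE R)).
move=> _ [_ [x ->] <-]; apply: open_measurable_plane; rewrite openE => p [Dp xp].
apply: filterI; first exact: open_nbhs_nbhs.
apply: (cF p Dp); apply: open_nbhs_nbhs; split=> //; exact: interval_open.
Qed.

Lemma open_rect (a b c d : R) : open (`]a, b[%classic `*` `]c, d[%classic : set (R * R)).
Proof.
rewrite openE => -[x y] [/= xI yI]; exists (`]a, b[%classic, `]c, d[%classic) => //.
by split; apply: open_nbhs_nbhs; split=> //; exact: interval_open.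
Qed.

(** In an open subset continuity relative to D is continuity. *)
Lemma continuous_on_open (D U : set (R * R)) (h : R -> R -> R) : continuous_on D h ->
  open U -> U `<=` D -> forall p, U p -> {for p, continuous (fun p => h p.1 p.2)}.
Proof.
move=> /subspace_continuousP ch oU UD p Up.
have c := ch p (UD _ Up).
move=> P HP; have h1 : nbhs p [set z | D z -> P (h z.1 z.2)] := c P HP.
have h2 : nbhs p U by exact: open_nbhs_nbhs.
have h3 : nbhs p [set z | P (h z.1 z.2)].
  by apply: filterS (filterI h1 h2) => z [H Uz]; apply: H; exact: UD.
exact: h3.
Qed.

Lemma continuous_on_bounded (D : set (R * R)) (h : R -> R -> R) (a b c d : R) :
  continuous_on D h -> (`[a, b]%classic `*` `[c, d]%classic) `<=` D ->
  exists2 M, 0 <= M & forall x t, a <= x <= b -> c <= t <= d -> `|h x t| <= M.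
Proof.
move=> ch KD.
have ck := compact_setX (@segment_compact R a b) (@segment_compact R c d).
have chK : {within (`[a, b]%classic `*` `[c, d]%classic), continuous (fun p : R * R => h p.1 p.2)}.
  exact: continuous_subspaceW KD ch.
have /compact_bounded[M [_ mrt]] := continuous_compact chK ck.
exists (`|M| + 1); first by rewrite addr_ge0.
move=> x t xI tI; apply: (mrt (`|M| + 1)); first by rewrite (le_lt_trans (ler_norm _))// ltrDl.
by exists (x, t) => //=; split; rewrite /= in_itv.
Qed.

End plane_measurability.

(** * Sine coefficients of functions of x and t *)

Section slices.
Context {R : realType}.
Notation mu := (@lebesgue_measure R).
Notation I := (`]0, pi[%classic : set R).
Variables (N : R -> R -> R) (M : R).
Hypothesis cN : continuous (fun p : R * R => N p.1 p.2).
Hypothesis NM : forall x t, `|N x t| <= M.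

Lemma continuous_fst (t : R) : continuous (N^~ t).
Proof.
move=> x; apply: continuous_seq => u ux.
have c : (u n, t) @[n --> \oo] --> (x, t) by apply: cvg_couple => //; exact: cvg_cst.
exact: cvg_comp _ _ c (@cN (x, t)).
Qed.

Lemma continuous_snd (x : R) : continuous (N x).
Proof.
move=> t; apply: continuous_seq => u ut.
have c : (x, u n) @[n --> \oo] --> (x, t) by apply: cvg_couple => //; exact: cvg_cst.
exact: cvg_comp _ _ c (@cN (x, t)).
Qed.

Lemma M_ge0 : 0 <= M. Proof. exact: le_trans (normr_ge0 _) (NM 0 0). Qed.

Lemma xint_continuous (a b K : R) (s : R -> R) : continuous s -> (forall x, `|s x| <= K) ->
  continuous (fun t => \int[mu]_(x in `]a, b[) (s x * N x t)).
Proof.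
move=> cs sK t; apply: continuous_seq => u ut.
have h := @Rdominated_cvg R _ _ mu `]a, b[ (fun m x => s x * N x (u m))
  (fun x => s x * N x t) (fun=> K * M) (measurable_itv _).
apply: (h _ _ _ _).2.
- move=> m; apply: measurable_funM; apply: measurable_continuous => //; exact: continuous_fst.
- move=> x _; apply: cvgM; first exact: cvg_cst.
  exact: cvg_comp _ _ ut (@continuous_snd x t).
- by apply: (@integ_bounded R a b `|K * M|) => //; exact: measurable_cst.
- move=> m x _; rewrite normrM; exact: ler_pM.
Qed.

Definition coef n t : R := \int[mu]_(x in I) (sin (n%:R * x) * N x t).

Lemma continuous_coef n : continuous (coef n).
Proof.
apply: (@xint_continuous 0 pi 1); first exact: continuous_sinM.
by move=> x; exact: sin_max.
Qed.

(** Convolution in time commutes with taking sine coefficients in space. *)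
Lemma conv_coef (rho b t : R) n : 0 < rho -> 0 < b -> 0 < t ->
  mu.-integrable I (EFin \o (fun x => sin (n%:R * x) * conv (gker b) (sg rho (N x)) t)) /\
  \int[mu]_(x in I) (sin (n%:R * x) * conv (gker b) (sg rho (N x)) t) =
  conv (gker b) (sg rho (coef n)) t.
Proof.
move=> rho0 b0 t0.
pose k s := gker b (t - s) * s `^ (rho - 1).
have ck : mu.-integrable `]0, t[ (EFin \o (fun s => gker b (t - s) * sg rho (fun=> 1) s)).
  by apply: conv_sg_integrable => //; exact: cont_cst.
have ik : mu.-integrable `]0, t[ (EFin \o k).
  by apply: (eq_integ _ _ ck) => // s _; rewrite /k /sg mulr1.
have mk : measurable_fun setT k.
  apply: measurable_funM.
    by apply: (measurableT_comp (measurable_sg _ (@cont_cst R _))); exact: measurable_funB.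
  by apply: (@measurable_powR R (rho - 1)).
have Gb : 0 < (Gamma b)^-1 by rewrite invr_gt0 Gamma_gt0.
have k0 s : `|k s| = k s.
  by rewrite ger0_norm// /k /gker /sg !mulr_ge0 ?powR_ge0// ltW.
pose f (z : R * R) := sin (n%:R * z.1) * (k z.2 * N z.1 z.2).
have mf : measurable_fun setT f.
  apply: measurable_funM.
    apply: (measurable_comp_fst (f := fun x => sin (n%:R * x))).
    by apply: measurable_continuous; exact: continuous_sinM.
  apply: measurable_funM; first exact: measurable_comp_snd.
  apply: (@measurable_cont_plane R [set: R * R]) => [|p _]; [exact: openT|exact: cN].
have bf x s : `|f (x, s)| <= M * k s.
  rewrite /f/= normrM normrM k0 [leRHS]mulrC -[leRHS]mul1r.
  have ks : 0 <= k s by rewrite -k0.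
  apply: ler_pM => //; [exact: mulr_ge0|exact: sin_max|exact: ler_wpM2l].
have mfx x : measurable_fun (`]0, t[%classic : set R) (fun s => f (x, s)).
  rewrite /f/=; apply: measurable_funTS; apply: measurable_funM; first exact: measurable_cst.
  by apply: measurable_funM => //; apply: measurable_continuous; exact: continuous_snd.
have i1 x : mu.-integrable `]0, t[ (EFin \o (fun s => f (x, s))).
  by apply: (@integ_dom R _ _ (fun s => M * k s)) => //; exact: integZ.
have i2 s : mu.-integrable I (EFin \o (fun x => f (x, s))).
  apply: (@integ_bounded R 0 pi (M * k s)) => //; rewrite /f/=.
  apply: measurable_funM; first by apply: measurable_continuous; exact: continuous_sinM.
  apply: measurable_funM; first exact: measurable_cst.
  by apply: measurable_continuous; exact: continuous_fst.
have E x : sin (n%:R * x) * conv (gker b) (sg rho (N x)) t = \int[mu]_(s in `]0, t[) f (x, s).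
  have ix : mu.-integrable `]0, t[ (EFin \o (fun s => gker b (t - s) * sg rho (N x) s)).
    by apply: conv_sg_integrable => //; [exact: cont_cst|exact: continuous_snd].
  rewrite /conv -(RintZ _ (measurable_itv _) ix); apply: eq_Rint => s _.
  by rewrite /f /k /sg /=; ring.
have E2 s : \int[mu]_(x in I) f (x, s) = gker b (t - s) * sg rho (coef n) s.
  have ix : mu.-integrable I (EFin \o (fun x => sin (n%:R * x) * N x s)).
    apply: (@integ_bounded R 0 pi M) => //.
      apply: measurable_funM; first by apply: measurable_continuous; exact: continuous_sinM.
      by apply: measurable_continuous; exact: continuous_fst.
    move=> x _; rewrite normrM -[leRHS]mul1r; apply: ler_pM => //; exact: sin_max.
  rewrite (_ : gker b (t - s) * sg rho (coef n) s = k s * coef n s); last by rewrite /k /sg mulrA.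
  rewrite /coef -(RintZ _ (measurable_itv _) ix); apply: eq_Rint => x _.
  by rewrite /f /=; ring.
have cst : mu.-integrable I (EFin \o (fun=> \int[mu]_(s in `]0, t[) (M * k s))).
  by apply: (@integ_bounded R 0 pi `|\int[mu]_(s in `]0, t[) (M * k s)|) => //; exact: measurable_cst.
split.
  have cc : continuous (fun x => conv (gker b) (sg rho (N x)) t).
    move=> x; apply: continuous_seq => u ux.
    apply: (@conv_dct R b (fun=> (Gamma b)^-1) (fun m => sg rho (N (u m))) (sg rho (N x)) rho M t b0 rho0 t0 (@cont_cst R _) _ _ _).2.
    - by move=> m; apply: measurable_funTS; apply: measurable_sg; exact: continuous_snd.
    - move=> m s _; rewrite /sg normrM ger0_norm ?powR_ge0// mulrC.
      by rewrite ler_wpM2r ?powR_ge0.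
    - move=> s _; apply: cvgM; first exact: cvg_cst.
      exact: cvg_comp _ _ ux (@continuous_fst s x).
  apply: (@integ_bounded R 0 pi (\int[mu]_(s in `]0, t[) (M * k s))).
    apply: measurable_funM; apply: measurable_continuous => //; exact: continuous_sinM.
  move=> x _; rewrite E; apply: le_norm_Rint => //; last exact: integZ.
rewrite (@eq_Rint R I _ (fun x => \int[mu]_(s in `]0, t[) f (x, s))); last by move=> x _; exact: E.
rewrite (@RFubini R I `]0, t[ f (fun=> \int[mu]_(s in `]0, t[) (M * k s))) //.
- by apply: eq_Rint => s _; exact: E2.
- exact: measurable_funTS.
move=> x _; apply: le_Rint => //; last exact: integZ.
by move: (integrable_norm (i1 x)); apply: eq_integrable.
Qed.

End slices.

(** * Sines of shrinking intervals *)

Section inner_sines.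
Context {R : realType}.
Notation mu := (@lebesgue_measure R).
Notation I := (`]0, pi[%classic : set R).

Lemma Rint_patch (A B : set R) (g : R -> R) : A `<=` B ->
  \int[mu]_(x in A) g x = \int[mu]_(x in B) (g \_ A) x.
Proof.
move=> AB; rewrite (Rint_support AB); last by move=> x _ nA; rewrite patchE memNset.
by apply: eq_Rint => x Ax; rewrite patchE mem_set.
Qed.

Variable n : nat.

(** The m-th shrunk interval is [gap m, pi - gap m]; [freq m] is the frequency of its
    n-th sine [isin m]. *)
Definition gap (m : nat) : R := pi / 4 * m.+1%:R^-1.
Definition freq (m : nat) : R := n%:R * pi / (pi - 2 * gap m).
Definition isin (m : nat) (x : R) : R := sin (freq m * (x - gap m)).

Lemma gap_gt0 m : 0 < gap m.
Proof. by rewrite /gap mulr_gt0 ?divr_gt0 ?pi_gt0 ?invr_gt0. Qed.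

Lemma gap_le m : gap m <= pi / 4.
Proof.
rewrite /gap ler_piMr ?divr_ge0 ?(ltW (pi_gt0 R))//.
by rewrite invf_le1// ler1n.
Qed.

Lemma gap_cvg0 : gap m @[m --> \oo] --> 0.
Proof.
rewrite -(mulr0 (pi / 4)); apply: cvgM; first exact: cvg_cst.
by have := @cvg_inv_shift R 0; under eq_fun do rewrite addn0.
Qed.

Lemma width_gt0 m : pi / 2 <= pi - 2 * gap m.
Proof. by have := gap_le m; lra. Qed.

Lemma freq_ge0 m : 0 <= freq m.
Proof.
have h := width_gt0 m; have p := pi_gt0 R.
by rewrite /freq divr_ge0 ?mulr_ge0 ?(ltW p)//; lra.
Qed.

Lemma freq_le m : freq m <= 2 * n%:R.
Proof.
have h := width_gt0 m; have p := pi_gt0 R.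
rewrite /freq ler_pdivrMr; last by lra.
rewrite (_ : 2 * n%:R * (pi - 2 * gap m) = n%:R * (2 * (pi - 2 * gap m))); last by ring.
by rewrite ler_wpM2l//; lra.
Qed.

Lemma freq_cvg : freq m @[m --> \oo] --> (n%:R : R).
Proof.
have p : (pi : R) != 0 by rewrite gt_eqF// pi_gt0.
have -> : (n%:R : R) = n%:R * pi / (pi - 2 * 0) by rewrite mulr0 subr0 mulfK.
rewrite /freq; apply: cvgM; first exact: cvg_cst.
apply: cvgV; first by rewrite mulr0 subr0.
apply: cvgB; first exact: cvg_cst.
by apply: cvgM; [exact: cvg_cst|exact: gap_cvg0].
Qed.

Lemma continuous_isin m : continuous (isin m).
Proof.
move=> x; apply: (@cont_comp R sin (fun x => freq m * (x - gap m))); last exact: continuous_sin.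
apply: cvgM; first exact: cvg_cst.
by apply: cvgB; [exact: cvg_id|exact: cvg_cst].
Qed.

Lemma isin_cvg x : isin m x @[m --> \oo] --> sin (n%:R * x).
Proof.
apply: cvg_cont_comp; last exact: continuous_sin.
have c : freq m * (x - gap m) @[m --> \oo] --> n%:R * (x - 0).
  apply: cvgM; first exact: freq_cvg.
  by apply: cvgB; [exact: cvg_cst|exact: gap_cvg0].
by rewrite subr0 in c; exact: c.
Qed.

Lemma inner_sub m : (`]gap m, pi - gap m[%classic : set R) `<=` I.
Proof.
move=> x; rewrite !in_Ioo => /andP[h1 h2]; have g := gap_gt0 m.
by rewrite (lt_trans g h1) (lt_le_trans h2)// gerBl ltW.
Qed.

Lemma inner_near x : 0 < x < pi -> \forall m \near \oo, gap m < x < pi - gap m.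
Proof.
move=> /andP[x0 xp].
have p0 : 0 < pi - x by rewrite subr_gt0.
near=> m.
have h1 : gap m < x by near: m; exact: (cvgr_lt _ gap_cvg0).
have h2 : gap m < pi - x by near: m; exact: (cvgr_lt _ gap_cvg0).
by rewrite h1/= ltrBrDl -ltrBrDr.
Unshelve. all: by end_near. Qed.

(** Dominated convergence; a given x eventually lies in the shrunk interval. *)
Lemma isin_int_cvg (h_ : nat -> R -> R) (h : R -> R) (K : R) :
  (forall m, measurable_fun I (h_ m)) -> (forall m x, 0 < x < pi -> `|h_ m x| <= K) ->
  (forall x, 0 < x < pi -> h_ m x @[m --> \oo] --> h x) ->
  \int[mu]_(x in `]gap m, pi - gap m[) (isin m x * h_ m x) @[m --> \oo] -->
  \int[mu]_(x in I) (sin (n%:R * x) * h x).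
Proof.
move=> mh hK hc.
under eq_fun do rewrite (Rint_patch _ (@inner_sub _)).
have H := @Rdominated_cvg R _ _ mu I
  (fun m => (fun x => isin m x * h_ m x) \_ `]gap m, pi - gap m[)
  (fun x => sin (n%:R * x) * h x) (fun=> K) (measurable_itv _).
apply: (H _ _ _ _).2.
- move=> m; apply/measurable_restrict => //.
  apply: measurable_funM; first by apply: measurable_continuous; exact: continuous_isin.
  by apply: measurable_funS (mh m) => //; exact: subIsetl.
- move=> x; rewrite in_Ioo => xI.
  have c : isin m x * h_ m x @[m --> \oo] --> sin (n%:R * x) * h x.
    by apply: cvgM; [exact: isin_cvg|exact: hc].
  apply: cvg_trans c; apply: near_eq_cvg; near=> m.
  by rewrite patchE mem_set// in_Ioo; near: m; exact: inner_near.
- by apply: (@integ_bounded R 0 pi `|K|) => //; exact: measurable_cst.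
- move=> m x; rewrite in_Ioo => xI; rewrite patchE; case: ifPn => _; last first.
    by rewrite normr0 (le_trans _ (hK m x xI)).
  rewrite normrM -[leRHS]mul1r; apply: ler_pM => //; [exact: sin_max|exact: hK].
Unshelve. all: by end_near. Qed.

(** The inner sines vanish at the ends of the shrunk interval, so two
    integrations by parts bring in only the values of the function there. *)
Lemma isin_parts (g g1 g2 : R -> R) m :
  (forall x, 0 < x < pi -> has_derive g x (g1 x)) ->
  (forall x, 0 < x < pi -> has_derive g1 x (g2 x)) ->
  (forall x, 0 < x < pi -> {for x, continuous g2}) ->
  mu.-integrable `]gap m, pi - gap m[ (EFin \o (fun x => isin m x * g2 x)) ->
  mu.-integrable `]gap m, pi - gap m[ (EFin \o (fun x => isin m x * g x)) ->
  \int[mu]_(x in `]gap m, pi - gap m[) (isin m x * g2 x) =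
  freq m * (g (gap m) - (-1) ^+ n * g (pi - gap m)) -
  freq m ^+ 2 * \int[mu]_(x in `]gap m, pi - gap m[) (isin m x * g x).
Proof.
move=> h1 h2 c2 i2 i0.
have g0 := gap_gt0 m; have gl := gap_le m; have p0 := pi_gt0 R; have w := width_gt0 m.
have gp : gap m < pi - gap m by lra.
have Ip x : gap m <= x <= pi - gap m -> 0 < x < pi.
  by move=> /andP[a b]; apply/andP; split; lra.
pose F x := isin m x * g1 x - freq m * cos (freq m * (x - gap m)) * g x.
pose f x := isin m x * g2 x + freq m ^+ 2 * (isin m x * g x).
have hlin x : has_derive (fun x => freq m * (x - gap m)) x (freq m).
  by apply: hd_eq (hdZ (freq m) (hdB (hd_id x) (hd_cst (gap m) x))) _; rewrite subr0 mulr1.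
have hs x : has_derive (isin m) x (freq m * cos (freq m * (x - gap m))).
  have H : has_derive (isin m) x (cos (freq m * (x - gap m)) * freq m).
    exact: (@hd_comp R sin (fun x => freq m * (x - gap m)) x _ _ (hd_sin _) (hlin x)).
  by apply: hd_eq H _; rewrite mulrC.
have hc x : has_derive (fun x => freq m * cos (freq m * (x - gap m))) x (- (freq m ^+ 2 * isin m x)).
  have H := @hd_comp R cos (fun x => freq m * (x - gap m)) x _ _ (hd_cos _) (hlin x).
  apply: hd_eq (hdZ (freq m) H) _.
  by rewrite /isin; ring.
have hF x : 0 < x < pi -> has_derive F x (f x).
  move=> xI; apply: hd_eq (hdB (hdM (hs x) (h2 x xI)) (hdM (hc x) (h1 x xI))) _.
  by rewrite /f; ring.
have cF x : gap m <= x <= pi - gap m -> {for x, continuous F}.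
  by move=> /Ip xI; exact: hd_continuous (hF x xI).
have cf x : gap m < x < pi - gap m -> {for x, continuous f}.
  move=> /andP[a b]; have xI : 0 < x < pi by apply: Ip; rewrite !ltW.
  apply: cvgD; first by apply: cvgM; [exact: continuous_isin|exact: c2].
  apply: cvgM; first exact: cvg_cst.
  by apply: cvgM; [exact: continuous_isin|exact: hd_continuous (h1 x xI)].
have if_ : mu.-integrable `]gap m, pi - gap m[ (EFin \o f).
  by apply: integD => //; exact: integZ.
have [_ E] : mu.-integrable `]gap m, pi - gap m[ (EFin \o f) /\
    \int[mu]_(x in `]gap m, pi - gap m[) f x = F (pi - gap m) - F (gap m).
  apply: FTC2_oo => //.
  - by move=> x /andP[a b]; apply: hF; apply: Ip; rewrite !ltW.
  - by apply: cvg_at_right_filter; apply: cF; rewrite lexx ltW.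
  - by apply: cvg_at_left_filter; apply: cF; rewrite lexx ltW.
  - by left.
move: E; rewrite /f RintD//; last exact: integZ.
rewrite RintZ// /F.
have wn : pi - 2 * gap m != 0 by rewrite gt_eqF//; lra.
have fw : freq m * (pi - gap m - gap m) = n%:R * pi.
  rewrite (_ : pi - gap m - gap m = pi - 2 * gap m); last by ring.
  by rewrite /freq divfK.
rewrite /isin !fw subrr mulr0 sin0 cos0 sin_natpi cos_natpi.
move: (\int[mu]_(x in _) _) (\int[mu]_(x in _) _) => A B E.
by rewrite -[LHS](addrK (freq m ^+ 2 * A)) E; ring.
Qed.

End inner_sines.

(** * Sine coefficients of a solution *)

Section projection.
Context {R : realType}.
Notation mu := (@lebesgue_measure R).
Notation I := (`]0, pi[%classic : set R).
Variables (rho al T M : R) (N1 N2 q d1 : R -> R -> R).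
Hypotheses (rho01 : 0 < rho < 1) (T0 : 0 < T).
Hypothesis cN1 : continuous (fun p : R * R => N1 p.1 p.2).
Hypothesis cN2 : continuous (fun p : R * R => N2 p.1 p.2).
Hypothesis N1M : forall x t, `|N1 x t| <= M.
Hypothesis N2M : forall x t, `|N2 x t| <= M.

Let d x t := sg rho (N1 x) t.
Let v x t := sg rho (N2 x) t.
Let D x t := conv (gker (1 - rho)) (sg rho (N2 x)) t.
Let r x t := - (2 * al) * v x t + q x t.

Hypothesis cq : continuous_on (Omega T) q.
Hypothesis dD : forall x t, 0 < x < pi -> 0 < t < T -> has_derive (D x) t (r x t).
Hypothesis D0 : forall x, 0 < x < pi -> D x t @[t --> 0^'+] --> (0 : R).
Hypothesis dd : forall x t, 0 < x < pi -> 0 < t < T ->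
  has_derive (d^~ t) x (d1 x t) /\ has_derive (d1^~ t) x (q x t).
Hypothesis bd : forall t, 0 < t < T -> N1 0 t = 0 /\ N1 pi t = 0.

Let U := (`]0, pi[%classic `*` `]0, T[%classic : set (R * R)).

Let UE x t : U (x, t) <-> 0 < x < pi /\ 0 < t < T.
Proof. by rewrite /U /setX/= !in_itv. Qed.

Let openU : open U.
Proof. exact: open_rect. Qed.

Let subU : U `<=` Omega T.
Proof. by move=> [x t] /UE[xI /andP[t0 tT]]; apply/OmegaE; rewrite t0 ltW. Qed.

Let cqU p : U p -> {for p, continuous (fun p => q p.1 p.2)}.
Proof. exact: continuous_on_open cq openU subU _. Qed.

Lemma q_cont_x x t : 0 < x < pi -> 0 < t < T -> {for x, continuous (q^~ t)}.
Proof.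
move=> xI tI; apply: continuous_seq => u ux.
have c : (u n, t) @[n --> \oo] --> (x, t) by apply: cvg_couple => //; exact: cvg_cst.
have Ux : U (x, t) by apply/UE.
exact: cvg_comp _ _ c (cqU Ux).
Qed.

Lemma q_cont_t x t : 0 < x < pi -> 0 < t < T -> {for t, continuous (q x)}.
Proof.
move=> xI tI; apply: continuous_seq => u ut.
have c : (x, u n) @[n --> \oo] --> (x, t) by apply: cvg_couple => //; exact: cvg_cst.
have Ux : U (x, t) by apply/UE.
exact: cvg_comp _ _ c (cqU Ux).
Qed.

Lemma q_bounded (a b e t : R) : 0 < a -> b < pi -> 0 < e -> t < T ->
  exists2 Q, 0 <= Q & forall x s, a <= x <= b -> e <= s <= t -> `|q x s| <= Q.
Proof.
move=> a0 bp e0 tT; apply: (continuous_on_bounded cq) => -[x s] [/=].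
rewrite !in_itv/= => /andP[ax xb] /andP[es st]; apply/OmegaE; split.
  by rewrite (lt_le_trans a0)//= (le_lt_trans xb).
by rewrite (lt_le_trans e0)//= (le_trans st)// ltW.
Qed.

Lemma D_bounded : exists2 K, 0 <= K & forall x t, 0 < t -> `|D x t| <= K.
Proof.
have r0 := rho_gt0 rho01; have rc := rhoC_gt0 rho01.
have ib := betaf_integrable rc r0 (@ltr01 R).
pose K := \int[mu]_(s in `]0, 1[) (M * (Gamma (1 - rho))^-1 * betaf (1 - rho) rho 1 s).
have G0 : 0 <= (Gamma (1 - rho))^-1 by rewrite invr_ge0 ltW// Gamma_gt0.
exists `|K| => // x t t0; rewrite /D /gker.
rewrite (conv_sg rc r0 t0 (@cont_cst R _) (continuous_snd cN2 (x := x))) /sg.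
rewrite subrK subrr powRr0 mul1r; apply: le_trans (ler_norm K).
apply: le_norm_Rint; first exact: measurable_itv.
- apply: measurable_funM; first exact: measurable_betaf.
  apply: measurable_continuous.
  have cs : continuous (fun s => (Gamma (1 - rho))^-1 * N2 x (t * s)).
    move=> s; apply: cvgM; first exact: cvg_cst.
    exact: (cont_comp (@cont_Ml R t s) (@continuous_snd R N2 cN2 x (t * s))).
  exact: cs.
- by apply: integZ => //; exact: measurable_itv.
- move=> s _; have b0 : 0 <= betaf (1 - rho) rho 1 s by rewrite mulr_ge0 ?powR_ge0.
  rewrite normrM ger0_norm// mulrC ler_wpM2r// normrM ger0_norm// mulrC.
  by rewrite ler_wpM2r.
Qed.

(** The equation for D is integrated in time over ]e, t[, away from the singularity,
    and in space over a segment inside ]0, pi[, where q is bounded; then the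
    integrals are exchanged. *)
Lemma slab (a b e t : R) (s : R -> R) : 0 < a -> b < pi -> 0 < e -> e < t -> t < T ->
  continuous s -> (forall x, `|s x| <= 1) ->
  \int[mu]_(x in `]a, b[) (s x * (D x t - D x e)) =
  \int[mu]_(h in `]e, t[) \int[mu]_(x in `]a, b[) (s x * r x h).
Proof.
move=> a0 bp e0 et tT cs s1.
have [Q Q0 qQ] := q_bounded a0 bp e0 tT.
have M0 := M_ge0 N2M.
have xIo x : a < x < b -> 0 < x < pi.
  by move=> /andP[ax xb]; rewrite (lt_trans a0)//= (lt_trans xb).
have tIo h : e < h < t -> 0 < h < T.
  by move=> /andP[eh ht]; rewrite (lt_trans e0)//= (lt_trans ht).
have [V [V0 vV]] : exists V, 0 <= V /\ forall x h, e < h < t -> `|v x h| <= V.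
  have [P [P0 hP]] : exists P, 0 <= P /\ forall h, e <= h <= t -> `|h `^ (rho - 1)| <= P.
    apply: cont_seg_bounded; apply: continuous_in_subspaceT => h; rewrite inE /= in_itv/=.
    by move=> /andP[eh _]; apply: continuous_powR; exact: lt_le_trans eh.
  exists (P * M); split; first exact: mulr_ge0.
  move=> x h /andP[eh ht]; rewrite /v /sg normrM; apply: ler_pM => //.
  by apply: hP; rewrite !ltW.
pose B := `|2 * al| * V + Q.
have B0 : 0 <= B by rewrite addr_ge0 ?mulr_ge0.
have rB x h : a < x < b -> e < h < t -> `|r x h| <= B.
  move=> /andP[ax xb] hI; apply: le_trans (ler_normD _ _) _; apply: lerD.
    by rewrite normrM normrN ler_wpM2l// vV.
  by apply: qQ; [rewrite !ltW|case/andP: hI => e1 e2; rewrite !ltW].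
have cr_t x h : 0 < x < pi -> 0 < h < T -> {for h, continuous (r x)}.
  move=> xI hI; apply: cvgD; last exact: q_cont_t.
  apply: cvgM; first exact: cvg_cst.
  by apply: continuous_sg; [exact: continuous_snd|case/andP: hI].
have cr_x x h : 0 < x < pi -> 0 < h < T -> {for x, continuous (r^~ h)}.
  move=> xI hI; apply: cvgD; last exact: q_cont_x.
  apply: cvgM; first exact: cvg_cst.
  by apply: cvgM; [exact: cvg_cst|exact: (continuous_fst cN2)].
have mrt x : 0 < x < pi -> measurable_fun (`]e, t[%classic : set R) (r x).
  by move=> xI; apply: measurable_cont => h hI; apply: cr_t => //; exact: tIo.
have E x : a < x < b -> s x * (D x t - D x e) = \int[mu]_(h in `]e, t[) (s x * r x h).
  move=> xI; have xI' := xIo x xI.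
  have ir : mu.-integrable `]e, t[ (EFin \o r x).
    by apply: (@integ_bounded R e t B) => [|h hI]; [exact: mrt|exact: rB].
  have [_ Ex] : mu.-integrable `]e, t[ (EFin \o r x) /\ \int[mu]_(h in `]e, t[) r x h = D x t - D x e.
    apply: FTC2_oo => //.
    - by move=> h hI; apply: cr_t => //; exact: tIo.
    - by move=> h hI; apply: dD => //; exact: tIo.
    - apply: cvg_at_right_filter; apply: hd_continuous (dD xI' _); by rewrite e0 (lt_trans et).
    - apply: cvg_at_left_filter; apply: hd_continuous (dD xI' _); by rewrite tT (lt_trans e0).
    - by left.
  by rewrite -Ex -(RintZ _ (measurable_itv _) ir).
rewrite (@eq_Rint R _ _ (fun x => \int[mu]_(h in `]e, t[) (s x * r x h))); last first.
  by move=> x; rewrite in_Ioo => xI; exact: E.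
pose f (z : R * R) := s z.1 * r z.1 z.2.
pose A := (`]a, b[%classic `*` `]e, t[%classic : set (R * R)).
have oA : open A by exact: open_rect.
have mf : measurable_fun A f.
  apply: measurable_cont_plane oA _ => -[x h] [/=]; rewrite !in_itv/= => xI hI.
  have xI' := xIo x xI; have hI' := tIo h hI.
  have c1 : p.1 @[p --> (x, h)] --> x by exact: cvg_fst.
  have c2 : p.2 @[p --> (x, h)] --> h by exact: cvg_snd.
  apply: cvgM; first by apply: (cvg_cont_comp c1); exact: cs.
  have Ux : U (x, h) by apply/UE.
  apply: cvgD; last exact: (cqU Ux).
  apply: cvgM; first exact: cvg_cst.
  apply: cvgM; last exact: cN2.
  by apply: (@cvg_cont_comp R _ (nbhs (x, h)) _ _ (fun y => y `^ (rho - 1)) h c2); apply: continuous_powR; case/andP: hI'.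
have fB x h : a < x < b -> e < h < t -> `|f (x, h)| <= B.
  move=> xI hI; rewrite /f/= normrM -[leRHS]mul1r; apply: ler_pM => //; exact: rB.
have mfx x : a < x < b -> measurable_fun (`]e, t[%classic : set R) (fun h => f (x, h)).
  by move=> xI; rewrite /f/=; apply: measurable_funM; [exact: measurable_cst|apply: mrt; exact: xIo].
apply: (@RFubini R `]a, b[ `]e, t[ f (fun=> B * (t - e)) (measurable_itv _) (measurable_itv _) mf).
- move=> x; rewrite in_Ioo => xI.
  by apply: (@integ_bounded R e t B) => [|h hI]; [exact: mfx|exact: fB].
- move=> h; rewrite in_Ioo => hI.
  apply: (@integ_bounded R a b B) => [|x xI]; last exact: fB.
  rewrite /f/=; apply: measurable_funM; first exact: measurable_continuous.
  by apply: measurable_cont => x xI; apply: cr_x; [exact: xIo|exact: tIo].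
- by apply: (@integ_bounded R a b `|B * (t - e)|) => //; exact: measurable_cst.
- move=> x; rewrite in_Ioo => xI.
  have := @Rint_norm_le R e t B (fun h => `|f (x, h)|) (ltW et).
  move=> /(_ _ _)/(le_trans (ler_norm _)); apply.
    by apply: measurableT_comp => //; exact: mfx.
  by move=> h hI; rewrite normr_id; exact: fB.
Qed.

Section mode.
Variable n : nat.
Notation gap := (@gap R).
Notation freq := (@freq R n).
Notation isin := (@isin R n).
Notation J m := (`]gap m, pi - gap m[%classic : set R).

Let X (N : R -> R -> R) m t := \int[mu]_(x in J m) (isin m x * N x t).
Let Q m t := - (2 * al) * X N2 m t + freq m * (N1 (gap m) t - (-1) ^+ n * N1 (pi - gap m) t) -
  freq m ^+ 2 * X N1 m t.

Let J_pos m : gap m <= pi - gap m.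
Proof. by have := @gap_le R m; have := pi_gt0 R; lra. Qed.

Let iX (N : R -> R -> R) m t : continuous (fun p : R * R => N p.1 p.2) ->
  (forall x t, `|N x t| <= M) ->
  mu.-integrable (J m) (EFin \o (fun x => isin m x * N x t)) /\ `|X N m t| <= M * pi.
Proof.
move=> cN NM.
have mf : measurable_fun (J m) (fun x => isin m x * N x t).
  by apply: measurable_funM; apply: measurable_continuous;
    [exact: continuous_isin|exact: (continuous_fst cN)].
have bf x : gap m < x < pi - gap m -> `|isin m x * N x t| <= M.
  by move=> _; rewrite normrM -[leRHS]mul1r; apply: ler_pM => //; exact: sin_max.
split; first exact: integ_bounded bf.
apply: le_trans (Rint_norm_le (J_pos m) mf bf) _.
by rewrite ler_wpM2l ?(M_ge0 NM)//; have := @gap_gt0 R m; lra.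
Qed.

Let cX (N : R -> R -> R) m : continuous (fun p : R * R => N p.1 p.2) ->
  (forall x t, `|N x t| <= M) -> continuous (X N m).
Proof.
move=> cN NM; apply: (xint_continuous cN NM (K := 1)); first exact: continuous_isin.
by move=> x; exact: sin_max.
Qed.

Let cQ m : continuous (Q m).
Proof.
move=> t; apply: cvgB.
  apply: cvgD; first by apply: cvgM; [exact: cvg_cst|exact: cX].
  apply: cvgM; first exact: cvg_cst.
  apply: cvgB; first exact: continuous_snd.
  by apply: cvgM; [exact: cvg_cst|exact: continuous_snd].
by apply: cvgM; [exact: cvg_cst|exact: cX].
Qed.

Lemma inner_equation m h : 0 < h < T ->
  \int[mu]_(x in J m) (isin m x * r x h) = sg rho (Q m) h.
Proof.
move=> hI; have /andP[h0 hT] := hI.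
have gp := @gap_gt0 R m; have gl := @gap_le R m; have p0 := pi_gt0 R.
have [i2 _] := iX m h cN2 N2M; have [i1 _] := iX m h cN1 N1M.
have xJ x : gap m < x < pi - gap m -> 0 < x < pi.
  by move=> /andP[a b]; apply/andP; split; lra.
have iq : mu.-integrable (J m) (EFin \o (fun x => isin m x * q x h)).
  have bp : pi - gap m < pi by lra.
  have [B B0 qB] := q_bounded gp bp h0 hT.
  apply: (@integ_bounded R _ _ B) => [|x /andP[a b]].
    apply: measurable_funM; first by apply: measurable_continuous; exact: continuous_isin.
    by apply: measurable_cont => x xI; apply: q_cont_x => //; exact: xJ.
  rewrite normrM -[leRHS]mul1r; apply: ler_pM => //; first exact: sin_max.
  by apply: qB; rewrite ?lexx ?(ltW a) ?(ltW b).
have idd : mu.-integrable (J m) (EFin \o (fun x => isin m x * d x h)).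
  apply: (eq_integ _ _ (integZ (h `^ (rho - 1)) (measurable_itv _) i1)); first exact: measurable_itv.
  by move=> x _; rewrite /d /sg; ring.
have P := isin_parts (fun x xI => (dd xI hI).1) (fun x xI => (dd xI hI).2)
  (fun x xI => q_cont_x xI hI) iq idd.
rewrite (@eq_Rint R _ _ (fun x => - (2 * al) * h `^ (rho - 1) * (isin m x * N2 x h) + isin m x * q x h)); last first.
  by move=> x _; rewrite /r /v /sg; ring.
rewrite (RintD (measurable_itv _) (integZ _ (measurable_itv _) i2) iq).
rewrite (RintZ _ (measurable_itv _) i2) P.
rewrite (@eq_Rint R _ (fun x => isin m x * d x h) (fun x => h `^ (rho - 1) * (isin m x * N1 x h))); last first.
  by move=> x _; rewrite /d /sg; ring.
rewrite (RintZ _ (measurable_itv _) i1) /sg /Q /X /d /sg.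
move: (\int[mu]_(x in _) _) (\int[mu]_(x in _) _) => A B; ring.
Qed.

Let Q_cvg h : 0 < h < T ->
  Q m h @[m --> \oo] --> - (2 * al) * coef N2 n h - n%:R ^+ 2 * coef N1 n h.
Proof.
move=> hI; have [b0 bp] := bd hI.
have cc (N : R -> R -> R) : continuous (fun p : R * R => N p.1 p.2) ->
    (forall x t, `|N x t| <= M) -> X N m h @[m --> \oo] --> coef N n h.
  move=> cN NM; apply: (@isin_int_cvg R n (fun _ x => N x h) (fun x => N x h) M).
  - by move=> m; apply: measurable_continuous; exact: continuous_fst.
  - by move=> m x _.
  - by move=> x _; exact: cvg_cst.
have g0 := @gap_cvg0 R.
have c1 : N1 (gap m) h @[m --> \oo] --> (0 : R).
  rewrite -b0; exact: (cvg_cont_comp g0 (@continuous_fst R N1 cN1 h 0)).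
have c2 : N1 (pi - gap m) h @[m --> \oo] --> (0 : R).
  have c : pi - gap m @[m --> \oo] --> (pi - 0 : R).
    by apply: cvgB; [exact: cvg_cst|exact: g0].
  rewrite subr0 in c; rewrite -bp; exact: (cvg_cont_comp c (@continuous_fst R N1 cN1 h pi)).
have c3 : Q m h @[m --> \oo] --> - (2 * al) * coef N2 n h + n%:R * (0 - (-1) ^+ n * 0) -
    n%:R ^+ 2 * coef N1 n h.
  apply: cvgB; last first.
    apply: cvgM; last exact: cc.
    by rewrite expr2; under eq_fun do rewrite expr2; apply: cvgM; exact: freq_cvg.
  apply: cvgD; first by apply: cvgM; [exact: cvg_cst|exact: cc].
  apply: cvgM; first exact: freq_cvg.
  by apply: cvgB => //; apply: cvgM => //; exact: cvg_cst.
by rewrite mulr0 subr0 mulr0 addr0 in c3; exact: c3.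
Qed.

Let Q_bound m h : `|Q m h| <= `|2 * al| * (M * pi) + (2 * n%:R) * (M + M) + (2 * n%:R) ^+ 2 * (M * pi).
Proof.
have [_ b2] := iX m h cN2 N2M; have [_ b1] := iX m h cN1 N1M.
have f0 := @freq_ge0 R n m; have f1 := @freq_le R n m.
apply: le_trans (ler_normB _ _) _; apply: lerD.
  apply: le_trans (ler_normD _ _) _; apply: lerD.
    by rewrite normrM normrN ler_wpM2l.
  rewrite normrM ger0_norm//; apply: ler_pM => //.
  apply: le_trans (ler_normB _ _) _; apply: lerD => //.
  by rewrite normrM normrX normrN1 expr1n mul1r.
rewrite normrM ger0_norm ?exprn_ge0//; apply: ler_pM => //; first exact: exprn_ge0.
by rewrite ler_pXn2r// nnegrE mulr_ge0.
Qed.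

(** Both sides of [slab] converge as the slab ]gap m, pi - gap m[ x ]e m, t[ exhausts
    ]0, pi[ x ]0, t[: the boundary values of N1 tend to 0 and all integrands in time
    are bounded by a multiple of h^(rho-1). *)
Lemma mode_equation t : 0 < t < T ->
  conv (gker (1 - rho)) (sg rho (coef N2 n)) t =
  conv (gker 1) (sg rho (fun h => - (2 * al) * coef N2 n h - n%:R ^+ 2 * coef N1 n h)) t.
Proof.
move=> /andP[t0 tT].
have r0 := rho_gt0 rho01; have rc := rhoC_gt0 rho01.
pose e m := t * (m.+2%:R)^-1.
have e0 m : 0 < e m by rewrite mulr_gt0 ?invr_gt0.
have et m : e m < t by rewrite /e gtr_pMr// invf_lt1// ltr1n.
have e_cvg : e m @[m --> \oo] --> (0 : R).
  rewrite -(mulr0 t); apply: cvgM; first exact: cvg_cst.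
  by have := @cvg_inv_shift R 1; under eq_fun do rewrite addn1.
pose L m := \int[mu]_(x in J m) (isin m x * (D x t - D x (e m))).
have L_R m : L m = \int[mu]_(h in `]e m, t[) sg rho (Q m) h.
  rewrite /L (@slab _ _ (e m) t (isin m)) //.
  - apply: eq_Rint => h; rewrite in_Ioo => /andP[eh ht]; apply: inner_equation.
    by rewrite (lt_trans (e0 m) eh)/= (lt_trans ht).
  - exact: gap_gt0.
  - by have := @gap_gt0 R m; lra.
  - exact: continuous_isin.
  - by move=> x; exact: sin_max.
have [K K0 DK] := D_bounded.
have mD s : 0 < s -> measurable_fun I (D^~ s).
  move=> s0; apply: measurable_continuous => x; apply: continuous_seq => u ux.
  apply: (@conv_dct R (1 - rho) (fun=> (Gamma (1 - rho))^-1) (fun m => sg rho (N2 (u m))) (sg rho (N2 x))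
     rho M s rc r0 s0 (@cont_cst R _) _ _ _).2.
  - by move=> m; apply: measurable_funTS; apply: measurable_sg; exact: continuous_snd.
  - move=> m h _; rewrite /sg normrM ger0_norm ?powR_ge0// mulrC.
    by rewrite ler_wpM2r ?powR_ge0.
  - move=> h _; apply: cvgM; first exact: cvg_cst.
    exact: cvg_comp _ _ ux (@continuous_fst R N2 cN2 h x).
have Lc : L m @[m --> \oo] --> conv (gker (1 - rho)) (sg rho (coef N2 n)) t.
  rewrite -(conv_coef cN2 N2M n r0 rc t0).2.
  apply: (@isin_int_cvg R n (fun m x => D x t - D x (e m)) (D^~ t) (K + K)).
  - by move=> m; apply: measurable_funB; exact: mD.
  - by move=> m x _; apply: le_trans (ler_normB _ _) _; apply: lerD; exact: DK.
  - move=> x xI; rewrite -[X in _ --> X]subr0; apply: cvgB; first exact: cvg_cst.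
    have := D0 xI => /cvg_at_rightP; apply; split=> //.
have Rc : \int[mu]_(h in `]e m, t[) sg rho (Q m) h @[m --> \oo] -->
    conv (gker 1) (sg rho (fun h => - (2 * al) * coef N2 n h - n%:R ^+ 2 * coef N1 n h)) t.
  rewrite /conv (@eq_Rint R `]0, t[ _ (fun h => sg rho (fun h => - (2 * al) * coef N2 n h - n%:R ^+ 2 * coef N1 n h) h)); last first.
    by move=> h _; rewrite gker1E mul1r.
  have sub m : (`]e m, t[%classic : set R) `<=` `]0, t[.
    by move=> h; rewrite !in_Ioo => /andP[eh ->]; rewrite (lt_trans (e0 m) eh).
  under eq_fun do rewrite (Rint_patch _ (@sub _)).
  pose B := `|2 * al| * (M * pi) + (2 * n%:R) * (M + M) + (2 * n%:R) ^+ 2 * (M * pi).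
  have B0 : 0 <= B by exact: le_trans (normr_ge0 _) (Q_bound 0%N 0).
  have H := @Rdominated_cvg R _ _ mu `]0, t[ (fun m => sg rho (Q m) \_ `]e m, t[)
    (sg rho (fun h => - (2 * al) * coef N2 n h - n%:R ^+ 2 * coef N1 n h))
    (fun h => B * h `^ (rho - 1)) (measurable_itv _).
  apply: (H _ _ _ _).2.
  - move=> m; apply/measurable_restrict => //.
    by apply: measurable_funTS; apply: measurable_sg; exact: cQ.
  - move=> h; rewrite in_Ioo => /andP[h0 ht].
    have hI : 0 < h < T by rewrite h0 (lt_trans ht).
    have c : sg rho (Q m) h @[m --> \oo] --> sg rho (fun h => - (2 * al) * coef N2 n h - n%:R ^+ 2 * coef N1 n h) h.
      by apply: cvgM; [exact: cvg_cst|exact: Q_cvg].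
    apply: cvg_trans c; apply: near_eq_cvg; near=> m.
    rewrite patchE mem_set// in_Ioo ht andbT.
    by near: m; exact: (cvgr_lt _ e_cvg).
  - by apply: integZ => //; exact: (integral_powR r0 t0).1.
  - move=> m h; rewrite in_Ioo => /andP[h0 ht]; rewrite patchE; case: ifPn => _; last first.
      by rewrite normr0 mulr_ge0 ?powR_ge0.
    by rewrite /sg normrM ger0_norm ?powR_ge0// mulrC ler_wpM2r ?powR_ge0// Q_bound.
rewrite -(funext L_R) in Rc.
exact: (cvg_unique (@Rhausdorff R) Lc Rc).
Unshelve. all: by end_near. Qed.

End mode.

End projection.

(** * Uniqueness *)

Section mode_uniqueness.
Context {R : realType}.
Notation mu := (@lebesgue_measure R).

Lemma conv_swap (k h l : R -> R) (t : R) : sing k -> sing h -> sing l -> 0 < t ->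
  conv (conv k h) l t = conv h (conv k l) t.
Proof.
move=> sk sh sl t0; rewrite -(convA sh sk sl t0).
by apply: conv_ext => // s /andP[s0 _]; exact: convC.
Qed.

Lemma conv_extl (k k' h : R -> R) (t : R) : (forall s, 0 < s < t -> k s = k' s) ->
  conv k h t = conv k' h t.
Proof. by move=> E; apply: conv_ext. Qed.

Lemma conv_extr (k h h' : R -> R) (t : R) : (forall s, 0 < s < t -> h s = h' s) ->
  conv k h t = conv k h' t.
Proof. by move=> E; apply: conv_ext. Qed.

(** Convolving g * H = 1 - c 1 * H - m 1 * G with U and using g * G = 1 * H, the
    homogeneous equations move g onto U and V, and everything but 1 * U cancels. *)
Lemma homogeneous_mode (g one G H U V : R -> R) (c m t : R) :
  sing g -> sing one -> sing G -> sing H -> sing U -> sing V ->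
  sing (fun s => - c * V s - m * U s) -> 0 < t ->
  (forall s, 0 < s -> one s = 1) ->
  (forall s, 0 < s -> conv g G s = conv one H s) ->
  (forall s, 0 < s -> conv g H s = 1 - c * conv one H s - m * conv one G s) ->
  (forall s, 0 < s <= t -> conv g U s = conv one V s) ->
  (forall s, 0 < s <= t -> conv g V s = conv one (fun s => - c * V s - m * U s) s) ->
  conv one U t = 0.
Proof.
move=> sg_ s1 sG sH sU sV sW t0 one1 gG gH eqU eqV.
pose W s := - c * V s - m * U s; pose P := conv one G.
have sP : sing P by exact: sing_conv.
have sQ : sing (conv one H) by exact: sing_conv.
have sgH : sing (conv g H) by exact: sing_conv.
have sI s : 0 < s < t -> 0 < s <= t by move=> /andP[-> /ltW].
have iV := sing_cint sP sV t0; have iU := sing_cint sP sU t0.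
have gW : conv P W t = - c * conv P V t - m * conv P U t /\ conv P W t = conv G (conv one W) t.
  have [e1 i1] := conv_addr (- c - 1) iV iV.
  have [e2 i2] := conv_addr (- m) i1 iU.
  split; last exact: conv_swap.
  rewrite (@conv_extr P W (fun s => V s + (- c - 1) * V s + - m * U s)); last first.
    by move=> s _; rewrite /W; ring.
  by rewrite e2 e1; ring.
have E1 : conv (conv g H) U t = conv P W t.
  rewrite gW.2 (conv_swap sg_ sH sU t0) (@conv_extr H (conv g U) (conv one V)); last by move=> s /sI; exact: eqU.
  rewrite -(conv_swap s1 sH sV t0) (@conv_extl (conv one H) (conv g G)); last by move=> s /andP[s0 _]; rewrite gG.
  rewrite (conv_swap sg_ sG sV t0); apply: conv_extr => s /sI; exact: eqV.
have E2 : conv (conv one H) U t = conv P V t.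
  rewrite (@conv_extl (conv one H) (conv g G)); last by move=> s /andP[s0 _]; rewrite gG.
  rewrite (conv_swap sg_ sG sU t0) (@conv_extr G (conv g U) (conv one V)); last by move=> s /sI; exact: eqU.
  by rewrite -(conv_swap s1 sG sV t0).
have [e1 i1] := conv_addl c (sing_cint sgH sU t0) (sing_cint sQ sU t0).
have [e2 i2] := conv_addl m i1 iU.
rewrite (@conv_extl one (fun s => conv g H s + c * conv one H s + m * P s)).
  by rewrite e2 e1 E1 E2 gW.1; ring.
by move=> s /andP[s0 _]; rewrite gH// one1// /P; ring.
Qed.

Variables rho al T k : R.
Hypotheses (rho01 : 0 < rho < 1) (al0 : 0 < al).
Variables A B : R -> R.
Hypotheses (cA : continuous A) (cB : continuous B).
Notation U := (sg rho A).
Notation V := (sg rho B).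
Notation g := (gker (1 - rho)).
Notation one := (gker (1 : R)).
Notation W := (sg rho (fun h => - (2 * al) * B h - k ^+ 2 * A h)).
Hypothesis eqU : forall t, 0 < t < T -> conv g U t = conv one V t.
Hypothesis eqV : forall t, 0 < t < T -> conv g V t = conv one W t.

Lemma mode_primitive_eq0 t : 0 < t < T -> conv one U t = 0.
Proof.
move=> /andP[t0 tT].
have r0 := rho_gt0 rho01; have rc := rhoC_gt0 rho01.
have sI s : 0 < s <= t -> 0 < s < T by move=> /andP[-> st]; rewrite (le_lt_trans st).
apply: (@homogeneous_mode g one (sg rho (symG rho al k)) (sg rho (symH rho al k)) U V (2 * al) (k ^+ 2)).
- exact: sing_gker.
- exact: sing_gker.
- by apply: sing_sg => //; exact: continuous_symG.
- by apply: sing_sg => //; exact: continuous_symH.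
- exact: sing_sg.
- exact: sing_sg.
- have cW : continuous (fun h => - (2 * al) * B h - k ^+ 2 * A h).
    by move=> h; apply: cvgB; apply: cvgM; [exact: cvg_cst|exact: cB|exact: cvg_cst|exact: cA].
  by apply: sing_ext (sing_sg r0 cW) => h _; rewrite /sg; ring.
- by [].
- by move=> s _; exact: gker1E.
- by move=> s; exact: conv_g_symG.
- by move=> s; exact: conv_g_symH.
- by move=> s /sI; exact: eqU.
- move=> s /sI sT; rewrite (eqV sT); apply: conv_extr => h _; rewrite /sg; ring.
Qed.

Lemma mode_eq0 t : 0 < t < T -> A t = 0.
Proof.
move=> /andP[t0 tT]; have r0 := rho_gt0 rho01.
have h1 : has_derive (conv (fun=> 1) U) t (U t) by exact: hd_conv1.
have h2 : has_derive (conv (fun=> 1) U) t 0.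
  apply: (near_eq_is_derive _ (hd_cst (0 : R) t)); near=> s.
  have -> : (fun=> 1) = one by apply/funext => z; rewrite gker1E.
  rewrite mode_primitive_eq0//; apply/andP; split; near: s.
    exact: lt_nbhsr.
  exact: lt_nbhsl.
have E : U t = 0.
  have := h1; rewrite /has_derive => d1; have := h2; rewrite /has_derive => d2.
  by rewrite -[LHS](@derive_val _ _ _ _ _ _ _ d1) (@derive_val _ _ _ _ _ _ _ d2).
move/eqP: E; rewrite /sg mulf_eq0 gt_eqF ?powR_gt0//= => /eqP//.
Unshelve. all: by end_near. Qed.

End mode_uniqueness.

Section solutions.
Context {R : realType}.
Notation mu := (@lebesgue_measure R).
Notation I := (`]0, pi[%classic : set R).
Variables rho al T : R.
Hypotheses (rho01 : 0 < rho < 1) (al0 : 0 < al) (T0 : 0 < T).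

(** The same device as [clamp], in both variables. *)
Definition clamp2 (h : R -> R -> R) (x t : R) : R := h (clamp pi x) (clamp T t).

Lemma clamp2_id (h : R -> R -> R) x t : 0 <= x <= pi -> 0 <= t <= T -> clamp2 h x t = h x t.
Proof. by move=> xI tI; rewrite /clamp2 !clamp_id. Qed.

Lemma clamp2_continuous (h : R -> R -> R) : continuous_on (Omega_bar T) h ->
  continuous (fun p : R * R => clamp2 h p.1 p.2).
Proof.
move=> ch [x t].
have cl p : Omega_bar T (clamp pi p.1, clamp T p.2).
  by apply/Omega_barE; split; apply: clampI => //; exact: pi_gt0.
have c := (subspace_continuousP _ _).1 ch _ (cl (x, t)).
have c1 : p.1 @[p --> (x, t)] --> x by exact: cvg_fst.
have c2 : p.2 @[p --> (x, t)] --> t by exact: cvg_snd.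
have d1 : clamp pi p.1 @[p --> (x, t)] --> clamp pi x.
  by apply: (cvg_cont_comp c1); exact: continuous_clamp.
have d2 : clamp T p.2 @[p --> (x, t)] --> clamp T t.
  by apply: (cvg_cont_comp c2); exact: continuous_clamp.
have cw : (clamp pi p.1, clamp T p.2) @[p --> (x, t)] -->
    within (Omega_bar T) (nbhs (clamp pi x, clamp T t)).
  move=> P [[A B] /= [Ax Bt] AB].
  have uA : \forall p \near (x, t), A (clamp pi p.1) := d1 _ Ax.
  have uB : \forall p \near (x, t), B (clamp T p.2) := d2 _ Bt.
  apply: filterS (filterI uA uB) => p [Ap Bp]; exact: (AB (clamp pi p.1, clamp T p.2)).
exact: cvg_comp _ _ cw c.
Qed.

Lemma clamp2_bounded (h : R -> R -> R) : continuous_on (Omega_bar T) h ->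
  exists2 M, 0 <= M & forall x t, `|clamp2 h x t| <= M.
Proof.
move=> ch; have [M M0 hM] := continuous_on_bounded ch (@subset_refl _ _).
exists M => // x t; apply: hM; apply: clampI => //; exact: pi_gt0.
Qed.

Lemma RL_has_derive (p : R -> R) (t : R) : RL_exists rho T p -> 0 < t < T ->
  has_derive (frac_int (rho - 1) p) t (RL rho T p t).
Proof.
move=> ex tI; have /andP[t0 tT] := tI.
have sub : (`]0, T[%classic : set R) `<=` `]0, T].
  by move=> s; rewrite /= !in_itv/= => /andP[-> /ltW].
apply: (derivable_on_interior sub tI).
by have [|_] := ex t; first by rewrite t0 ltW.
Qed.

(** The converse of [RL_step], by the fundamental theorem; on ]0, T[ the one-sided
    derivatives are two-sided. *)
Lemma RL_integrated (A t : R) (p B : R -> R) : RL_exists rho T p -> continuous B ->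
  (forall s, 0 < s <= T -> RL rho T p s = sg rho B s) ->
  frac_int (rho - 1) p s @[s --> 0^'+] --> A -> 0 < t < T ->
  conv (gker (1 - rho)) p t = A + conv (gker 1) (sg rho B) t.
Proof.
move=> ex cB pB p0 tI; have /andP[t0 tT] := tI.
have r0 := rho_gt0 rho01.
have sI s : 0 < s < t -> 0 < s < T by move=> /andP[-> st]; rewrite (lt_trans st).
have sI' s : 0 < s < T -> 0 < s <= T by move=> /andP[-> /ltW].
have iB : mu.-integrable `]0, t[ (EFin \o sg rho B).
  have := conv_sg_integrable ltr01 r0 t0 (@cont_cst R 1) cB.
  apply: eq_integ; first exact: measurable_itv.
  by move=> s; rewrite in_Ioo => /andP[_ st]; rewrite {1}/sg subrr powRr0 !mul1r.
have [_] : mu.-integrable `]0, t[ (EFin \o sg rho B) /\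
    \int[mu]_(s in `]0, t[) sg rho B s = frac_int (rho - 1) p t - A.
  apply: FTC2_oo => //.
  - by move=> s /andP[s0 _]; exact: continuous_sg.
  - by move=> s /sI sT; rewrite -(pB s (sI' s sT)); exact: RL_has_derive.
  - exact: p0.
  - apply: cvg_at_left_filter; exact: hd_continuous (RL_has_derive ex tI).
  - by left.
have fe : frac_int_exists (rho - 1) p t := (ex t (sI' t tI)).1.
rewrite (frac_intE fe) => E.
have -> : conv (gker 1) (sg rho B) t = \int[mu]_(s in `]0, t[) sg rho B s.
  by apply: eq_Rint => s _; rewrite gker1E mul1r.
by rewrite E [RHS]addrC subrK.
Qed.

Lemma dxx_has_derive (u : R -> R -> R) (x t : R) : dxx_exists u x t ->
  has_derive (u^~ t) x (derive1 (u^~ t) x) /\ has_derive (derive1 (u^~ t)) x (dxx u x t).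
Proof.
move=> [h1 h2]; rewrite /dxx /= !derive1E.
by split; [exact: derivableP h1|exact: derivableP h2].
Qed.

Section two_solutions.
Variables (f : R -> R -> R) (phi0 phi1 : R -> R) (u1 u2 : R -> R -> R).
Hypotheses (s1 : is_solution rho T al f phi0 phi1 u1) (s2 : is_solution rho T al f phi0 phi1 u2).

Let v1 := dt_rho rho T u1.
Let v2 := dt_rho rho T u2.
Let E1 x t := ext T (tweight rho u1) x t - ext T (tweight rho u2) x t.
Let E2 x t := ext T (tweight rho v1) x t - ext T (tweight rho v2) x t.
Let N1 := clamp2 E1.
Let N2 := clamp2 E2.

Let cE1 : continuous_on (Omega_bar T) E1.
Proof.
have [c1 _] := sol_Cbar s1; have [c2 _] := sol_Cbar s2.
apply/subspace_continuousP => p xt; apply: cvgB.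
  exact: ((subspace_continuousP _ _).1 c1 p xt).
exact: ((subspace_continuousP _ _).1 c2 p xt).
Qed.

Let cE2 : continuous_on (Omega_bar T) E2.
Proof.
have [c1 _] := sol_dt_Cbar s1; have [c2 _] := sol_dt_Cbar s2.
apply/subspace_continuousP => p xt; apply: cvgB.
  exact: ((subspace_continuousP _ _).1 c1 p xt).
exact: ((subspace_continuousP _ _).1 c2 p xt).
Qed.

Let sgE (h : R -> R -> R) (x t : R) : in_Cbar T (Omega_lat T) (tweight rho h) ->
  0 <= x <= pi -> 0 < t <= T -> sg rho (fun s => clamp2 (ext T (tweight rho h)) x s) t = h x t.
Proof.
move=> [_ hE] xI /andP[t0 tT]; rewrite /sg clamp2_id ?(ltW t0)//.
rewrite hE; last by apply/Omega_latE; rewrite t0.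
rewrite /tweight mulrA -powRD; last by rewrite (gt_eqF t0) implybT.
by rewrite (_ : rho - 1 + (1 - rho) = 0) ?powRr0 ?mul1r//; ring.
Qed.

Let dE x t : 0 <= x <= pi -> 0 < t <= T -> sg rho (N1 x) t = u1 x t - u2 x t.
Proof.
move=> xI tI; rewrite -(sgE (sol_Cbar s1) xI tI) -(sgE (sol_Cbar s2) xI tI).
by rewrite /sg /N1 /clamp2 /E1 mulrBr.
Qed.

Let vE x t : 0 <= x <= pi -> 0 < t <= T -> sg rho (N2 x) t = v1 x t - v2 x t.
Proof.
move=> xI tI; rewrite /v1 /v2 -(sgE (sol_dt_Cbar s1) xI tI) -(sgE (sol_dt_Cbar s2) xI tI).
by rewrite /sg /N2 /clamp2 /E2 mulrBr.
Qed.

Let sym_continuous (h : R -> R -> R) (x : R) : in_Cbar T (Omega_lat T) (tweight rho h) ->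
  continuous (clamp2 (ext T (tweight rho h)) x).
Proof. by move=> [ch _]; exact: (continuous_snd (clamp2_continuous ch)). Qed.

Let conv_diff (k p1 p2 : R -> R) t : cint k p1 t -> cint k p2 t ->
  conv k (fun s => p1 s - p2 s) t = conv k p1 t - conv k p2 t.
Proof.
move=> i1 i2; have [e _] := conv_addr (-1) i1 i2.
rewrite mulN1r in e; rewrite -e; apply: conv_ext => // s _; by rewrite mulN1r.
Qed.

Let tIo (t : R) : 0 < t < T -> 0 < t <= T.
Proof. by move=> /andP[-> /ltW]. Qed.

Let first_eq x t : 0 <= x <= pi -> 0 < t < T ->
  conv (gker (1 - rho)) (sg rho (N1 x)) t = conv (gker 1) (sg rho (N2 x)) t.
Proof.
move=> xI tI; have tI' := tIo tI; have /andP[t0 tT] := tI.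
have r0 := rho_gt0 rho01.
have sI s : 0 < s < t -> 0 < s <= T by move=> /andP[-> st]; rewrite ltW// (lt_trans st).
have step (u : R -> R -> R) (s : is_solution rho T al f phi0 phi1 u) :
    conv (gker (1 - rho)) (u x) t = phi1 x + conv (gker 1) (dt_rho rho T u x) t.
  have E := RL_integrated (sol_dt_exists s xI) (@sym_continuous (dt_rho rho T u) x (sol_dt_Cbar s))
    (fun h hI => esym (sgE (sol_dt_Cbar s) xI hI)) (sol_init1 s xI) tI.
  rewrite E; congr (_ + _); apply: conv_ext => // h /sI hI; exact: sgE (sol_dt_Cbar s) xI hI.
have i (u : R -> R -> R) (s : is_solution rho T al f phi0 phi1 u) : cint (gker (1 - rho)) (u x) t.
  by apply/(frac_existsE rho01); exact: (sol_dt_exists s xI tI').1.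
have j (u : R -> R -> R) (s : is_solution rho T al f phi0 phi1 u) : cint (gker 1) (dt_rho rho T u x) t.
  have sv := sing_sg r0 (@sym_continuous (dt_rho rho T u) x (sol_dt_Cbar s)).
  apply: eq_integ (sing_cint (sing_gker ltr01) sv t0); first exact: measurable_itv.
  by move=> h; rewrite in_Ioo => /sI hI; rewrite -(sgE (sol_dt_Cbar s) xI hI).
rewrite (conv_ext (k' := gker (1 - rho)) (h' := fun s => u1 x s - u2 x s)) //; last first.
  by move=> s /sI sT; exact: dE.
rewrite (conv_ext (k := gker 1) (k' := gker 1) (h' := fun s => v1 x s - v2 x s)) //; last first.
  by move=> s /sI sT; exact: vE.
have alg (a1 a2 b1 b2 p : R) : a1 = p + b1 -> a2 = p + b2 -> a1 - a2 = b1 - b2.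
  by move=> -> ->; ring.
apply: (etrans (conv_diff (i _ s1) (i _ s2))).
apply: (etrans (alg _ _ _ _ _ (step _ s1) (step _ s2))).
exact: (esym (conv_diff (j _ s1) (j _ s2))).
Qed.

Let D x t := conv (gker (1 - rho)) (sg rho (N2 x)) t.

Let DE x t : 0 < x < pi -> 0 < t <= T ->
  D x t = frac_int (rho - 1) (v1 x) t - frac_int (rho - 1) (v2 x) t.
Proof.
move=> xI tI; have /andP[t0 tT] := tI.
have xI' : 0 <= x <= pi by case/andP: xI => x0 xp; rewrite !ltW.
have x1 := (sol_dt2_exists s1 xI tI).1; have x2 := (sol_dt2_exists s2 xI tI).1.
rewrite (frac_intE x1) (frac_intE x2).
rewrite -(conv_diff ((frac_existsE rho01 _ _).1 x1) ((frac_existsE rho01 _ _).1 x2)).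
apply: conv_ext => // s /andP[s0 st]; apply: vE => //.
by rewrite s0 (le_trans (ltW st)).
Qed.

Let q x t := dxx u1 x t - dxx u2 x t.

Let cq : continuous_on (Omega T) q.
Proof.
have c1 := sol_dxx_cont s1; have c2 := sol_dxx_cont s2.
apply/subspace_continuousP => p xt; apply: cvgB.
  exact: ((subspace_continuousP _ _).1 c1 p xt).
exact: ((subspace_continuousP _ _).1 c2 p xt).
Qed.

Let dD x t : 0 < x < pi -> 0 < t < T ->
  has_derive (D x) t (- (2 * al) * sg rho (N2 x) t + q x t).
Proof.
move=> xI tI; have tI' := tIo tI.
have xI' : 0 <= x <= pi by case/andP: xI => x0 xp; rewrite !ltW.
have h := hdB (RL_has_derive (sol_dt2_exists s1 xI) tI) (RL_has_derive (sol_dt2_exists s2 xI) tI).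
have e1 := sol_eq s1 xI tI'; have e2 := sol_eq s2 xI tI'.
have h2 : has_derive (D x) t (RL rho T (dt_rho rho T u1 x) t - RL rho T (dt_rho rho T u2 x) t).
  have /andP[t0 tT] := tI.
  have n1 : \forall s \near t, 0 < s by exact: lt_nbhsr.
  have n2 : \forall s \near t, s < T by exact: lt_nbhsl.
  apply: (near_eq_is_derive _ h); near=> s; rewrite DE//; apply/andP; split.
    by near: s.
  by apply: ltW; near: s.
have alg (a1 a2 b1 b2 q1 q2 p m : R) : a1 + m * b1 - q1 = p -> a2 + m * b2 - q2 = p ->
    a1 - a2 = - m * (b1 - b2) + (q1 - q2).
  move=> h1' h2'; have -> : a1 = p - m * b1 + q1 by rewrite -h1'; ring.
  have -> : a2 = p - m * b2 + q2 by rewrite -h2'; ring.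
  ring.
by apply: (hd_eq h2); rewrite vE//; exact: alg e1 e2.
Unshelve. all: by end_near. Qed.

Let D0 x : 0 < x < pi -> D x t @[t --> 0^'+] --> (0 : R).
Proof.
move=> xI; have xI' : 0 <= x <= pi by case/andP: xI => x0 xp; rewrite !ltW.
have c : frac_int (rho - 1) (v1 x) t - frac_int (rho - 1) (v2 x) t @[t --> 0^'+] --> phi0 x - phi0 x.
  by apply: cvgB; [exact: sol_init0 s1 _ xI'|exact: sol_init0 s2 _ xI'].
rewrite subrr in c; apply: cvg_trans c; apply: near_eq_cvg; near=> t.
by rewrite DE//; apply/andP; split; near: t; [exact: nbhs_right_gt|exact: nbhs_right_le].
Unshelve. all: by end_near. Qed.

Let d1 x t := derive1 (u1^~ t) x - derive1 (u2^~ t) x.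

Let dd x t : 0 < x < pi -> 0 < t < T ->
  has_derive (fun x => sg rho (N1 x) t) x (d1 x t) /\ has_derive (d1^~ t) x (q x t).
Proof.
move=> xI tI; have tI' := tIo tI.
have [a1 b1] := dxx_has_derive (sol_dxx_exists s1 xI tI').
have [a2 b2] := dxx_has_derive (sol_dxx_exists s2 xI tI').
split; last exact: hdB b1 b2.
have /andP[x0 xp] := xI.
have n1 : \forall y \near x, 0 < y by exact: lt_nbhsr.
have n2 : \forall y \near x, y < pi by exact: lt_nbhsl.
apply: (near_eq_is_derive _ (hdB a1 a2)); near=> y.
by rewrite dE//; apply/andP; split; apply: ltW; near: y.
Unshelve. all: by end_near. Qed.

Let bd t : 0 < t < T -> N1 0 t = 0 /\ N1 pi t = 0.
Proof.
move=> tI; have tI' := tIo tI; have /andP[t0 _] := tI.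
have [a1 b1] := sol_boundary s1 tI'; have [a2 b2] := sol_boundary s2 tI'.
have p0 := ltW (pi_gt0 R).
have z x : 0 <= x <= pi -> u1 x t - u2 x t = 0 -> N1 x t = 0.
  move=> xI ux; have := dE xI tI'; rewrite ux /sg => /eqP.
  by rewrite mulf_eq0 gt_eqF ?powR_gt0//= => /eqP.
split; apply: z; rewrite ?lexx ?p0//; [by rewrite a1 a2 subr0|by rewrite b1 b2 subr0].
Qed.

(** The difference d of the solutions and the difference of their derivatives are
    t^(rho-1) N1 and t^(rho-1) N2. The source and the initial values cancel, so
    their sine coefficients solve the homogeneous equations on ]0, T[. The final
    time is reached by continuity. *)
Theorem solutions_eq x t : 0 <= x <= pi -> 0 < t <= T -> u1 x t = u2 x t.
Proof.
move=> xI tI; have /andP[t0 tT] := tI.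
have r0 := rho_gt0 rho01; have rc := rhoC_gt0 rho01.
have c1 := clamp2_continuous cE1; have c2 := clamp2_continuous cE2.
have [M1 M10 b1] := clamp2_bounded cE1; have [M2 M20 b2] := clamp2_bounded cE2.
have B1 y s : `|N1 y s| <= Num.max M1 M2 by rewrite le_max b1.
have B2 y s : `|N2 y s| <= Num.max M1 M2 by rewrite le_max b2 orbT.
have cc1 n := continuous_coef c1 B1 (n := n).
have cc2 n := continuous_coef c2 B2 (n := n).
have z n s : 0 < s < T -> coef N1 n s = 0.
  apply: (mode_eq0 (k := n%:R) rho01 al0 (cc1 n) (cc2 n)) => h hI; have /andP[h0 hT] := hI.
    rewrite -(conv_coef c1 B1 n r0 rc h0).2 -(conv_coef c2 B2 n r0 ltr01 h0).2.
    apply: eq_Rint => y; rewrite in_Ioo => /andP[y0 yp]; rewrite first_eq//.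
    by rewrite !ltW.
  exact: (mode_equation rho01 c1 c2 B1 B2 cq dD D0 dd bd).
have zT n : coef N1 n t = 0.
  have [tlt|Tle] := ltP t T; first by apply: z; rewrite t0.
  have tE : t = T by apply/eqP; rewrite eq_le tT.
  pose s m : R := T - T * m.+2%:R^-1.
  have sc : s m @[m --> \oo] --> T.
    rewrite -[X in _ --> X]subr0 -[X in _ --> _ - X](mulr0 T); apply: cvgB; first exact: cvg_cst.
    apply: cvgM; first exact: cvg_cst.
    by have := @cvg_inv_shift R 1; under eq_fun do rewrite addn1.
  have sI m : 0 < s m < T.
    rewrite /s gtrBl subr_gt0 gtr_pMr// invf_lt1// ltr1n/=.
    by rewrite mulr_gt0// invr_gt0.
  have c : coef N1 n (s m) @[m --> \oo] --> coef N1 n T.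
    by apply: (cvg_cont_comp sc); exact: cc1.
  have E : (fun m => coef N1 n (s m)) = fun=> 0 by apply/funext => m; exact: z.
  rewrite E in c; rewrite tE.
  exact: (cvg_unique (@Rhausdorff R) c (cvg_cst _)).
have inI y : 0 < y < pi -> N1 y t = 0.
  move=> yI; apply: (@fsin_complete R (N1^~ t)) yI.
    by apply: continuous_subspaceT => y'; exact: continuous_fst.
  move=> n; have E : \int[mu]_(y in I) (N1 y t * sin (n%:R * y)) = coef N1 n t.
    by apply: eq_Rint => y' _; rewrite mulrC.
  by rewrite /fsin E zT mulr0.
have [a1 p1] := sol_boundary s1 tI; have [a2 p2] := sol_boundary s2 tI.
have /andP[x0 xp] := xI.
move: x0; rewrite le_eqVlt => /orP[/eqP <-|x0]; first by rewrite a1 a2.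
move: xp; rewrite le_eqVlt => /orP[/eqP ->|xp]; first by rewrite p1 p2.
apply/eqP; rewrite -subr_eq0 -dE// /sg inI ?mulr0//.
by rewrite x0.
Qed.

End two_solutions.

End solutions.

Lemma le_add_inf (R : realType) (S : set R) (y z : R) : S !=set0 ->
  (forall x, S x -> y <= z + x) -> y <= z + inf S.
Proof.
move=> S0 H; rewrite -lerBlDl; apply: lb_le_inf => // x /H.
by rewrite -lerBlDl.
Qed.

Theorem theorem1p2 (R : realType) (rho T alpha a : R)
    (hrho : 0 < rho < 1) (hT : 0 < T) (halpha : 0 < alpha) (ha : 2^-1 < a) :
  (forall (f : R -> R -> R) (phi0 phi1 : R -> R),
     in_Cax a T (tweight rho f) -> in_C2a a phi0 -> in_C2a a phi1 ->
     exists u : R -> R -> R,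
       is_solution rho T alpha f phi0 phi1 u /\
       (forall v : R -> R -> R, is_solution rho T alpha f phi0 phi1 v ->
          forall x t : R, 0 <= x <= pi -> 0 < t <= T -> v x t = u x t)) /\
  (exists C : R, 0 < C /\
     forall (f : R -> R -> R) (phi0 phi1 : R -> R) (u : R -> R -> R),
       in_Cax a T (tweight rho f) -> in_C2a a phi0 -> in_C2a a phi1 ->
       is_solution rho T alpha f phi0 phi1 u ->
       [/\ in_Cbar T (Omega T) (tweight rho (dt_rho rho T (dt_rho rho T u))),
           in_Cbar T (Omega T) (tweight rho (dxx u)) &
           Cbar_norm T (tweight rho (dt_rho rho T (dt_rho rho T u)))
             + Cbar_norm T (tweight rho (dt_rho rho T u))
             + Cbar_norm T (tweight rho (dxx u))
           <= C * (C2a_norm a phi0 + C2a_norm a phi1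
                   + Cax_norm a T (tweight rho f))]).
Proof.
have [C C0 H] := existence hrho hT halpha ha.
split.
  move=> f phi0 phi1 hf h0 h1.
  have [_ _ [Cf bf]] := hf; have [_ [_ _ _ [D0 b0]] _ _] := h0; have [_ [_ _ _ [D1 b1]] _ _] := h1.
  have [u0 Hu] := H f phi0 phi1 D0 D1 Cf hf h0 h1 b0 b1 bf.
  have [s0 _ _ _] := Hu u0 (fun _ _ _ _ => erefl).
  exists u0; split=> // v sv x t; exact: (solutions_eq hrho halpha hT sv s0).
exists C; split=> // f phi0 phi1 u hf h0 h1 su.
have K D0 D1 Cf : Ca_bound a (d2 phi0) D0 -> Ca_bound a (d2 phi1) D1 -> Cax_bound a T (tweight rho f) Cf ->
    [/\ in_Cbar T (Omega T) (tweight rho (dt_rho rho T (dt_rho rho T u))),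
       in_Cbar T (Omega T) (tweight rho (dxx u)) &
       Cbar_norm T (tweight rho (dt_rho rho T (dt_rho rho T u)))
             + Cbar_norm T (tweight rho (dt_rho rho T u))
             + Cbar_norm T (tweight rho (dxx u)) <= C * (D0 + D1 + Cf)].
  move=> b0 b1 bf; have [u0 Hu] := H f phi0 phi1 D0 D1 Cf hf h0 h1 b0 b1 bf.
  have [s0 _ _ _] := Hu u0 (fun _ _ _ _ => erefl).
  have [] // := Hu u; first by move=> x t; exact: (solutions_eq hrho halpha hT su s0).
have [_ _ [Cf bf]] := hf; have [_ [_ _ _ [D0 b0]] _ _] := h0; have [_ [_ _ _ [D1 b1]] _ _] := h1.
have [i1 i2 _] := K D0 D1 Cf b0 b1 bf; split=> //.
move: (Cbar_norm _ _ + _ + _) K => X K.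
have K' E0 E1 Ef : Ca_bound a (d2 phi0) E0 -> Ca_bound a (d2 phi1) E1 ->
    Cax_bound a T (tweight rho f) Ef -> X / C <= E0 + E1 + Ef.
  by move=> e0 e1 ef; rewrite ler_pdivrMr// mulrC; have [] := K E0 E1 Ef e0 e1 ef.
rewrite mulrC -ler_pdivrMr//.
apply: le_add_inf => [|Ef ef]; first by exists Cf.
rewrite addrAC; apply: le_add_inf => [|E1 e1]; first by exists D1.
rewrite -addrA addrC; apply: le_add_inf => [|E0 e0]; first by exists D0.
rewrite (_ : Ef + E1 + E0 = E0 + E1 + Ef); last by ring.
exact: K'.
Qed.
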